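(* Let $f:M\to M$ possess a two-sided Chernov–Markarian–Zhang structure and suppose $\mu_Y(\varphi>n)=O(n^{-\beta'})$ for some $\beta'>1$. Then there is $C>0$ such that for all $n\ge1$: (a) for all $v,w\in\mathcal H(X)$, $$\Big|\rho_{v,w}(n)-\bar\varphi^{-1}\sum_{j>n}\mu_Y(\varphi>j)\int_Mv\,d\mu\int_Mw\,d\mu\Big|\le C\|v\|_{\mathcal H}\|w\|_{\mathcal H}\big(\gamma_{[n/3]}+\zeta_{\beta'}(n)\big);$$ (b) for all $v,w\in\mathcal H(X)$ with $\int_Mv\,d\mu=0$, $|\rho_{v,w}(n)|\le C\|v\|_{\mathcal H}\|w\|_{\mathcal H}\,\gamma_{[n/3]}$.
   Context: Full-branch Gibbs–Markov map: $\bar F:\bar Y\to\bar Y$ ergodic, preserving a probability $\bar\mu_Y$, with countable partition $\alpha$ such that $\bar F|_a:a\to\bar Y$ is a measurable bijection for each $a\in\alpha$ and $\xi=d\bar\mu_Y/d(\bar\mu_Y\circ\bar F)$ satisfies $|\log\xi(y)-\log\xi(y')|\le C_0\theta^{s(y,y')}$ on each $a$, where the separation time $s(y,y')$ is the least $n\ge0$ with $\bar F^ny,\bar F^ny'$ in different elements of $\alpha$. Two-sided Gibbs–Markov map: $(Y,d)$ a bounded metric space with Borel probability $\mu_Y$, $F:Y\to Y$ ergodic measure-preserving, and a measure-preserving semiconjugacy $\bar\pi:Y\to\bar Y$ ($\bar\pi\circ F=\bar F\circ\bar\pi$, $\bar\pi_*\mu_Y=\bar\mu_Y$) onto a full-branch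 Gibbs–Markov map; $s(y,y')=s(\bar\pi y,\bar\pi y')$; and $d(F^ny,F^ny')\le C_0(\theta^n+\theta^{s(y,y')-n})$ for all $y,y'\in Y$, $n\ge1$. Two-sided CMZ structure: $(M,d)$ a bounded metric space with Borel probability $\mu$, $f:M\to M$ ergodic mixing measure-preserving; Borel $Y\subset X\subset M$ with $\mu(Y)>0$; $h:X\to\mathbb Z^+$ the integrable first return time to $X$, $f_X=f^h$, $\mu_X=\mu|_X/\mu(X)$; an integrable $\sigma:Y\to\mathbb Z^+$ constant on each $\bar\pi^{-1}a$, $a\in\alpha$, with $F=f_X^\sigma:Y\to Y$ a two-sided Gibbs–Markov map (w.r.t. $\mu_Y$); $f_X$ modelled by the tower $Y^\sigma$ (i.e. $(y,\ell)\mapsto f_X^\ell y$, $0\le\ell<\sigma(y)$, pushes $(\mu_Y\times\text{counting})/\int\sigma d\mu_Y$ to $\mu_X$); $h$ constant on $f_X^\ell\bar\pi^{-1}a$ for $a\in\alpha$, $0\le\ell<\sigma(a)$; induced return time $\varphi=\sum_{\ell=0}^{\sigma-1}h\circ f_X^\ell$, $\bar\varphi=\int\varphi\,d\mu_Y$, with $(y,\ell)\mapsto f^\ell y$ ($0\le\ell<\varphi(y)$) pushing $(\mu_Y\times\text{counting})/\bar\varphi$ to $\mu$. Two-sided dynamically Hölder observables: $|v|_{\mathcal H}=\sup_{y\ne y'\in Y}\sup_{0\le\ell<\varphi(y)}|v(f^\ell y)-v(f^\ell y')|/(d(y,y')+\theta^{s(y,y')})$, $\|v\|_{\mathcal H}=|v|_\infty+|v|_{\mathcal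 H}$; $\mathcal H(X)$ = observables with finite norm supported in $X$. $\rho_{v,w}(n)=\int v\,w\circ f^nd\mu-\int v\,d\mu\int w\,d\mu$. $\sigma_n=\int_Y\sigma1_{\{\varphi>n\}}d\mu_Y$, $\gamma_n=\sigma_n+\sum_{j=1}^nj^{-\beta'}\sigma_{n-j}$, $\zeta_{\beta'}(n)=n^{-\beta'}$ ($\beta'>2$), $n^{-2}\log n$ ($\beta'=2$), $n^{-2(\beta'-1)}$ ($1<\beta'<2$); $[x]$ is the integer part. *)

(* Defs.v *)
From HB Require Import structures.
From mathcomp Require Import all_boot all_order all_algebra.
From mathcomp Require Import all_classical all_reals all_analysis.
Set Implicit Arguments. Unset Strict Implicit. Unset Printing Implicit Defensive.
Import Order.TTheory GRing.Theory Num.Theory numFieldNormedType.Exports.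
Local Open Scope classical_set_scope.
Local Open Scope ring_scope.

Section CMZDefs.
Context {R : realType}.

(* g maps D into D, is measurable on D and preserves mu (mu is carried by D) *)
Definition mpreserving d (T : measurableType d) (mu : {measure set T -> \bar R})
  (D : set T) (g : T -> T) : Prop :=
  [/\ measurable D, measurable_fun D g, (forall x, D x -> D (g x)) &
      forall A, measurable A -> mu (D `&` g @^-1` A) = mu (D `&` A)].

Definition ergodic d (T : measurableType d) (mu : {measure set T -> \bar R})
  (D : set T) (g : T -> T) : Prop :=
  forall A, measurable A -> A `<=` D -> D `&` g @^-1` A = A ->
    mu A = 0%E \/ mu A = 1%E.

Definition mixing d (T : measurableType d) (mu : {measure set T -> \bar R})
  (g : T -> T) : Prop :=
  forall A B, measurable A -> measurable B ->
    (fun n => fine (mu (A `&` (iter n g) @^-1` B))) @ \oo -->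
      fine (mu A) * fine (mu B).

Definition same_elem (T : Type) (I : Type) (a : I -> set T) (x y : T) : Prop :=
  exists i, a i x /\ a i y.

(* s(x,y) = least n with G^n x, G^n y in different elements; None = infinity *)
Definition sep_time (T : Type) (I : Type) (G : T -> T) (a : I -> set T) (x y : T)
  : option nat :=
  let P : pred nat := fun n => `[< ~ same_elem a (iter n G x) (iter n G y) >] in
  match pselect (exists n, P n) with
  | left H => Some (ex_minn H)
  | right _ => None
  end.

Definition thpow (θ : R) (s : option nat) : R :=
  match s with Some k => θ ^+ k | None => 0 end.

Definition thpow_shift (θ : R) (s : option nat) (n : nat) : R :=
  match s with Some k => θ ^ (k%:Z - n%:Z) | None => 0 end.

Definition full_branch_GM d (T : measurableType d) (mub : probability T R)
  (G : T -> T) (I : countType) (a : I -> set T) (C0 θ : R) : Prop :=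
  [/\ mpreserving mub setT G /\ ergodic mub setT G,
      (forall i, measurable (a i)),
      (forall i j, i != j -> a i `&` a j = set0),
      (forall x, exists i, a i x) &
      exists (hinv : I -> T -> T) (xi : T -> R),
        [/\ (* F|_a : a -> Ybar measurable bijection, with measurable inverse hinv a *)
            (forall i, measurable_fun setT (hinv i)) /\
            (forall i z, a i (hinv i z) /\ G (hinv i z) = z),
            (forall i x, a i x -> hinv i (G x) = x),
            (* xi = d mub / d (mub o G) : for A = a i `&` G^-1 B,
               mub A = \int_A xi d(mub o G) = \int_B xi o (G|_a)^-1 dmub *)
            measurable_fun setT xi /\ (forall x, 0 < xi x),
            (forall i B, measurable B ->
               mub (a i `&` G @^-1` B) = (\int[mub]_(z in B) (xi (hinv i z))%:E)%E) &
            (forall i x y, a i x -> a i y ->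
               `|ln (xi x) - ln (xi y)| <= C0 * thpow θ (sep_time G a x y))]].

Definition two_sided_GM dM (M : measurableType dM) (dist : M -> M -> R)
  (Y : set M) (muY : probability M R) (F : M -> M)
  dB (Yb : measurableType dB) (mub : probability Yb R) (Fb : Yb -> Yb)
  (I : countType) (a : I -> set Yb) (pib : M -> Yb) (C0 θ : R) : Prop :=
  [/\ muY (~` Y) = 0%E /\ mpreserving muY Y F /\ ergodic muY Y F,
      full_branch_GM mub Fb a C0 θ,
      measurable_fun Y pib /\ (forall y, Y y -> pib (F y) = Fb (pib y)) &
      (forall B, measurable B -> muY (Y `&` pib @^-1` B) = mub B) /\
      (forall y y' n, Y y -> Y y' -> (1 <= n)%N ->
         dist (iter n F y) (iter n F y') <=
           C0 * (θ ^+ n + thpow_shift θ (sep_time Fb a (pib y) (pib y')) n))].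

Definition dopen (M : Type) (dist : M -> M -> R) : set (set M) :=
  [set A | forall x, A x -> exists2 e, 0 < e & [set y | dist x y < e] `<=` A].

Definition bounded_borel_metric dM (M : measurableType dM) (dist : M -> M -> R)
  : Prop :=
  [/\ (forall x y, 0 <= dist x y) /\ (forall x y, dist x y = 0 <-> x = y),
      (forall x y, dist x y = dist y x),
      (forall x y z, dist x z <= dist x y + dist y z),
      (exists B, forall x y, dist x y <= B) &
      (@measurable dM M) = <<s dopen dist >>].

Definition first_return (M : Type) (f : M -> M) (X : set M) (h : M -> nat) : Prop :=
  forall x, X x -> [/\ (0 < h x)%N, X (iter (h x) f x) &
                      forall k, (0 < k < h x)%N -> ~ X (iter k f x)].

Definition fX (M : Type) (f : M -> M) (h : M -> nat) (x : M) : M := iter (h x) f x.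

Definition Fmap (M : Type) (f : M -> M) (h sigma : M -> nat) (y : M) : M :=
  iter (sigma y) (fX f h) y.

Definition phi (M : Type) (f : M -> M) (h sigma : M -> nat) (y : M) : nat :=
  (\sum_(l < sigma y) h (iter l (fX f h) y))%N.

Definition CMZ2 dM (M : measurableType dM) (dist : M -> M -> R)
  (mu : probability M R) (f : M -> M) (X Y : set M) (h sigma : M -> nat)
  (muY : probability M R)
  dB (Yb : measurableType dB) (mub : probability Yb R) (Fb : Yb -> Yb)
  (I : countType) (a : I -> set Yb) (pib : M -> Yb) (C0 θ : R) : Prop :=
  [/\ bounded_borel_metric dist /\
      [/\ mpreserving mu setT f, ergodic mu setT f & mixing mu f],
      [/\ measurable X, measurable Y, Y `<=` X & (0 < mu Y)%E],
      [/\ first_return f X h, (forall n, measurable (X `&` [set x | h x = n])) &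
          (\int[mu]_(x in X) (h x)%:R%:E < +oo)%E] /\
      [/\ (forall y, Y y -> (0 < sigma y)%N),
          (forall n, measurable (Y `&` [set y | sigma y = n])),
          (\int[muY]_(y in Y) (sigma y)%:R%:E < +oo)%E &
          (forall i y y', Y y -> Y y' -> a i (pib y) -> a i (pib y') -> sigma y = sigma y')],
      two_sided_GM dist Y muY (Fmap f h sigma) mub Fb a pib C0 θ &
      [/\ (* f_X modelled by the tower Y^sigma: mu_X = push of (muY x counting)/int sigma *)
          (forall A, measurable A ->
             (mu (X `&` A) * (mu X)^-1 =
              (\sum_(0 <= l <oo)
                  muY (Y `&` [set y | (l < sigma y)%N] `&` (iter l (fX f h)) @^-1` A))
              * (\int[muY]_(y in Y) (sigma y)%:R%:E)^-1)%E),
          (forall i l y y', Y y -> Y y' -> a i (pib y) -> a i (pib y') ->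
             (l < sigma y)%N -> h (iter l (fX f h) y) = h (iter l (fX f h) y')) &
          (* mu = push of (muY x counting)/varphi_bar under (y,l) |-> f^l y *)
          (forall A, measurable A ->
             (mu A =
              (\sum_(0 <= l <oo)
                  muY (Y `&` [set y | (l < phi f h sigma y)%N] `&` (iter l f) @^-1` A))
              * (\int[muY]_(y in Y) (phi f h sigma y)%:R%:E)^-1)%E)]].

Definition holder_set dM (M : measurableType dM) (dist : M -> M -> R)
  (f : M -> M) (h sigma : M -> nat) (Y : set M)
  (Yb : Type) (Fb : Yb -> Yb) (I : Type) (a : I -> set Yb) (pib : M -> Yb)
  (θ : R) (v : M -> R) : set R :=
  [set r | exists y y' l, [/\ Y y, Y y', y <> y', (l < phi f h sigma y)%N &
     r = `|v (iter l f y) - v (iter l f y')| /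
           (dist y y' + thpow θ (sep_time Fb a (pib y) (pib y')))]].

Definition supnorm (M : Type) (v : M -> R) : R := sup (range (fun x => `|v x|)).

Definition normH dM (M : measurableType dM) (dist : M -> M -> R)
  (f : M -> M) (h sigma : M -> nat) (Y : set M)
  (Yb : Type) (Fb : Yb -> Yb) (I : Type) (a : I -> set Yb) (pib : M -> Yb)
  (θ : R) (v : M -> R) : R :=
  supnorm v + sup (holder_set dist f h sigma Y Fb a pib θ v).

Definition inHX dM (M : measurableType dM) (dist : M -> M -> R)
  (f : M -> M) (X : set M) (h sigma : M -> nat) (Y : set M)
  (Yb : Type) (Fb : Yb -> Yb) (I : Type) (a : I -> set Yb) (pib : M -> Yb)
  (θ : R) (v : M -> R) : Prop :=
  [/\ measurable_fun setT v, (forall x, ~ X x -> v x = 0),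
      has_ubound (range (fun x => `|v x|)) &
      has_ubound (holder_set dist f h sigma Y Fb a pib θ v)].

Definition rho dM (M : measurableType dM) (mu : probability M R) (f : M -> M)
  (v w : M -> R) (n : nat) : R :=
  \int[mu]_x (v x * w (iter n f x)) - (\int[mu]_x v x) * (\int[mu]_x w x).

Definition sigman dM (M : measurableType dM) (muY : probability M R) (Y : set M)
  (f : M -> M) (h sigma : M -> nat) (n : nat) : R :=
  \int[muY]_(y in Y `&` [set y | (n < phi f h sigma y)%N]) (sigma y)%:R.

Definition gamma dM (M : measurableType dM) (muY : probability M R) (Y : set M)
  (f : M -> M) (h sigma : M -> nat) (β' : R) (n : nat) : R :=
  sigman muY Y f h sigma n +
  \sum_(1 <= j < n.+1) (j%:R `^ (- β')) * sigman muY Y f h sigma (n - j).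

Definition zeta (β' : R) (n : nat) : R :=
  if 2 < β' then n%:R `^ (- β')
  else if β' == 2 then n%:R `^ (-2) * ln n%:R
  else n%:R `^ (- (2 * (β' - 1))).

Definition tail dM (M : measurableType dM) (muY : probability M R) (Y : set M)
  (f : M -> M) (h sigma : M -> nat) (n : nat) : R :=
  fine (\sum_(n.+1 <= j <oo) muY (Y `&` [set y | (j < phi f h sigma y)%N]))%E.

Definition phibar dM (M : measurableType dM) (muY : probability M R) (Y : set M)
  (f : M -> M) (h sigma : M -> nat) : R :=
  \int[muY]_(y in Y) (phi f h sigma y)%:R.

End CMZDefs.

(* Main.v *)
Require Import Defs.
From HB Require Import structures.
From mathcomp Require Import all_boot all_order all_algebra.
From mathcomp Require Import all_classical all_reals all_analysis.
From mathcomp Require Import measurable_realfun ring lra zify.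
Import Order.TTheory GRing.Theory Num.Theory numFieldNormedType.Exports.
Local Open Scope classical_set_scope.
Local Open Scope ring_scope.

(* Coding the induced map [F] by the full-branch Gibbs-Markov map [Fb], a correlation at time [n] splits
   into the last stretch of the current excursion (the kick of [v]) and the evolution of [w] from the next
   return.  The latter is replaced by a function [cyl_obs w N] of finitely many letters, whose increment
   over one block is of size [th ^ (number of completed blocks)] and lives on visits to [X]; hence these
   increments, and likewise the kicks, have tails dominated by [sigman].

   The transfer operator keeps a cone of log-Hoelder densities even after a fixed fraction of mass is
   removed as a constant.  This regeneration reduces everything to a scalar renewal equation for a law
   with tail [O(n^-b)].  For its renewal sequence, the Erdos-Feller-Pollard theorem and a quantitative
   Wiener lemma for the weight [n^-b] give the expansion whose second term is the tail sum of [phi] and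
   whose error is [zeta].  In a convolution of two sequences with tails below [gamma], one index is at least
   [n / 3], which accounts for [gamma (n %/ 3)].  A possible period of the renewal law is harmless: mixing
   of [f] equidistributes the kicks among the residue classes. *)

Set Implicit Arguments.
Unset Strict Implicit.
Unset Printing Implicit Defensive.

(** * Convolution of real sequences and its effect on tail sums *)

Section Convolution.
Variable R : realType.
Implicit Types x y z : nat -> R.

(** The observables see the past of a point, while a transfer operator exists only for the quotient
    map. Hence kicks are read after [N] further returns, with [N] depending on the time [n]; [N + 1]
    applications of the transfer operator then bring them into one cone whose constant does not
    depend on [N]. A signed kick is written as a difference of two cone elements. Errors have to be
    weighed by [sigman], which sup norm estimates cannot see. All estimates are therefore in mean:
    [gm_mix] bounds expectations of products by products of expectations up to the factor [gD], so
    that only convolutions of scalar sequences remain. Regeneration replaces the spectral theory of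
    operator renewal sequences by positive real sequences. Its price is that the mean and the tails
    of the regeneration law are not those of [phi]; they are linked by a balance of mass ([mass])
    and by a Green function identity ([green_limit]), the latter up to [Zt], the surrogate of
    [zeta]. *)

Definition conv x y n : R := \sum_(i < n.+1) x i * y (n - i)%N.

Lemma eq_conv x x' y y' n :
  (forall i, (i <= n)%N -> x i = x' i) -> (forall i, (i <= n)%N -> y i = y' i) ->
  conv x y n = conv x' y' n.
Proof.
move=> hx hy; apply: eq_bigr => i _.
by rewrite hx ?hy ?leq_subr // -ltnS ltn_ord.
Qed.

Lemma convC x y n : conv x y n = conv y x n.
Proof.
rewrite /conv (reindex_inj rev_ord_inj) /=; apply: eq_bigr => i _.
by rewrite subSS subKn 1?mulrC // -ltnS ltn_ord.
Qed.

Lemma conv_coef x y n N : (n < N)%N ->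
  conv x y n = ((\poly_(i < N) x i) * (\poly_(i < N) y i))`_n.
Proof.
move=> h; rewrite coefM; apply: eq_bigr => i _; rewrite !coef_poly.
rewrite (leq_ltn_trans _ h) ?(leq_ltn_trans _ h) ?leq_subr //.
by rewrite -ltnS ltn_ord.
Qed.

(** Coefficients up to [n] only see the sequences up to [n], so associativity is inherited from
    products of truncated polynomials. *)
Lemma convA x y z n : conv x (conv y z) n = conv (conv x y) z n.
Proof.
pose P u : {poly R} := \poly_(i < n.+1) u i.
have e u i : (i <= n)%N -> u i = (P u)`_i by rewrite coef_poly ltnS => ->.
transitivity ((P x * (P y * P z))`_n).
  rewrite coefM; apply: eq_bigr => i _; rewrite -e -1?ltnS ?ltn_ord //.
  by rewrite (@conv_coef _ _ _ n.+1) // ltnS leq_subr.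
rewrite mulrA coefM; apply: eq_bigr => i _.
by rewrite -e ?leq_subr // (@conv_coef _ _ _ n.+1).
Qed.

Lemma conv_recl x y n : conv x y n = x 0%N * y n + \sum_(i < n) x i.+1 * y (n - i.+1)%N.
Proof. by rewrite /conv big_ord_recl subn0. Qed.

Lemma convDl x x' y n : conv (fun i => x i + x' i) y n = conv x y n + conv x' y n.
Proof. by rewrite -big_split; apply: eq_bigr => i _; rewrite mulrDl. Qed.

Lemma convBl x x' y n : conv (fun i => x i - x' i) y n = conv x y n - conv x' y n.
Proof. by rewrite -sumrB; apply: eq_bigr => i _; rewrite mulrBl. Qed.

Lemma convDr x y y' n : conv x (fun i => y i + y' i) n = conv x y n + conv x y' n.
Proof. by rewrite -big_split; apply: eq_bigr => i _; rewrite mulrDr. Qed.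

Lemma convBr x y y' n : conv x (fun i => y i - y' i) n = conv x y n - conv x y' n.
Proof. by rewrite -sumrB; apply: eq_bigr => i _; rewrite mulrBr. Qed.

Lemma convZl a x y n : conv (fun i => a * x i) y n = a * conv x y n.
Proof. by rewrite mulr_sumr; apply: eq_bigr => i _; rewrite mulrA. Qed.

Lemma convZr a x y n : conv x (fun i => a * y i) n = a * conv x y n.
Proof. by rewrite mulr_sumr; apply: eq_bigr => i _; rewrite mulrCA. Qed.

Lemma ler_conv x x' y y' n : (forall i, 0 <= x i <= x' i) -> (forall i, 0 <= y i <= y' i) ->
  conv x y n <= conv x' y' n.
Proof.
move=> hx hy; apply: ler_sum => i _.
have /andP[? ?] := hx i; have /andP[? ?] := hy (n - i)%N; exact: ler_pM.
Qed.

Lemma conv_ge0 x y n : (forall i, 0 <= x i) -> (forall i, 0 <= y i) -> 0 <= conv x y n.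
Proof. by move=> hx hy; apply: sumr_ge0 => i _; apply: mulr_ge0. Qed.

Lemma ler_norm_conv x y n : `|conv x y n| <= conv (fun i => `|x i|) (fun i => `|y i|) n.
Proof. by apply: (le_trans (ler_norm_sum _ _ _)); apply: ler_sum => i _; rewrite normrM. Qed.

Definition delta n : R := (n == 0)%N%:R.

Lemma conv_delta x n : conv delta x n = x n.
Proof.
rewrite conv_recl /delta eqxx mul1r big1 ?addr0 // => i _.
by rewrite mul0r.
Qed.

Lemma conv1 x n : conv (fun=> 1) x n = \sum_(i < n.+1) x i.
Proof. by rewrite convC; apply: eq_bigr => i _; rewrite mulr1. Qed.

Lemma sum_conv x y n : \sum_(m < n.+1) conv x y m = conv x (fun k => \sum_(i < k.+1) y i) n.
Proof.
rewrite -conv1 convC -convA; apply: eq_conv => // i _.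
by rewrite convC conv1.
Qed.

(** The upper ends [m] are finite, so that no summability is presupposed. Pointwise bounds are the
    case [m = n + 1], the total mass is the case [n = 0]. *)
Definition tailb (A : R) (r x : nat -> R) :=
  (forall n, 0 <= x n) /\ forall n m, \sum_(n <= j < m) x j <= A * r n.

Lemma tailb_ub A r x n : tailb A r x -> x n <= A * r n.
Proof. by move=> [_ h]; have := h n n.+1; rewrite big_nat1. Qed.

Lemma tailb_sum A r x n : tailb A r x -> \sum_(i < n) x i <= A * r 0%N.
Proof. by move=> [_ h]; have := h 0%N n; rewrite big_mkord. Qed.

(** A pair of indices with sum at least [n] either has first index [i <= n], and then the second is
    at least [n - i], or has first index beyond [n]. The second kind contributes at most [A * p n]
    times the whole mass of [y], which is covered by the last term of [conv p r n]; hence the factor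
    2. *)
Lemma tailb_conv A B p r x y : (forall n, 0 <= p n) -> (forall n, 0 <= r n) ->
  0 <= A -> 0 <= B ->
  tailb A p x -> tailb B r y -> tailb (2 * A * B) (conv p r) (conv x y).
Proof.
move=> p0 r0 A0 B0 hx hy; have [x0 hx1] := hx; have [y0 hy1] := hy.
split=> [n|n m]; first exact: conv_ge0.
case: (leqP m n) => [mn|nm].
  by rewrite big_geq // mulr_ge0 ?conv_ge0 // !mulr_ge0.
have -> : \sum_(n <= j < m) conv x y j =
    \sum_(0 <= i < m) x i * \sum_(n <= j < m | (i <= j)%N) y (j - i)%N.
  under [RHS]eq_bigr do rewrite mulr_sumr.
  rewrite (exchange_big_dep xpredT) //=; apply: eq_big_nat => j /andP[nj jm].
  rewrite /conv -(big_mkord xpredT (fun i => x i * y (j - i)%N)).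
  rewrite [RHS](big_cat_nat (n := j.+1)) //=.
  rewrite [X in _ = _ + X]big_nat_cond [X in _ = _ + X]big_pred0 ?addr0; last first.
    by move=> i; apply/negbTE; rewrite -!andbA negb_and -ltnNge ltnS; lia.
  rewrite big_nat_cond [RHS]big_nat_cond; apply: eq_bigl => i; lia.
have inner i : (i < m)%N ->
    \sum_(n <= j < m | (i <= j)%N) y (j - i)%N <= B * r (n - i)%N.
  move=> im; case: (leqP i n) => [ni|ni].
    apply: le_trans (hy1 (n - i)%N (m - i)%N).
    rewrite -{1}(subnK ni) big_addn big_mkcond.
    by apply: ler_sum => j _; rewrite addnK leq_addl.
  have -> : (n - i = 0)%N by lia.
  apply: le_trans (hy1 0%N (m - i)%N).
  rewrite (big_cat_nat (n := i) (ltnW ni) (ltnW im)) /= big_nat_cond big_pred0; last first.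
    by move=> j; lia.
  rewrite add0r -{1}(add0n i) big_addn.
  by rewrite big_mkcond; apply: ler_sum => j _; rewrite addnK leq_addl.
apply: (@le_trans _ _ (\sum_(0 <= i < m) x i * (B * r (n - i)%N))).
  rewrite big_nat [leRHS]big_nat; apply: ler_sum => i /andP[_ im].
  by apply: ler_wpM2l => //; exact: inner.
rewrite (big_cat_nat (n := n.+1)) //= big_mkord.
have h1 : \sum_(i < n.+1) x i * (B * r (n - i)%N) <= A * B * conv p r n.
  rewrite mulr_sumr; apply: ler_sum => i _.
  have -> : A * B * (p i * r (n - i)%N) = A * p i * (B * r (n - i)%N) by ring.
  by apply: ler_wpM2r; [exact: mulr_ge0|exact: tailb_ub].
have h2 : \sum_(n.+1 <= i < m) x i * (B * r (n - i)%N) <= A * B * conv p r n.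
  apply: (@le_trans _ _ ((\sum_(n.+1 <= i < m) x i) * (B * r 0%N))).
    rewrite mulr_suml big_nat [leRHS]big_nat; apply: ler_sum => i /andP[ni _].
    by rewrite (_ : n - i = 0)%N //; lia.
  apply: (@le_trans _ _ ((A * p n) * (B * r 0%N))).
    apply: ler_wpM2r; first exact: mulr_ge0.
    apply: le_trans (hx1 n m).
    by rewrite [leRHS]big_ltn // lerDr.
  have -> : A * p n * (B * r 0%N) = A * B * (p n * r 0%N) by ring.
  apply: ler_wpM2l; first exact: mulr_ge0.
  rewrite /conv big_ord_recr /= subnn lerDr.
  by apply: sumr_ge0 => i _; exact: mulr_ge0.
have -> : 2 * A * B * conv p r n = A * B * conv p r n + A * B * conv p r n by ring.
exact: lerD.
Qed.

Lemma tailb_weaken A B p r x : (forall n, A * p n <= B * r n) -> tailb A p x -> tailb B r x.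
Proof. by move=> h [x0 hx]; split=> // n m; apply: le_trans (hx n m) (h n). Qed.

End Convolution.
Arguments delta {R} n.

(** * Polynomial weights and the comparison sequence [eta] *)

Section Psi.
Variables (R : realType) (b : R).
Hypothesis b1 : 1 < b.

(** The shift by one gives the value 1 at 0 and avoids the degenerate power of 0. *)
Definition psi (c : R) n : R := n.+1%:R `^ (- c).

Lemma psi_gt0 c n : 0 < psi c n.
Proof. by apply: powR_gt0; rewrite ltr0n. Qed.

Lemma psi_ge0 c n : 0 <= psi c n. Proof. exact/ltW/psi_gt0. Qed.

Lemma psi_scale c L n m : 0 <= c -> (n.+1 <= L * m.+1)%N -> psi c m <= L%:R `^ c * psi c n.
Proof.
move=> c0 h; rewrite /psi !powRN.
rewrite ler_pdivlMr ?powR_gt0 ?ltr0n // mulrC ler_pdivrMr ?powR_gt0 ?ltr0n //.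
rewrite -powRM ?ler0n //; apply: ge0_ler_powR => //; rewrite ?nnegrE ?mulr_ge0 ?ler0n //.
by rewrite -natrM ler_nat.
Qed.

Lemma psi_decr c n m : 0 <= c -> (n <= m)%N -> psi c m <= psi c n.
Proof. by move=> c0 h; have := @psi_scale c 1 n m c0; rewrite powR1 !mul1r; apply; rewrite mul1n. Qed.

Lemma psi0 c : psi c 0 = 1. Proof. by rewrite /psi powR1. Qed.

Lemma psi_le1 c n : 0 <= c -> psi c n <= 1.
Proof. by move=> c0; rewrite -(psi0 c); exact: psi_decr. Qed.

(** Discrete form of the comparison of [x^-b] with the derivative of [x^(1-b)]; the inequalities
    [ln x <= x - 1] and [1 + x <= expR x] stand in for the mean value theorem. *)
Lemma psi_step n : psi b n.+1 <= (b - 1)^-1 * (psi (b - 1) n - psi (b - 1) n.+1).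
Proof.
have a0 : 0 < b - 1 by rewrite subr_gt0.
rewrite mulrC ler_pdivlMr //.
set t : R := n.+1%:R; set s : R := n.+2%:R.
have t0 : 0 < t by rewrite ltr0n.
have s0 : 0 < s by rewrite ltr0n.
have st : s = t + 1 by rewrite /s /t -natr1.
have -> : psi b n.+1 = s `^ (- (b - 1)) * s^-1.
  rewrite /psi -/s -[s^-1](powR_inv1 (ltW s0)) -powRD; first by congr (_ `^ _); ring.
  by rewrite (gt_eqF s0) implybT.
rewrite /psi -/s -/t.
have -> : t `^ (- (b - 1)) = s `^ (- (b - 1)) * (t / s) `^ (- (b - 1)).
  rewrite -powRM ?divr_ge0 ?ltW //; congr (_ `^ _); field; lra.
have ln1 : ln (t / s) <= t / s - 1.
  have := @ln_sublinear _ (t/s); have := @le_ln1Dx R (t / s - 1).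
  rewrite (_ : 1 + (t / s - 1) = t / s); last by ring.
  by move=> h _; apply: h; rewrite -subr_gt0 opprK subrK divr_gt0.
have e1 : 1 + (b - 1) / s <= (t / s) `^ (- (b - 1)).
  rewrite /powR gt_eqF ?divr_gt0 //; apply: le_trans (expR_ge1Dx _).
  rewrite lerD2l; have -> : (b - 1) / s = - (b - 1) * (t / s - 1).
    rewrite st; field; lra.
  rewrite !mulNr lerN2; apply: ler_wpM2l => //; exact: ltW.
have -> : s `^ (- (b - 1)) / s * (b - 1) = s `^ (- (b - 1)) * ((b - 1) / s) by ring.
have -> : s `^ (- (b - 1)) * (t / s) `^ (- (b - 1)) - s `^ (- (b - 1)) =
  s `^ (- (b - 1)) * ((t / s) `^ (- (b - 1)) - 1) by ring.
by apply: ler_wpM2l; [exact: powR_ge0|rewrite lerBrDl].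
Qed.

Lemma psi_tail n m : \sum_(n <= j < m) psi b j <= (1 + (b - 1)^-1) * psi (b - 1) n.
Proof.
have a0 : 0 < b - 1 by rewrite subr_gt0.
have a1 : 0 <= b - 1 by exact: ltW.
have a2 : 0 <= (b - 1)^-1 by rewrite invr_ge0.
case: (leqP m n) => [mn|nm].
  by rewrite big_geq // mulr_ge0 ?psi_ge0 // addr_ge0.
rewrite big_ltn // mulrDl mul1r; apply: lerD.
  by rewrite /psi ler_powR ?ler1n // lerN2 gerBl.
case: m nm => // m nm; rewrite big_add1 /=.
apply: (@le_trans _ _ ((b - 1)^-1 * (psi (b - 1) n - psi (b - 1) m))); last first.
  by apply: ler_wpM2l => //; rewrite gerBl psi_ge0.
have nm' : (n <= m)%N by [].
rewrite -[X in _ * X]opprB -(telescope_sumr (psi (b - 1)) nm') -sumrN mulr_sumr.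
by apply: ler_sum => j _; rewrite opprB; exact: psi_step.
Qed.

Definition psiC : R := 1 + (b - 1)^-1.

Lemma psiC_ge1 : 1 <= psiC.
Proof. by rewrite lerDl invr_ge0 subr_ge0 ltW. Qed.

Lemma psiC_ge0 : 0 <= psiC. Proof. exact: le_trans psiC_ge1. Qed.

Lemma sum_psi n : \sum_(i < n) psi b i <= psiC.
Proof. by have := psi_tail 0 n; rewrite psi0 mulr1 big_mkord. Qed.

Lemma b_ge0 : 0 <= b. Proof. exact: le_trans (ltW b1). Qed.

Definition ppC : R := 2 * 2 `^ b * psiC.

Lemma ppC_ge0 : 0 <= ppC. Proof. by rewrite !mulr_ge0 ?powR_ge0 ?psiC_ge0. Qed.

(** One of [i] and [n - i] is at least [n / 2], so its weight is at most [2^b * psi b n], and the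
    other weight is summable. *)
Lemma conv_psi n : conv (psi b) (psi b) n <= ppC * psi b n.
Proof.
rewrite /conv; apply: (@le_trans _ _
  (\sum_(i < n.+1) 2 `^ b * psi b n * (psi b i + psi b (n - i)%N))).
  apply: ler_sum => i _; have hi : (i <= n)%N by rewrite -ltnS ltn_ord.
  have p0 k := psi_ge0 b k.
  have hc k : (n <= k.*2)%N -> psi b k <= 2 `^ b * psi b n.
    by move=> h; apply: psi_scale; [exact: b_ge0|lia].
  case: (leqP n i.*2) => h.
    apply: (@le_trans _ _ (2 `^ b * psi b n * psi b (n - i)%N)).
      by apply: ler_wpM2r => //; exact: hc.
    by apply: ler_wpM2l; rewrite ?mulr_ge0 ?powR_ge0 // lerDr.
  rewrite mulrC; apply: (@le_trans _ _ (2 `^ b * psi b n * psi b i)).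
    by apply: ler_wpM2r => //; apply: hc; lia.
  by apply: ler_wpM2l; rewrite ?mulr_ge0 ?powR_ge0 // lerDl.
rewrite -mulr_sumr big_split /= [X in _ + X](reindex_inj rev_ord_inj) /=.
rewrite [X in _ + X](eq_bigr (fun i : 'I_n.+1 => psi b i)); last first.
  by move=> i _; rewrite subSS subKn // -ltnS ltn_ord.
rewrite /ppC; have := sum_psi n.+1; set S := bigop _ _ _ => hS.
have -> : 2 * 2 `^ b * psiC * psi b n = 2 `^ b * psi b n * (psiC + psiC) by ring.
by apply: ler_wpM2l; rewrite ?mulr_ge0 ?powR_ge0 ?psi_ge0 // lerD.
Qed.

Section Eta.
Variable s : nat -> R.
Hypothesis s0 : forall n, 0 <= s n.
Hypothesis sdecr : forall n m, (n <= m)%N -> s m <= s n.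

(* The [gamma] of the paper, up to the shift [(j + 1)^-b] in place of [j^-b]. *)
Definition eta := conv s (psi b).

Lemma eta_ge0 n : 0 <= eta n.
Proof. by apply: conv_ge0 => // i; exact: psi_ge0. Qed.

Lemma s_le_eta n : s n <= eta n.
Proof.
rewrite /eta /conv big_ord_recr /= subnn psi0 mulr1 lerDr.
by apply: sumr_ge0 => i _; rewrite mulr_ge0 ?psi_ge0.
Qed.

Lemma psi_le_eta n : s 0%N * psi b n <= eta n.
Proof.
rewrite /eta conv_recl lerDl; apply: sumr_ge0 => i _.
by rewrite mulr_ge0 ?psi_ge0.
Qed.

Lemma conv_psi_eta n : conv (psi b) eta n <= ppC * eta n.
Proof.
rewrite convC -convA -[leRHS]convZr; apply: ler_conv => i; first by rewrite s0 lexx.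
by rewrite conv_psi conv_ge0 // => j; exact: psi_ge0.
Qed.

(** [eta] itself need not be monotone. The terms already present at [n] decrease; those with index
    beyond [n] add at most [psiC * s n], which [s_le_eta] absorbs. *)
Lemma eta_almost_decr n m : (n <= m)%N -> eta m <= (1 + psiC) * eta n.
Proof.
move=> nm; rewrite /eta /conv -(big_mkord xpredT (fun i => s i * psi b (m - i)%N)).
rewrite (big_cat_nat (n := n.+1)) //= mulrDl mul1r; apply: lerD.
  rewrite big_mkord; apply: ler_sum => i _; apply: ler_wpM2l => //.
  by apply: psi_decr; [exact: b_ge0|lia].
apply: (@le_trans _ _ (\sum_(n.+1 <= i < m.+1) s n * psi b (m - i)%N)).
  rewrite big_nat [leRHS]big_nat; apply: ler_sum => i /andP[ni _].
  by apply: ler_wpM2r; [exact: psi_ge0|apply: sdecr; lia].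
rewrite -mulr_sumr mulrC; apply: (@le_trans _ _ (psiC * s n)).
  apply: ler_wpM2r => //; apply: le_trans (sum_psi m.+1).
  rewrite [leRHS](reindex_inj rev_ord_inj) /=.
  rewrite -(big_mkord xpredT (fun i => psi b (m.+1 - i.+1)%N)).
  rewrite [leRHS](big_cat_nat (n := n.+1)) //= lerDr.
  by apply: sumr_ge0 => i _; exact: psi_ge0.
by apply: ler_wpM2l; [exact: psiC_ge0|exact: s_le_eta].
Qed.

(* Of the two indices summing to [n - 1], either the second is at least [n / 3]
   or the first is. *)
Lemma conv_big_jump A B x y n : 0 <= A -> 0 <= B ->
  (forall j, 0 <= x j <= A * eta j) -> tailb B eta y ->
  conv x y n.-1 <= 2 * A * B * (1 + psiC) * eta 0%N * eta (n %/ 3)%N.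
Proof.
move=> A0 B0 hx hy; have [y0 hy1] := hy.
set q := (n %/ 3)%N.
have c0 : 0 <= 1 + psiC by rewrite addr_ge0 ?psiC_ge0.
rewrite convC /conv -(big_mkord xpredT (fun i => y i * x (n.-1 - i)%N)).
have hx' k m : (k <= m)%N -> x m <= A * (1 + psiC) * eta k.
  move=> km; have /andP[_ h] := hx m; apply: le_trans h _.
  by rewrite -mulrA; apply: ler_wpM2l => //; exact: eta_almost_decr.
have -> : 2 * A * B * (1 + psiC) * eta 0 * eta q =
  (B * eta 0) * (A * (1 + psiC) * eta q) + (B * eta q) * (A * (1 + psiC) * eta 0).
  ring.
have qn : (q <= n.-1.+1)%N by rewrite /q; lia.
rewrite (big_cat_nat (n := q)) //=; apply: lerD.
  apply: (@le_trans _ _ (\sum_(0 <= i < q) y i * (A * (1 + psiC) * eta q))).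
    rewrite big_nat [leRHS]big_nat; apply: ler_sum => i /andP[_ iq].
    by apply: ler_wpM2l => //; apply: hx'; rewrite /q in iq *; lia.
  rewrite -mulr_suml; apply: ler_wpM2r => //; rewrite !mulr_ge0 ?eta_ge0 //.
apply: (@le_trans _ _ (\sum_(q <= i < n.-1.+1) y i * (A * (1 + psiC) * eta 0))).
  by apply: ler_sum => i _; apply: ler_wpM2l => //; exact: hx'.
by rewrite -mulr_suml; apply: ler_wpM2r => //; rewrite !mulr_ge0 ?eta_ge0.
Qed.

End Eta.
End Psi.

(** * From a contraction over windows to polynomial decay *)

Section Decay.
Variables (R : realType) (b : R).
Hypothesis b1 : 1 < b.
Local Notation psi := (psi b).

Lemma bernoulli (y : R) B : 0 <= y <= 1 -> 1 - B%:R * (1 - y) <= y ^+ B.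
Proof.
move=> /andP[y0 y1]; elim: B => [|B IH]; first by rewrite mul0r subr0 expr0.
rewrite exprS; apply: (@le_trans _ _ (y * (1 - B%:R * (1 - y)))); last exact: ler_wpM2l.
rewrite -natr1 -subr_ge0.
have -> : y * (1 - B%:R * (1 - y)) - (1 - (B%:R + 1) * (1 - y)) = B%:R * (1 - y) * (1 - y) by ring.
by rewrite !mulr_ge0 ?subr_ge0.
Qed.

(** Over a window that is a small fraction of [n] the weight changes by a factor close to 1. The
    exponent is rounded up to an integer so that Bernoulli's inequality applies. *)
Lemma psi_slow (r : R) : r < 1 -> exists2 L, (0 < L)%N &
  forall n m, (m <= n)%N -> (L * (n - m) <= n.+1)%N -> r * psi m <= psi n.
Proof.
move=> r1; pose B := Num.bound b.
have hB : b <= B%:R by apply: ltW; apply: archi_boundP; exact: b_ge0.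
pose L := (Num.bound (B%:R / (1 - r))).+1.
have r1' : 0 < 1 - r by rewrite subr_gt0.
have hL : B%:R / (1 - r) <= L%:R.
  apply: (@le_trans _ _ (Num.bound (B%:R / (1 - r)))%:R); last by rewrite ler_nat.
  by apply: ltW; apply: archi_boundP; rewrite divr_ge0 // ltW.
exists L => // n m mn h.
pose y : R := m.+1%:R / n.+1%:R.
have y0 : 0 < y by rewrite divr_gt0 ?ltr0n.
have y1 : y <= 1 by rewrite ler_pdivrMr ?ltr0n // mul1r ler_nat.
have e : psi n = y `^ b * psi m.
  rewrite /psi powRM ?ler0n ?invr_ge0 // -(@powR_inv1 _ n.+1%:R) ?ler0n // -powRrM mulN1r.
  rewrite mulrAC -powRD; first by rewrite subrr powRr0 mul1r.
  by rewrite subrr eqxx pnatr_eq0.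
rewrite e; apply: ler_wpM2r; first exact: psi_ge0.
apply: (@le_trans _ _ (y `^ B%:R)); last by apply: ger_powR; rewrite ?y0.
rewrite powR_mulrn ?(ltW y0) //; apply: le_trans (bernoulli B _); last by rewrite (ltW y0).
rewrite lerBrDl -lerBrDr.
have L0 : 0 < L%:R :> R by rewrite ltr0n.
have hy : 1 - y <= L%:R^-1.
  rewrite /y -[X in X - _](@divff _ n.+1%:R) ?pnatr_eq0 // -mulrBl -natrB // subSS.
  rewrite ler_pdivrMr ?ltr0n // mulrC ler_pdivlMr //.
  by rewrite -natrM ler_nat mulnC.
apply: (@le_trans _ _ (B%:R * L%:R^-1)); first by apply: ler_wpM2l.
by rewrite ler_pdivrMr // mulrC -ler_pdivrMr.
Qed.

(** The window length is free: [h = n / L] makes [psi h] comparable to [psi n], while the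
    contraction beats the loss from [psi (n - h)] to [psi n]. This serves both the renewal
    differences ([rho = 1 / 2]) and the overshoots of chains of blocks ([rho] the surviving
    fraction). *)
Lemma decay_rec (rho : R) : 0 <= rho < 1 -> exists2 K, 0 <= K &
  forall A (x : nat -> R), 0 <= A -> (forall n, x n <= A) ->
  (forall h n M, (0 < h <= n)%N -> (forall m, (n - h <= m < n)%N -> x m <= M) ->
     x n <= A * psi h + rho * M) ->
  forall n, x n <= K * A * psi n.
Proof.
move=> /andP[r0 r1].
(* The mean of [rho] and 1 satisfies [rho <= r' ^ 2]: one factor pays for the passage from
   [psi (n - h)] to [psi n], the other remains as a contraction. *)
pose r' := (1 + rho) / 2.
have r'1 : r' < 1 by rewrite /r'; lra.
have [L L0 hL] := psi_slow r'1.
have i0 : 0 < 1 - r' by rewrite subr_gt0.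
have Lb : 0 <= L%:R `^ b by exact: powR_ge0.
exists (L%:R `^ b / (1 - r')) => [|A x A0 xA hx n]; first by rewrite divr_ge0 // ltW.
set K := L%:R `^ b / (1 - r').
have hK : K * (1 - r') = L%:R `^ b by rewrite /K divfK // gt_eqF.
have KL : L%:R `^ b <= K.
  have K0 : 0 <= K by rewrite /K divr_ge0 // ltW.
  rewrite -hK ler_piMr // /r'; lra.
have b0 := b_ge0 b1.
elim/ltn_ind: n => n IH.
case: (ltnP n L) => nL.
  apply: (le_trans (xA n)); rewrite mulrAC ler_peMl //.
  apply: (@le_trans _ _ (L%:R `^ b * psi n)); last by apply: ler_wpM2r => //; exact: psi_ge0.
  by have := @psi_scale R b L n 0 b0; rewrite psi0 => h; apply: h; rewrite muln1.
pose h := (n %/ L)%N.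
have h1 : (0 < h <= n)%N by rewrite divn_gt0 // nL leq_div.
have hh := hx h n (K * A * psi (n - h)%N) h1.
have K0 : 0 <= K by rewrite /K divr_ge0 // ltW.
have {hh} hh : x n <= A * psi h + rho * (K * A * psi (n - h)%N).
  apply: hh => m /andP[m1 m2]; apply: le_trans (IH m m2) _.
  by apply: ler_wpM2l; [exact: mulr_ge0|exact: psi_decr].
apply: (le_trans hh).
have e1 : psi h <= L%:R `^ b * psi n.
  by apply: psi_scale => //; rewrite /h mulnC ltn_ceil.
have e2 : r' * psi (n - h)%N <= psi n.
  apply: hL; first exact: leq_subr.
  rewrite subKn; last by case/andP: h1.
  by rewrite /h mulnC; apply: leqW; exact: leq_trunc_div.
have e3 : rho * psi (n - h)%N <= r' * psi n.
  apply: (@le_trans _ _ (r' * (r' * psi (n - h)%N))); last by apply: ler_wpM2l => //; rewrite /r'; lra.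
  rewrite mulrA; apply: ler_wpM2r; first exact: psi_ge0.
  by rewrite /r'; have := sqr_ge0 (1 - rho); rewrite expr2; lra.
have -> : rho * (K * A * psi (n - h)%N) = K * A * (rho * psi (n - h)%N) by ring.
apply: (@le_trans _ _ (A * (L%:R `^ b * psi n) + K * A * (r' * psi n))).
  by apply: lerD; apply: ler_wpM2l => //; exact: mulr_ge0.
by rewrite -hK -subr_ge0 le_eqVlt; apply/orP; left; apply/eqP; ring.
Qed.

Lemma psi_le_inv n : psi n <= n.+1%:R^-1.
Proof.
rewrite -powR_inv1 ?ler0n // /psi ler_powR ?ler1n // lerN2; exact: ltW.
Qed.

Lemma psi_to0 (A eps : R) : 0 < eps -> exists N, forall n, (N <= n)%N -> A * psi n <= eps.
Proof.
move=> e0; exists (Num.bound (`|A| / eps)) => n hn.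
apply: (@le_trans _ _ (`|A| * psi n)).
  by apply: ler_wpM2r; [exact: psi_ge0|exact: ler_norm].
apply: (@le_trans _ _ (`|A| * n.+1%:R^-1)); first by apply: ler_wpM2l => //; exact: psi_le_inv.
rewrite ler_pdivrMr ?ltr0n // mulrC -ler_pdivrMr //.
apply: (@le_trans _ _ (Num.bound (`|A| / eps))%:R); last by rewrite ler_nat; exact: leqW.
by apply: ltW; apply: archi_boundP; rewrite divr_ge0 // ltW.
Qed.

End Decay.

(** * Limit superior and additive semigroups of integers *)

Section Limsup.
Variable R : realType.

Lemma limsup_ex (x : nat -> R) B : (forall n, `|x n| <= B) -> exists L,
  (forall eps, 0 < eps -> exists N, forall n, (N <= n)%N -> x n <= L + eps) /\
  (forall eps, 0 < eps -> forall N, exists2 n, (N <= n)%N & L - eps <= x n).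
Proof.
move=> hB; pose A := [set c | exists N, forall n, (N <= n)%N -> x n <= c].
have hA : has_inf A.
  split; first by exists B, 0%N => n _; exact: le_trans (ler_norm _) (hB n).
  exists (- B) => c [N /(_ N (leqnn _)) h]; apply: le_trans h.
  by have := hB N; rewrite ler_norml => /andP[].
exists (inf A); split=> eps e0.
  have [c [N hN] hc] := inf_adherent e0 hA.
  by exists N => n hn; apply: (le_trans (hN n hn)); exact: ltW.
move=> N; apply: contrapT => hn.
have : A (inf A - eps).
  exists N => n Nn; rewrite leNgt; apply/negP => h; apply: hn; exists n => //; exact: ltW.
move=> /(ge_inf hA.2); rewrite lerBrDl; lra.
Qed.

(** [d] is the least positive difference of two elements [a] and [a + d]. If it did not divide some
    [j >= d], then [(j / d) * (a + d)] and [(j / d) * a + j] would differ by the smaller remainder;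
    for [j < d] the elements [j] and [j + j] do it. Large multiples of [d] are combinations of [a]
    and [a + d]. *)
Lemma semigroup_gcd (J : nat -> Prop) :
  (forall i j, J i -> J j -> J (i + j)%N) -> (exists2 j, (0 < j)%N & J j) ->
  exists d, [/\ (0 < d)%N, forall j, J j -> (d %| j)%N &
    exists N, forall n, (N <= n)%N -> J (d * n)%N].
Proof.
move=> Jadd [j0 j0p Jj0].
pose D : pred nat := fun k => `[< (0 < k)%N /\ exists a, J a /\ J (a + k)%N >].
have exD : exists k, D k by exists j0; apply/asboolP; split => //; exists j0; split=> //; exact: Jadd.
have Jmul a k : J a -> (0 < k)%N -> J (k * a)%N.
  by move=> Ja; elim: k => // -[|k] IH _; rewrite ?mul1n // mulSn; apply: Jadd => //; exact: IH.
case: (ex_minnP exD) => d /asboolP[d0 [a [Ja Jad]]] dmin.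
have dvdJ j : J j -> (d %| j)%N.
  move=> Jj; rewrite /dvdn; apply/negPn/negP => r0.
  have : D (j %% d)%N.
    apply/asboolP; split; first by rewrite lt0n.
    case: (posnP (j %/ d)) => [q0|q0].
      exists j; split => //; apply: Jadd => //.
      by rewrite {1}(divn_eq j d) q0 in Jj; rewrite mul0n add0n in Jj.
    exists ((j %/ d) * (a + d))%N; split; first exact: Jmul.
    have -> : (j %/ d * (a + d) + j %% d = j %/ d * a + j)%N.
      by rewrite mulnDr -addnA -divn_eq.
    by apply: Jadd => //; exact: Jmul.
  by move/dmin; rewrite leqNgt ltn_mod d0.
exists d; split => //.
have [k0|k0] := posnP (a %/ d).
  have a0 : a = 0%N by rewrite -(divnK (dvdJ _ Ja)) k0.
  by exists 1%N => n n0; rewrite mulnC; apply: Jmul => //; rewrite a0 in Jad.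
exists ((a %/ d) * (a %/ d).+1)%N => n hn.
set k := (a %/ d)%N in k0 hn *.
have ak : a = (k * d)%N by rewrite /k divnK // dvdJ.
have hr : (n %% k < k)%N by rewrite ltn_mod.
have hm : (k < n %/ k)%N by rewrite leq_divRL // mulnC.
have -> : (d * n = (n %/ k - n %% k) * a + n %% k * (a + d))%N.
  rewrite {1}(divn_eq n k) ak.
  have -> : (n %/ k = (n %/ k - n %% k) + n %% k)%N by lia.
  rewrite addnK; nia.
case: (posnP (n %% k)) => [->|r0].
  by rewrite mul0n addn0 subn0; apply: Jmul => //; lia.
by apply: Jadd; apply: Jmul => //; lia.
Qed.

End Limsup.

Lemma sum_ord_split (R : realType) (x : nat -> R) M n : (M <= n)%N ->
  \sum_(i < n) x i = \sum_(i < M) x i + \sum_(M <= i < n) x i.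
Proof. by move=> h; rewrite -!(big_mkord xpredT x) (big_cat_nat (n := M)). Qed.

Lemma sum_shift_le (R : realType) (x : nat -> R) N m i : (i <= N)%N ->
  \sum_(N <= n < m) x (n - i)%N = \sum_(N - i <= n < m - i) x n.
Proof.
move=> h; rewrite -{1}(subnK h) big_addn; apply: eq_bigr => j _.
by rewrite addnK.
Qed.

(** * Aperiodic renewal sequences and the rate of their differences *)

Section Renewal.
Variables (R : realType) (b : R).
Hypothesis b1 : 1 < b.
Local Notation psi := (psi b).

Definition tail1 (f : nat -> R) n := 1 - \sum_(i < n.+1) f i.

Fixpoint cpow (f : nat -> R) r : nat -> R :=
  if r is r'.+1 then conv f (cpow f r') else delta.

(** When [f 0 = 0] the powers beyond [n] vanish at [n], so this truncation is the full renewal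
    series. *)
Definition ren (f : nat -> R) n := \sum_(r < n.+1) cpow f r n.

Section Aperiodic.
Variables (f : nat -> R) (A : R).
Hypothesis f0 : f 0%N = 0.
Hypothesis fge0 : forall n, 0 <= f n.
Hypothesis A0 : 0 <= A.
Hypothesis tA : forall n, 0 <= tail1 f n <= A * psi n.
Local Notation t := (tail1 f).

Lemma cpow_ge0 r n : 0 <= cpow f r n.
Proof.
elim: r n => [|r IH] n; first by rewrite /= /delta ler0n.
by apply: conv_ge0.
Qed.

Lemma cpow_vanish r n : (n < r)%N -> cpow f r n = 0.
Proof using f0.
elim: r n => // r IH n; rewrite ltnS => nr /=.
rewrite conv_recl f0 mul0r add0r big1 // => -[i hi] _ /=.
rewrite IH ?mulr0 //; apply: leq_trans nr.
by rewrite ltn_subrL (leq_ltn_trans _ hi).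
Qed.

Lemma ren_trunc m N : (m < N)%N -> \sum_(r < N) cpow f r m = ren f m.
Proof using f0.
move=> h; rewrite (@sum_ord_split _ (fun r => cpow f r m) _ _ h) big_nat [X in _ + X]big1 ?addr0 //.
by move=> i /andP[hi _]; rewrite cpow_vanish.
Qed.

Lemma renE n : ren f n = delta n + conv f (ren f) n.
Proof using f0.
rewrite {1}/ren big_ord_recl; congr (_ + _).
transitivity (\sum_(r < n) conv f (cpow f r) n).
  by apply: eq_bigr => r _; rewrite lift0.
rewrite exchange_big /=; apply: eq_bigr => -[[|i] hi] _ /=.
  by rewrite f0 mul0r big1 // => r _; rewrite mul0r.
rewrite -mulr_sumr ren_trunc // ltn_subrL /=.
exact: leq_ltn_trans (leq0n i) hi.
Qed.

(** Decomposition by the last renewal up to time [n]: the gap that follows it exceeds the remaining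
    time. *)
Lemma conv_tail_ren r n : (forall n, r n = delta n + conv f r n) -> conv t r n = 1.
Proof using Type.
move=> hr; rewrite convBl conv1.
have -> : conv (fun n => \sum_(i < n.+1) f i) r n = \sum_(m < n.+1) conv f r m.
  by rewrite convC -sum_conv; apply: eq_bigr => i _; rewrite convC.
rewrite -sumrB big_ord_recl hr addrK /delta eqxx big1 ?addr0 // => i _.
by rewrite hr addrK.
Qed.

Lemma tail0 : t 0%N = 1.
Proof using f0. by rewrite /tail1 big_ord1 f0 subr0. Qed.

Lemma ren_ge0 n : 0 <= ren f n.
Proof. by apply: sumr_ge0 => r _; exact: cpow_ge0. Qed.

Lemma tail_ge0 n : 0 <= t n. Proof. by have /andP[] := tA n. Qed.

Lemma ren_le1 n : ren f n <= 1.
Proof.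
rewrite -(conv_tail_ren n renE) conv_recl tail0 mul1r lerDl.
by apply: sumr_ge0 => i _; rewrite mulr_ge0 ?tail_ge0 ?ren_ge0.
Qed.

Lemma tail_step n : t n - t n.+1 = f n.+1.
Proof. rewrite /tail1 [in X in _ - X]big_ord_recr /=; ring. Qed.

Lemma sum_f_tail n m : \sum_(n.+1 <= i < m) f i <= t n.
Proof.
case: (leqP m n.+1) => h; first by rewrite big_geq ?tail_ge0.
have := tail_ge0 m.-1; rewrite /tail1 prednK; last by lia.
by rewrite (@sum_ord_split _ f _ _ (ltnW h)) opprD addrA subr_ge0.
Qed.

(** The mean of the law [f], written as the sum of its tails. *)
Definition Tsum : R := sup (range (fun K => \sum_(j < K) t j)).

Lemma Tsum_has : has_sup (range (fun K => \sum_(j < K) t j)).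
Proof.
split; first by exists (\sum_(j < 0) t j), 0%N.
exists (A * psiC b) => _ [K _ <-].
apply: (@le_trans _ _ (\sum_(j < K) A * psi j)).
  by apply: ler_sum => j _; have /andP[] := tA j.
by rewrite -mulr_sumr; apply: ler_wpM2l => //; exact: sum_psi.
Qed.

Lemma Tsum_ub K : \sum_(j < K) t j <= Tsum.
Proof. by apply: (ub_le_sup Tsum_has.2); exists K. Qed.

Lemma Tsum_near eps : 0 < eps -> exists K, Tsum - \sum_(j < K) t j <= eps.
Proof.
move=> e0; have [_ [K _ <-] h] := sup_adherent e0 Tsum_has.
by exists K; rewrite lerBlDr -lerBlDl; exact: ltW.
Qed.

Lemma Tsum_ge1 : 1 <= Tsum.
Proof. by have := Tsum_ub 1; rewrite big_ord1 tail0. Qed.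

Lemma Tsum_gt0 : 0 < Tsum. Proof. exact: lt_le_trans Tsum_ge1. Qed.

Lemma sum_tail_Tsum n m : \sum_(n <= j < m) t j <= Tsum - \sum_(j < n) t j.
Proof.
case: (leqP n m) => h; first by rewrite lerBrDl -sum_ord_split // Tsum_ub.
by rewrite big_geq ?subr_ge0 ?Tsum_ub // ltnW.
Qed.

Lemma Tsum_tail n : 0 <= Tsum - \sum_(j < n) t j <= A * psiC b * n.+1%:R `^ (- (b - 1)).
Proof.
rewrite subr_ge0 Tsum_ub /=; apply/ler_addgt0Pr => eps e0.
have [K hK] := Tsum_near e0.
apply: (@le_trans _ _ (Tsum - \sum_(j < K + n) t j + \sum_(n <= j < K + n) t j)).
  rewrite (@sum_ord_split _ t n (K + n)) ?leq_addl //; lra.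
rewrite addrC; apply: lerD.
  apply: (@le_trans _ _ (\sum_(n <= j < K + n) A * psi j)).
    by apply: ler_sum => j _; have /andP[] := tA j.
  by rewrite -mulr_sumr -mulrA; apply: ler_wpM2l => //; exact: psi_tail.
apply: le_trans hK; rewrite lerD2l lerN2 (@sum_ord_split _ t K (K + n)) ?leq_addr // lerDl.
by apply: sumr_ge0 => j _; exact: tail_ge0.
Qed.

Lemma tail_to0 eps : 0 < eps -> exists N, forall n, (N <= n)%N -> t n <= eps.
Proof.
move=> e0; have [N hN] := psi_to0 b1 A e0; exists N => n hn.
by apply: le_trans (hN n hn); have /andP[] := tA n.
Qed.

Hypothesis aper : forall d, (forall j, 0 < f j -> (d %| j)%N) -> d = 1%N.

Section Window.
Variables (x : nat -> R) (L : R).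
Hypothesis xb : forall n, `|x n| <= 1.
Hypothesis xr : forall n, (0 < n)%N -> x n = conv f x n.
Hypothesis L1 : forall eps, 0 < eps -> exists N, forall n, (N <= n)%N -> x n <= L + eps.
Hypothesis L2 : forall eps, 0 < eps -> forall N, exists2 n, (N <= n)%N & L - eps <= x n.

(** Values close to the limit superior propagate back by the lag [j]. This set of lags is additive
    and contains the support of [f], hence by aperiodicity all large integers. *)
Let J j := forall eps, 0 < eps -> exists2 del, 0 < del & exists N,
  forall n, (N <= n)%N -> L - del <= x n -> (j <= n)%N /\ L - eps <= x (n - j)%N.

Let Jadd i j : J i -> J j -> J (i + j)%N.
Proof.
move=> hi hj eps e0; have [d1 d10 [N1 h1]] := hj _ e0.
have [d2 d20 [N2 h2]] := hi _ d10; exists d2 => //; exists (N2 + N1 + i)%N => n hn hx.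
have [a1 a2] := h2 n ltac:(lia) hx.
have [a3 a4] := h1 (n - i)%N ltac:(lia) a2.
by rewrite subnDA; split => //; lia.
Qed.

Let Jsupp j : 0 < f j -> J j.
Proof.
(* If [x (n - j)] were well below [L], the weighted mean [x n] could not be within [q] of [L], since
   values at late times do not exceed [L + q]. The two truncation errors [3 * t M] and [2 * t n]
   together cost at most [q], which explains the 5. *)
move=> fj eps e0; pose q := f j * eps / 4.
have q0 : 0 < q by rewrite /q !mulr_gt0 // invr_gt0.
have q5 : 0 < q / 5 by rewrite divr_gt0.
have [N1 h1] := L1 q0; have [M' h2] := tail_to0 q5.
have jp : (0 < j)%N by case: j fj {q q0 q5 h1 h2} => //; rewrite f0 ltxx.
pose M := maxn M' j; exists q => //; exists (N1 + M)%N => n hn hx.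
have jM : (j <= M)%N by rewrite leq_maxr.
have tM : t M <= q / 5 by apply: h2; rewrite leq_maxl.
have tn : t n <= q / 5 by apply: h2; rewrite /M in hn; lia.
split; first by lia.
have hL : -2 <= L.
  have [N hN] := L1 ltr01; have := hN N (leqnn _); have := xb N.
  rewrite ler_norml => /andP[]; lra.
pose y i := x (n - i)%N - L - q.
have Ey : \sum_(i < n.+1) f i * y i = x n - (L + q) * (1 - t n).
  have -> : 1 - t n = \sum_(i < n.+1) f i by rewrite /tail1; ring.
  rewrite xr /conv; last by lia.
  rewrite mulr_sumr -sumrB; apply: eq_bigr => i _; rewrite /y; ring.
have jn : (j < n.+1)%N by lia.
rewrite (bigD1 (Ordinal jn)) //= in Ey.
have Hr : \sum_(i < n.+1 | i != Ordinal jn) f i * y i <= 3 * t M.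
  apply: (@le_trans _ _ (\sum_(i < n.+1) (if (M < i)%N then 3 * f i else 0))).
    rewrite big_mkcond; apply: ler_sum => i _.
    have fi := fge0 i.
    have hif : 0 <= (if (M < i)%N then 3 * f i else 0) by case: ifP => _; rewrite ?mulr_ge0.
    case: ifP => // _; case: ltnP => Mi in hif *.
      rewrite mulrC; apply: ler_wpM2r => //; rewrite /y.
      have := xb (n - i)%N; rewrite ler_norml => /andP[]; lra.
    rewrite mulr_ge0_le0 // /y; have := h1 (n - i)%N ltac:(lia); lra.
  rewrite -(big_mkord xpredT (fun i => if (M < i)%N then 3 * f i else 0)).
  rewrite (big_cat_nat (n := M.+1)) //=; last by lia.
  rewrite [X in X + _]big_nat [X in X + _]big1 ?add0r; last first.
    by move=> i /andP[_ hi]; rewrite ltnNge -ltnS hi.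
  rewrite big_nat (eq_bigr (fun i => 3 * f i)); last by move=> i /andP[-> _].
  by rewrite -big_nat -mulr_sumr; apply: ler_wpM2l => //; exact: sum_f_tail.
have t0 := tail_ge0 n; have tM0 := tail_ge0 M.
have prod : -2 * t n <= (L + q) * t n by apply: ler_wpM2r => //; lra.
have fy : - (3 * q) <= f j * y j.
  move: Ey Hr prod hx tM tn t0 tM0 q0.
  rewrite (_ : (L + q) * (1 - t n) = L + q - (L + q) * t n); last by ring.
  set S := bigop _ _ _; set P := (L + q) * t n; set F := f j * y j.
  lra.
have : - (3 / 4 * eps) <= y j.
  rewrite -(ler_pM2l fj); apply: le_trans fy; rewrite /q; lra.
rewrite /y; lra.
Qed.

(** All lags from some [N0] on lie in [J]. Applying [N0, ..., N0 + K] to a single late time where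
    [x] is close to [L] produces a whole window of such values. *)
Lemma limsup_window eps K N : 0 < eps ->
  exists m, [/\ (N <= m)%N, (K <= m)%N & forall j, (j <= K)%N -> L - eps <= x (m - j)%N].
Proof.
move=> e0.
have [j0 fj0] : exists j, 0 < f j.
  apply: contrapT => hn; have // : 2%N = 1%N.
  by apply: aper => j fj; exfalso; apply: hn; exists j.
have j0p : (0 < j0)%N by case: j0 fj0 => //; rewrite f0 ltxx.
have [d [d0 dJ [N0 hN0]]] := semigroup_gcd Jadd (ex_intro2 _ _ j0 j0p (Jsupp fj0)).
have d1 : d = 1%N by apply: aper => j fj; apply: dJ; exact: Jsupp.
rewrite {}d1 in hN0.
have : exists2 del, 0 < del & exists N', forall n, (N' <= n)%N -> L - del <= x n ->
   forall j, (j <= K)%N -> (N0 + j <= n)%N /\ L - eps <= x (n - (N0 + j))%N.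
  elim: K => [|K [d1 d10 [N1 h1]]].
    have [d1 d10 [N1 h1]] := hN0 N0 (leqnn _) _ e0.
    exists d1 => //; exists N1 => n hn hx j; rewrite leqn0 => /eqP ->.
    by have := h1 n hn hx; rewrite mul1n addn0.
  have [d2 d20 [N2 h2]] := hN0 (N0 + K.+1)%N (leq_addr _ _) _ e0.
  exists (Num.min d1 d2); first by rewrite lt_min d10.
  exists (maxn N1 N2) => n; rewrite geq_max => /andP[n1 n2] hx j jK.
  have m1 : Num.min d1 d2 <= d1 by rewrite ge_min lexx.
  have m2 : Num.min d1 d2 <= d2 by rewrite ge_min lexx orbT.
  case: (leqP j K) => hj; first by apply: h1 => //; lra.
  have -> : j = K.+1 by lia.
  by have := h2 n n2; rewrite mul1n; apply; lra.
move=> [del d0' [N' h]]; have [n hn hx] := L2 d0' (N' + N + N0 + K)%N.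
exists (n - N0)%N; split; [lia|lia|move=> j jK].
by have [_] := h n ltac:(lia) hx j jK; rewrite subnDA.
Qed.

End Window.

Local Notation u := (ren f).

(** On a long window where [u] is close to its limit superior [L], the identity [conv_tail_ren]
    gives [L * Tsum <= 1]; the same argument for [- u] bounds the limit inferior from below. *)
Lemma ren_cvg eps : 0 < eps -> exists N, forall n, (N <= n)%N -> `|u n - Tsum^-1| <= eps.
Proof.
have T0 := Tsum_gt0.
have ub n : `|u n| <= 1 by rewrite ger0_norm ?ren_ge0 ?ren_le1.
have ub' n : `|- u n| <= 1 by rewrite normrN.
have ur n : (0 < n)%N -> u n = conv f u n.
  by move=> n0; rewrite {1}renE /delta (gtn_eqF n0) add0r.
have ur' n : (0 < n)%N -> - u n = conv f (fun i => - u i) n.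
  move=> n0; rewrite ur // /conv -sumrN; apply: eq_bigr => i _; ring.
have [L [L1 L2]] := limsup_ex ub; have [l [l1 l2]] := limsup_ex ub'.
have key m K : (K <= m)%N -> 1 = \sum_(j < K) t j * u (m - j)%N + \sum_(K <= j < m.+1) t j * u (m - j)%N.
  move=> Km; rewrite -(conv_tail_ren m renE) /conv.
  by rewrite (@sum_ord_split _ (fun j => t j * u (m - j)%N) K m.+1) //; lia.
have part K : \sum_(j < K) t j <= Tsum by exact: Tsum_ub.
have LT : L <= Tsum^-1.
  rewrite -[leRHS]mul1r ler_pdivlMr //; apply/ler_addgt0Pr => e e0.
  have L1' : L <= 1.
    apply/ler_addgt0Pr => e' e'0; have [n _] := L2 _ e'0 0%N.
    have := ren_le1 n; lra.
  have L0 : 0 <= L.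
    apply/ler_addgt0Pr => e' e'0; have [n /(_ n (leqnn _))] := L1 _ e'0.
    have := ren_ge0 n; lra.
  pose e1 := e / 2 / Tsum.
  have e10 : 0 < e1 by rewrite /e1 !divr_gt0.
  have e20 : 0 < e / 2 by rewrite divr_gt0.
  have [K hK] := Tsum_near e20.
  have [m [_ Km hm]] := limsup_window ub ur L1 L2 K 0 e10.
  have h1 : (L - e1) * \sum_(j < K) t j <= 1.
    rewrite (key m K Km) mulr_sumr; apply: ler_wpDr.
      by apply: sumr_ge0 => j _; rewrite mulr_ge0 ?tail_ge0 ?ren_ge0.
    apply: ler_sum => j _; rewrite mulrC; apply: ler_wpM2l; first exact: tail_ge0.
    by apply: hm; exact: ltnW.
  have h2 : e1 * \sum_(j < K) t j <= e / 2.
    apply: (@le_trans _ _ (e1 * Tsum)); first by apply: ler_wpM2l => //; exact: ltW.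
    by rewrite /e1 divfK // gt_eqF.
  have h3 : L * (Tsum - \sum_(j < K) t j) <= e / 2.
    apply: le_trans hK; rewrite ler_piMl // subr_ge0 //.
  move: h1 h2 h3; rewrite mulrBl mulrBr; lra.
have lT : Tsum^-1 <= - l.
  rewrite -[leLHS]mul1r ler_pdivrMr //; apply/ler_addgt0Pr => e e0.
  pose e1 := e / 2 / Tsum.
  have e10 : 0 < e1 by rewrite /e1 !divr_gt0.
  have e20 : 0 < e / 2 by rewrite divr_gt0.
  have [K hK] := Tsum_near e20.
  have [m [_ Km hm]] := limsup_window ub' ur' l1 l2 K 0 e10.
  have l0 : 0 <= - l.
    apply/ler_addgt0Pr => e' e'0; have [n _] := l2 _ e'0 0%N.
    have := ren_ge0 n; lra.
  have h1 : \sum_(j < K) t j * u (m - j)%N <= (- l + e1) * Tsum.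
    apply: (@le_trans _ _ ((- l + e1) * \sum_(j < K) t j)); last first.
      by apply: ler_wpM2l => //; lra.
    rewrite mulr_sumr; apply: ler_sum => j _; rewrite mulrC; apply: ler_wpM2r; first exact: tail_ge0.
    have := hm j (ltnW (ltn_ord j)); lra.
  have h2 : \sum_(K <= j < m.+1) t j * u (m - j)%N <= e / 2.
    apply: le_trans hK; apply: le_trans (sum_tail_Tsum K m.+1).
    by apply: ler_sum => j _; rewrite ler_piMr ?tail_ge0 ?ren_le1.
  have h3 : e1 * Tsum = e / 2 by rewrite /e1 divfK // gt_eqF.
  have := key m K Km; move: h1 h2 h3; rewrite mulrDl.
  set S1 := \sum_(j < K) _; set S2 := \sum_(K <= j < m.+1) _; lra.
move=> e0; have [N1 h1] := L1 _ e0; have [N2 h2] := l1 _ e0.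
exists (maxn N1 N2) => n; rewrite geq_max => /andP[n1 n2].
have := h1 n n1; have := h2 n n2; rewrite ler_norml; lra.
Qed.

(** In generating functions this is [1 - z] times the renewal series, that is, the convolution
    inverse of the tail sequence [t]. *)
Definition rdiff n := u n - (if n is n'.+1 then u n' else 0).
Local Notation e := rdiff.

Lemma sum_rdiff n : \sum_(i < n.+1) e i = u n.
Proof.
elim: n => [|n IH]; first by rewrite big_ord1 /rdiff subr0.
by rewrite big_ord_recr IH /= /rdiff addrC subrK.
Qed.

Lemma conv_rdiff_tail n : conv e t n = delta n.
Proof.
have h m : \sum_(i < m.+1) conv e t i = 1.
  rewrite -(conv_tail_ren m renE) -(@eq_conv _ t t (fun m => \sum_(i < m.+1) e i)) //; last first.
    by move=> i _; exact: sum_rdiff.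
  by rewrite -sum_conv; apply: eq_bigr => i _; exact: convC.
case: n => [|n]; first by have := h 0%N; rewrite big_ord1 => ->.
by have := h n.+1; rewrite big_ord_recr /= h -{2}[1]addr0 => /addrI ->.
Qed.

Lemma conv_to0 (x : nat -> R) V : 0 <= V -> (forall n, 0 <= x n <= V) ->
  (forall eps, 0 < eps -> exists N, forall n, (N <= n)%N -> x n <= eps) ->
  forall eps, 0 < eps -> exists N, forall n, (N <= n)%N -> conv x t n <= eps.
Proof.
have T0 := Tsum_gt0.
move=> V0 xV xto eps e0; pose e1 := eps / 2 / Tsum; pose e2 := eps / 2 / (V + 1).
have e10 : 0 < e1 by rewrite /e1 !divr_gt0.
have V1 : 0 < V + 1 by lra.
have e20 : 0 < e2 by rewrite /e2 !divr_gt0.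
have [N hN] := xto _ e10; have [K hK] := Tsum_near e20.
exists (N + K)%N => n hn; rewrite convC /conv.
rewrite (@sum_ord_split _ (fun i => t i * x (n - i)%N) K n.+1); last by lia.
have -> : eps = eps / 2 + eps / 2 by lra.
apply: lerD.
  apply: (@le_trans _ _ (e1 * \sum_(i < K) t i)).
    rewrite mulr_sumr; apply: ler_sum => i _; rewrite mulrC; apply: ler_wpM2r; first exact: tail_ge0.
    by apply: hN; have := ltn_ord i; lia.
  apply: (@le_trans _ _ (e1 * Tsum)); first by apply: ler_wpM2l; [exact: ltW|exact: Tsum_ub].
  by rewrite /e1 divfK // gt_eqF.
apply: (@le_trans _ _ (V * \sum_(K <= i < n.+1) t i)).
  rewrite mulr_sumr; apply: ler_sum => i _; rewrite mulrC; apply: ler_wpM2r; first exact: tail_ge0.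
  by have /andP[] := xV (n - i)%N.
apply: (@le_trans _ _ (V * e2)).
  by apply: ler_wpM2l => //; apply: le_trans hK; exact: sum_tail_Tsum.
rewrite /e2 mulrA ler_pdivrMr // mulrC; apply: ler_wpM2l; lra.
Qed.

Let v i := u i - Tsum^-1.

(** Summation by parts, with [e] viewed as the differences of [v = u - 1 / Tsum]. Summed over
    [n > N], the three terms are controlled by [v N], by the tail of [Tsum] and by [conv |v| t N],
    which all tend to 0. *)
Lemma rdiff_partial N n : (N <= n)%N ->
  \sum_(i < N.+1) e i * t (n - i)%N =
  v N * t (n - N)%N + t n / Tsum - \sum_(i < N) v i * f (n - i)%N.
Proof.
elim: N => [|N IH] hN.
  rewrite big_ord1 big_ord0 subr0 subn0 /v /rdiff subr0; ring.
rewrite big_ord_recr IH /=; last by lia.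
rewrite [\sum_(i < N.+1) _]big_ord_recr /= /v /rdiff.
have -> : f (n - N)%N = t (n - N.+1)%N - t (n - N)%N.
  by rewrite (_ : (n - N = (n - N.+1).+1)%N) ?tail_step //; lia.
ring.
Qed.

(* Wiener's lemma by hand: a truncation [eN] of [e] is an approximate inverse of [t],
   with a defect [y] of small l1 norm. *)
Theorem rdiff_psi : exists2 C, 0 <= C & forall n, `|e n| <= C * psi n.
Proof.
have T0 := Tsum_gt0; have b0 := b_ge0 b1.
have Ti0 : 0 <= Tsum^-1 by rewrite invr_ge0 ltW.
have vV n : 0 <= `|v n| <= 1 + Tsum^-1.
  rewrite normr_ge0 /=; apply: le_trans (ler_normB _ _) _; apply: lerD.
    by rewrite ger0_norm ?ren_ge0 ?ren_le1.
  by rewrite ger0_norm.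
have e40 : 0 < 1 / 8 :> R by lra.
have e50 : 0 < 1 / 8 / Tsum by rewrite divr_gt0.
have e60 : 0 < 1 / 8 * Tsum by rewrite mulr_gt0.
have V0 : 0 <= 1 + Tsum^-1 by rewrite addr_ge0.
have [N1 h1] := @conv_to0 (fun i => `|v i|) _ V0 vV ren_cvg _ e40.
have [N2 h2] := ren_cvg e50.
have [N3 h3] := Tsum_near e60.
pose N := maxn N1 (maxn N2 N3).
have hN1 : (N1 <= N)%N by rewrite leq_maxl.
have hN2 : (N2 <= N)%N by rewrite /N maxnCA leq_maxl.
have hN3 : (N3 <= N)%N by rewrite /N maxnA leq_maxr.
clearbody N.
have {}h1 := h1 N hN1.
have {}h2 := h2 N hN2.
have {}h3 : Tsum - \sum_(j < N) t j <= 1 / 8 * Tsum.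
  apply: le_trans h3; rewrite lerD2l lerN2 (@sum_ord_split _ t N3 N) //.
  by rewrite lerDl; apply: sumr_ge0 => j _; exact: tail_ge0.
pose eN i := if (i <= N)%N then e i else 0.
pose y n := delta n - conv eN t n.
have y0 n : (n <= N)%N -> y n = 0.
  move=> hn; rewrite /y -conv_rdiff_tail (@eq_conv _ e eN t t n) ?subrr // => i hi.
  by rewrite /eN (leq_trans hi hn).
have yE n : (N < n)%N -> y n = - \sum_(i < N.+1) e i * t (n - i)%N.
  move=> hn; rewrite /y /delta (gtn_eqF (leq_ltn_trans (leq0n _) hn)) sub0r /conv.
  rewrite (@sum_ord_split _ (fun i => eN i * t (n - i)%N) N.+1 n.+1); last by rewrite ltnS ltnW.
  rewrite big_nat [X in - (_ + X)]big1 ?addr0; last first.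
    by move=> i /andP[hi _]; rewrite /eN leqNgt hi mul0r.
  by congr (- _); apply: eq_bigr => i _; rewrite /eN -ltnS ltn_ord.
have ysum m : \sum_(i < m) `|y i| <= 1 / 2.
  apply: (@le_trans _ _ (\sum_(N.+1 <= i < m) `|y i|)).
    case: (leqP m N.+1) => hm.
      rewrite big1 ?sumr_ge0 // => i _; rewrite y0 ?normr0 // -ltnS; exact: leq_trans (ltn_ord i) hm.
    rewrite (@sum_ord_split _ (fun i => `|y i|) N.+1 m); last exact: ltnW.
    by rewrite big1 ?add0r // => i _; rewrite y0 ?normr0 // -ltnS.
  apply: (@le_trans _ _ (\sum_(N.+1 <= n < m) (\sum_(i < N) `|v i| * f (n - i)%N +
       (`|v N| * t (n - N)%N + t n / Tsum)))).
    rewrite big_nat [leRHS]big_nat; apply: ler_sum => n /andP[hn _].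
    rewrite yE // normrN rdiff_partial; last exact: ltnW.
    apply: le_trans (ler_normB _ _) _; rewrite addrC; apply: lerD.
      apply: le_trans (ler_norm_sum _ _ _) _; apply: ler_sum => i _.
      by rewrite normrM (ger0_norm (fge0 _)).
    apply: le_trans (ler_normD _ _) _.
    rewrite normrM (ger0_norm (tail_ge0 _)) lerD2l ger0_norm // mulr_ge0 ?tail_ge0 //.
  rewrite !big_split /=.
  have s1 : \sum_(N.+1 <= n < m) \sum_(i < N) `|v i| * f (n - i)%N <= 1 / 8.
    apply: le_trans h1; rewrite exchange_big /=.
    apply: (@le_trans _ _ (\sum_(i < N) `|v i| * t (N - i)%N)).
      apply: ler_sum => i _; rewrite -mulr_sumr; apply: ler_wpM2l => //.
      have iN : (i <= N)%N by exact: ltnW.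
      by rewrite sum_shift_le ?subSn ?sum_f_tail // ltnW.
    by rewrite /conv [leRHS]big_ord_recr /= lerDl mulr_ge0 ?tail_ge0.
  have s2 : \sum_(N.+1 <= n < m) `|v N| * t (n - N)%N <= 1 / 8.
    rewrite -mulr_sumr; apply: (@le_trans _ _ (1 / 8 / Tsum * Tsum)); last by rewrite divfK // gt_eqF.
    apply: ler_pM => //; first by apply: sumr_ge0 => j _; exact: tail_ge0.
    rewrite sum_shift_le //; apply: le_trans (sum_tail_Tsum _ _) _.
    by rewrite gerBl; apply: sumr_ge0 => j _; exact: tail_ge0.
  have s3 : \sum_(N.+1 <= n < m) t n / Tsum <= 1 / 8.
    rewrite -mulr_suml ler_pdivrMr //; apply: le_trans h3.
    apply: le_trans (sum_tail_Tsum _ _) _; rewrite lerD2l lerN2 big_ord_recr /= lerDl.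
    exact: tail_ge0.
  lra.
pose E := \sum_(i < N.+1) `|e i|.
have E0 : 0 <= E by apply: sumr_ge0.
have econv n : e n = eN n + conv y e n.
  rewrite /y convBl conv_delta -convA.
  rewrite (@eq_conv _ eN eN (conv t e) delta n) //; last by move=> i _; rewrite convC conv_rdiff_tail.
  by rewrite (convC eN) conv_delta; ring.
have eNE m : \sum_(i < m) `|eN i| <= E.
  case: (leqP m N.+1) => hm.
    rewrite /E (@sum_ord_split _ (fun i => `|e i|) m N.+1) //; apply: ler_wpDr; first exact: sumr_ge0.
    by apply: ler_sum => i _; rewrite /eN; case: ifP; rewrite ?normr0.
  rewrite (@sum_ord_split _ (fun i => `|eN i|) N.+1 m); last exact: ltnW.
  rewrite big_nat [X in _ + X]big1 ?addr0; last first.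
    by move=> i /andP[hi _]; rewrite /eN leqNgt hi normr0.
  by apply: ler_sum => i _; rewrite /eN; case: ifP; rewrite ?normr0.
(* From [e = eN + conv y e] a partial l1 norm [S] of [e] satisfies [S <= E + S / 2]; finiteness of
   [S] is free because the sum is finite. *)
have esum m : \sum_(i < m.+1) `|e i| <= 2 * E.
  set S := \sum_(i < m.+1) `|e i|.
  have S0 : 0 <= S by exact: sumr_ge0.
  have : S <= E + 1 / 2 * S.
    apply: (@le_trans _ _ (\sum_(i < m.+1) (`|eN i| + conv (fun j => `|y j|) (fun j => `|e j|) i))).
      apply: ler_sum => i _; rewrite {1}econv; apply: le_trans (ler_normD _ _) _.
      by rewrite lerD2l ler_norm_conv.
    rewrite big_split /=; apply: lerD; first exact: eNE.
    rewrite sum_conv; apply: (@le_trans _ _ (\sum_(i < m.+1) `|y i| * S)).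
      apply: ler_sum => i _; apply: ler_wpM2l => //.
      rewrite /S (@sum_ord_split _ (fun i => `|e i|) (m - i).+1 m.+1); last by rewrite ltnS leq_subr.
      by rewrite lerDl sumr_ge0.
    by rewrite -mulr_suml; apply: ler_wpM2r.
  lra.
have e1b n : `|e n| <= 2 * E.
  by apply: le_trans (esum n); rewrite big_ord_recr /= lerDr sumr_ge0.
pose Y := E * A * N.+1%:R `^ b.
have Y0 : 0 <= Y by rewrite !mulr_ge0 ?powR_ge0.
have yY n : `|y n| <= Y * psi n.
  case: (leqP n N) => hn; first by rewrite y0 // normr0 mulr_ge0 ?psi_ge0.
  rewrite yE // normrN; apply: le_trans (ler_norm_sum _ _ _) _.
  rewrite /Y /E -!mulrA mulr_suml; apply: ler_sum => i _.
  rewrite normrM (ger0_norm (tail_ge0 _)); apply: ler_wpM2l => //.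
  have /andP[_ h] := tA (n - i)%N; apply: le_trans h _; apply: ler_wpM2l => //.
  apply: psi_scale => //; have := ltn_ord i; clear; nia.
have half : 0 <= (1 / 2 : R) < 1 by apply/andP; split; lra.
have [K K0 hK] := decay_rec b1 half.
pose A' := 2 * E * (1 + Y + N.+1%:R `^ b).
have Nb0 : 0 <= N.+1%:R `^ b :> R by exact: powR_ge0.
have A'0 : 0 <= A' by rewrite /A' !mulr_ge0 // !addr_ge0.
exists (K * A'); first exact: mulr_ge0.
apply: hK => //.
  move=> n; apply: le_trans (e1b n) _; rewrite /A' ler_peMr ?mulr_ge0 //; lra.
(* In [conv y e] the indices [i > h] are paid by the decay of [y], which is that of [t] because [eN]
   has finite support, and the indices [i <= h] by the l1 norm of [y]. The index 0 would bring back
   [e n] itself, but [y 0 = 0]. *)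
move=> h n M hn hM.
have M0 : 0 <= M by apply: le_trans (hM n.-1 _); [exact: normr_ge0|clear -hn; lia].
case: (leqP n N) => nN.
  apply: ler_wpDr; first by rewrite mulr_ge0.
  apply: le_trans (e1b n) _; rewrite /A' -(mulrA (2 * E)) ler_peMr ?mulr_ge0 //.
  apply: (@le_trans _ _ (N.+1%:R `^ b * psi h)).
    have := @psi_scale R b N.+1 h 0 b0; rewrite psi0 => hh; apply: hh.
    by rewrite muln1; clear -hn nN; lia.
  by apply: ler_wpM2r; [exact: psi_ge0|lra].
rewrite econv {1}/eN leqNgt nN add0r.
apply: le_trans (ler_norm_sum _ _ _) _.
have hn1 : (h < n.+1)%N by clear -hn; lia.
rewrite (@sum_ord_split _ (fun i => `|y i * e (n - i)%N|) h.+1 n.+1) // addrC; apply: lerD.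
  apply: (@le_trans _ _ (Y * psi h * (2 * E))).
    apply: (@le_trans _ _ (\sum_(h.+1 <= i < n.+1) Y * psi h * `|e (n - i)%N|)).
      rewrite big_nat [leRHS]big_nat; apply: ler_sum => i /andP[hi _].
      rewrite normrM; apply: ler_wpM2r => //; apply: le_trans (yY i) _.
      by apply: ler_wpM2l => //; apply: psi_decr => //; exact: ltnW.
    rewrite -mulr_sumr; apply: ler_wpM2l; first by rewrite mulr_ge0 ?psi_ge0.
    apply: le_trans (esum n); rewrite [leRHS](reindex_inj rev_ord_inj) /=.
    rewrite -(big_mkord xpredT (fun i => `|e (n.+1 - i.+1)%N|)).
    rewrite [leRHS](big_cat_nat (n := h.+1)) //= lerDr sumr_ge0 //.
  have -> : Y * psi h * (2 * E) = 2 * E * Y * psi h by ring.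
  apply: ler_wpM2r; first exact: psi_ge0.
  by rewrite /A'; apply: ler_wpM2l; [rewrite mulr_ge0|lra].
apply: (@le_trans _ _ (\sum_(i < h.+1) `|y i| * M)).
  apply: ler_sum => i _; rewrite normrM.
  case: (posnP i) => i0; first by rewrite i0 y0 // normr0 !mul0r.
  by apply: ler_wpM2l => //; apply: hM; have := ltn_ord i; clear -hn i0; lia.
by rewrite -mulr_suml; apply: ler_wpM2r.
Qed.

End Aperiodic.
End Renewal.

(** * Lattice renewal sequences, their expansion and the order of its error *)

Section Periodic.
Variables (R : realType) (b : R).
Hypothesis b1 : 1 < b.
Local Notation psib := (psi b).

Definition dl (d n : nat) : R := (n == d)%:R.

Lemma conv_dl d x n : conv (dl d) x n = if (d <= n)%N then x (n - d)%N else 0.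
Proof.
rewrite /conv /dl; case: ifP => h.
  have h' : (d < n.+1)%N by [].
  rewrite (bigD1 (Ordinal h')) //= eqxx mul1r big1 ?addr0 // => i hi.
  by rewrite (_ : (i == d :> nat) = false) ?mul0r //; apply: contraNF hi => /eqP hi; apply/eqP/val_inj.
rewrite big1 // => i _; rewrite (_ : (i == d :> nat) = false) ?mul0r //.
by apply/negbTE/eqP => hi; move: h; rewrite -hi -ltnS ltn_ord.
Qed.

Lemma sum_multiples d (F : nat -> R) n : (0 < d)%N -> (forall j, ~~ (d %| j)%N -> F j = 0) ->
  \sum_(i < n.+1) F (d * i)%N = \sum_(j < (d * n).+1) F j.
Proof.
move=> d0 hF; elim: n => [|n IH]; first by rewrite muln0 !big_ord1 /= muln0.
rewrite big_ord_recr IH [RHS](@sum_ord_split _ F (d * n).+1) /=; last by nia.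
congr (_ + _); rewrite big_nat_recr /=; last by nia.
rewrite big_nat big1 ?add0r // => j /andP[j1 j2]; apply: hF.
apply/negP => /dvdnP[k hk]; move: j1 j2; rewrite hk (mulnC k) ltn_pmul2l // => h.
by rewrite ltn_pmul2l // ltnS leqNgt h.
Qed.

(** With [d] the greatest common divisor of the support, the law [n |-> f (d * n)] is aperiodic. Its
    renewal sequence, spread over the multiples of [d], solves the equation for [f], and the
    difference with lag [d] inherits the rate. *)
Theorem renewal_period (f : nat -> R) A : f 0%N = 0 -> (forall n, 0 <= f n) -> 0 <= A ->
  (forall n, 0 <= tail1 f n <= A * psib n) ->
  exists d, [/\ (0 < d)%N, forall j, 0 < f j -> (d %| j)%N &
  exists r e C, [/\ 0 <= C, forall n, r n = delta n + conv f r n,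
    forall n, e n = r n - conv (dl d) r n & forall n, `|e n| <= C * psib n]].
Proof.
move=> f0 fge0 A0 tA.
have [j0 fj0] : exists j, 0 < f j.
  apply: contrapT => hn; have h2 : (0 : R) < 1 / 2 by lra.
  have [N hN] := tail_to0 b1 tA h2.
  have : tail1 f N = 1.
    rewrite /tail1 big1 ?subr0 // => i _; apply/eqP; rewrite eq_le fge0 andbT leNgt.
    by apply/negP => h; apply: hn; exists i.
  by have := hN N (leqnn _); lra.
have j0p : (0 < j0)%N by case: j0 fj0 => //; rewrite f0 ltxx.
pose P : pred nat := fun d => `[< (0 < d)%N /\ forall j, 0 < f j -> (d %| j)%N >].
have exP : exists d, P d by exists 1%N; apply/asboolP; split => // j _; exact: dvd1n.
have Pub d : P d -> (d <= j0)%N by move=> /asboolP[_ h]; apply: dvdn_leq => //; exact: h.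
case: (ex_maxnP exP Pub) => d /asboolP[d0 hd] dmax.
have fv j : ~~ (d %| j)%N -> f j = 0.
  by move=> h; apply/eqP; rewrite eq_le fge0 andbT leNgt; apply: contra h => /hd.
pose f' i := f (d * i)%N.
have f'0 : f' 0%N = 0 by rewrite /f' muln0.
have f'ge0 n : 0 <= f' n by exact: fge0.
have tE n : tail1 f' n = tail1 f (d * n)%N by rewrite /tail1 -(sum_multiples _ d0 fv).
have b0 := b_ge0 b1.
have tA' n : 0 <= tail1 f' n <= A * psib n.
  rewrite tE; have /andP[-> h] := tA (d * n)%N; apply: le_trans h _.
  by apply: ler_wpM2l => //; apply: psi_decr => //; rewrite leq_pmull.
have aper d' : (forall j, 0 < f' j -> (d' %| j)%N) -> d' = 1%N.
  move=> hd'; have d'0 : (0 < d')%N.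
    case: d' hd' => // h; have /dvdnP[k hk] := hd _ fj0.
    have := h k; rewrite /f' mulnC -hk => /(_ fj0); rewrite dvd0n => /eqP k0.
    by move: j0p; rewrite hk k0.
  have : P (d * d')%N.
    apply/asboolP; split=> [|j fj]; first by rewrite muln_gt0 d0.
    have /dvdnP[k hk] := hd _ fj; rewrite hk mulnC dvdn_pmul2r //; apply: hd'.
    by rewrite /f' mulnC -hk.
  by move=> /dmax; rewrite -[leqRHS]muln1 leq_pmul2l //; lia.
have [C C0 hC] := rdiff_psi b1 f'0 f'ge0 A0 tA' aper.
exists d; split => //.
pose r n := if (d %| n)%N then ren f' (n %/ d)%N else 0.
exists r, (fun n => r n - conv (dl d) r n), (C * d%:R `^ b).
have rren k : ren f' k = delta k + conv f' (ren f') k by exact: renE.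
have rE n : r n = delta n + conv f r n.
  case: (boolP (d %| n)%N) => [/dvdnP[k ->]|hn].
    rewrite /r dvdn_mull // mulnK // rren mulnC; congr (_ + _).
      by rewrite /delta muln_eq0 (gtn_eqF d0).
    rewrite {2}/conv -(@sum_multiples d (fun j => f j * r (d * k - j)%N)) //; last first.
      by move=> j hj; rewrite fv ?mul0r.
    by apply: eq_bigr => i _; rewrite -mulnBr /r dvdn_mulr // mulKn.
  have n0 : n != 0%N by apply: contraNneq hn => ->; rewrite dvdn0.
  rewrite {1}/r (negbTE hn) /delta (negbTE n0) add0r /conv big1 // => i _.
  case: (boolP (d %| i)%N) => hi; last by rewrite fv ?mul0r.
  have hi2 : (i <= n)%N by rewrite -ltnS ltn_ord.
  rewrite /r; case: ifP => [h|]; rewrite ?mulr0 //.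
  have hh : (d %| n)%N by rewrite -(subnK hi2) dvdn_add.
  by rewrite hh in hn.
split => //; first by rewrite mulr_ge0 ?powR_ge0.
move=> n; rewrite conv_dl; case: (boolP (d %| n)%N) => [/dvdnP[k ->]|hn].
  have -> : r (k * d)%N - (if (d <= k * d)%N then r (k * d - d)%N else 0) = rdiff f' k.
    rewrite /rdiff /r dvdn_mull // mulnK //; congr (_ - _); case: k => [|k].
      by rewrite mul0n leqNgt d0.
    by rewrite mulSn leq_addr addKn dvdn_mull // mulnK.
  apply: le_trans (hC k) _; rewrite -mulrA; apply: ler_wpM2l => //.
  by apply: psi_scale => //; nia.
have e0 : r n - (if (d <= n)%N then r (n - d)%N else 0) = 0.
  rewrite /r (negbTE hn); case: ifP => h; rewrite ?subr0 //.
  by rewrite dvdn_subl ?(negbTE hn) ?subr0.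
by rewrite e0 normr0 !mulr_ge0 ?powR_ge0 ?psi_ge0.
Qed.

Definition psum (x : nat -> R) n := \sum_(i < n.+1) x i.

Lemma ut_bound e Ce n : 0 <= Ce -> (forall n, `|e n| <= Ce * psib n) ->
  `|psum e n| <= Ce * psiC b.
Proof.
move=> Ce0 ePsi; apply: le_trans (ler_norm_sum _ _ _) _.
apply: (@le_trans _ _ (\sum_(i < n.+1) Ce * psib i)); first by apply: ler_sum => i _.
by rewrite -mulr_sumr; apply: ler_wpM2l => //; exact: sum_psi.
Qed.

Section Assembly.
Variables (d : nat) (r e : nat -> R) (Ce : R).
Hypothesis d0 : (0 < d)%N.
Hypothesis Ce0 : 0 <= Ce.
Hypothesis eE : forall n, e n = r n - conv (dl d) r n.
Hypothesis ePsi : forall n, `|e n| <= Ce * psib n.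

(** Summation along the residue class of [n] is convolution with [1 / (1 - z ^ d)], the inverse of
    the operation that takes [r] to [e]. *)
Definition cpsum (x : nat -> R) n := \sum_(i < n.+1 | (i %% d == n %% d)%N) x i.

Lemma cpsum_step x n : cpsum x n = x n + conv (dl d) (cpsum x) n.
Proof.
rewrite conv_dl /cpsum !(big_mkcond (fun i => _ == _)) /= big_ord_recr /= eqxx addrC.
congr (_ + _).
rewrite -(big_mkord xpredT (fun i => if (i %% d == n %% d)%N then x i else 0)).
case: leqP => h; last first.
  rewrite big_nat big1 // => i /andP[_ hi]; case: eqP => //.
  by rewrite !modn_small //; [lia|exact: ltn_trans h].
rewrite (big_cat_nat (n := (n - d).+1)) //=; last by lia.
rewrite [X in _ + X]big_nat [X in _ + X]big1 ?addr0; last first.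
  move=> i /andP[h1 h2]; case: eqP => // /eqP.
  rewrite eq_sym eqn_mod_dvd; last exact: ltnW.
  by move=> /dvdn_leq hh; have := hh ltac:(lia); lia.
rewrite big_mkord [RHS]big_mkcond; apply: eq_bigr => i _.
by rewrite -(modnDr (n - d)) subnK.
Qed.

Lemma conv_cpsum x n : conv x r n = conv (cpsum x) e n.
Proof.
have -> : conv (cpsum x) e n = conv (cpsum x) (fun i => r i - conv (dl d) r i) n.
  by apply: eq_conv.
rewrite convBr convA -convBl; apply: eq_conv => // i _.
by rewrite (convC (cpsum x)) cpsum_step addrK.
Qed.

Variable s : nat -> R.
Hypothesis s0 : forall n, 0 <= s n.
Hypothesis sdecr : forall n m, (n <= m)%N -> s m <= s n.
Local Notation eta := (eta b s).

(** The class sums of [X] and the partial sums of [C] are replaced by the constants [V] and [W],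
    which leaves [V * W * psum e]. The first replacement costs a convolution of three sequences,
    settled by [conv_big_jump]; the second costs only a multiple of [eta]. Class sums are controlled
    up to [n - 1] only, whence the cut-off in [g]. *)
Lemma conv_assembly X C V W A1 A2 A3 n : 0 <= A1 -> 0 <= A2 -> 0 <= A3 ->
  (forall k, (k <= n.-1)%N -> `|cpsum X k - V| <= A1 * eta k) ->
  (forall k, `|psum C k - W| <= A2 * eta k) -> tailb A3 eta (fun k => `|C k|) ->
  `|conv (conv X r) C n.-1 - V * W * psum e n.-1| <=
    (2 * Ce * ppC b * (1 + psiC b) * (eta 0%N + 1)) * (A1 * A3 + `|V| * A2) * eta (n %/ 3)%N.
Proof.
move=> A10 A20 A30 hX hC hC'; set N := n.-1.
pose g k := if (k <= N)%N then cpsum X k - V else 0.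
have gE k : `|g k| <= A1 * eta k.
  by rewrite /g; case: ifP => h; [exact: hX|rewrite normr0 mulr_ge0 // eta_ge0].
have -> : conv (conv X r) C N = V * conv (psum e) C N + conv (conv g e) C N.
  rewrite -convZl -convDl; apply: eq_conv => // i hi.
  rewrite conv_cpsum /psum -conv1 -convZl -convDl; apply: eq_conv => // j hj.
  by rewrite /g (leq_trans hj hi); ring.
have -> : conv (psum e) C N = W * psum e N + conv e (fun k => psum C k - W) N.
  have -> : conv (psum e) C N = conv e (psum C) N.
    transitivity (conv (conv e (fun=> 1)) C N).
      by apply: eq_conv => // i _; rewrite convC conv1.
    by rewrite -convA; apply: eq_conv => // i _; rewrite conv1.
  rewrite convBr (convC e (fun=> W)).
  have -> : conv (fun=> W) e N = W * psum e N.
    by rewrite /psum mulr_sumr convC; apply: eq_bigr => i _; rewrite mulrC.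
  ring.
have -> : V * (W * psum e N + conv e (fun k => psum C k - W) N) + conv (conv g e) C N -
    V * W * psum e N = conv (conv g e) C N + V * conv e (fun k => psum C k - W) N by ring.
have p0 := psi_ge0 b; have pc := psiC_ge0 b1; have pp := ppC_ge0 b1.
have et0 k : 0 <= eta k by exact: eta_ge0.
apply: le_trans (ler_normD _ _) _.
have h1 : `|conv (conv g e) C N| <=
    2 * (A1 * Ce * ppC b) * A3 * (1 + psiC b) * eta 0%N * eta (n %/ 3)%N.
  apply: le_trans (ler_norm_conv _ _ _) _; apply: conv_big_jump => //; first by rewrite !mulr_ge0.
  move=> j; rewrite normr_ge0 /=; apply: le_trans (ler_norm_conv _ _ _) _.
  apply: (@le_trans _ _ (conv (fun k => A1 * eta k) (fun k => Ce * psib k) j)).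
    by apply: ler_conv => k; rewrite normr_ge0 //=.
  rewrite convZl convZr convC mulrA -(mulrA _ (ppC b)); apply: ler_wpM2l; first exact: mulr_ge0.
  exact: conv_psi_eta.
have h2 : `|V * conv e (fun k => psum C k - W) N| <=
    `|V| * (Ce * A2 * ppC b * (1 + psiC b) * eta (n %/ 3)%N).
  rewrite normrM; apply: ler_wpM2l => //.
  apply: le_trans (ler_norm_conv _ _ _) _.
  apply: (@le_trans _ _ (conv (fun k => Ce * psib k) (fun k => A2 * eta k) N)).
    by apply: ler_conv => k; rewrite normr_ge0 //=.
  rewrite convZl convZr mulrA -(mulrA _ (1 + psiC b)) -(mulrA _ (ppC b)).
  apply: ler_wpM2l; first exact: mulr_ge0.
  apply: le_trans (conv_psi_eta b1 s0 N) _; apply: ler_wpM2l => //.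
  by apply: eta_almost_decr => //; rewrite /N; lia.
apply: le_trans (lerD h1 h2) _.
set q := eta (n %/ 3)%N; have q0 : 0 <= q by exact: et0.
have c0 : 0 <= Ce * ppC b * (1 + psiC b) * q by rewrite !mulr_ge0 // addr_ge0.
rewrite -subr_ge0.
have -> : 2 * Ce * ppC b * (1 + psiC b) * (eta 0 + 1) * (A1 * A3 + `|V| * A2) * q -
   (2 * (A1 * Ce * ppC b) * A3 * (1 + psiC b) * eta 0 * q +
    `|V| * (Ce * A2 * ppC b * (1 + psiC b) * q)) =
   Ce * ppC b * (1 + psiC b) * q * (2 * A1 * A3 + (2 * eta 0 + 1) * (`|V| * A2)) by ring.
by rewrite mulr_ge0 // addr_ge0 ?mulr_ge0 ?addr_ge0 ?mulr_ge0.
Qed.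

End Assembly.

(** Size of the second order error: the sum is bounded for [b > 2], logarithmic for [b = 2] and of
    order [n ^ (2 - b)] for [b < 2], which are the three cases of [zeta]. *)
Definition Zt n : R := psib n * \sum_(i < n.+1) psi (b - 1) i.

Lemma b_sub1_ge0 : 0 <= b - 1. Proof. by rewrite subr_ge0 ltW. Qed.

Lemma psi_succ n : n.+1%:R * psib n = psi (b - 1) n.
Proof.
rewrite /psi -{1}[n.+1%:R]powRr1 ?ler0n // -powRD; first by congr (_ `^ _); ring.
by rewrite pnatr_eq0 implybT.
Qed.

Lemma Zt_ge_psi n : psib n <= Zt n.
Proof.
rewrite /Zt ler_peMr ?psi_ge0 // big_ord_recl psi0 lerDl.
by apply: sumr_ge0 => i _; exact: psi_ge0.
Qed.

Lemma Zt_ge0 n : 0 <= Zt n. Proof. exact: le_trans (psi_ge0 b n) (Zt_ge_psi n). Qed.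

Lemma Zt_ge_sqr n : psi (b - 1) n * psi (b - 1) n <= Zt n.
Proof.
rewrite -{1}psi_succ -mulrA mulrCA /Zt; apply: ler_wpM2l; first exact: psi_ge0.
rewrite mulr_natl -[X in _ *+ X]card_ord -sumr_const; apply: ler_sum => i _.
by apply: psi_decr; [exact: b_sub1_ge0|rewrite -ltnS].
Qed.

Definition ErC : R := 2 `^ b * (1 + psiC b).

(** What a triangular sum over [i + k <= n] leaves out of the square; it occurs in the renewal
    expansion and in the truncated Green function. For [i <= n / 2] the inner sum has [i] weights of
    order [psi b n]; for larger [i] the outer weight has this order. *)
Lemma psi_window n :
  \sum_(i < n.+1) psib i * \sum_((n - i).+1 <= s < n.+1) psib s <= ErC * Zt n.
Proof.
have b0 := b_ge0 b1; have pc := psiC_ge0 b1; have p0 := psi_ge0 b; have p1 := psi_ge0 (b - 1).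
apply: (@le_trans _ _ (\sum_(i < n.+1) 2 `^ b * psib n *
    (psi (b - 1) i + psiC b * psi (b - 1) (n - i)%N))).
  apply: ler_sum => i _; have hi : (i <= n)%N by rewrite -ltnS.
  have hc k : (n.+1 <= 2 * k.+1)%N -> psib k <= 2 `^ b * psib n by move=> h; exact: psi_scale.
  case: (leqP i.*2 n) => h.
    apply: (@le_trans _ _ (psib i * (i.+1%:R * (2 `^ b * psib n)))).
      apply: ler_wpM2l => //.
      apply: (@le_trans _ _ (\sum_((n - i).+1 <= s < n.+1) 2 `^ b * psib n)).
        rewrite big_nat [leRHS]big_nat; apply: ler_sum => s /andP[hs _].
        by apply: hc; lia.
      rewrite sumr_const_nat -[leLHS]mulr_natl; apply: ler_wpM2r; first by rewrite mulr_ge0 ?powR_ge0.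
      by rewrite ler_nat; lia.
    rewrite mulrA (mulrC (psib i)) psi_succ mulrC; apply: ler_wpM2l; first by rewrite mulr_ge0 ?powR_ge0.
    by rewrite lerDl mulr_ge0.
  apply: (@le_trans _ _ (2 `^ b * psib n * (psiC b * psi (b - 1) (n - i)%N))).
    apply: ler_pM => //; [by apply: sumr_ge0|by apply: hc; lia|].
    apply: le_trans (psi_tail b1 _ _) _; apply: ler_wpM2l => //.
    by apply: psi_decr; [exact: b_sub1_ge0|exact: leqnSn].
  by apply: ler_wpM2l; [rewrite mulr_ge0 ?powR_ge0|rewrite lerDr].
rewrite -mulr_sumr big_split /= -mulr_sumr.
have -> : \sum_(i < n.+1) psi (b - 1) (n - i)%N = \sum_(i < n.+1) psi (b - 1) i.
  rewrite [RHS](reindex_inj rev_ord_inj) /=; apply: eq_bigr => i _.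
  by rewrite subSS.
rewrite le_eqVlt; apply/orP; left; apply/eqP; rewrite /ErC /Zt; ring.
Qed.

(** The increments of [x ^ (1 - c)] dominate the terms; the factor 2 absorbs the passage from [m] to
    [m + 1] in [psi (c - 1)]. *)
Lemma sum_psi_lt2 (c : R) n : 0 < c < 1 -> \sum_(i < n.+1) psi c i <= (2 / (1 - c)) * psi (c - 1) n.
Proof.
move=> /andP[c0' c1]; have p0 : 0 < 1 - c by rewrite subr_gt0.
have key m : psi c m.+1 <= (2 / (1 - c)) * (psi (c - 1) m.+1 - psi (c - 1) m).
  have h1 := psi_ge0 (c - 1).
  set x : R := m.+1%:R; set y : R := m.+2%:R.
  have x0 : 0 < x by rewrite ltr0n.
  have y0 : 0 < y by rewrite ltr0n.
  have x1 : 1 <= x by rewrite ler1n.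
  have yx : y = x + 1 by rewrite /y /x -natr1.
  have e1 : psi (c - 1) m * (1 + (1 - c) / y) <= psi (c - 1) m.+1.
    rewrite /psi -/x -/y opprB.
    have -> : y `^ (1 - c) = x `^ (1 - c) * (y / x) `^ (1 - c).
      rewrite -powRM ?divr_ge0 ?ltW //; congr (_ `^ _); field; lra.
    apply: ler_wpM2l; first exact: powR_ge0.
    rewrite /powR gt_eqF ?divr_gt0 //; apply: le_trans (expR_ge1Dx _); rewrite lerD2l.
    apply: ler_wpM2l; first exact: ltW.
    have -> : ln (y / x) = - ln (x / y) by rewrite !ln_div ?posrE //; ring.
    have := @le_ln1Dx R (x / y - 1).
    rewrite (_ : 1 + (x / y - 1) = x / y); last by ring.
    move=> h; have {}h : ln (x / y) <= x / y - 1.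
      by apply: h; rewrite -subr_gt0 opprK subrK divr_gt0.
    apply: (@le_trans _ _ (- (x / y - 1))); last by rewrite lerN2.
    by rewrite le_eqVlt; apply/orP; left; apply/eqP; rewrite yx; field; lra.
  have e2 : psi (c - 1) m.+1 <= 2 * psi (c - 1) m.
    rewrite /psi -/x -/y opprB.
    apply: (@le_trans _ _ ((2 * x) `^ (1 - c))).
      by apply: ge0_ler_powR; rewrite ?nnegrE;
        [exact: ltW|exact: ltW|by rewrite mulr_ge0 // ltW|by rewrite yx; lra].
    rewrite powRM; [|by []|exact: ltW]; apply: ler_wpM2r; first exact: powR_ge0.
    by rewrite -{2}[2]powRr1 // ler_powR ?ler1n //; lra.
  have e3 : psi c m.+1 * y = psi (c - 1) m.+1.
    rewrite /psi -/y -{2}[y]powRr1 ?ltW // -powRD; first by congr (_ `^ _); ring.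
    by rewrite (gt_eqF y0) implybT.
  have e4 : (1 - c) / y * psi (c - 1) m <= psi (c - 1) m.+1 - psi (c - 1) m.
    by move: e1; rewrite mulrDr mulr1 (mulrC (psi (c - 1) m) (_ / y)) lerBrDl.
  apply: (@le_trans _ _ (2 / (1 - c) * ((1 - c) / y * psi (c - 1) m))); last first.
    by apply: ler_wpM2l => //; rewrite divr_ge0 // ltW.
  have -> : 2 / (1 - c) * ((1 - c) / y * psi (c - 1) m) = 2 * psi (c - 1) m / y.
    by field; rewrite !gt_eqF.
  by rewrite ler_pdivlMr // e3.
elim: n => [|n IH].
  by rewrite big_ord1 !psi0 mulr1 ler_pdivlMr // mul1r; lra.
rewrite big_ord_recr /=; apply: le_trans (lerD IH (key n)) _.
by rewrite -mulrDr addrCA subrr addr0.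
Qed.

Lemma sum_psi1 n : (0 < n)%N -> \sum_(i < n.+1) psi 1 i <= 2 + ln n%:R :> R.
Proof.
have pE m : psi 1 m = m.+1%:R^-1 :> R by rewrite /psi powR_inv1 ?ler0n.
elim: n => // -[|n] IH _.
  by rewrite big_ord_recr big_ord1 /= psi0 ln1 pE; lra.
rewrite big_ord_recr /= pE; apply: le_trans (lerD (IH isT) (lexx _)) _.
rewrite -addrA lerD2l.
have := @le_ln1Dx R (n.+1%:R / n.+2%:R - 1).
rewrite (_ : 1 + (n.+1%:R / n.+2%:R - 1) = n.+1%:R / n.+2%:R); last by ring.
move=> h; have {}h : ln (n.+1%:R / n.+2%:R) <= n.+1%:R / n.+2%:R - 1 :> R.
  by apply: h; rewrite -subr_gt0 opprK subrK divr_gt0 ?ltr0n.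
move: h; rewrite ln_div ?posrE ?ltr0n //.
have -> : n.+1%:R / n.+2%:R - 1 = - n.+2%:R^-1 :> R.
  have z0 : 0 < n.+1%:R :> R by rewrite ltr0n.
  by rewrite -(natr1 n.+1); field; lra.
have : n.+3%:R^-1 <= n.+2%:R^-1 :> R by rewrite lef_pV2 ?posrE ?ltr0n // ler_nat.
set p := n.+3%:R^-1; set q := n.+2%:R^-1; set l1 := ln _; set l2 := ln _.
clearbody p q l1 l2; clear; lra.
Qed.

(** For [b = 2] the logarithm makes [zeta] vanish at [n = 1]; the additional [psib n] repairs
    this. *)
Lemma Zt_zeta : exists2 C, 0 <= C & forall n, (0 < n)%N -> Zt n <= C * (zeta b n + psib n).
Proof.
have p0 := psi_ge0 b; have b0 := b_ge0 b1.
have hn (n : nat) (c : R) : (0 < n)%N -> 0 <= c -> psi c n <= n%:R `^ (- c).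
  move=> n0 c0'; rewrite /psi !powRN lef_pV2 ?posrE ?powR_gt0 ?ltr0n //.
  by apply: ge0_ler_powR; rewrite ?nnegrE ?ler0n // ler_nat.
have [b2|b2'] := ltP 2 b; last have [b2|b2] := eqVneq b 2.
- have b1' : 1 < b - 1 by lra.
  exists (psiC (b - 1)); first exact: psiC_ge0.
  move=> n n0; rewrite /zeta b2 /Zt mulrC; apply: ler_pM => //; first by apply: sumr_ge0 => i _; exact: psi_ge0.
    exact: sum_psi.
  by rewrite lerDr powR_ge0.
- exists 2 => // n n0; rewrite /zeta b2 ltxx eqxx.
  rewrite /Zt b2 (_ : 2 - 1 = 1 :> R); last by ring.
  apply: (@le_trans _ _ (psi 2 n * (2 + ln n%:R))).
    by apply: ler_wpM2l; [exact: psi_ge0|exact: sum_psi1].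
  have l0 : 0 <= ln n%:R :> R by rewrite ln_ge0 // ler1n.
  have h2 : psi 2 n <= n%:R `^ (- 2) :> R by apply: hn.
  have := ler_wpM2r l0 h2; have q0 : 0 <= n%:R `^ (- 2) * ln n%:R :> R by rewrite mulr_ge0 ?powR_ge0.
  rewrite mulrDr; set a := psi 2 n * 2; have : a = 2 * psi 2 n by rewrite /a mulrC.
  lra.
have {b2'} b2' : b < 2 by rewrite lt_neqAle b2.
have cc : 0 < b - 1 < 1 by rewrite subr_gt0 b1 /= ltrBlDl.
exists (2 / (1 - (b - 1))); first by rewrite divr_ge0 //; lra.
move=> n n0; rewrite /zeta ltNge (ltW b2') (negbTE b2) /=.
apply: (@le_trans _ _ (2 / (1 - (b - 1)) * n%:R `^ (- (2 * (b - 1))))); last first.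
  by apply: ler_wpM2l; [rewrite divr_ge0 //; lra|rewrite lerDl].
apply: (@le_trans _ _ (psib n * (2 / (1 - (b - 1)) * psi (b - 1 - 1) n))).
  by apply: ler_wpM2l => //; exact: sum_psi_lt2.
rewrite mulrCA; apply: ler_wpM2l; first by rewrite divr_ge0 //; lra.
apply: le_trans (hn n (2 * (b - 1)) n0 _); last by rewrite mulr_ge0 // b_sub1_ge0.
rewrite /psi -powRD; last by rewrite pnatr_eq0 implybT.
by rewrite le_eqVlt; apply/orP; left; apply/eqP; congr (_ `^ _); ring.
Qed.

Section Expansion.
Variables (f : nat -> R) (A : R).
Hypothesis f0 : f 0%N = 0.
Hypothesis fge0 : forall n, 0 <= f n.
Hypothesis A0 : 0 <= A.
Hypothesis tA : forall n, 0 <= tail1 f n <= A * psib n.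
Variables (d : nat) (r e : nat -> R) (Ce : R).
Hypothesis d0 : (0 < d)%N.
Hypothesis Ce0 : 0 <= Ce.
Hypothesis rE : forall n, r n = delta n + conv f r n.
Hypothesis eE : forall n, e n = r n - conv (dl d) r n.
Hypothesis ePsi : forall n, `|e n| <= Ce * psib n.
Local Notation t := (tail1 f).
Local Notation T := (Tsum f).

Definition TT n : R := T - \sum_(j < n.+1) t j.

Lemma TT_bound n : 0 <= TT n <= A * psiC b * psi (b - 1) n.
Proof.
have /andP[h1 h2] := Tsum_tail b1 A0 tA n.+1; rewrite /TT h1 /=.
apply: le_trans h2 _; apply: ler_wpM2l; first by rewrite mulr_ge0 ?psiC_ge0.
by apply: psi_decr; [exact: b_sub1_ge0|exact: leqnSn].
Qed.

(** Since [e] is [1 - z ^ d] times [r], and [t] convolved with [r] is constantly 1, the convolution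
    of [t] with [e] is the indicator of [m < d]. Its partial sums equal [d] as soon as
    [d <= n + 1]. *)
Lemma ut_TT n : (d <= n.+1)%N -> T * psum e n = d%:R + conv e TT n.
Proof.
move=> dn.
have h m : conv e t m = (m < d)%N%:R.
  transitivity (conv t (fun i => r i - conv (dl d) r i) m).
    by rewrite convC; apply: eq_conv.
  rewrite convBr (conv_tail_ren _ rE) convA.
  rewrite (@eq_conv _ (conv t (dl d)) (conv (dl d) t) r r) //; last by move=> i _; exact: convC.
  rewrite -convA (@eq_conv _ (dl d) (dl d) (conv t r) (fun=> 1)) //; last first.
    by move=> i _; exact: conv_tail_ren.
  by rewrite conv_dl; case: leqP; rewrite ?subrr ?subr0.
have : \sum_(m < n.+1) conv e t m = d%:R.
  rewrite (@sum_ord_split _ (conv e t) d n.+1) // big_nat [X in _ + X]big1 ?addr0; last first.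
    by move=> i /andP[hi _]; rewrite h ltnNge hi.
  rewrite (eq_bigr (fun=> 1)); last by move=> i _; rewrite h ltn_ord.
  by rewrite sumr_const card_ord.
rewrite sum_conv => <-; rewrite -convDr /psum mulr_sumr; apply: eq_bigr => i _.
by rewrite /TT addrC subrK mulrC.
Qed.

(** Replacing [TT (n - i)] by [TT n] in [ut_TT] gives a linear equation for [psum e n], which is
    inserted once into itself. The replacement costs [psi_window]; the quadratic remainder is
    covered by [Zt_ge_sqr]. *)
Lemma ut_expand : exists2 K, 0 <= K &
  forall n, `|psum e n - d%:R / T * (1 + TT n / T)| <= K * Zt n.
Proof.
have T1 := Tsum_ge1 b1 f0 A0 tA; have T0 : 0 < T by exact: lt_le_trans T1.
have Ti : 0 <= T^-1 by rewrite invr_ge0 ltW.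
have Ti1 : T^-1 <= 1 by rewrite invf_le1.
have pc := psiC_ge0 b1; have b0 := b_ge0 b1.
have Er0 : 0 <= ErC by rewrite mulr_ge0 ?powR_ge0 // addr_ge0.
pose U := Ce * psiC b; have U0 : 0 <= U by exact: mulr_ge0.
pose B := A * psiC b; have B0 : 0 <= B by exact: mulr_ge0.
pose K1 := Ce * A * ErC; have K10 : 0 <= K1 by exact: mulr_ge0 (mulr_ge0 Ce0 A0) Er0.
(* Only finitely many [n] have [n + 1 < d]; there a crude bound is divided by [psib d], which is
   below all the weights concerned. *)
pose K0 := (U + d%:R * (1 + B)) / psib d.
have K00 : 0 <= K0 by rewrite divr_ge0 ?psi_ge0 // addr_ge0 // mulr_ge0 // addr_ge0.
have hK : 0 <= U * B * B + K1 * B + K1.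
  apply: addr_ge0 => //; apply: addr_ge0; apply: mulr_ge0 => //; exact: mulr_ge0.
exists (K0 + (U * B * B + K1 * B + K1)); first exact: addr_ge0.
move=> n; have Z0 := Zt_ge0 n.
have /andP[TT0 TTb] := TT_bound n.
have q1 : psi (b - 1) n <= 1 by apply: psi_le1; exact: b_sub1_ge0.
have q0 := psi_ge0 (b - 1) n.
have TTB : TT n <= B by apply: le_trans TTb _; rewrite ler_piMr.
have ub := ut_bound n Ce0 ePsi.
case: (leqP d n.+1) => dn; last first.
  rewrite [leRHS]mulrDl; apply: ler_wpDr; first exact: mulr_ge0.
  apply: (@le_trans _ _ (K0 * psib d)).
    rewrite /K0 divfK ?gt_eqF ?psi_gt0 //; apply: le_trans (ler_normB _ _) _; apply: lerD => //.
    rewrite ger0_norm; last by rewrite !mulr_ge0 // addr_ge0 // mulr_ge0.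
    rewrite -mulrA; apply: ler_wpM2l => //.
    apply: (@le_trans _ _ (1 + TT n / T)).
      by rewrite ler_piMl // addr_ge0 // mulr_ge0.
    by rewrite lerD2l; apply: le_trans TTB; rewrite ler_piMr.
  apply: ler_wpM2l => //; apply: le_trans (Zt_ge_psi n).
  by apply: psi_decr => //; clear -dn; lia.
have hT := ut_TT dn.
pose R1 := \sum_(i < n.+1) e i * (TT (n - i)%N - TT n).
have cE : conv e TT n = psum e n * TT n + R1.
  rewrite /psum mulr_suml -big_split; apply: eq_bigr => i _ /=; ring.
have R1b : `|R1| <= K1 * Zt n.
  apply: le_trans (ler_norm_sum _ _ _) _.
  rewrite /K1 -(mulrA (Ce * A) ErC) -(mulrA Ce A); apply: (@le_trans _ _ (Ce * (A * \sum_(i < n.+1) psib i *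
     \sum_((n - i).+1 <= s < n.+1) psib s))); last first.
    by do 2!apply: ler_wpM2l => //; exact: psi_window.
  rewrite !mulr_sumr; apply: ler_sum => i _; rewrite normrM.
  have -> : TT (n - i)%N - TT n = \sum_((n - i).+1 <= s < n.+1) t s.
    rewrite /TT (@sum_ord_split _ t (n - i).+1 n.+1); last by rewrite ltnS leq_subr.
    ring.
  have -> : Ce * (A * (psib i * \sum_((n - i).+1 <= s < n.+1) psib s)) =
     (Ce * psib i) * (\sum_((n - i).+1 <= s < n.+1) A * psib s).
    by rewrite -mulr_sumr; ring.
  apply: ler_pM => //; rewrite ger0_norm; last by apply: sumr_ge0 => s _; have /andP[] := tA s.
  by apply: ler_sum => s _; have /andP[] := tA s.
have eq1 : psum e n - d%:R / T = (psum e n * TT n + R1) / T.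
  by apply/eqP; rewrite eq_sym -subr_eq0 -cE; apply/eqP; rewrite -(mulKf (lt0r_neq0 T0) (psum e n)) hT; field; exact: lt0r_neq0.
have eq2 : psum e n - d%:R / T * (1 + TT n / T) =
   (psum e n * TT n * TT n + R1 * TT n) / T / T + R1 / T.
  have -> : psum e n - d%:R / T * (1 + TT n / T) =
     (psum e n - d%:R / T) + (psum e n - d%:R / T) * TT n / T - psum e n * TT n / T.
    by field; exact: lt0r_neq0.
  by rewrite eq1; field; exact: lt0r_neq0.
rewrite {}eq2.
have nT x : `|x / T| <= `|x| by rewrite normrM (ger0_norm Ti) ler_piMr.
apply: le_trans (ler_normD _ _) _.
have h1 : `|(psum e n * TT n * TT n + R1 * TT n) / T / T| <= (U * B * B + K1 * B) * Zt n.
  apply: le_trans (nT _) _; apply: le_trans (nT _) _; apply: le_trans (ler_normD _ _) _.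
  rewrite mulrDl !normrM (ger0_norm TT0); apply: lerD.
    apply: (@le_trans _ _ (U * ((B * psi (b - 1) n) * (B * psi (b - 1) n)))).
      rewrite -(mulrA `|psum e n|); apply: ler_pM => //; first exact: mulr_ge0.
      exact: ler_pM.
    have -> : U * (B * psi (b - 1) n * (B * psi (b - 1) n)) =
      U * B * B * (psi (b - 1) n * psi (b - 1) n) by ring.
    by apply: ler_wpM2l; [apply: mulr_ge0 => //; exact: mulr_ge0|exact: Zt_ge_sqr].
  rewrite mulrAC; exact: ler_pM.
have h2 : `|R1 / T| <= K1 * Zt n by apply: le_trans (nT _) _.
apply: le_trans (lerD h1 h2) _; rewrite -mulrDl; apply: ler_wpM2r => //.
by rewrite lerDr.
Qed.

End Expansion.
End Periodic.

(** * Measurability of functions of a countable key *)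

Section CountableGlue.
Context d (T : measurableType d) d' (U : measurableType d') (K : countType).

Lemma measurable_glue (D : set T) (key : T -> K) (u : T -> U) :
  (forall k, measurable (D `&` [set x | key x = k])) ->
  (forall k, measurable_fun (D `&` [set x | key x = k]) u) -> measurable_fun D u.
Proof.
move=> mk mu mD B mB.
have -> : D `&` u @^-1` B = \bigcup_k ((D `&` [set x | key x = k]) `&` u @^-1` B).
  rewrite eqEsubset; split => [x [Dx Bx]|x [k _ [[Dx _] Bx]]] //.
  by exists (key x).
apply: countable_bigcupT_measurable; first exact: countableP.
by move=> k; exact: mu.
Qed.

Lemma measurable_key (D : set T) (key : T -> K) (F : K -> U) :
  (forall k, measurable (D `&` [set x | key x = k])) ->
  measurable_fun D (fun x => F (key x)).
Proof.
move=> mk; apply: measurable_glue mk _ => k mD' B mB.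
have [hB|hB] := pselect (B (F k)).
  rewrite (_ : _ `&` _ = D `&` [set x | key x = k]) //.
  by rewrite eqEsubset; split => [x [] //|x [Dx kx]]; split => //=; rewrite kx.
rewrite (_ : _ `&` _ = set0) // eqEsubset; split => // x [[_ kx]] /=.
by rewrite kx.
Qed.

Lemma measurable_key_set (D : set T) (key : T -> K) (P : K -> bool) :
  (forall k, measurable (D `&` [set x | key x = k])) ->
  measurable (D `&` [set x | P (key x)]).
Proof.
move=> mk; have -> : D `&` [set x | P (key x)] =
    \bigcup_k (if P k then D `&` [set x | key x = k] else set0).
  rewrite eqEsubset; split => [x [Dx Px]|x [k _]].
    by exists (key x) => //; rewrite Px.
  by case: ifP => // Pk [Dx /= ->].
apply: countable_bigcupT_measurable; first exact: countableP.
by move=> k; case: ifP.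
Qed.

End CountableGlue.

(** * Bounded measurable functions and their expectations *)

Section Expectation.
Context (R : realType) d (T : measurableType d).

Definition bm (D : set T) (u : T -> R) :=
  measurable_fun D u /\ exists B, forall x, D x -> `|u x| <= B.

Definition Ex (mu : probability T R) (D : set T) (u : T -> R) : R := \int[mu]_(x in D) u x.

Variables (mu : probability T R) (D : set T).
Hypothesis mD : measurable D.
Implicit Types u v : T -> R.

Lemma bm_cst c : bm D (fun=> c).
Proof. by split; [exact: measurable_cst|exists `|c|]. Qed.

Lemma bmD u v : bm D u -> bm D v -> bm D (fun x => u x + v x).
Proof.
move=> [mu1 [B hB]] [mv [C hC]]; split; first exact: measurable_funD.
by exists (B + C) => x Dx; apply: le_trans (ler_normD _ _) _; apply: lerD; [exact: hB|exact: hC].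
Qed.

Lemma bmM u v : bm D u -> bm D v -> bm D (fun x => u x * v x).
Proof.
move=> [mu1 [B hB]] [mv [C hC]]; split; first exact: measurable_funM.
by exists (B * C) => x Dx; rewrite normrM; apply: ler_pM => //; [exact: hB|exact: hC].
Qed.

Lemma bmZ c u : bm D u -> bm D (fun x => c * u x).
Proof. by apply: bmM; exact: bm_cst. Qed.

Lemma bmN u : bm D u -> bm D (fun x => - u x).
Proof.
move=> hu; rewrite (_ : (fun x => - u x) = (fun x => -1 * u x)); first exact: bmZ.
by apply/funext => x; rewrite mulN1r.
Qed.

Lemma bmB u v : bm D u -> bm D v -> bm D (fun x => u x - v x).
Proof. by move=> hu hv; apply: bmD => //; exact: bmN. Qed.

Lemma bm_norm u : bm D u -> bm D (fun x => `|u x|).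
Proof.
move=> [mu1 [B hB]]; split; first exact: measurableT_comp.
by exists B => x Dx; rewrite normr_id; exact: hB.
Qed.

Lemma bm_sum (I : Type) (r : seq I) (P : pred I) (F : I -> T -> R) :
  (forall i, P i -> bm D (F i)) -> bm D (fun x => \sum_(i <- r | P i) F i x).
Proof.
move=> h; elim: r => [|i r IH].
  by rewrite (_ : (fun x => _) = (fun=> 0)); [exact: bm_cst|apply/funext => x; rewrite big_nil].
case: (boolP (P i)) => Pi; last first.
  rewrite (_ : (fun x => _) = (fun x => \sum_(j <- r | P j) F j x)) //.
  by apply/funext => x; rewrite big_cons (negbTE Pi).
rewrite (_ : (fun x => _) = (fun x => F i x + \sum_(j <- r | P j) F j x)).
  by apply: bmD => //; exact: h.
by apply/funext => x; rewrite big_cons Pi.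
Qed.

Lemma bm_bool (P : T -> bool) : measurable (D `&` [set x | P x]) -> bm D (fun x => (P x)%:R).
Proof.
move=> mP; split; last by exists 1 => x _; case: (P x); rewrite ?normr1 ?normr0.
apply: (@measurable_glue _ _ _ _ _ D P) => b.
  case: b; first by rewrite (_ : [set x | P x = true] = [set x | P x]).
  rewrite (_ : D `&` _ = D `\` (D `&` [set x | P x])); first exact: measurableD.
  rewrite eqEsubset; split => [x [Dx /= Px]|x [Dx /= hx]].
    by split => // -[_] /=; rewrite Px.
  by split => //=; apply/negbTE/negP => Px; apply: hx.
apply: (@eq_measurable_fun _ _ _ _ _ (fun=> b%:R : R)); last exact: measurable_cst.
by move=> x; rewrite inE => -[_ /= ->].
Qed.

Lemma bm_indic A : measurable A -> bm D (\1_A : T -> R).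
Proof.
move=> mA; split; last by exists 1 => x _; rewrite indicE; case: (_ \in _); rewrite ?normr1 ?normr0.
exact: measurable_indic.
Qed.

Lemma eq_bm u v : (forall x, D x -> u x = v x) -> bm D u -> bm D v.
Proof.
move=> h [mu1 [B hB]]; split; last by exists B => x Dx; rewrite -h //; exact: hB.
by apply: eq_measurable_fun mu1 => x; rewrite inE => /h.
Qed.

Lemma bm_integrable u : bm D u -> mu.-integrable D (EFin \o u).
Proof.
move=> [mu1 [B hB]]; apply: measurable_bounded_integrable => //.
  by apply: le_lt_trans (probability_le1 mu mD) _; rewrite ltry.
exists B; split; first exact: num_real.
by move=> M BM x Dx; apply: le_trans (hB x Dx) (ltW BM).
Qed.

Local Notation E := (Ex mu D).

Lemma eq_Ex u v : (forall x, D x -> u x = v x) -> E u = E v.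
Proof. by move=> h; apply: eq_Rintegral => x; rewrite inE => /h. Qed.

Lemma ExD u v : bm D u -> bm D v -> E (fun x => u x + v x) = E u + E v.
Proof. by move=> hu hv; apply: RintegralD => //; exact: bm_integrable. Qed.

Lemma ExZ c u : bm D u -> E (fun x => c * u x) = c * E u.
Proof. by move=> hu; apply: RintegralZl => //; exact: bm_integrable. Qed.

Lemma ExB u v : bm D u -> bm D v -> E (fun x => u x - v x) = E u - E v.
Proof. by move=> hu hv; apply: RintegralB => //; exact: bm_integrable. Qed.

Lemma Ex0 : E (fun=> 0) = 0.
Proof. by rewrite /Ex Rintegral_cst // mul0r. Qed.

Lemma Ex_sum (I : Type) (r : seq I) (P : pred I) (F : I -> T -> R) :
  (forall i, P i -> bm D (F i)) ->
  E (fun x => \sum_(i <- r | P i) F i x) = \sum_(i <- r | P i) E (F i).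
Proof.
move=> h; elim: r => [|i r IH].
  by rewrite big_nil -[RHS]Ex0; apply: eq_Ex => x _; rewrite big_nil.
rewrite big_cons; case: ifP => Pi.
  rewrite -IH -ExD; [|exact: h|exact: bm_sum].
  by apply: eq_Ex => x _; rewrite big_cons Pi.
by rewrite -IH; apply: eq_Ex => x _; rewrite big_cons Pi.
Qed.

Lemma Ex_ge0 u : (forall x, D x -> 0 <= u x) -> 0 <= E u.
Proof. exact: Rintegral_ge0. Qed.

Lemma le_Ex u v : bm D u -> bm D v -> (forall x, D x -> u x <= v x) -> E u <= E v.
Proof. by move=> hu hv h; apply: le_Rintegral => //; exact: bm_integrable. Qed.

Lemma ler_norm_Ex u : bm D u -> `|E u| <= E (fun x => `|u x|).
Proof. by move=> hu; apply: le_normr_Rintegral => //; exact: bm_integrable. Qed.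

Lemma Ex_cst c : E (fun=> c) = c * fine (mu D).
Proof. exact: Rintegral_cst. Qed.

Lemma Ex_indic A : measurable A -> E (\1_A) = fine (mu (D `&` A)).
Proof. by move=> mA; rewrite /Ex /Rintegral integral_indic // setIC. Qed.

Lemma Ex_bool (P : T -> bool) : measurable (D `&` [set x | P x]) ->
  E (fun x => (P x)%:R) = fine (mu (D `&` [set x | P x])).
Proof.
move=> mP; rewrite -[in RHS](setIidr (@subIsetl _ D [set x | P x])) -Ex_indic //.
apply: eq_Ex => x Dx; rewrite indicE; congr (nat_of_bool _)%:R.
apply/idP/idP => [Px|]; first by rewrite inE.
by rewrite inE => -[].
Qed.

Lemma count_floor (z : R) N : 0 <= z <= N%:R ->
  z - 1 <= \sum_(k < N) (k.+1%:R <= z)%R%:R <= z.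
Proof.
move=> /andP[z0]; elim: N => [|N IH] zN.
  have -> : z = 0 by apply/eqP; rewrite eq_le zN z0.
  by rewrite big_ord0; apply/andP; split; lra.
rewrite big_ord_recr /=; have [h|h] := leP z N%:R.
  have -> : (N.+1%:R <= z) = false.
    by apply/negbTE; rewrite -ltNge; apply: le_lt_trans h _; rewrite ltr_nat.
  by rewrite addr0; exact: IH.
rewrite (eq_bigr (fun=> 1)); last first.
  move=> i _; rewrite (_ : i.+1%:R <= z = true) //.
  by apply/ltW/(le_lt_trans _ h); rewrite ler_nat.
rewrite sumr_const card_ord -[1 *+ N]/(N%:R) -natr1 in zN *.
by have [hz|hz] := leP (N%:R + 1) z; rewrite /= ?mulr1n ?mulr0n; apply/andP; split; lra.
Qed.

(** Sums of level set indicators, with steps of height [1 / (p + 1)], approximate [u] uniformly, and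
    continuity in sup norm suffices. Identities between integrals are thereby reduced to indicators
    without monotone limits. *)
Lemma linear_ext0 (Phi : (T -> R) -> R) (K : R) :
  (forall u v, bm D u -> bm D v -> Phi (fun x => u x + v x) = Phi u + Phi v) ->
  (forall c u, bm D u -> Phi (fun x => c * u x) = c * Phi u) ->
  (forall u B, 0 <= B -> bm D u -> (forall x, D x -> `|u x| <= B) -> `|Phi u| <= K * B) ->
  (forall A, measurable A -> Phi (\1_A) = 0) ->
  forall u, bm D u -> Phi u = 0.
Proof.
move=> PD PZ Pb P1 u hu.
have K0 : 0 <= K.
  have := Pb (fun=> 0) 1 ler01 (bm_cst 0); rewrite mulr1 => h; apply: le_trans (normr_ge0 _) (h _) => x _.
  by rewrite normr0.
have Pc c : Phi (fun=> c) = 0.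
  have := PZ c _ (bm_cst 1); have -> : (fun x : T => c * 1) = (fun=> c) by apply/funext => x; rewrite mulr1.
  move=> ->; have -> : (fun=> 1) = (\1_setT : T -> R).
    by apply/funext => x; rewrite indicE in_setT.
  by rewrite P1 ?mulr0.
have Ps (I : Type) (r : seq I) (F : I -> T -> R) : (forall i, bm D (F i)) -> (forall i, Phi (F i) = 0) ->
    Phi (fun x => \sum_(i <- r) F i x) = 0.
  move=> hF h0; elim: r => [|i r IH].
    by rewrite -(Pc 0); congr Phi; apply/funext => x; rewrite big_nil.
  transitivity (Phi (F i) + Phi (fun x => \sum_(j <- r) F j x)); last by rewrite h0 IH addr0.
  rewrite -PD; [|exact: hF|exact: bm_sum].
  by congr Phi; apply/funext => x; rewrite big_cons.
have [mu1 [B0 hB0]] := hu; pose B := `|B0|.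
have hB x : D x -> `|u x| <= B by move=> Dx; apply: le_trans (hB0 x Dx) (ler_norm _).
pose m := Num.bound (2 * B).
have Bge0 : 0 <= B by exact: normr_ge0.
have hm : 2 * B <= m%:R by apply/ltW/archi_boundP; rewrite mulr_ge0.
have key p : `|Phi u| <= K * p.+1%:R^-1.
  have p0 : 0 < p.+1%:R :> R by rewrite ltr0n.
  pose N := (m * p.+1)%N.
  pose A k := D `&` [set x | k.+1%:R / p.+1%:R - B <= u x].
  have mA k : measurable (A k) by apply: measurable_fun_le => //; exact: measurable_cst.
  pose s x := \sum_(0 <= k < N) (\1_(A k) x : R).
  have bs : bm D s by apply: bm_sum => k _; exact: bm_indic.
  have s0 : Phi s = 0 by apply: Ps => k; [exact: bm_indic|exact: P1].
  pose r x := u x + (B - p.+1%:R^-1 * s x).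
  have bz : bm D (fun x => - p.+1%:R^-1 * s x) by exact: bmZ.
  have -> : Phi u = Phi r.
    have -> : r = (fun x => u x + (B + - p.+1%:R^-1 * s x)).
      by apply/funext => x; rewrite /r mulNr.
    rewrite PD //; last by apply: bmD => //; exact: bm_cst.
    by rewrite PD ?PZ ?Pc ?s0 ?mulr0 ?addr0 //; exact: bm_cst.
  apply: Pb; first by rewrite invr_ge0 ltW.
    by apply: bmD => //; apply: bmB; [exact: bm_cst|exact: bmZ].
  move=> x Dx; pose z := (u x + B) * p.+1%:R.
  have := hB x Dx; rewrite ler_norml => /andP[h1 h2].
  have zN : 0 <= z <= N%:R.
    apply/andP; split; first by rewrite /z mulr_ge0 //; lra.
    by rewrite /z /N natrM; apply: ler_wpM2r => //; lra.
  have sE : s x = \sum_(k < N) (k.+1%:R <= z)%R%:R.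
    rewrite /s big_mkord.
    apply: eq_bigr => k _; rewrite indicE; congr (nat_of_bool _)%:R.
    rewrite /z -ler_pdivrMr // -lerBlDr.
    by apply/idP/idP => [|h]; [rewrite inE => -[]|rewrite inE].
  have /andP[c1 c2] := count_floor zN; rewrite -sE in c1 c2.
  have -> : r x = (z - s x) / p.+1%:R by rewrite /r /z; field; rewrite gt_eqF.
  rewrite ger0_norm; last by rewrite divr_ge0 // subr_ge0.
  rewrite -[leRHS]mul1r; apply: ler_wpM2r; first by rewrite invr_ge0.
  lra.
apply/eqP; rewrite -normr_le0; apply/ler_addgt0Pr => e e0; rewrite add0r.
apply: le_trans (key (Num.bound (K / e))) _.
rewrite ler_pdivrMr ?ltr0n // mulrC -ler_pdivrMr //.
apply: (@le_trans _ _ (Num.bound (K / e))%:R); last by rewrite ler_nat.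
by apply/ltW/archi_boundP; rewrite divr_ge0 // ltW.
Qed.

Lemma bmX u n : bm D u -> bm D (fun x => u x ^+ n).
Proof.
move=> hu; elim: n => [|n IH]; first by apply: (eq_bm _ (bm_cst 1)) => x _; rewrite expr0.
by apply: (eq_bm _ (bmM hu IH)) => x _; rewrite exprS.
Qed.

End Expectation.

Lemma bm_comp (R : realType) d (T : measurableType d) d' (T' : measurableType d')
  (D : set T) (D' : set T') (g : T' -> T) (u : T -> R) :
  measurable D -> measurable_fun D' g -> (forall x, D' x -> D (g x)) ->
  bm D u -> bm D' (fun x => u (g x)).
Proof.
move=> mD mg h [mu1 [B hB]]; split; last by exists B => x Dx; exact/hB/h.
by apply: (measurable_comp mD) mu1 mg => _ [x Dx <-]; exact: h.
Qed.

(* [gCn] is a cone of log-Hoelder densities, and [gTr P u] is the transfer operator applied to the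
   restriction of [u] to the letters satisfying [P].  By [gm_Q] a fraction [gkap] of the mass of each
   branch can be removed as a constant function without leaving the cone. *)
Record gibbs_markov (R : realType) d (T : measurableType d) := GibbsMarkov {
  gmu : probability T R;
  gG : T -> T;
  glt : T -> nat;
  gph : nat -> nat;
  gCn : (T -> R) -> Prop;
  gTr : pred nat -> (T -> R) -> T -> R;
  gkap : R;
  gD : R;
  gm_mG : measurable_fun setT gG;
  gm_inv : forall g, bm setT g -> Ex gmu setT (fun x => g (gG x)) = Ex gmu setT g;
  gm_mlt : forall k, measurable (setT `&` [set x | glt x = k]);
  gm_ph : forall k, (0 < gph k)%N;
  gm_kap : 0 < gkap;
  gm_D : 1 <= gD;
  gm_bm : forall u, gCn u -> bm setT u;
  gm_ge0 : forall u x, gCn u -> 0 <= u x;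
  gm_1 : gCn (fun=> 1);
  gm_Z : forall c u, 0 <= c -> gCn u -> gCn (fun x => c * u x);
  gm_Tr : forall P u, gCn u -> gCn (gTr P u);
  gm_TrE : forall P u g, gCn u -> bm setT g ->
    Ex gmu setT (fun x => gTr P u x * g x) =
    Ex gmu setT (fun x => (P (glt x))%:R * u x * g (gG x));
  gm_Q : forall P u, gCn u ->
    gCn (fun x => gTr P u x - gkap * Ex gmu setT (fun x => (P (glt x))%:R * u x));
  gm_mix : forall u g, gCn u -> bm setT g -> (forall x, 0 <= g x) ->
    Ex gmu setT (fun x => u x * g x) <= gD * Ex gmu setT u * Ex gmu setT g }.

Lemma sum_triangle (R : realType) (F : nat -> nat -> R) n :
  \sum_(i < n.+1) \sum_(j < i) F i j = \sum_(j < n) \sum_(i < n - j) F (i + j.+1)%N j.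
Proof.
elim: n => [|n IH]; first by rewrite big_ord1 !big_ord0.
rewrite big_ord_recr IH /=.
transitivity (\sum_(j < n.+1) (\sum_(i < n - j) F (i + j.+1)%N j + F n.+1 j)).
  rewrite big_split /=; congr (_ + _).
  by rewrite big_ord_recr /= subnn big_ord0 addr0.
apply: eq_bigr => j _; have jn : (j <= n)%N by rewrite -ltnS ltn_ord.
by rewrite subSn // big_ord_recr /= addnS subnK.
Qed.

Lemma sum_eqS (R : realType) (p n : nat) : (0 < p)%N ->
  (n < p)%N%:R + \sum_(j < n) (p == j.+1)%:R = 1 :> R.
Proof.
move=> p0; elim: n => [|n IH]; first by rewrite p0 big_ord0 addr0.
rewrite big_ord_recr /= addrCA -[RHS]IH addrC; congr (_ + _).
by case: ltngtP; rewrite ?addr0 ?add0r.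
Qed.

(** * Chains of blocks under an operator that loses a fixed fraction of mass *)

Section Kernel.
Context (R : realType) d (T : measurableType d) (X : gibbs_markov R T).
Local Notation E := (Ex (gmu X) setT).
Local Notation Cn := (gCn X).
Local Notation D := (gD X).
Local Notation bmT := (@bm R d T setT).
Local Notation ph x := (gph X (glt X x)).
Let mT := @measurableT d T.

Definition pj (j : nat) : pred nat := fun k => gph X k == j.

Lemma D_ge0 : 0 <= D. Proof. exact: le_trans (gm_D X). Qed.

Lemma bm_letter (P : pred nat) : bmT (fun x => (P (glt X x))%:R).
Proof. by apply: bm_bool => //; apply: measurable_key_set; exact: gm_mlt. Qed.

Lemma bm_comp_G g : bmT g -> bmT (fun x => g (gG X x)).
Proof. by apply: bm_comp => //; exact: gm_mG. Qed.

Lemma Cn_bm u : Cn u -> bmT u. Proof. exact: gm_bm. Qed.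

Lemma Cn_Ege0 u : Cn u -> 0 <= E u.
Proof. by move=> hu; apply: Ex_ge0 => x _; exact: gm_ge0 hu. Qed.

Lemma E1 : E (fun=> 1) = 1.
Proof. by rewrite Ex_cst // probability_setT mul1r. Qed.

Lemma bm_phgt m : bmT (fun x => (m < ph x)%N%:R).
Proof. exact: (bm_letter (fun k => m < gph X k)%N). Qed.

Lemma bm_pj j : bmT (fun x => (pj j (glt X x))%:R).
Proof. exact: bm_letter. Qed.

Lemma E_split u n : bmT u ->
  E u = E (fun x => (n < ph x)%N%:R * u x) + \sum_(j < n) E (fun x => (pj j.+1 (glt X x))%:R * u x).
Proof.
move=> hu; rewrite -Ex_sum //; last by move=> j _; apply: bmM => //; exact: bm_pj.
rewrite -ExD //; [|by apply: bmM => //; exact: bm_phgt|]; last first.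
  by apply: bm_sum => j _; apply: bmM => //; exact: bm_pj.
apply: eq_Ex => x _; rewrite -mulr_suml -mulrDl.
by rewrite (sum_eqS _ n (gm_ph X (glt X x))) mul1r.
Qed.

Section Op.
Variables (Op : pred nat -> (T -> R) -> T -> R) (rho : R).
Hypothesis rho01 : 0 <= rho < 1.
Hypothesis Op_Cn : forall P u, Cn u -> Cn (Op P u).
Hypothesis Op_mass : forall P u, Cn u -> E (Op P u) = rho * E (fun x => (P (glt X x))%:R * u x).

Set Default Proof Using "rho01 Op_Cn Op_mass".

(* Expectation of [g] summed over all ways of reaching time [n] exactly by a succession of blocks,
   with [u] pushed forward by [Op] along each block. *)
Fixpoint op_at_fuel F u n g : R :=
  (n == 0)%N%:R * E (fun x => u x * g x) +
  (if F is F'.+1 then \sum_(j < n) op_at_fuel F' (Op (pj j.+1) u) (n - j.+1)%N g else 0).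

Definition op_at u n g := op_at_fuel n u n g.

Lemma op_at_fuelP F F' u n g : (n <= F)%N -> (n <= F')%N -> op_at_fuel F u n g = op_at_fuel F' u n g.
Proof.
elim: F F' u n => [|F IH] F' u n.
  by rewrite leqn0 => /eqP -> _; case: F' => [|F'] //=; rewrite big_ord0.
move=> h h'; case: F' h' => [|F'] h'.
  by move: h'; rewrite leqn0 => /eqP -> /=; rewrite big_ord0.
rewrite /=; congr (_ + _); apply: eq_bigr => j _; apply: IH; have := ltn_ord j; lia.
Qed.

Lemma op_atE u n g : op_at u n g = (n == 0)%N%:R * E (fun x => u x * g x) +
  \sum_(j < n) op_at (Op (pj j.+1) u) (n - j.+1)%N g.
Proof.
case: n => [|n]; first by rewrite /op_at /= big_ord0.
rewrite {1}/op_at /=; congr (_ + _); apply: eq_bigr => j _.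
by apply: op_at_fuelP; have := ltn_ord j; lia.
Qed.

Lemma op_at_D u n g g' : Cn u -> bmT g -> bmT g' ->
  op_at u n (fun x => g x + g' x) = op_at u n g + op_at u n g'.
Proof.
move=> hu hg hg'; elim/ltn_ind: n u hu => n IH u hu.
rewrite !(op_atE u n) addrACA -mulrDr -big_split /=; congr (_ * _ + _).
  rewrite -ExD //; [|apply: bmM => //; exact: Cn_bm|apply: bmM => //; exact: Cn_bm].
  by apply: eq_Ex => x _; rewrite mulrDr.
by apply: eq_bigr => j _; apply: IH; [have := ltn_ord j; lia|exact: Op_Cn].
Qed.

Lemma op_at_Z u n c g : Cn u -> bmT g -> op_at u n (fun x => c * g x) = c * op_at u n g.
Proof.
move=> hu hg; elim/ltn_ind: n u hu => n IH u hu.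
rewrite !(op_atE u n) mulrDr mulr_sumr mulrCA; congr (_ * _ + _).
  rewrite -ExZ //; last by apply: bmM => //; exact: Cn_bm.
  by apply: eq_Ex => x _; rewrite mulrCA.
by apply: eq_bigr => j _; apply: IH; [have := ltn_ord j; lia|exact: Op_Cn].
Qed.

Lemma op_at_mono u n g g' : Cn u -> bmT g -> bmT g' -> (forall x, g x <= g' x) ->
  op_at u n g <= op_at u n g'.
Proof.
move=> hu hg hg' h; elim/ltn_ind: n u hu => n IH u hu.
rewrite !(op_atE u n); apply: lerD.
  apply: ler_wpM2l => //; apply: le_Ex => //; [apply: bmM => //; exact: Cn_bm|
    apply: bmM => //; exact: Cn_bm|move=> x _; apply: ler_wpM2l => //; exact: gm_ge0 hu].
by apply: ler_sum => j _; apply: IH; [have := ltn_ord j; lia|exact: Op_Cn].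
Qed.

Lemma op_at_0 u n : Cn u -> op_at u n (fun=> 0) = 0.
Proof.
move=> hu; by have := op_at_Z n 0 hu (bm_cst _ 1); rewrite !mul0r.
Qed.

Lemma op_at_ge0 u n g : Cn u -> bmT g -> (forall x, 0 <= g x) -> 0 <= op_at u n g.
Proof. by move=> hu hg h; rewrite -(op_at_0 n hu); apply: op_at_mono => //; exact: bm_cst. Qed.

(** [gm_mix] is applied only at the end of the chain, so [D] appears once whatever the number of
    blocks. *)
Lemma op_at_mix u n g : Cn u -> bmT g -> (forall x, 0 <= g x) ->
  op_at u n g <= D * op_at u n (fun=> 1) * E g.
Proof.
move=> hu hg g0; elim/ltn_ind: n u hu => n IH u hu.
rewrite !(op_atE u n) mulrDr mulrDl; apply: lerD.
  rewrite mulrCA -mulrA; apply: ler_wpM2l => //.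
  apply: le_trans (gm_mix hu hg g0) _; rewrite -!mulrA; apply: ler_wpM2l; first exact: D_ge0.
  apply: ler_wpM2r; first by apply: Ex_ge0.
  rewrite le_eqVlt; apply/orP; left; apply/eqP; apply: eq_Ex => x _; by rewrite mulr1.
rewrite mulr_sumr mulr_suml; apply: ler_sum => j _.
by apply: IH; [have := ltn_ord j; lia|exact: Op_Cn].
Qed.

Lemma op_at_norm u n g : Cn u -> bmT g ->
  `|op_at u n g| <= D * op_at u n (fun=> 1) * E (fun x => `|g x|).
Proof.
move=> hu hg; have hn : bmT (fun x => `|g x|) by exact: bm_norm.
apply: (@le_trans _ _ (op_at u n (fun x => `|g x|))); last exact: op_at_mix.
rewrite ler_norml; apply/andP; split; last by apply: op_at_mono => // x; exact: ler_norm.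
rewrite -mulN1r -op_at_Z //; apply: op_at_mono => //; first exact: bmZ.
by move=> x; rewrite mulN1r lerNl; apply: le_trans (ler_norm _) _; rewrite normrN.
Qed.

(** A chain of blocks ends at time [i], and the function attached to the remaining time [n - i] is
    evaluated there. *)
Definition op_conv u (c : nat -> T -> R) n := \sum_(i < n.+1) op_at u i (c (n - i)%N).

Lemma op_convE u c n : op_conv u c n = E (fun x => u x * c n x) +
  \sum_(j < n) op_conv (Op (pj j.+1) u) c (n - j.+1)%N.
Proof.
rewrite /op_conv.
transitivity (\sum_(i < n.+1) (i == 0 :> nat)%N%:R * E (fun x => u x * c (n - i)%N x) +
    \sum_(i < n.+1) \sum_(j < i) op_at (Op (pj j.+1) u) (i - j.+1)%N (c (n - i)%N)).
  by rewrite -big_split; apply: eq_bigr => i _; rewrite op_atE.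
congr (_ + _).
  rewrite big_ord_recl mul1r subn0 big1 ?addr0 // => i _.
  by rewrite mul0r.
rewrite (sum_triangle (fun i j => op_at (Op (pj j.+1) u) (i - j.+1)%N (c (n - i)%N))).
apply: eq_bigr => j _; rewrite -subSn ?subSS ?ltn_ord //; apply: eq_bigr => i _.
by rewrite addnK addnC subnDA.
Qed.

Lemma op_conv_norm u c lam n : Cn u -> (forall m, bmT (c m)) ->
  (forall m, E (fun x => `|c m x|) <= lam m) ->
  `|op_conv u c n| <= D * conv (fun i => op_at u i (fun=> 1)) lam n.
Proof.
move=> hu hc hl; apply: le_trans (ler_norm_sum _ _ _) _.
rewrite /conv mulr_sumr; apply: ler_sum => i _.
apply: le_trans (op_at_norm _ hu (hc _)) _; rewrite -mulrA; apply: ler_wpM2l; first exact: D_ge0.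
apply: ler_wpM2l => //; apply: op_at_ge0 => //; [exact: bm_cst].
Qed.

Definition op_hits u n := op_conv u (fun _ _ => 1) n.
Definition op_overshoot u n := op_conv u (fun m x => (m < ph x)%N%:R) n.

(** Conservation of mass when every block is killed with probability [1 - rho]: either some block
    started up to time [n] is killed, or the block in progress at time [n] survives. The bounds on
    overshoots and on tails both rest on this balance. *)
Lemma mass u n : Cn u -> (1 - rho) * op_hits u n + rho * op_overshoot u n = E u.
Proof.
elim/ltn_ind: n u => n IH u hu; rewrite /op_hits /op_overshoot !op_convE.
have -> : E (fun x => u x * 1) = E u by apply: eq_Ex => x _; rewrite mulr1.
have -> : E (fun x => u x * (n < ph x)%N%:R) = E (fun x => (n < ph x)%N%:R * u x).
  by apply: eq_Ex => x _; rewrite mulrC.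
rewrite !mulrDr !mulr_sumr addrACA -big_split /=.
rewrite (eq_bigr (fun j : 'I_n => rho * E (fun x => (pj j.+1 (glt X x))%:R * u x))); last first.
  move=> j _; rewrite -Op_mass // -(IH (n - j.+1)%N) //; last exact: Op_Cn.
  by have := ltn_ord j; lia.
rewrite -mulr_sumr; have := E_split n (Cn_bm hu).
set a := E _; set b := E _; set s := bigop _ _ _ => ->; ring.
Qed.

Lemma op_overshoot_ge0 u n : Cn u -> 0 <= op_overshoot u n.
Proof. by move=> hu; apply: sumr_ge0 => i _; apply: op_at_ge0 => //; exact: bm_phgt. Qed.

Lemma op_hitsE u n : op_hits u n = \sum_(i < n.+1) op_at u i (fun=> 1).
Proof. by []. Qed.

Lemma op_overshoot_le u n : Cn u -> op_overshoot u n <= E u.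
Proof.
move=> hu; have h := mass n hu.
have : op_overshoot u n <= op_hits u n.
  apply: ler_sum => i _; apply: op_at_mono => //; [exact: bm_phgt|exact: bm_cst|].
  by move=> x; case: (_ < _)%N.
have /andP[r0 r1] := rho01; have r2 : 0 <= 1 - rho by rewrite subr_ge0 ltW.
by move=> /(ler_wpM2l r2); rewrite -h; rewrite mulrBl; lra.
Qed.

Lemma op_hits_le u n : Cn u -> op_hits u n <= E u / (1 - rho).
Proof.
move=> hu; have /andP[r0 r1] := rho01; rewrite ler_pdivlMr ?subr_gt0 // mulrC -(mass n hu).
by rewrite lerDl mulr_ge0 // op_overshoot_ge0.
Qed.

Variables (b A : R).
Hypothesis b1 : 1 < b.
Hypothesis A0 : 0 <= A.
Hypothesis phA : forall n, E (fun x => (n < ph x)%N%:R) <= A * psi b n.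

Set Default Proof Using "rho01 Op_Cn Op_mass b1 A0 phA".

(** A block started up to [n - h] and still in progress at [n] is longer than [h], which costs
    [psi b h]. The blocks started later are counted by the difference of two mass balances, in terms
    of overshoots alone; the result is the recursion of [decay_rec]. *)
Lemma op_overshoot_bound : exists2 C, 0 <= C & forall u n, Cn u -> op_overshoot u n <= C * E u * psi b n.
Proof.
have [K K0 hK] := decay_rec b1 rho01; have /andP[r0 r1] := rho01.
have r2 : 0 < 1 - rho by rewrite subr_gt0.
have DA : 0 <= D * A by rewrite mulr_ge0 // D_ge0.
exists (K * (D * A + 1)); first by rewrite mulr_ge0 // addr_ge0.
move=> u n hu; rewrite -(mulrA K); have u0 := Cn_Ege0 hu.
apply: hK => {n}.
- by rewrite mulr_ge0 // addr_ge0.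
- by move=> n; apply: le_trans (op_overshoot_le n hu) _; rewrite ler_peMl // lerDr.
move=> h n M /andP[h0 hn] hM.
have ht : op_overshoot u (n - h)%N <= M by apply: hM; clear -h0 hn; lia.
have hsplit : op_hits u n = op_hits u (n - h)%N + \sum_((n - h).+1 <= i < n.+1) op_at u i (fun=> 1).
  rewrite !op_hitsE -(sum_ord_split (fun i => op_at u i (fun=> 1))) // ltnS leq_subr //.
have m1 := mass n hu; have m2 := mass (n - h) hu.
have e1 : op_overshoot u n <= D * A * psi b h * op_hits u (n - h)%N + \sum_((n - h).+1 <= i < n.+1) op_at u i (fun=> 1).
  rewrite /op_overshoot /op_conv (@sum_ord_split _ (fun i => op_at u i (fun x => (n - i < ph x)%N%:R)) (n - h).+1); last first.
    by rewrite ltnS leq_subr.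
  apply: lerD; last first.
    apply: ler_sum => i _; apply: op_at_mono => //; [exact: bm_phgt|exact: bm_cst|].
    by move=> x; case: (_ < _)%N.
  rewrite op_hitsE mulr_sumr; apply: ler_sum => i _.
  apply: le_trans (op_at_mix _ hu (bm_phgt _) _) _; first by move=> x; case: (_ < _)%N.
  rewrite -!mulrA; apply: ler_wpM2l; first exact: D_ge0.
  rewrite mulrC mulrA; apply: ler_wpM2r; first by apply: op_at_ge0 => //; exact: bm_cst.
  apply: le_trans (phA _) _; apply: ler_wpM2l => //; apply: psi_decr; first exact: b_ge0.
  by have := ltn_ord i; clear -hn; lia.
have e2 : D * A * psi b h * op_hits u (n - h)%N * (1 - rho) <= D * A * psi b h * E u.
  rewrite -mulrA; apply: ler_wpM2l; first by rewrite mulr_ge0 ?psi_ge0.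
  by rewrite -ler_pdivlMr // op_hits_le.
have e3 : (1 - rho) * \sum_((n - h).+1 <= i < n.+1) op_at u i (fun=> 1) = rho * (op_overshoot u (n - h)%N - op_overshoot u n).
  move: m1; rewrite hsplit -m2; set S := bigop _ _ _ => hh.
  have : (1 - rho) * S = rho * op_overshoot u (n - h)%N - rho * op_overshoot u n.
    by move: hh; rewrite mulrDr; lra.
  by rewrite mulrBr.
have e4 : op_overshoot u n * (1 - rho) <= D * A * psi b h * E u + rho * (op_overshoot u (n - h)%N - op_overshoot u n).
  rewrite -e3; apply: le_trans (ler_wpM2r (ltW r2) e1) _; rewrite mulrDl [_ * (1 - rho) in X in _ + X]mulrC.
  by rewrite lerD2r.
have e5 : op_overshoot u n <= D * A * psi b h * E u + rho * op_overshoot u (n - h)%N.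
  move: e4; have -> : op_overshoot u n * (1 - rho) = op_overshoot u n - rho * op_overshoot u n by ring.
  have -> : rho * (op_overshoot u (n - h)%N - op_overshoot u n) = rho * op_overshoot u (n - h)%N - rho * op_overshoot u n by ring.
  lra.
apply: (le_trans e5); apply: lerD; last exact: ler_wpM2l.
rewrite mulrAC; apply: ler_wpM2r; first exact: psi_ge0.
by rewrite mulrDl lerDl mul1r.
Qed.

(** Comparing the mass balances at two times bounds the sum in between by the overshoot at the
    first. *)
Lemma op_at_tail : exists2 C, 0 <= C &
  forall u, Cn u -> tailb (C * E u) (psi b) (fun n => op_at u n (fun=> 1)).
Proof.
have [C C0 hC] := op_overshoot_bound; have /andP[r0 r1] := rho01.
have r2 : 0 < 1 - rho by rewrite subr_gt0.
have r3 : 0 <= (1 - rho)^-1 by rewrite invr_ge0 ltW.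
have b0 := b_ge0 b1; have p2 : 0 <= 2 `^ b :> R by exact: powR_ge0.
pose C' := (1 + C * 2 `^ b) / (1 - rho).
exists C'; first by rewrite /C' mulr_ge0 // addr_ge0 // mulr_ge0.
move=> u hu; have u0 := Cn_Ege0 hu; split=> [n|n m]; first by apply: op_at_ge0 => //; exact: bm_cst.
have S0 k : 0 <= op_at u k (fun=> 1) by apply: op_at_ge0 => //; exact: bm_cst.
have rhs0 : 0 <= C' * E u * psi b n.
  by rewrite mulr_ge0 ?psi_ge0 // mulr_ge0 // /C' mulr_ge0 // addr_ge0 // mulr_ge0.
case: m => [|m]; first by rewrite big_geq.
case: n rhs0 => [|n] rhs0.
  rewrite psi0 mulr1 big_mkord -op_hitsE; apply: le_trans (op_hits_le m hu) _.
  have -> : C' * E u = (1 + C * 2 `^ b) * E u / (1 - rho) by rewrite /C' mulrAC.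
  apply: ler_wpM2r => //; rewrite ler_peMl //.
  by rewrite lerDl mulr_ge0.
case: (leqP m n) => mn; first by rewrite big_geq.
have hsplit : \sum_(n.+1 <= i < m.+1) op_at u i (fun=> 1) = op_hits u m - op_hits u n.
  by rewrite !op_hitsE (@sum_ord_split _ (fun i => op_at u i (fun=> 1)) n.+1 m.+1) 1?ltnW // addrC addKr.
have m1 := mass n hu; have m2 := mass m hu.
have e1 : (1 - rho) * (op_hits u m - op_hits u n) <= op_overshoot u n.
  have t1 := op_overshoot_ge0 m hu; have t2 := op_overshoot_ge0 n hu.
  have t3 : 0 <= rho * op_overshoot u m by rewrite mulr_ge0.
  have t4 : rho * op_overshoot u n <= op_overshoot u n by rewrite ler_piMl // ltW.
  by rewrite mulrBr; lra.
rewrite hsplit; rewrite mulrC -ler_pdivlMr // in e1; apply: (le_trans e1).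
have -> : C' * E u * psi b n.+1 = (1 + C * 2 `^ b) * (E u * psi b n.+1) / (1 - rho) by rewrite /C'; ring.
apply: ler_wpM2r => //.
have -> : (1 + C * 2 `^ b) * (E u * psi b n.+1) =
  E u * psi b n.+1 + C * E u * (2 `^ b * psi b n.+1) by ring.
apply: ler_wpDl; first by rewrite mulr_ge0 ?psi_ge0.
apply: le_trans (hC u n hu) _; apply: ler_wpM2l; first exact: mulr_ge0.
by apply: psi_scale => //; lia.
Qed.

Unset Default Proof Using.

End Op.
End Kernel.

Lemma sum_diag (R : realType) (F : nat -> nat -> R) n :
  \sum_(m < n.+1) \sum_(i < m.+1) F i (m - i)%N = \sum_(i < n.+1) \sum_(k < (n - i).+1) F i k.
Proof.
elim: n => [|n IH]; first by rewrite !big_ord1.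
rewrite big_ord_recr IH /=.
rewrite [X in _ + X]big_ord_recr [RHS]big_ord_recr /= subnn addrA; congr (_ + _); last first.
  by rewrite big_ord1.
rewrite -big_split; apply: eq_bigr => i _ /=.
have h : (i <= n)%N by rewrite -ltnS ltn_ord.
by rewrite subSn // [RHS]big_ord_recr.
Qed.

(** Uniqueness for the renewal equation: convolve it with [r] and cancel. *)
Lemma conv_renewal (R : realType) (f r y c : nat -> R) n :
  (forall n, r n = delta n + conv f r n) -> (forall n, y n = c n + conv f y n) ->
  y n = conv r c n.
Proof.
move=> hr hy.
have e1 : conv r y n = conv r c n + conv r (conv f y) n.
  by rewrite -convDr; apply: eq_conv.
have e2 : conv r y n = y n + conv r (conv f y) n.
  rewrite convA -(conv_delta y n) -convDl; apply: eq_conv => // i _.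
  by rewrite (convC r f) -hr.
by move: e1; rewrite e2 => /addIr.
Qed.

Lemma powR_to0 (R : realType) (c eps : R) : 0 < c -> 0 < eps ->
  exists N, forall n, (N <= n)%N -> psi c n <= eps.
Proof.
move=> c0 e0; exists (Num.bound (eps^-1 `^ (c^-1))) => n hn.
rewrite /psi powRN -[leRHS]invrK lef_pV2 ?posrE ?invr_gt0 ?powR_gt0 ?ltr0n //.
have -> : eps^-1 = (eps^-1 `^ c^-1) `^ c.
  by rewrite -powRrM mulVf ?gt_eqF // powRr1 // invr_ge0 ltW.
apply: ge0_ler_powR; rewrite ?nnegrE ?powR_ge0 ?ler0n //; first exact: ltW.
apply/ltW/(lt_le_trans (archi_boundP _)); first exact: powR_ge0.
by rewrite ler_nat leqW.
Qed.

(** * Regeneration: a constant part of the density is split off after every block *)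

Section Regeneration.
Context (R : realType) d (T : measurableType d) (X : gibbs_markov R T).
Local Notation E := (Ex (gmu X) setT).
Local Notation Cn := (gCn X).
Local Notation D := (gD X).
Local Notation bmT := (@bm R d T setT).
Local Notation ph x := (gph X (glt X x)).
Local Notation kap := (gkap X).
Local Notation Tr := (gTr X).
Local Notation ind P x := ((P (glt X x))%:R : R).
Let mT := @measurableT d T.
Implicit Types P : pred nat.

Definition Qop (P : pred nat) (u : T -> R) (x : T) : R :=
  Tr P u x - kap * E (fun x => ind P x * u x).

Lemma Qop_Cn P u : Cn u -> Cn (Qop P u). Proof. exact: gm_Q. Qed.

Lemma Tr_mass P u : Cn u -> E (Tr P u) = E (fun x => ind P x * u x).
Proof.
move=> hu; have := gm_TrE P hu (bm_cst _ 1).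
rewrite (_ : (fun x => Tr P u x * 1) = Tr P u); last by apply/funext => x; rewrite mulr1.
by move=> ->; apply: eq_Ex => x _; rewrite mulr1.
Qed.

Lemma bm_ind_mul P u : bmT u -> bmT (fun x => ind P x * u x).
Proof. by move=> hu; apply: bmM => //; exact: bm_letter. Qed.

Lemma Qop_E P u g : Cn u -> bmT g -> E (fun x => Qop P u x * g x) =
  E (fun x => ind P x * u x * g (gG X x)) - kap * E (fun x => ind P x * u x) * E g.
Proof.
move=> hu hg; rewrite -gm_TrE // -ExZ // -ExB //.
- by apply: eq_Ex => x _; rewrite /Qop mulrBl.
- by apply: bmM => //; apply: Cn_bm; exact: gm_Tr.
- exact: bmZ.
Qed.

Lemma Qop_mass P u : Cn u -> E (Qop P u) = (1 - kap) * E (fun x => ind P x * u x).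
Proof.
move=> hu; have := Qop_E P hu (bm_cst _ 1).
rewrite (_ : (fun x => Qop P u x * 1) = Qop P u); last by apply/funext => x; rewrite mulr1.
move=> ->; rewrite E1 mulr1 mulrBl mul1r; congr (_ - _).
by apply: eq_Ex => x _; rewrite mulr1.
Qed.

Lemma Q01 : 0 <= 1 - kap < 1.
Proof.
rewrite gtrBl gm_kap andbT; have := Cn_Ege0 (Qop_Cn predT (gm_1 X)).
rewrite Qop_mass; last exact: gm_1.
rewrite (_ : E _ = 1) ?mulr1 // -[RHS](E1 X).
by apply: eq_Ex => x _; rewrite mul1r.
Qed.

Local Notation op_at := (op_at X Qop).
Local Notation op_conv := (op_conv X Qop).
Local Notation op_overshoot := (op_overshoot X Qop).
Local Notation op_hits := (op_hits X Qop).

Let QC := Qop_Cn.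
Let QM := Qop_mass.

Lemma D0 : 0 <= D. Proof. exact: D_ge0. Qed.
Lemma kap0 : 0 < kap. Proof. exact: gm_kap. Qed.

(** Up to the factor [kap], the mass that regenerates for the first time at time [n]. *)
Definition beta u n := op_conv u (fun m x => ind (pj X m) x) n.

Lemma beta_ge0 u n : Cn u -> 0 <= beta u n.
Proof.
move=> hu; apply: sumr_ge0 => i _; apply: (op_at_ge0 Q01 QC QM) => //.
exact: bm_pj.
Qed.

Lemma beta_sum u n : Cn u -> kap * \sum_(m < n.+1) beta u m = E u - op_overshoot u n.
Proof.
move=> hu.
have -> : \sum_(m < n.+1) beta u m = op_hits u n - op_overshoot u n.
  rewrite (sum_diag (fun i k => op_at u i (fun x => ind (pj X k) x))).
  rewrite (op_hitsE Q01 QC QM) /op_overshoot /op_conv -sumrB; apply: eq_bigr => i _.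
  have hsum m : op_at u i (fun x => \sum_(k < m) ind (pj X k) x) =
      \sum_(k < m) op_at u i (fun x => ind (pj X k) x).
    elim: m => [|m IH].
      transitivity (op_at u i (fun=> 0)); last by rewrite big_ord0 (op_at_0 Q01 QC QM).
      by congr (op_at _ _ _); apply/funext => x; rewrite big_ord0.
    rewrite [RHS]big_ord_recr /= -IH.
    transitivity (op_at u i (fun x => \sum_(k < m) ind (pj X k) x + ind (pj X m) x)).
      by congr (op_at _ _ _); apply/funext => x; rewrite big_ord_recr.
    apply: (op_at_D Q01 QC QM) => //; last exact: bm_pj.
    by apply: bm_sum => k _; exact: bm_pj.
  rewrite -hsum; apply/eqP; rewrite eq_sym subr_eq -(op_at_D Q01 QC QM) //; last exact: bm_phgt.
    apply/eqP; congr (op_at _ _ _); apply/funext => x.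
    rewrite big_ord_recl /= {1}/pj (gtn_eqF (gm_ph X (glt X x))) add0r addrC.
    by rewrite (eq_bigr (fun j : 'I_(n - i) => (ph x == j.+1)%:R)) ?(sum_eqS R (n - i)) // gm_ph.
  by apply: bm_sum => k _; exact: bm_pj.
rewrite -(mass Q01 QC QM n hu); ring.
Qed.

Lemma beta_le u n : Cn u -> kap * beta u n <= E u.
Proof.
move=> hu; apply: (@le_trans _ _ (kap * \sum_(m < n.+1) beta u m)).
  rewrite ler_pM2l ?kap0 // big_ord_recr /= lerDr; apply: sumr_ge0 => i _; exact: beta_ge0.
by rewrite beta_sum // gerBl; exact: (op_overshoot_ge0 Q01 QC QM).
Qed.

(** The law of the time between two regenerations, each of which restarts from a constant
    density. *)
Definition regen_law n := kap * beta (fun=> 1) n.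

Lemma freg0 : regen_law 0%N = 0.
Proof.
rewrite /regen_law /beta /op_conv big_ord1 (_ : (fun x => ind (pj X (0 - 0)%N) x) = (fun=> 0)).
  by rewrite (op_at_0 Q01 QC QM) ?mulr0 //; exact: gm_1.
by apply/funext => x; rewrite /pj /= (gtn_eqF (gm_ph X (glt X x))).
Qed.

Lemma regen_law_ge0 n : 0 <= regen_law n.
Proof. by rewrite mulr_ge0 ?(ltW kap0) // beta_ge0 //; exact: gm_1. Qed.

Lemma regen_law_tail n : tail1 regen_law n = op_overshoot (fun=> 1) n.
Proof.
rewrite /tail1 -mulr_sumr beta_sum; last exact: gm_1.
by rewrite E1; ring.
Qed.

(** A block length of positive probability is itself a possible regeneration time, hence a multiple
    of [dd]. By [gm_mix] the other lengths remain null from any initial density and after any number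
    of blocks. *)
Lemma beta_period dd u n : (forall j, 0 < regen_law j -> (dd %| j)%N) -> Cn u ->
  ~~ (dd %| n)%N -> beta u n = 0.
Proof.
move=> hd; have hz j : ~~ (dd %| j)%N -> E (fun x => ind (pj X j) x) = 0.
  move=> hj; apply/eqP; rewrite eq_le; apply/andP; split; last by apply: Ex_ge0.
  rewrite leNgt; apply: contra hj => h; apply: hd.
  rewrite /regen_law mulr_gt0 ?kap0 // /beta (op_convE Q01 QC QM).
  apply: ltr_wpDr.
    by apply: sumr_ge0 => i _; apply: beta_ge0; exact: QC (gm_1 X).
  by apply: lt_le_trans h _; rewrite le_eqVlt; apply/orP; left; apply/eqP;
    apply: eq_Ex => x _; rewrite mul1r.
elim/ltn_ind: n u => n IH u hu hn.
have hz' v j : Cn v -> ~~ (dd %| j)%N -> E (fun x => v x * ind (pj X j) x) = 0.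
  move=> hv hj; apply/eqP; rewrite eq_le; apply/andP; split.
    apply: le_trans (gm_mix hv (bm_pj X j) _) _; first by move=> x.
    by rewrite hz // mulr0.
  by apply: Ex_ge0 => x _; rewrite mulr_ge0 // (gm_ge0 _ hv).
rewrite /beta (op_convE Q01 QC QM) hz' // add0r big1 // => j _.
case: (boolP (dd %| j.+1)%N) => hj.
  apply: IH; [by have := ltn_ord j; clear; lia|exact: QC|].
  apply: contra hn => h; rewrite -(subnK (ltn_ord j)); exact: dvdn_add.
apply/eqP; rewrite eq_le beta_ge0 ?andbT; last exact: QC.
rewrite -(ler_pM2l kap0) mulr0; apply: le_trans (beta_le _ (QC _ hu)) _.
rewrite QM // (_ : E _ = 0) ?mulr0 // -(hz' _ _ hu hj).
by apply: eq_Ex => x _; rewrite mulrC.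
Qed.

(* [g_N] is a functional of the whole orbit read off at time [N]; [b_N] is its part
   which does not factor through the first block. *)
Section Decomposition.
Variables (g bb : nat -> T -> R).
Hypothesis bmg : forall n, bmT (g n).
Hypothesis bmb : forall n, bmT (bb n).
Hypothesis gE : forall n x, g n x = bb n x + (ph x <= n)%N%:R * g (n - ph x)%N (gG X x).

(** Split by the first regeneration: before it the chain evolves under [Qop] and contributes through
    [bb]; at it the density becomes constant, and the remaining time is described by the means
    [E (g m)]. *)
Lemma regen_decomp u n : Cn u ->
  E (fun x => u x * g n x) = op_conv u bb n + kap * conv (beta u) (fun m => E (g m)) n.
Proof.
elim/ltn_ind: n u => n IH u hu; have hub := Cn_bm hu.
have b1 j : bmT (fun x => ind (pj X j) x * u x) by exact: bm_ind_mul.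
have b2 j m : bmT (fun x => ind (pj X j) x * u x * g m (gG X x)).
  by apply: bmM => //; exact: bm_comp_G.
have -> : E (fun x => u x * g n x) = E (fun x => u x * bb n x) +
   \sum_(j < n) E (fun x => ind (pj X j.+1) x * u x * g (n - j.+1)%N (gG X x)).
  rewrite -Ex_sum // -ExD //; [|exact: bmM|by apply: bm_sum].
  apply: eq_Ex => x _; rewrite gE mulrDr; congr (_ + _).
  case: leqP => h; last first.
    rewrite mul0r mulr0 big1 // => j _; rewrite /pj /= (_ : (_ == _) = false) ?mul0r //.
    by apply/negbTE; rewrite neq_ltn orbC (leq_ltn_trans _ h) // ltn_ord.
  have hp := gm_ph X (glt X x); have hj : ((ph x).-1 < n)%N by rewrite prednK.
  rewrite (bigD1 (Ordinal hj)) //= {1}/pj /= prednK // eqxx !mul1r big1 ?addr0 // => j hj'.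
  rewrite /pj /= (_ : (_ == _) = false) ?mul0r //; apply: contraNF hj' => /eqP e.
  by apply/eqP/val_inj; rewrite /= e.
have step (j : 'I_n) : E (fun x => ind (pj X j.+1) x * u x * g (n - j.+1)%N (gG X x)) =
   op_conv (Qop (pj X j.+1) u) bb (n - j.+1)%N +
   kap * (conv (beta (Qop (pj X j.+1) u)) (fun m => E (g m)) (n - j.+1)%N +
          E (fun x => ind (pj X j.+1) x * u x) * E (g (n - j.+1)%N)).
  have := Qop_E (pj X j.+1) hu (bmg (n - j.+1)%N).
  rewrite IH; [|by have := ltn_ord j; clear; lia|exact: QC].
  move=> h; rewrite mulrDr addrA h; ring.
rewrite (eq_bigr _ (fun j _ => step j)) big_split /= addrA -(op_convE Q01 QC QM) -mulr_sumr.
congr (_ + _ * _).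
transitivity (\sum_(i < n.+1) (E (fun x => u x * ind (pj X i) x) +
    \sum_(j < i) beta (Qop (pj X j.+1) u) (i - j.+1)%N) * E (g (n - i)%N)); last first.
  by apply: eq_bigr => i _; rewrite /beta (op_convE Q01 QC QM).
under [RHS]eq_bigr do rewrite mulrDl mulr_suml.
rewrite !big_split /= addrC; congr (_ + _).
  rewrite big_ord_recl /= (_ : E _ = 0) ?mul0r ?add0r; last first.
    rewrite -(@Ex0 _ _ _ (gmu X) setT) //; apply: eq_Ex => x _.
    by rewrite /pj /= (gtn_eqF (gm_ph X (glt X x))) mulr0.
  by apply: eq_bigr => j _; congr (_ * _); apply: eq_Ex => x _; rewrite mulrC.
rewrite (sum_triangle (fun i j => beta (Qop (pj X j.+1) u) (i - j.+1)%N * E (g (n - i)%N))).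
apply: eq_bigr => j _; rewrite /conv -subSn ?subSS ?ltn_ord //; apply: eq_bigr => i _.
by rewrite addnK addnC subnDA.
Qed.

Lemma regen_renewal r u n : (forall n, r n = delta n + conv regen_law r n) -> Cn u ->
  E (fun x => u x * g n x) = op_conv u bb n +
    kap * conv (beta u) (conv r (fun m => op_conv (fun=> 1) bb m)) n.
Proof.
move=> hr hu; rewrite regen_decomp //; congr (_ + _ * _); apply: eq_conv => // i _.
apply: (@conv_renewal _ regen_law r (fun m => E (g m)) (fun m => op_conv (fun=> 1) bb m)) => // m.
have := regen_decomp m (gm_1 X); rewrite -convZl => <-.
by apply: eq_Ex => x _; rewrite mul1r.
Qed.

End Decomposition.

(** Partial sums of the Neumann series of the dual of [Qop predT]: the expected sum of [g] along the
    first [M] blocks before regeneration, regardless of time. *)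
Fixpoint gM (g : T -> R) M : T -> R :=
  if M is M'.+1 then fun x => g x + (gM g M' (gG X x) - kap * E (gM g M')) else fun=> 0.

Section Green.
Variable g : T -> R.
Hypothesis hg : bmT g.
Hypothesis g0 : forall x, 0 <= g x.

Lemma bm_gM M : bmT (gM g M).
Proof.
elim: M => [|M IH] /=; first exact: bm_cst.
by apply: bmD => //; apply: bmB; [exact: bm_comp_G|exact: bm_cst].
Qed.

Lemma E_gM M : E (gM g M) = E g * (1 - (1 - kap) ^+ M) / kap.
Proof.
have k0 : kap != 0 by rewrite gt_eqF ?kap0.
elim: M => [|M IH] /=; first by rewrite Ex0 // expr0 subrr mulr0 mul0r.
rewrite ExD //; last by apply: bmB; [exact: bm_comp_G (bm_gM M)|exact: bm_cst].
rewrite ExB //; [|exact: bm_comp_G (bm_gM M)|exact: bm_cst].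
rewrite gm_inv; last exact: bm_gM.
by rewrite Ex_cst // probability_setT mulr1 IH exprS; field.
Qed.

Lemma gM_step u M n : Cn u -> E (fun x => u x * gM g M.+1 x) = E (fun x => u x * g x) +
  E (fun x => Qop (fun k => (n < gph X k)%N) u x * gM g M x) +
  \sum_(j < n) E (fun x => Qop (pj X j.+1) u x * gM g M x).
Proof.
move=> hu; have hub := Cn_bm hu; have hM := bm_gM M.
have hq : bmT (fun x => gM g M (gG X x) - kap * E (gM g M)).
  by apply: bmB; [exact: bm_comp_G|exact: bm_cst].
have QE P : E (fun x => Qop P u x * gM g M x) =
    E (fun x => ind P x * (u x * (gM g M (gG X x) - kap * E (gM g M)))).
  rewrite Qop_E //; set c := E (gM g M).
  have -> : kap * E (fun x => ind P x * u x) * c = E (fun x => kap * c * (ind P x * u x)).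
    by rewrite ExZ; [ring| |exact: bm_ind_mul].
  rewrite -ExB //.
  - by apply: eq_Ex => x _; ring.
  - by apply: bmM; [exact: bm_ind_mul|exact: bm_comp_G].
  - by apply: bmZ; exact: bm_ind_mul.
rewrite -addrA (eq_bigr _ (fun j _ => QE _)) QE -(@E_split _ _ _ X (fun x => u x *
   (gM g M (gG X x) - kap * E (gM g M)))); last exact: bmM.
rewrite -ExD //; [|exact: bmM|exact: bmM].
by apply: eq_Ex => x _; rewrite /= mulrDr.
Qed.

Lemma gM_ub u M : Cn u -> 0 <= E (fun x => u x * gM g M x) <= D / kap * E u * E g.
Proof.
have k0 := kap0; have k1 : 0 <= kap^-1 by rewrite invr_ge0 ltW.
have Eg0 : 0 <= E g by apply: Ex_ge0.
elim: M u => [|M IH] u hu.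
  have -> : E (fun x => u x * gM g 0 x) = 0.
    by rewrite -[RHS](@Ex0 _ _ _ (gmu X) setT) //; apply: eq_Ex => x _; rewrite /= mulr0.
  by rewrite lexx !mulr_ge0 ?D0 // Cn_Ege0.
rewrite (gM_step _ 0 hu) big_ord0 addr0.
have /andP[h1 h2] := IH _ (QC (fun k => (0 < gph X k)%N) hu).
have hEu : E (Qop (fun k => (0 < gph X k)%N) u) = (1 - kap) * E u.
  by rewrite QM //; congr (_ * _); apply: eq_Ex => x _; rewrite gm_ph mul1r.
have h3 := gm_mix hu hg g0.
apply/andP; split.
  by apply: addr_ge0 => //; apply: Ex_ge0 => x _; rewrite mulr_ge0 // (gm_ge0 _ hu).
apply: le_trans (lerD h3 h2) _; rewrite hEu le_eqVlt; apply/orP; left; apply/eqP.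
by field; rewrite gt_eqF.
Qed.

(** [gM] ignores time, while [op_conv] keeps the blocks that start up to time [n]. Blocks last at
    least 1, so [M > n] of them reach all such starts; the rest stems from mass that overshoots [n],
    and [gM_ub] bounds its contribution. *)
Lemma green_bound u n M : Cn u -> (n < M)%N ->
  0 <= E (fun x => u x * gM g M x) - op_conv u (fun=> g) n <= D / kap * E g * op_overshoot u n.
Proof.
have k0 := kap0; have k1 : 0 <= kap^-1 by rewrite invr_ge0 ltW.
have Eg0 : 0 <= E g by apply: Ex_ge0.
have c0 : 0 <= D / kap * E g by rewrite !mulr_ge0 ?D0.
elim/ltn_ind: n u M => n IH u [//|M] hu hn.
rewrite (gM_step _ n hu) (op_convE Q01 QC QM) /op_overshoot (op_convE Q01 QC QM).
set a := E (fun x => u x * g x).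
set q := E _; set S := \sum_(j < n) E _.
have -> : a + q + S - (a + \sum_(j < n) op_conv (Qop (pj X j.+1) u) (fun=> g) (n - j.+1)%N) =
   q + \sum_(j < n) (E (fun x => Qop (pj X j.+1) u x * gM g M x) -
       op_conv (Qop (pj X j.+1) u) (fun=> g) (n - j.+1)%N).
  rewrite sumrB -/S; ring.
have hj (j : 'I_n) := IH (n - j.+1)%N ltac:(have := ltn_ord j; clear; lia) _ M
   (QC (pj X j.+1) hu) ltac:(have := ltn_ord j; clear -hn; lia).
have /andP[q0 q1] := gM_ub M (QC (fun k => (n < gph X k)%N) hu).
apply/andP; split.
  by apply: addr_ge0 => //; apply: sumr_ge0 => j _; have /andP[] := hj j.
rewrite mulrDr mulr_sumr; apply: lerD; last by apply: ler_sum => j _; have /andP[] := hj j.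
apply: (le_trans q1); rewrite QM // mulrAC; apply: ler_wpM2l => //.
have -> : E (fun x => u x * (n < ph x)%N%:R) = E (fun x => (n < ph x)%N%:R * u x).
  by apply: eq_Ex => x _; rewrite mulrC.
rewrite ler_piMl //; last by rewrite gerBl ltW.
by apply: Ex_ge0 => x _; rewrite mulr_ge0 // (gm_ge0 _ hu).
Qed.

Lemma green_limit_ge0 n : `|op_conv (fun=> 1) (fun=> g) n - E g / kap| <= D / kap * E g * op_overshoot (fun=> 1) n.
Proof.
have k0 := kap0; have k1 : 0 <= kap^-1 by rewrite invr_ge0 ltW.
have Eg0 : 0 <= E g by apply: Ex_ge0.
have /andP[r0 r1] := Q01.
apply/ler_addgt0Pr => e e0.
pose e1 := e / (E g / kap + 1).
have c1 : 0 < E g / kap + 1 by rewrite ltr_wpDl // mulr_ge0.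
have e10 : 0 < e1 by rewrite divr_gt0.
have [M nM hM] : exists2 M, (n < M)%N & (1 - kap) ^+ M <= e1.
  have : (fun M => (1 - kap) ^+ M) @ \oo --> (0 : R) by apply: cvg_expr; rewrite ger0_norm.
  move=> /cvgr0Pnorm_le /(_ _ e10)[M0 _ h].
  exists (maxn M0 n.+1); first by rewrite leq_maxr.
  have := h (maxn M0 n.+1) (leq_maxl _ _).
  by rewrite ger0_norm // exprn_ge0.
have /andP[h1 h2] := green_bound (gm_1 X) nM.
have hE : E (fun x => 1 * gM g M x) = E g / kap - E g / kap * (1 - kap) ^+ M.
  rewrite -[LHS](_ : E (gM g M) = _); last by apply: eq_Ex => x _; rewrite mul1r.
  by rewrite E_gM; field; rewrite gt_eqF.
have hr : 0 <= E g / kap * (1 - kap) ^+ M <= e.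
  apply/andP; split; first by rewrite !mulr_ge0 // exprn_ge0.
  apply: (@le_trans _ _ ((E g / kap + 1) * e1)).
    by apply: ler_pM => //; [rewrite mulr_ge0|rewrite exprn_ge0|rewrite lerDl].
  by rewrite /e1 mulrC divfK // gt_eqF.
have /andP[hr1 hr2] := hr; rewrite hE in h1 h2.
have rhs0 : 0 <= D / kap * E g * op_overshoot (fun=> 1) n by lra.
rewrite ler_norml; apply/andP; split; lra.
Qed.

End Green.

(** The limit is the total expected sum of [g] over the blocks before regeneration, of which there
    are [1 / kap] in mean. Treating positive and negative parts separately keeps the error
    proportional to the mean of [|g|]. *)
Lemma green_limit g n : bmT g ->
  `|op_conv (fun=> 1) (fun=> g) n - E g / kap| <= D / kap * E (fun x => `|g x|) * op_overshoot (fun=> 1) n.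
Proof.
move=> hg; pose p x := (`|g x| + g x) / 2; pose q x := (`|g x| - g x) / 2.
have hn : bmT (fun x => `|g x|) by exact: bm_norm.
have hp : bmT p.
  by apply: (eq_bm _ (bmZ 2^-1 (bmD hn hg))) => x _; rewrite /p mulrC.
have hq : bmT q.
  by apply: (eq_bm _ (bmZ 2^-1 (bmB hn hg))) => x _; rewrite /q mulrC.
have p0 x : 0 <= p x.
  rewrite /p divr_ge0 //; have := ler_norm (- g x); rewrite normrN; lra.
have q0 x : 0 <= q x by rewrite /q divr_ge0 // subr_ge0 ler_norm.
have eg : g = (fun x => p x + -1 * q x) by apply/funext => x; rewrite /p /q; lra.
have en : (fun x => `|g x|) = (fun x => p x + q x) by apply/funext => x; rewrite /p /q; lra.
have h1 := green_limit_ge0 hp p0 n; have h2 := green_limit_ge0 hq q0 n.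
rewrite en ExD // (_ : E g = E p - E q); last by rewrite eg ExD ?ExZ // ?mulN1r //; exact: bmZ.
have -> : op_conv (fun=> 1) (fun=> g) n = op_conv (fun=> 1) (fun=> p) n - op_conv (fun=> 1) (fun=> q) n.
  rewrite /op_conv -sumrB; apply: eq_bigr => i _; have o := gm_1 X.
  rewrite {1}eg (op_at_D Q01 QC QM) // ?(op_at_Z Q01 QC QM) ?mulN1r //; exact: bmZ.
have -> : op_conv (fun=> 1) (fun=> p) n - op_conv (fun=> 1) (fun=> q) n - (E p - E q) / kap =
  (op_conv (fun=> 1) (fun=> p) n - E p / kap) - (op_conv (fun=> 1) (fun=> q) n - E q / kap) by ring.
apply: le_trans (ler_normB _ _) _; rewrite mulrDr mulrDl; exact: lerD.
Qed.

End Regeneration.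

(** * Renewal expansion of correlations for a Gibbs-Markov map with block lengths *)

Section RegenExpansion.
Context (R : realType) d (T : measurableType d) (X : gibbs_markov R T).
Local Notation E := (Ex (gmu X) setT).
Local Notation Cn := (gCn X).
Local Notation D := (gD X).
Local Notation bmT := (@bm R d T setT).
Local Notation ph x := (gph X (glt X x)).
Local Notation kap := (gkap X).
Local Notation op_at := (op_at X (Qop X)).
Local Notation op_conv := (op_conv X (Qop X)).
Local Notation op_overshoot := (op_overshoot X (Qop X)).
Let mT := @measurableT d T.
Let QC := @Qop_Cn R d T X.
Let QM := @Qop_mass R d T X.
Let Q1 := Q01 X.

Definition return_tail n : R := E (fun x => (n < ph x)%N%:R).

Variables (b A : R).
Hypothesis b1 : 1 < b.
Hypothesis A0 : 0 <= A.
Hypothesis phA : forall n, return_tail n <= A * psi b n.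
Local Notation psib := (psi b).

Lemma return_tail_ge0 n : 0 <= return_tail n. Proof. by apply: Ex_ge0. Qed.

Lemma ptail0 : return_tail 0 = 1.
Proof. by rewrite -(E1 X); apply: eq_Ex => x _; rewrite gm_ph. Qed.

(** Regeneration takes a multiple of [dd] steps, so it preserves residue classes, and [beta_sum]
    evaluates the sum up to an overshoot. *)
Lemma cpsum_regen dd (u : nat -> T -> R) k : (forall j, 0 < regen_law X j -> (dd %| j)%N) ->
  (forall i, Cn (u i)) ->
  cpsum dd (fun j => \sum_(i < j.+1) kap * beta X (u i) (j - i)%N) k =
  \sum_(i < k.+1 | (i %% dd == k %% dd)%N) (E (u i) - op_overshoot (u i) (k - i)%N).
Proof.
move=> hd hu; rewrite /cpsum big_mkcond /=.
transitivity (\sum_(j < k.+1) \sum_(i < j.+1)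
   (if ((i + (j - i)) %% dd == k %% dd)%N then kap * beta X (u i) (j - i)%N else 0)).
  apply: eq_bigr => j _; case: ifP => h.
    by apply: eq_bigr => i _; rewrite subnKC ?h // -ltnS.
  by rewrite big1 // => i _; rewrite subnKC ?h // -ltnS.
rewrite (sum_diag (fun i m => if ((i + m) %% dd == k %% dd)%N then kap * beta X (u i) m else 0)).
rewrite [RHS]big_mkcond; apply: eq_bigr => i _.
rewrite -beta_sum // mulr_sumr.
transitivity (\sum_(m < (k - i).+1) (if (i %% dd == k %% dd)%N then kap * beta X (u i) m else 0)).
  apply: eq_bigr => m _; case: (boolP (dd %| m)%N) => hm.
    by rewrite -modnDmr (eqP hm) addn0.
  by rewrite (beta_period hd) // mulr0 !if_same.
by case: ifP => // _; rewrite big1.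
Qed.

Lemma psum_op_conv u bb k : psum (op_conv u bb) k = \sum_(j < k.+1) op_conv u (fun=> bb j) (k - j)%N.
Proof.
rewrite /psum /op_conv -(sum_diag (fun j i => op_at u i (bb j))); apply: eq_bigr => m _.
rewrite (reindex_inj rev_ord_inj) /=; apply: eq_bigr => i _.
by rewrite subSS subKn // -ltnS.
Qed.

Lemma tailb_dom (x y : nat -> R) c L r : 0 <= c -> (forall n, `|x n| <= c * y n) ->
  tailb L r y -> tailb (c * L) r (fun n => `|x n|).
Proof.
move=> c0 h [y0 hy]; split => // n m.
apply: (@le_trans _ _ (\sum_(n <= j < m) c * y j)); first by apply: ler_sum.
by rewrite -mulr_sumr -mulrA; apply: ler_wpM2l.
Qed.

(** A truncated Wald identity between the regeneration law and the block lengths. The left sum runs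
    over a triangle of pairs (start of a block, age); completing it to a square allows [green_limit]
    at each age, and the added part is estimated by [psi_window]. *)
Lemma return_tail_green : exists2 K, 0 <= K &
  forall n, `|\sum_(s < n.+1) op_overshoot (fun=> 1) s - \sum_(j < n.+1) return_tail j / kap| <= K * Zt b n.
Proof.
have [Ct Ct0 hCt] := op_overshoot_bound Q1 QC QM b1 A0 phA.
have [Cs Cs0 hCs] := op_at_tail Q1 QC QM b1 A0 phA.
have o := gm_1 X; have k0 := kap0 X; have k1 : 0 <= kap^-1 by rewrite invr_ge0 ltW.
have D0 := D0 X; have pc := psiC_ge0 b1.
have Er0 : 0 <= ErC b by rewrite mulr_ge0 ?powR_ge0 // addr_ge0.
pose K1 := D * Cs * A * ErC b; pose K2 := D / kap * A * psiC b * Ct.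
have K10 : 0 <= K1 by rewrite /K1 mulr_ge0 // mulr_ge0 // mulr_ge0.
have K20 : 0 <= K2 by rewrite /K2 mulr_ge0 // mulr_ge0 // mulr_ge0 // mulr_ge0.
exists (K1 + K2); first exact: addr_ge0.
move=> n; rewrite (sum_diag (fun i k => op_at (fun=> 1) i (fun x => (k < ph x)%N%:R))).
pose S i := \sum_((n - i).+1 <= k < n.+1) op_at (fun=> 1) i (fun x => (k < ph x)%N%:R).
have e1 : \sum_(i < n.+1) \sum_(k < (n - i).+1) op_at (fun=> 1) i (fun x => (k < ph x)%N%:R) =
   \sum_(k < n.+1) op_conv (fun=> 1) (fun=> fun x => (k < ph x)%N%:R) n - \sum_(i < n.+1) S i.
  rewrite /op_conv exchange_big /= -sumrB; apply: eq_bigr => i _.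
  rewrite (@sum_ord_split _ (fun k => op_at (fun=> 1) i (fun x => (k < ph x)%N%:R)) (n - i).+1 n.+1).
    by rewrite addrK.
  by rewrite ltnS leq_subr.
rewrite {}e1 addrAC -sumrB mulrDl.
apply: le_trans (ler_normB _ _) _; rewrite [leRHS]addrC; apply: lerD.
  apply: (@le_trans _ _ (\sum_(k < n.+1) D / kap * (A * psib k) * (Ct * psib n))).
    apply: le_trans (ler_norm_sum _ _ _) _; apply: ler_sum => k _.
    apply: le_trans (green_limit X n (bm_phgt X k)) _.
    have hk : E (fun x => `|(k < ph x)%N%:R : R|) = return_tail k.
      by apply: eq_Ex => x _; rewrite ger0_norm.
    rewrite hk; apply: ler_pM.
    - by rewrite !mulr_ge0 // return_tail_ge0.
    - exact: (op_overshoot_ge0 Q1 QC QM).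
    - by apply: ler_wpM2l; [rewrite mulr_ge0|exact: phA].
    - by have := hCt _ n o; rewrite E1 mulr1.
  rewrite (eq_bigr (fun k : 'I_n.+1 => (D / kap * A * Ct * psib n) * psib k)); last first.
    by move=> k _; ring.
  rewrite -mulr_sumr; apply: (@le_trans _ _ (D / kap * A * Ct * psib n * psiC b)).
    apply: ler_wpM2l; last exact: sum_psi.
    by rewrite mulr_ge0 ?psi_ge0 // mulr_ge0 // mulr_ge0 // mulr_ge0.
  have -> : D / kap * A * Ct * psib n * psiC b = K2 * psib n by rewrite /K2; ring.
  by apply: ler_wpM2l => //; exact: Zt_ge_psi.
have S0 i : 0 <= S i.
  by apply: sumr_ge0 => k _; apply: (op_at_ge0 Q1 QC QM) => //; exact: bm_phgt.
rewrite ger0_norm; last exact: sumr_ge0.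
have -> : K1 * Zt b n = D * Cs * A * (ErC b * Zt b n) by rewrite /K1; ring.
apply: (@le_trans _ _ (D * Cs * A * \sum_(i < n.+1) psib i * \sum_((n - i).+1 <= k < n.+1) psib k)).
  rewrite mulr_sumr; apply: ler_sum => i _; rewrite /S mulrA mulr_sumr; apply: ler_sum => k _.
  apply: le_trans (op_at_mix Q1 QC QM _ o (bm_phgt X k) _) _; first by move=> x.
  have -> : D * Cs * A * psib i * psib k = D * (Cs * psib i) * (A * psib k) by ring.
  apply: ler_pM.
  - by rewrite mulr_ge0 // (op_at_ge0 Q1 QC QM) //; exact: bm_cst.
  - by apply: Ex_ge0.
  - by apply: ler_wpM2l => //; have := tailb_ub i (hCs _ o); rewrite E1 mulr1.
  - exact: phA.
apply: ler_wpM2l; last exact: psi_window.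
by rewrite mulr_ge0 // mulr_ge0.
Qed.

Lemma Zt_le n : Zt b n <= psi (b - 1) n.
Proof.
rewrite /Zt -psi_succ mulrC; apply: ler_wpM2r; first exact: psi_ge0.
rewrite -[X in _ <= X%:R]card_ord -sumr_const; apply: ler_sum => i _.
by apply: psi_le1; rewrite subr_ge0 ltW.
Qed.

(** The constants are uniform in the observables, which enter only through [B1] and [B2]. A signed
    kick is a pair [u1], [u2] of cone densities: the renewal equation is applied to each of them,
    but only the difference of their class sums has to be close to [V]. *)
Theorem regen_expansion : exists dd e, [/\ (0 < dd)%N,
  forall j, 0 < E (fun x => (pj X j (glt X x))%:R) -> (dd %| j)%N,
  exists2 Ce, 0 <= Ce & forall n, `|e n| <= Ce * psib n,
  forall PB, (forall n, \sum_(j < n) return_tail j <= PB) ->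
    (forall eps, 0 < eps -> exists n, PB - \sum_(j < n) return_tail j <= eps) ->
    exists2 K, 0 <= K & forall n,
     `|psum e n / (dd%:R * kap) - (1 + (PB - \sum_(j < n.+1) return_tail j) / PB) / PB| <= K * Zt b n &
  forall s L, (forall n, 0 <= s n) -> (forall n m, (n <= m)%N -> s m <= s n) -> 0 <= L ->
    exists2 K, 0 <= K & forall u1 u2 l lam g bb V W B1 B2 n,
     0 <= B1 -> 0 <= B2 -> (forall i, Cn (u1 i)) -> (forall i, Cn (u2 i)) ->
     (forall i, E (u1 i) <= B1 * l i) -> (forall i, E (u2 i) <= B1 * l i) ->
     (forall i, 0 <= l i <= s i) ->
     (forall k, bmT (g k)) -> (forall k, bmT (bb k)) ->
     (forall k x, g k x = bb k x + (ph x <= k)%N%:R * g (k - ph x)%N (gG X x)) ->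
     (forall k, E (fun x => `|bb k x|) <= B2 * lam k) -> tailb L (eta b s) lam ->
     (forall k, (k <= n.-1)%N ->
       `|\sum_(i < k.+1 | (i %% dd == k %% dd)%N) (E (u1 i) - E (u2 i)) - V| <= B1 * eta b s k) ->
     (forall k, `|psum (fun j => E (bb j)) k - W| <= B2 * L * eta b s k) ->
     `|\sum_(i < n.-1.+1) (E (fun x => u1 i x * g (n.-1 - i)%N x) - E (fun x => u2 i x * g (n.-1 - i)%N x))
        - V * W / kap * psum e n.-1| <= K * B1 * B2 * eta b s (n %/ 3)%N].
Proof.
have [Ct Ct0 hCt] := op_overshoot_bound Q1 QC QM b1 A0 phA.
have [Cs Cs0 hCs] := op_at_tail Q1 QC QM b1 A0 phA.
have o := gm_1 X; have k0 := kap0 X; have k1 : 0 <= kap^-1 by rewrite invr_ge0 ltW.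
have D0 := D0 X; have pc := psiC_ge0 b1; have pp := ppC_ge0 b1.
have tA n : 0 <= tail1 (regen_law X) n <= Ct * psib n.
  rewrite regen_law_tail; have := hCt _ n o; rewrite E1 mulr1 => ->.
  by rewrite andbT; exact: (op_overshoot_ge0 Q1 QC QM).
have [dd [dd0 hdd [r [e [Ce [Ce0 rE eE ePsi]]]]]] :=
  renewal_period b1 (freg0 X) (regen_law_ge0 X) Ct0 tA.
exists dd, e; split => //.
- move=> j hj; apply: hdd; rewrite /regen_law mulr_gt0 //.
  rewrite /beta (op_convE Q1 QC QM); apply: ltr_wpDr.
    by apply: sumr_ge0 => i _; apply: beta_ge0; exact: QC o.
  by apply: lt_le_trans hj _; rewrite le_eqVlt; apply/orP; left; apply/eqP;
    apply: eq_Ex => x _; rewrite mul1r.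
- by exists Ce.
- move=> PB PB1 PB2.
  have [K K0 hK] := ut_expand b1 (freg0 X) Ct0 tA Ce0 rE eE ePsi.
  have [K1 K10 hK1] := return_tail_green.
  have PBge1 : 1 <= PB by have := PB1 1%N; rewrite big_ord1 ptail0.
  have PB0 : 0 < PB by exact: lt_le_trans PBge1.
  pose Tf := Tsum (regen_law X).
  have h1 n : `|\sum_(s < n.+1) tail1 (regen_law X) s - \sum_(j < n.+1) return_tail j / kap| <= K1 * Zt b n.
    rewrite (eq_bigr (fun s : 'I_n.+1 => op_overshoot (fun=> 1) s)); first exact: hK1.
    by move=> i _; exact: regen_law_tail.
  (* In mean there are [1 / kap] blocks of mean length [PB] between regenerations; the identity
     follows by letting [n] grow in [return_tail_green]. *)
  have TE : Tf = PB / kap.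
    apply/eqP; rewrite -subr_eq0 -normr_le0; apply/ler_addgt0Pr => eps e0; rewrite add0r.
    have e3 : 0 < eps / 3 by rewrite divr_gt0.
    have e4 : 0 < eps / 3 / (K1 + 1) by rewrite divr_gt0 // ltr_wpDl.
    have e5 : 0 < eps / 3 * kap by rewrite mulr_gt0.
    have [N1 hN1] := Tsum_near b1 Ct0 tA e3.
    have c0 : 0 < b - 1 by rewrite subr_gt0.
    have [N2 hN2] := powR_to0 c0 e4; have [N3 hN3] := PB2 _ e5.
    pose N := (N1 + N2 + N3)%N.
    have g1 : 0 <= Tf - \sum_(s < N.+1) tail1 (regen_law X) s <= eps / 3.
      rewrite subr_ge0 (Tsum_ub b1 Ct0 tA) /=; apply: le_trans hN1; rewrite lerD2l lerN2.
      rewrite (@sum_ord_split _ (tail1 (regen_law X)) N1 N.+1); last by rewrite /N; clear; lia.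
      by rewrite lerDl; apply: sumr_ge0 => i _; have /andP[] := tA i.
    have g2 : 0 <= (PB - \sum_(j < N.+1) return_tail j) / kap <= eps / 3.
      apply/andP; split; first by rewrite mulr_ge0 // subr_ge0.
      rewrite ler_pdivrMr //; apply: le_trans hN3; rewrite lerD2l lerN2.
      rewrite (@sum_ord_split _ return_tail N3 N.+1); last by rewrite /N; clear; lia.
      by rewrite lerDl; apply: sumr_ge0 => i _; exact: return_tail_ge0.
    have g3 : K1 * Zt b N <= eps / 3.
      apply: (@le_trans _ _ ((K1 + 1) * (eps / 3 / (K1 + 1)))); last first.
        by rewrite mulrC divfK // gt_eqF // ltr_wpDl.
      apply: ler_pM => //; [exact: Zt_ge0|by rewrite lerDl|].
      apply: le_trans (Zt_le N) _; apply: hN2; rewrite /N; clear; lia.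
    have := h1 N; rewrite -mulr_suml; move/le_trans => /(_ _ g3).
    move: g1 g2; rewrite mulrBl !ler_norml.
    set a1 := \sum_(s < N.+1) tail1 _ _; set a2 := (\sum_(j < N.+1) return_tail j) / kap.
    move=> /andP[? ?] /andP[? ?] /andP[? ?]; apply/andP; split; lra.
  exists (K / (dd%:R * kap) + K1 * kap).
    by rewrite addr_ge0 // ?divr_ge0 // ?mulr_ge0 // ltW.
  move=> n; have dd0' : 0 < dd%:R :> R by rewrite ltr0n.
  pose tl := PB - \sum_(j < n.+1) return_tail j.
  pose del := TT (regen_law X) n - tl / kap.
  have hdel : `|del| <= K1 * Zt b n.
    rewrite /del /TT -/Tf TE /tl mulrBl.
    set p := PB / kap; have := h1 n; rewrite -mulr_suml -normrN.
    by rewrite (_ : - (_ - _) = p - \sum_(j < n.+1) tail1 (regen_law X) j -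
      (p - (\sum_(j < n.+1) return_tail j) / kap)) //; ring.
  have := hK n; rewrite -/Tf TE (_ : TT (regen_law X) n = del + tl / kap); last by rewrite /del subrK.
  move=> h2; have Z0 := Zt_ge0 b n.
  have -> : psum e n / (dd%:R * kap) - (1 + tl / PB) / PB =
    (psum e n - dd%:R / (PB / kap) * (1 + (del + tl / kap) / (PB / kap))) / (dd%:R * kap)
     + del * kap / PB / PB.
    by field; rewrite !gt_eqF.
  apply: le_trans (ler_normD _ _) _; rewrite [leRHS]mulrDl; apply: lerD.
    rewrite normrM normfV (ger0_norm (ltW (mulr_gt0 dd0' k0))) [leRHS]mulrAC.
    by apply: ler_wpM2r => //; rewrite invr_ge0 ltW // mulr_gt0.
  have nPB x : `|x / PB| <= `|x|.
    rewrite normrM normfV (ger0_norm (ltW PB0)) ler_piMr // invf_le1 //.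
  apply: le_trans (nPB _) _; apply: le_trans (nPB _) _.
  by rewrite normrM (ger0_norm (ltW k0)) [leRHS]mulrAC; apply: ler_wpM2r => //; exact: ltW.
move=> s L s0 sdecr L0.
have et0 k : 0 <= eta b s k by exact: eta_ge0.
have p0 := psi_ge0 b.
(* [a1], [a2] and [a3] serve the class sums of the kicks and the partial sums and tails of the fresh
   part [C], as [conv_assembly] requires; [KN] covers what happens before the first regeneration. *)
pose a1 := 2 * Ct + 1.
pose a2 := L * (D / kap * Ct * ppC b + kap^-1).
pose a3 := D * (2 * Cs * L) * ppC b.
pose KA := 2 * Ce * ppC b * (1 + psiC b) * (eta b s 0%N + 1).
pose KN := 2 * (D * Cs) * (2 * 1 * L * (1 + psiC b) * eta b s 0%N).
have a10 : 0 <= a1 by rewrite /a1 addr_ge0 // mulr_ge0.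
have a20 : 0 <= a2 by rewrite /a2 mulr_ge0 // addr_ge0 // mulr_ge0 // mulr_ge0 // mulr_ge0.
have a30 : 0 <= a3 by rewrite /a3 mulr_ge0 // mulr_ge0 // mulr_ge0 // mulr_ge0.
have pc1 : 0 <= 1 + psiC b by rewrite addr_ge0.
have KA0 : 0 <= KA.
  by rewrite /KA mulr_ge0 ?addr_ge0 // mulr_ge0 // mulr_ge0 // mulr_ge0.
have KN0 : 0 <= KN by rewrite /KN !mulr_ge0.
exists (KN + KA * (a1 * a3 + (eta b s 0%N + 2 * s 0%N) * a2)).
  by rewrite addr_ge0 // mulr_ge0 // addr_ge0 // mulr_ge0 // addr_ge0 // mulr_ge0.
move=> u1 u2 l lam g bb V W B1 B2 n B10 B20 hu1 hu2 hl1 hl2 hl bmg bmb gE hlam Hlam hV hW.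
set N := n.-1 in hV *; have [lam0 _] := Hlam.
have lamE k : lam k <= L * eta b s k by exact: tailb_ub.
pose C k := op_conv (fun=> 1) bb k.
pose Xc j := \sum_(i < j.+1) kap * beta X (u1 i) (j - i)%N -
             \sum_(i < j.+1) kap * beta X (u2 i) (j - i)%N.
have hconv (u : nat -> T -> R) : (forall i, Cn (u i)) ->
  \sum_(i < N.+1) E (fun x => u i x * g (N - i)%N x) = \sum_(i < N.+1) op_conv (u i) bb (N - i)%N +
    conv (fun j => \sum_(i < j.+1) kap * beta X (u i) (j - i)%N) (conv r C) N.
  move=> hu; rewrite (eq_bigr (fun i : 'I_N.+1 => op_conv (u i) bb (N - i)%N +
      kap * conv (beta X (u i)) (conv r C) (N - i)%N)); last first.
    by move=> i _; exact: (regen_renewal bmg bmb gE _ rE (hu i)).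
  rewrite big_split /=; congr (_ + _).
  transitivity (\sum_(i < N.+1) \sum_(k < (N - i).+1) kap * beta X (u i) k * conv r C (N - i - k)%N).
    by apply: eq_bigr => i _; rewrite -convZl.
  rewrite -(sum_diag (fun i k => kap * beta X (u i) k * conv r C (N - i - k)%N)).
  apply: eq_bigr => m _; rewrite mulr_suml; apply: eq_bigr => i _.
  by rewrite -subnDA subnKC // -ltnS.
have hnon (u : nat -> T -> R) : (forall i, Cn (u i)) -> (forall i, E (u i) <= B1 * l i) ->
  `|\sum_(i < N.+1) op_conv (u i) bb (N - i)%N| <=
     B1 * B2 * (D * Cs * (2 * 1 * L * (1 + psiC b) * eta b s 0%N) * eta b s (n %/ 3)%N).
  move=> hu hE.
  have hjump : conv (conv l psib) lam N <= 2 * 1 * L * (1 + psiC b) * eta b s 0%N * eta b s (n %/ 3)%N.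
    apply: conv_big_jump => //.
    move=> j; rewrite mul1r; apply/andP; split.
      by apply: conv_ge0 => // i; have /andP[] := hl i.
    by apply: ler_conv => i; rewrite ?hl // p0 lexx.
  rewrite -(mulrA (D * Cs)).
  have -> : B1 * B2 * (D * Cs * (2 * 1 * L * (1 + psiC b) * eta b s 0%N * eta b s (n %/ 3)%N)) =
    B1 * B2 * D * Cs * (2 * 1 * L * (1 + psiC b) * eta b s 0%N * eta b s (n %/ 3)%N) by ring.
  apply: (@le_trans _ _ (B1 * B2 * D * Cs * conv (conv l psib) lam N)); last first.
    by apply: ler_wpM2l => //; rewrite !mulr_ge0.
  rewrite -convA -convZl; apply: le_trans (ler_norm_sum _ _ _) _; apply: ler_sum => i _.
  apply: le_trans (op_conv_norm Q1 QC QM _ (hu i) bmb hlam) _.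
  have /andP[l0 _] := hl i.
  rewrite convZr.
  have -> : B1 * B2 * D * Cs * l i * conv psib lam (N - i)%N =
     D * (B2 * (Cs * (B1 * l i) * conv psib lam (N - i)%N)) by ring.
  apply: ler_wpM2l => //; apply: ler_wpM2l => //; rewrite -convZl; apply: ler_conv => k.
    rewrite (op_at_ge0 Q1 QC QM) //=; last exact: bm_cst.
    apply: le_trans (tailb_ub k (hCs _ (hu i))) _; apply: ler_wpM2r => //.
    exact: ler_wpM2l.
  by rewrite lam0 lexx.
have hX k : (k <= N)%N -> `|cpsum dd Xc k - V| <= B1 * a1 * eta b s k.
  move=> kN.
  have -> : cpsum dd Xc k = \sum_(i < k.+1 | (i %% dd == k %% dd)%N) (E (u1 i) - E (u2 i)) -
     \sum_(i < k.+1 | (i %% dd == k %% dd)%N) (op_overshoot (u1 i) (k - i)%N - op_overshoot (u2 i) (k - i)%N).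
    have -> : cpsum dd Xc k = cpsum dd (fun j => \sum_(i < j.+1) kap * beta X (u1 i) (j - i)%N) k -
        cpsum dd (fun j => \sum_(i < j.+1) kap * beta X (u2 i) (j - i)%N) k by rewrite /cpsum sumrB.
    by rewrite !cpsum_regen // -!sumrB; apply: eq_bigr => i _; ring.
  set S1 := \sum_(i < k.+1 | _) (E _ - _); set S2 := \sum_(i < k.+1 | _) (op_overshoot _ _ - _).
  have -> : S1 - S2 - V = (S1 - V) - S2 by ring.
  apply: le_trans (ler_normB _ _) _; rewrite /a1 mulrDr mulr1 [leRHS]mulrDl [leRHS]addrC; apply: lerD; first exact: hV.
  rewrite /S2; apply: le_trans (ler_norm_sum _ _ _) _; rewrite big_mkcond /=.
  have hh : forall i, 0 <= 2 * Ct * B1 * l i by move=> i; have /andP[? _] := hl i; rewrite !mulr_ge0.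
  apply: (@le_trans _ _ (conv (fun i => 2 * Ct * B1 * l i) psib k)); last first.
    rewrite convZl (_ : B1 * (2 * Ct) = 2 * Ct * B1); last by ring.
    apply: ler_wpM2l; first by rewrite !mulr_ge0.
    by apply: ler_conv => i; rewrite ?hl // p0 lexx.
  apply: ler_sum => i _; case: ifP => _; last by rewrite mulr_ge0.
  apply: le_trans (ler_normB _ _) _.
  rewrite !ger0_norm; try exact: (op_overshoot_ge0 Q1 QC QM).
  have q (u : nat -> T -> R) : (forall i, Cn (u i)) -> (forall i, E (u i) <= B1 * l i) ->
     op_overshoot (u i) (k - i)%N <= Ct * B1 * l i * psib (k - i)%N.
    move=> hu hE; apply: le_trans (hCt _ _ (hu i)) _; apply: ler_wpM2r => //.
    by rewrite -mulrA; apply: ler_wpM2l.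
  apply: le_trans (lerD (q _ hu1 hl1) (q _ hu2 hl2)) _.
  by rewrite le_eqVlt; apply/orP; left; apply/eqP; ring.
have hC k : `|psum C k - W / kap| <= B2 * a2 * eta b s k.
  rewrite psum_op_conv.
  have -> : \sum_(j < k.+1) op_conv (fun=> 1) (fun=> bb j) (k - j)%N - W / kap =
    \sum_(j < k.+1) (op_conv (fun=> 1) (fun=> bb j) (k - j)%N - E (bb j) / kap) +
     (psum (fun j => E (bb j)) k - W) / kap.
    rewrite sumrB /psum mulrBl mulr_suml; ring.
  apply: le_trans (ler_normD _ _) _.
  rewrite /a2 [X in B2 * X]mulrDr [B2 * (_ + _)]mulrDr [leRHS]mulrDl; apply: lerD; last first.
    rewrite normrM normfV (ger0_norm (ltW k0)) (_ : B2 * (L / kap) * eta b s k = B2 * L * eta b s k / kap).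
      by apply: ler_wpM2r.
    ring.
  apply: le_trans (ler_norm_sum _ _ _) _.
  apply: (@le_trans _ _ (D / kap * B2 * Ct * conv lam psib k)).
    rewrite -convZl; apply: ler_sum => j _.
    apply: le_trans (green_limit X _ (bmb j)) _.
    have -> : D / kap * B2 * Ct * lam j * psib (k - j)%N = D / kap * (B2 * lam j) * (Ct * psib (k - j)%N) by ring.
    apply: ler_pM.
    - by rewrite mulr_ge0 ?mulr_ge0 //; apply: Ex_ge0.
    - exact: (op_overshoot_ge0 Q1 QC QM).
    - by apply: ler_wpM2l; rewrite ?mulr_ge0.
    - by have := hCt _ (k - j)%N o; rewrite E1 mulr1.
  have -> : B2 * (L * (D / kap * Ct * ppC b)) * eta b s k = D / kap * B2 * Ct * (L * (ppC b * eta b s k)) by ring.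
  apply: ler_wpM2l; first by rewrite !mulr_ge0.
  apply: (@le_trans _ _ (conv (fun i => L * eta b s i) psib k)).
    by apply: ler_conv => i; rewrite ?lam0 ?lamE ?p0 ?lexx.
  rewrite convZl; apply: ler_wpM2l => //; rewrite convC; exact: conv_psi_eta.
have hC' : tailb (B2 * a3) (eta b s) (fun k => `|C k|).
  have ht : tailb (2 * Cs * L * ppC b) (eta b s) (conv (fun i => op_at (fun=> 1) i (fun=> 1)) lam).
    apply: (@tailb_weaken _ (2 * Cs * L) _ (conv psib (eta b s))).
      move=> k; rewrite -(mulrA _ (ppC b)); apply: ler_wpM2l; first by rewrite !mulr_ge0.
      exact: conv_psi_eta.
    apply: tailb_conv => //; have := hCs _ o; rewrite E1 mulr1; exact.
  have -> : B2 * a3 = D * B2 * (2 * Cs * L * ppC b) by rewrite /a3; ring.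
  apply: tailb_dom ht; first by rewrite mulr_ge0.
  move=> k; apply: le_trans (op_conv_norm Q1 QC QM k o bmb hlam) _.
  by rewrite convZr mulrA.
(* The case [k = 0] of the hypothesis on class sums bounds [V] itself. *)
have hVb : `|V| <= B1 * (eta b s 0%N + 2 * s 0%N).
  have := hV 0%N (leq0n _); rewrite big_mkcond big_ord1 /= eqxx => h0.
  have /andP[l0 l1] := hl 0%N.
  have q1 : E (u1 0%N) <= B1 * s 0%N by apply: le_trans (hl1 0%N) _; exact: ler_wpM2l.
  have q2 : E (u2 0%N) <= B1 * s 0%N by apply: le_trans (hl2 0%N) _; exact: ler_wpM2l.
  have q3 := Cn_Ege0 (hu1 0%N); have q4 := Cn_Ege0 (hu2 0%N).
  move: h0; rewrite !ler_norml mulrDr (_ : B1 * (2 * s 0%N) = 2 * (B1 * s 0%N)); last by ring.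
  move: q1 q2 q3 q4; set w := B1 * s 0%N; set y := B1 * eta _ _ _; clearbody w y; clear.
  move=> ? ? ? ? /andP[? ?]; apply/andP; split; lra.
rewrite sumrB !hconv //.
have -> : conv (fun j => \sum_(i < j.+1) kap * beta X (u1 i) (j - i)%N) (conv r C) N =
  conv (conv Xc r) C N + conv (fun j => \sum_(i < j.+1) kap * beta X (u2 i) (j - i)%N) (conv r C) N.
  by rewrite -convA -convDl; apply: eq_conv => // j _; rewrite /Xc subrK.
set c2 := conv (fun j => \sum_(i < j.+1) kap * beta X (u2 i) (j - i)%N) _ _.
have hmain := conv_assembly b1 dd0 Ce0 eE ePsi s0 sdecr (mulr_ge0 B10 a10) (mulr_ge0 B20 a20)
  (mulr_ge0 B20 a30) hX hC hC'; rewrite -/N in hmain.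
have n1 := hnon _ hu1 hl1; have n2 := hnon _ hu2 hl2.
set Y1 := \sum_(i < N.+1) op_conv (u1 i) _ _ in n1 *; set Y2 := \sum_(i < N.+1) op_conv (u2 i) _ _ in n2 *.
have -> : Y1 + (conv (conv Xc r) C N + c2) - (Y2 + c2) - V * W / kap * psum e N =
  (Y1 - Y2) + (conv (conv Xc r) C N - V * (W / kap) * psum e N) by ring.
apply: le_trans (ler_normD _ _) _.
set q := eta b s (n %/ 3)%N in n1 n2 hmain *; have q0 : 0 <= q by exact: et0.
have hh1 : `|Y1 - Y2| <= KN * B1 * B2 * q.
  apply: le_trans (ler_normB _ _) _; apply: le_trans (lerD n1 n2) _.
  by rewrite le_eqVlt; apply/orP; left; apply/eqP; rewrite /KN; ring.
have hh2 : `|conv (conv Xc r) C N - V * (W / kap) * psum e N| <=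
   KA * (a1 * a3 + (eta b s 0%N + 2 * s 0%N) * a2) * B1 * B2 * q.
  apply: (le_trans hmain); rewrite -/KA; apply: ler_wpM2r => //.
  have -> : KA * (a1 * a3 + (eta b s 0%N + 2 * s 0%N) * a2) * B1 * B2 =
    KA * (B1 * a1 * (B2 * a3) + B1 * (eta b s 0%N + 2 * s 0%N) * (B2 * a2)) by ring.
  apply: ler_wpM2l => //; rewrite lerD2l; apply: ler_wpM2r => //; exact: mulr_ge0.
apply: le_trans (lerD hh1 hh2) _.
by rewrite le_eqVlt; apply/orP; left; apply/eqP; ring.
Qed.

End RegenExpansion.

Lemma Ex_bound (R : realType) d (T : measurableType d) (mu : probability T R) (D : set T) u B :
  measurable D -> 0 <= B -> bm D u -> (forall x, D x -> `|u x| <= B) -> `|Ex mu D u| <= B.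
Proof.
move=> mD B0 hu h; apply: le_trans (ler_norm_Ex _ mD hu) _.
apply: (@le_trans _ _ (Ex mu D (fun=> B))).
  by apply: le_Ex => //; [exact: bm_norm|exact: bm_cst].
rewrite Ex_cst // ler_piMr // -lee_fin fineK ?fin_num_measure //.
exact: probability_le1.
Qed.

(** Change of variables with bounded weights on both sides; it covers invariance, the projection to
    the quotient and the inverse branches alike. *)
Lemma Ex_transfer (R : realType) d (T : measurableType d) (mu : probability T R)
  (D : set T) d' (T' : measurableType d') (nu : probability T' R) (D' : set T')
  (G : T' -> T) (w : T -> R) (w' : T' -> R) :
  measurable D -> measurable D' -> measurable_fun D' G -> (forall x, D' x -> D (G x)) ->
  bm D w -> bm D' w' ->
  (forall A, measurable A -> Ex nu D' (fun x => w' x * \1_A (G x)) = Ex mu D (fun x => w x * \1_A x)) ->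
  forall g, bm D g -> Ex nu D' (fun x => w' x * g (G x)) = Ex mu D (fun x => w x * g x).
Proof.
move=> mD mD' mG GD hw hw' inv g hg; apply/eqP; rewrite -subr_eq0; apply/eqP.
have bG u : bm D u -> bm D' (fun x => w' x * u (G x)) by move=> hu; apply: bmM => //; exact: bm_comp hu.
have [_ [W hW]] := hw; have [_ [W' hW']] := hw'.
apply: (@linear_ext0 R d T D mD
  (fun g => Ex nu D' (fun x => w' x * g (G x)) - Ex mu D (fun x => w x * g x)) (`|W'| + `|W|)) => //.
- move=> u v hu hv.
  have -> : Ex nu D' (fun x => w' x * (u (G x) + v (G x))) =
      Ex nu D' (fun x => w' x * u (G x) + w' x * v (G x)).
    by apply: eq_Ex => x _; rewrite mulrDr.
  have -> : Ex mu D (fun x => w x * (u x + v x)) = Ex mu D (fun x => w x * u x + w x * v x).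
    by apply: eq_Ex => x _; rewrite mulrDr.
  by rewrite !ExD //; [ring|exact: bmM|exact: bmM|exact: bG|exact: bG].
- move=> c u hu.
  have -> : Ex nu D' (fun x => w' x * (c * u (G x))) = Ex nu D' (fun x => c * (w' x * u (G x))).
    by apply: eq_Ex => x _; rewrite mulrCA.
  have -> : Ex mu D (fun x => w x * (c * u x)) = Ex mu D (fun x => c * (w x * u x)).
    by apply: eq_Ex => x _; rewrite mulrCA.
  by rewrite !ExZ //; [ring|exact: bmM|exact: bG].
- move=> u B B0 hu hB; rewrite mulrDl; apply: le_trans (ler_normB _ _) _; apply: lerD.
    apply: Ex_bound => //; [by rewrite mulr_ge0|exact: bG|].
    move=> y Dy; rewrite normrM; apply: ler_pM => //; last exact/hB/GD.
    by apply: le_trans (hW' _ Dy) (ler_norm _).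
  apply: Ex_bound => //; [by rewrite mulr_ge0|exact: bmM|].
  move=> y Dy; rewrite normrM; apply: ler_pM => //; last exact: hB.
  by apply: le_trans (hW _ Dy) (ler_norm _).
- by move=> A mA; rewrite inv ?subrr.
Qed.

Lemma Ex_invariant (R : realType) d (T : measurableType d) (mu : probability T R) (D : set T)
  (G : T -> T) : measurable D -> measurable_fun D G -> (forall x, D x -> D (G x)) ->
  (forall A, measurable A -> mu (D `&` G @^-1` A) = mu (D `&` A)) ->
  forall g, bm D g -> Ex mu D (fun x => g (G x)) = Ex mu D g.
Proof.
move=> mD mG GD inv g hg.
have h1 v : Ex mu D v = Ex mu D (fun x => 1 * v x) by apply: eq_Ex => x _; rewrite mul1r.
rewrite h1 (h1 g); apply: (@Ex_transfer _ _ _ mu D _ _ mu D G (fun=> 1) (fun=> 1)) => //;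
  try exact: bm_cst.
move=> A mA; rewrite -!h1 Ex_indic // -inv //.
have mP : measurable (D `&` G @^-1` A) by exact: mG.
rewrite -[in RHS](setIidr (@subIsetl _ D (G @^-1` A))) -Ex_indic //.
apply: eq_Ex => x Dx; rewrite !indicE; congr (nat_of_bool _)%:R.
apply/idP/idP; first by rewrite !inE => h; split.
by rewrite !inE => -[].
Qed.

Lemma geometric_bound (R : realType) (th : R) N : 0 < th < 1 -> \sum_(j < N) th ^+ j <= (1 - th)^-1.
Proof.
move=> /andP[t0 t1]; rewrite -[leRHS]mul1r ler_pdivlMr ?subr_gt0 // mulrC.
rewrite -{1}[1 - th]opprB mulNr -subrX1 opprB gerBl exprn_ge0 //; exact: ltW.
Qed.

(** * The transfer operator of a full-branch map and its invariant cone *)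

Section FullBranch.
Context (R : realType) d (T : measurableType d) (mu : probability T R).
Variables (G : T -> T) (lt : T -> nat) (ok : pred nat) (hv : nat -> T -> T)
  (wt : nat -> T -> R) (C0 th : R).
Hypothesis th01 : 0 < th < 1.
Hypothesis C0ge0 : 0 <= C0.
Hypothesis mG : measurable_fun setT G.
Hypothesis Ginv : forall A, measurable A -> mu (setT `&` G @^-1` A) = mu (setT `&` A).
Hypothesis mlt : forall k, measurable (setT `&` [set x | lt x = k]).
Hypothesis mhv : forall k, measurable_fun setT (hv k).
Hypothesis mwt : forall k, measurable_fun setT (wt k).
Hypothesis wt0 : forall k x, 0 <= wt k x.
Hypothesis ok_lt : forall x, ok (lt x).
Hypothesis lt_hv : forall k z, ok k -> lt (hv k z) = k.
Hypothesis G_hv : forall k z, ok k -> G (hv k z) = z.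
Hypothesis hv_G : forall x, hv (lt x) (G x) = x.
Hypothesis wt_nok : forall k z, ~~ ok k -> wt k z = 0.
Hypothesis mu_branch : forall k B, ok k -> measurable B ->
  mu ([set x | lt x = k] `&` G @^-1` B) = (\int[mu]_(z in B) (wt k z)%:E)%E.

Definition agree n (x y : T) := forall j, (j < n)%N -> lt (iter j G x) = lt (iter j G y).

Hypothesis wt_dist : forall k n x y, ok k -> agree n x y ->
  wt k x <= expR (C0 * th ^+ n.+1) * wt k y.

Local Notation E := (Ex mu setT).
Local Notation bmT := (@bm R d T setT).
Let mT := @measurableT d T.
Let t0 : 0 <= th. Proof. by case/andP: th01 => /ltW. Qed.
Let t1 : th <= 1. Proof. by case/andP: th01 => _ /ltW. Qed.

Lemma agreeS n x y : agree n.+1 x y -> agree n (G x) (G y).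
Proof. by move=> h j jn; rewrite -!iterSr; apply: h. Qed.

Lemma agree_hv k n x y : ok k -> agree n x y -> agree n.+1 (hv k x) (hv k y).
Proof.
move=> hk h [|j] jn; first by rewrite /= !lt_hv.
by rewrite !iterSr !G_hv //; apply: h.
Qed.

Lemma agree_le n m x y : (n <= m)%N -> agree m x y -> agree n x y.
Proof. by move=> nm h j jn; apply: h; exact: leq_trans nm. Qed.

Let bm_lt (P : pred nat) : bmT (fun x => (P (lt x))%:R).
Proof. by apply: bm_bool => //; apply: measurable_key_set. Qed.

Definition pk k : R := E (fun x => (lt x == k)%:R).

Let pk_ge0 k : 0 <= pk k. Proof. by apply: Ex_ge0. Qed.

Lemma th_pow_le1 n : th ^+ n <= 1. Proof. exact: exprn_ile1. Qed.

Let eC : R := expR C0.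

Lemma wt_eC k x y : wt k x <= eC * wt k y.
Proof.
case: (boolP (ok k)) => hk; last by rewrite !wt_nok // mulr0.
apply: le_trans (@wt_dist k 0 x y hk _) _; first by [].
by apply: ler_wpM2r => //; rewrite ler_expR ler_piMr // th_pow_le1.
Qed.

Lemma T_inh : exists x : T, True.
Proof.
apply: contrapT => h; have e : [set: T] = set0 by rewrite -subset0 => x _; apply: h; exists x.
have := probability_setT mu; rewrite e measure0 => /eqP; rewrite eq_sym onee_eq0 //.
Qed.

Lemma bm_wt k : bmT (wt k).
Proof.
split; first exact: mwt.
have [x0 _] := T_inh; exists (eC * wt k x0) => x _.
by rewrite ger0_norm // wt_eC.
Qed.

Lemma branch_change k g : bmT g -> E (fun x => (lt x == k)%:R * g (G x)) = E (fun z => wt k z * g z).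
Proof.
case: (boolP (ok k)) => hk hg; last first.
  have -> : E (fun z => wt k z * g z) = 0.
    by rewrite -[RHS](@Ex0 _ _ _ mu setT) //; apply: eq_Ex => x _; rewrite wt_nok // mul0r.
  rewrite -[RHS](@Ex0 _ _ _ mu setT) //; apply: eq_Ex => x _.
  by case: eqP => [e|]; rewrite ?mul0r //; move: hk; rewrite -e ok_lt.
apply: (@Ex_transfer _ _ _ mu setT _ _ mu setT G (wt k) (fun x => (lt x == k)%:R)) => //.
- exact: bm_wt.
- exact: (bm_lt (fun j => j == k)).
move=> A mA.
have mS : measurable ([set x | lt x = k] `&` G @^-1` A).
  apply: measurableI; first by rewrite -[X in measurable X]setTI.
  by rewrite -[X in measurable X]setTI; exact: mG.
have -> : E (fun x => (lt x == k)%:R * \1_A (G x)) = E (\1_([set x | lt x = k] `&` G @^-1` A)).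
  apply: eq_Ex => x _; rewrite !indicE -natrM mulnb; congr (nat_of_bool _)%:R.
  apply/andP/idP => [[/eqP h]|]; rewrite !inE; first by split.
  by case=> /= -> h; rewrite eqxx; split.
rewrite Ex_indic // setTI mu_branch // /Ex /Rintegral; congr fine.
rewrite [LHS]integral_mkcond; apply: eq_integral => x _; rewrite patchE indicE.
by case: (_ \in _); rewrite ?mulr1 ?mulr0.
Qed.

Lemma E_wt k : E (wt k) = pk k.
Proof.
have := branch_change k (bm_cst _ 1).
rewrite (_ : E (fun z => wt k z * 1) = E (wt k)); last by apply: eq_Ex => x _; rewrite mulr1.
by move=> <-; apply: eq_Ex => x _; rewrite mulr1.
Qed.

Lemma E_1 : E (fun=> 1) = 1. Proof. by rewrite Ex_cst // probability_setT mul1r. Qed.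

Lemma wt_le k x : wt k x <= eC * pk k.
Proof.
rewrite -E_wt -ExZ //; last exact: bm_wt.
rewrite -[leLHS]mulr1 -E_1 -ExZ //; last exact: bm_cst.
apply: le_Ex => //; [exact: bm_cst|apply: bmZ; exact: bm_wt|].
by move=> y _; rewrite mulr1 wt_eC.
Qed.

Lemma sum_pk K : \sum_(k < K) pk k = E (fun x => (lt x < K)%N%:R).
Proof.
rewrite -Ex_sum //; last by move=> k _; exact: (bm_lt (fun j => j == k)).
apply: eq_Ex => x _; case: ltnP => h.
  rewrite (bigD1 (Ordinal h)) //= eqxx big1 ?addr0 // => k hk.
  by rewrite eq_sym (_ : (k == lt x :> nat) = false) //; apply: contraNF hk => /eqP e; apply/eqP/val_inj.
rewrite big1 // => k _; rewrite gtn_eqF //; exact: leq_trans h.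
Qed.

Definition pkt K : R := 1 - \sum_(k < K) pk k.

Lemma pkt_ge0 K : 0 <= pkt K.
Proof.
rewrite /pkt sum_pk subr_ge0 -[leRHS]E_1; apply: le_Ex => //; [exact: (bm_lt (fun j => j < K)%N)|
  exact: bm_cst|by move=> x _; case: (_ < _)%N].
Qed.

Lemma pktE K : pkt K = E (fun x => (K <= lt x)%N%:R).
Proof.
rewrite /pkt sum_pk; transitivity (E (fun=> 1) - E (fun x => (lt x < K)%N%:R)); first by rewrite E_1.
rewrite -ExB //; [|exact: bm_cst|exact: (bm_lt (fun j => j < K)%N)].
by apply: eq_Ex => x _; case: ltnP; rewrite ?subrr ?subr0.
Qed.

Lemma pkt_decr K K' : (K <= K')%N -> pkt K' <= pkt K.
Proof.
move=> h; rewrite /pkt lerD2l lerN2 (@sum_ord_split _ pk K K') // lerDl.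
by apply: sumr_ge0.
Qed.

Lemma pkt_to0 eps : 0 < eps -> exists K, pkt K <= eps.
Proof.
move=> e0; pose F K := [set x | (lt x < K)%N].
have mF K : measurable (F K) by rewrite -[F K]setTI; exact: (measurable_key_set (fun j => j < K)%N mlt).
have FT : \bigcup_K F K = setT by rewrite -subTset => x _; exists (lt x).+1 => //=; rewrite /F /= ltnS.
have hF : {homo F : n m / (n <= m)%N >-> (n <= m)%O}.
  by move=> n m nm; apply/subsetPset => x; rewrite /F /= => h; exact: leq_trans nm.
have := @nondecreasing_cvg_mu _ _ _ mu F mF; rewrite FT => /(_ measurableT hF).
have hT : mu [set: T] = 1%:E by exact: probability_setT.
move=> hc; have {hc} : (mu \o F) @ \oo --> (1 : R)%:E.
  exact: (eq_rect _ (fun z => (mu \o F) @ \oo --> z) hc _ hT).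
move=> /fine_cvg; rewrite /= => /cvgrPdist_le /(_ _ e0)[K _ /(_ K (leqnn _))] h.
exists K; apply: le_trans h; rewrite /pkt sum_pk.
have -> : E (fun x => (lt x < K)%N%:R) = fine (mu (F K)).
  rewrite Ex_bool // ?setTI //; exact: mF.
exact: ler_norm.
Qed.

Definition trp (P : pred nat) (u : T -> R) x K := \sum_(k < K) (P k)%:R * wt k x * u (hv k x).
(** The branches form a series of nonnegative terms, summed as a supremum; by [trp_diff] the
    truncation error is uniform, governed by the mass [pkt] of the remaining letters. *)
Definition Tr (P : pred nat) (u : T -> R) x : R := sup (range (trp P u x)).

Section TrBounds.
Variables (P : pred nat) (u : T -> R) (B : R).
Hypothesis hu : bmT u.
Hypothesis u0 : forall x, 0 <= u x.
Hypothesis uB : forall x, u x <= B.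

Let term_ge0 k x : 0 <= (P k)%:R * wt k x * u (hv k x).
Proof. by rewrite !mulr_ge0. Qed.

Lemma B_ge0 : 0 <= B.
Proof. by have [x _] := T_inh; apply: le_trans (u0 x) (uB x). Qed.

Lemma trp_incr x K K' : (K <= K')%N -> trp P u x K <= trp P u x K'.
Proof.
move=> h; rewrite /trp (@sum_ord_split _ (fun k => (P k)%:R * wt k x * u (hv k x)) K K') // lerDl.
by apply: sumr_ge0 => k _; exact: term_ge0.
Qed.

Lemma trp_diff x K K' : (K <= K')%N -> trp P u x K' <= trp P u x K + eC * B * pkt K.
Proof.
move=> h; rewrite /trp (@sum_ord_split _ (fun k => (P k)%:R * wt k x * u (hv k x)) K K') // lerD2l.
have eC0 : 0 <= eC by exact: expR_ge0.
apply: (@le_trans _ _ (\sum_(K <= k < K') eC * B * pk k)).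
  apply: ler_sum => k _; rewrite (mulrAC eC); apply: ler_pM => //; first by rewrite mulr_ge0.
  rewrite -[leRHS]mul1r; apply: ler_pM => //; [by case: (P k)|exact: wt_le].
rewrite -mulr_sumr; apply: ler_wpM2l; first by rewrite mulr_ge0 ?B_ge0.
have := pkt_ge0 K'; rewrite /pkt (@sum_ord_split _ pk K K') //; lra.
Qed.

Lemma trp_has x : has_sup (range (trp P u x)).
Proof.
split; first by exists (trp P u x 0), 0%N.
exists (trp P u x 0 + eC * B * pkt 0) => _ [K _ <-]; exact: trp_diff.
Qed.

Lemma Tr_ge x K : trp P u x K <= Tr P u x.
Proof. by apply: (ub_le_sup (trp_has x).2); exists K. Qed.

Lemma Tr_le x K : Tr P u x <= trp P u x K + eC * B * pkt K.
Proof.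
apply: ge_sup; first exact: (trp_has x).1.
move=> _ [K' _ <-]; case: (leqP K K') => h; first exact: trp_diff.
apply: le_trans (trp_incr x (ltnW h)) _; rewrite lerDl.
by rewrite !mulr_ge0 ?expR_ge0 ?B_ge0 ?pkt_ge0.
Qed.

Lemma bm_trp K : bmT (fun x => trp P u x K).
Proof.
apply: bm_sum => k _; apply: bmM; first by apply: bmZ; exact: bm_wt.
by apply: bm_comp hu => //; exact: mhv.
Qed.

Lemma Tr_ge0' x : 0 <= Tr P u x.
Proof. by apply: le_trans (Tr_ge x 0); rewrite /trp big_ord0. Qed.

Lemma bm_Tr : bmT (Tr P u).
Proof.
have BC : 0 <= eC * B by rewrite mulr_ge0 ?expR_ge0 ?B_ge0.
split; last first.
  exists (eC * B * pkt 0) => x _; rewrite ger0_norm ?Tr_ge0' //.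
  by apply: le_trans (Tr_le x 0) _; rewrite /trp big_ord0 add0r.
apply: (@measurable_fun_cvg _ _ _ _ (fun K x => trp P u x K)) => [K|x _].
  by have [] := bm_trp K.
apply/cvgrPdist_le => eps e0.
have e1 : 0 < eps / (eC * B + 1) by rewrite divr_gt0 // ltr_wpDl.
have [K0 hK0] := pkt_to0 e1; exists K0 => // K /= hK.
rewrite ger0_norm ?subr_ge0 ?Tr_ge // lerBlDl; apply: le_trans (Tr_le x K) _; rewrite lerD2l.
apply: (@le_trans _ _ ((eC * B + 1) * (eps / (eC * B + 1)))); last first.
  by rewrite mulrC divfK // gt_eqF // ltr_wpDl.
apply: ler_pM => //; [exact: pkt_ge0|by rewrite lerDl|].
by apply: le_trans (pkt_decr hK) hK0.
Qed.

(** For finitely many letters this is the change of variables branch by branch. The truncation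
    errors on both sides are proportional to [pkt K]. *)
Lemma Tr_dual g : bmT g -> E (fun x => Tr P u x * g x) = E (fun x => (P (lt x))%:R * u x * g (G x)).
Proof.
move=> hg; have [_ [Bg hBg]] := hg.
have [x00 _] := T_inh; have Bg0 : 0 <= Bg by apply: le_trans (hBg x00 _).
have bG : bmT (fun x => g (G x)) by apply: bm_comp hg.
have BC : 0 <= eC * B by rewrite mulr_ge0 ?expR_ge0 ?B_ge0.
have bL K : bmT (fun x => (P (lt x) && (lt x < K)%N)%:R * u x * g (G x)).
  by apply: bmM => //; apply: bmM => //; exact: (bm_lt (fun k => P k && (k < K)%N)).
have bR : bmT (fun x => (P (lt x))%:R * u x * g (G x)) by apply: bmM => //; apply: bmM => //; exact: (bm_lt P).
have bTg : bmT (fun x => Tr P u x * g x) by apply: bmM => //; exact: bm_Tr.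
have bSg K : bmT (fun x => trp P u x K * g x) by apply: bmM => //; exact: bm_trp.
have eqK K : E (fun x => trp P u x K * g x) = E (fun x => (P (lt x) && (lt x < K)%N)%:R * u x * g (G x)).
  have bw k : bmT (fun x => (P k)%:R * wt k x * u (hv k x) * g x).
    apply: bmM => //; apply: bmM; first by apply: bmZ; exact: bm_wt.
    by apply: bm_comp hu => //; exact: mhv.
  have -> : E (fun x => trp P u x K * g x) = \sum_(k < K) E (fun x => (P k)%:R * wt k x * u (hv k x) * g x).
    by rewrite -Ex_sum //; apply: eq_Ex => x _; rewrite /trp mulr_suml.
  have bk k : bmT (fun x => (P k)%:R * ((lt x == k)%:R * (u (hv k (G x)) * g (G x)))).
    apply: bmZ; apply: bmM; first exact: (bm_lt (fun j => j == k)).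
    by apply: bmM => //; apply: (@bm_comp _ _ _ _ _ setT setT G (fun x => u (hv k x))) => //;
      apply: bm_comp hu => //; exact: mhv.
  transitivity (\sum_(k < K) E (fun x => (P k)%:R * ((lt x == k)%:R * (u (hv k (G x)) * g (G x))))).
    apply: eq_bigr => k _; have bh : bmT (fun x => u (hv k x) * g x).
      by apply: bmM => //; apply: bm_comp hu => //; exact: mhv.
    rewrite [RHS]ExZ //; last first.
      apply: bmM; first exact: (bm_lt (fun j => j == k)).
      exact: (@bm_comp _ _ _ _ _ setT setT G (fun x => u (hv k x) * g x)).
    rewrite (branch_change k bh) -ExZ //; last by apply: bmM => //; exact: bm_wt.
    by apply: eq_Ex => x _; rewrite !mulrA.
  rewrite -Ex_sum //; apply: eq_Ex => x _.
  case: (ltnP (lt x) K) => h; last first.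
    rewrite andbF !mul0r big1 // => k _; rewrite (gtn_eqF (leq_trans (ltn_ord k) h)).
    by rewrite mul0r mulr0.
  rewrite (bigD1 (Ordinal h)) //= eqxx mul1r hv_G big1 ?addr0 ?andbT ?mulrA // => k hk.
  rewrite (_ : (lt x == k) = false) ?mul0r ?mulr0 //.
  by apply: contraNF hk => /eqP e; apply/eqP/val_inj.
apply/eqP; rewrite -subr_eq0 -normr_le0; apply/ler_addgt0Pr => eps e0; rewrite add0r.
pose M := eC * B * Bg + B * Bg.
have M0 : 0 <= M by apply: addr_ge0; apply: mulr_ge0 => //; exact: B_ge0.
have e1 : 0 < eps / (M + 1) by rewrite divr_gt0 // ltr_wpDl.
have [K hK] := pkt_to0 e1.
have -> : E (fun x => Tr P u x * g x) - E (fun x => (P (lt x))%:R * u x * g (G x)) =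
  E (fun x => Tr P u x * g x - trp P u x K * g x) -
  E (fun x => (P (lt x))%:R * u x * g (G x) - (P (lt x) && (lt x < K)%N)%:R * u x * g (G x)).
  rewrite !ExB // eqK; ring.
apply: (@le_trans _ _ (M * pkt K)); last first.
  apply: (@le_trans _ _ ((M + 1) * (eps / (M + 1)))); last by rewrite mulrC divfK // gt_eqF // ltr_wpDl.
  by apply: ler_pM => //; [exact: pkt_ge0|rewrite lerDl].
rewrite mulrDl; apply: le_trans (ler_normB _ _) _; apply: lerD.
  apply: Ex_bound => //; [by apply: mulr_ge0; [apply: mulr_ge0|exact: pkt_ge0]|by apply: bmB|].
  move=> x _; rewrite -mulrBl normrM mulrAC; apply: ler_pM => //; last exact: hBg.
  by rewrite ger0_norm ?subr_ge0 ?Tr_ge // lerBlDl Tr_le.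
apply: le_trans (ler_norm_Ex _ mT _) _; first exact: bmB.
rewrite pktE -ExZ; [|exact: mT|exact: (bm_lt (fun k => (K <= k)%N))].
apply: le_Ex => //; [by apply: bm_norm; exact: bmB|by apply: bmZ; exact: (bm_lt (fun k => (K <= k)%N))|].
move=> x _; rewrite -!mulrBl; case: ltnP => h; first by rewrite andbT subrr !mul0r normr0 mulr0.
rewrite andbF subr0 mulr1 !normrM; apply: ler_pM => //; last exact: hBg.
rewrite ger0_norm // -[leRHS]mul1r; apply: ler_pM => //.
  by case: (P _); rewrite ?normr1 ?normr0.
by rewrite ger0_norm.
Qed.

End TrBounds.

(* The first [m] letters are unconstrained: they are smoothed out by [m] applications of [Tr]. *)
Definition cone (c : R) m (u : T -> R) := [/\ bmT u, forall x, 0 <= u x &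
  forall n x y, agree (m + n) x y -> u x <= expR (c * th ^+ n) * u y].

Lemma cone_ub c m u : cone c m u -> exists B, forall x, u x <= B.
Proof. by case=> [[_ [B hB]] u0 _]; exists B => x; have := hB x I; rewrite ger0_norm. Qed.

Lemma cone_le c c' m u : c <= c' -> cone c m u -> cone c' m u.
Proof.
move=> cc [h1 h2 h3]; split => // n x y h; apply: le_trans (h3 n x y h) _.
by apply: ler_wpM2r => //; rewrite ler_expR; apply: ler_wpM2r => //; exact: exprn_ge0.
Qed.

(** The preimages of [x] and [y] along a branch share one letter more, which uses up one
    unconstrained letter. The distortion of the weight adds [C0 * th ^ (m + 1)], summable as [m]
    decreases to 0. *)
Lemma cone_Tr c m P u : cone c m.+1 u -> cone (c + C0 * th ^+ m.+1) m (Tr P u).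
Proof.
move=> hc; have [B uB] := cone_ub hc; have [hu u0 hreg] := hc.
split; [exact: bm_Tr uB|by move=> x; exact: Tr_ge0' uB x|].
move=> n x y hxy; apply: ge_sup; first by exists (trp P u x 0), 0%N.
move=> _ [K _ <-]; apply: (@le_trans _ _ (expR ((c + C0 * th ^+ m.+1) * th ^+ n) * trp P u y K)); last first.
  by apply: ler_wpM2l; [exact: expR_ge0|exact: Tr_ge uB _ _].
rewrite /trp mulr_sumr; apply: ler_sum => k _.
case: (boolP (ok k)) => hk; last by rewrite !wt_nok // !(mulr0, mul0r).
have h1 := wt_dist hk hxy.
have h2 := hreg n _ _ (agree_hv hk hxy).
have -> : (c + C0 * th ^+ m.+1) * th ^+ n = C0 * th ^+ (m + n).+1 + c * th ^+ n.
  by rewrite -addSn exprD; ring.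
rewrite expRD.
have -> : expR (C0 * th ^+ (m + n).+1) * expR (c * th ^+ n) * ((P k)%:R * wt k y * u (hv k y)) =
  (P k)%:R * (expR (C0 * th ^+ (m + n).+1) * wt k y) * (expR (c * th ^+ n) * u (hv k y)) by ring.
by apply: ler_pM => //; [rewrite mulr_ge0|apply: ler_wpM2l].
Qed.

(** One more letter of agreement is worth a factor [th]. *)
Lemma cone_shift c u : cone c 0 u -> cone (th * c) 1 u.
Proof.
case=> h1 h2 h3; split => // n x y h; apply: le_trans (h3 n.+1 x y h) _.
by rewrite exprS mulrCA mulrA.
Qed.

(** The increments of the constant form a geometric series, so the result does not depend on the
    number [N] of smoothing steps. This is what allows [N] to grow with time. *)
Lemma cone_iter c N u : 0 <= c -> cone c N u -> cone (c + C0 / (1 - th)) 0 (iter N (Tr predT) u).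
Proof.
move=> c0 hu; apply: (@cone_le (c + C0 * \sum_(j < N) th ^+ j.+1)).
  rewrite lerD2l; apply: ler_wpM2l => //; apply: le_trans (geometric_bound N th01).
  by apply: ler_sum => j _; rewrite exprS ler_piMl // exprn_ge0.
elim: N c c0 u hu => [|N IH] c c0 u hu; first by rewrite big_ord0 mulr0 addr0.
rewrite iterSr big_ord_recr /= mulrDr addrCA addrC -addrA [X in cone X](_ : _ = c + C0 * th ^+ N.+1 +
  C0 * \sum_(j < N) th ^+ j.+1); last by ring.
apply: IH; last exact: cone_Tr.
by rewrite addr_ge0 // mulr_ge0 // exprn_ge0.
Qed.

Lemma iter_Tr_dual c N u g : 0 <= c -> cone c N u -> bmT g ->
  E (fun x => iter N (Tr predT) u x * g x) = E (fun x => u x * g (iter N G x)).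
Proof.
elim: N c u g => [//|N IH] c u g c0 hu hg.
have [B uB] := cone_ub hu; have [bu u0 _] := hu.
rewrite iterSr (IH _ _ _ _ (cone_Tr predT hu)) //; last first.
  by rewrite addr_ge0 // mulr_ge0 // exprn_ge0.
have bN : bmT (fun x => g (iter N G x)).
  elim: N {IH hu} => [//|N IHN].
  by apply: eq_bm (@bm_comp _ _ _ _ _ setT setT G _ mT mG _ IHN) => // x _; rewrite -iterSr.
rewrite (Tr_dual predT bu u0 uB bN); apply: eq_Ex => x _.
by rewrite mul1r -iterSr.
Qed.

Section Build.
Variables (c : R) (ph : nat -> nat).
Hypothesis hc : (1 + th * C0) / (1 - th) <= c.
Hypothesis ph0 : forall k, (0 < ph k)%N.

(** The cone constant after one application of [Tr]; the condition on [c] says precisely that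
    [c - c' >= 1]. *)
Let c' : R := th * (c + C0).

Let c1 : 1 <= c.
Proof.
apply: le_trans hc; rewrite ler_pdivlMr ?subr_gt0; last by case/andP: th01.
have : 0 <= th * C0 by rewrite mulr_ge0.
by have := t0; lra.
Qed.

Let cge0 : 0 <= c. Proof. exact: le_trans c1. Qed.

Let c'c : 1 <= c - c'.
Proof.
have h : 0 < 1 - th by rewrite subr_gt0; case/andP: th01.
move: hc; rewrite ler_pdivrMr // /c' mulrBr mulrDr mulr1 (mulrC c th); lra.
Qed.

(* Chosen so that removing [fkap * E u] costs at most [c - c'] in the logarithmic modulus. *)
Definition fkap : R := (c * expR (c + th * (c + C0)))^-1.

Let c'0 : 0 <= c'. Proof. by rewrite mulr_ge0 // addr_ge0. Qed.

Let cpos : 0 < c. Proof. exact: lt_le_trans c1. Qed.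

Lemma fkap_gt0 : 0 < fkap.
Proof. by rewrite invr_gt0 mulr_gt0 // expR_gt0. Qed.

Lemma cone0_Tr P u : cone c 0 u -> cone c' 0 (Tr P u).
Proof.
move=> hu; have := cone_Tr P (cone_shift hu); rewrite expr1.
by rewrite (_ : th * c + C0 * th = c') //; rewrite /c'; ring.
Qed.

Lemma cone_mix a u g : cone a 0 u -> bmT g -> (forall x, 0 <= g x) ->
  E (fun x => u x * g x) <= expR a * E u * E g.
Proof.
case=> hu u0 hreg hg g0.
have h x : u x <= expR a * E u.
  rewrite -ExZ // -[leLHS]mulr1 -E_1 -ExZ //; last exact: bm_cst.
  apply: le_Ex => //; [exact: bm_cst|exact: bmZ|].
  by move=> y _; rewrite mulr1; have := hreg 0%N x y (fun j => ltac:(by [])); rewrite expr0 mulr1.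
rewrite -ExZ //; apply: le_Ex => //; [exact: bmM|exact: bmZ|].
by move=> x _; apply: ler_wpM2r.
Qed.

Lemma cone_lb a u x : cone a 0 u -> E u <= expR a * u x.
Proof.
case=> hu u0 hreg; rewrite -[leRHS]mulr1 -E_1 -ExZ //; last exact: bm_cst.
apply: le_Ex => //; first exact: bm_cst.
by move=> y _; rewrite mulr1; have := hreg 0%N y x (fun j => ltac:(by [])); rewrite expr0 mulr1.
Qed.

Lemma expR_sub_le (z : R) : expR z - 1 <= z * expR z.
Proof.
have h := expR_ge1Dx (- z); have e0 := expR_gt0 z.
have : (1 - z) * expR z <= expR (- z) * expR z by apply: ler_wpM2r => //; exact: ltW.
by rewrite -expRD addNr expR0 mulrBl mul1r; lra.
Qed.

(** With [a = fkap * E u] and [t = th ^ n] it suffices that [a * (expR (c * t) - 1) <= (expR (c * t)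
    - expR (c' * t)) * u y]. The right side is at least [t * u y] because [c - c' >= 1], the left
    side at most [a * c * t * expR c], and [cone_lb] bounds [u y] from below. *)
Lemma cone_sub u : cone c' 0 u -> cone c 0 (fun x => u x - fkap * E u).
Proof.
move=> hu; have [bu u0 hreg] := hu.
have k0 := fkap_gt0; have Eu0 : 0 <= E u by apply: Ex_ge0.
have kE x : fkap * c * expR c * E u <= u x.
  have h := cone_lb x hu.
  apply: (@le_trans _ _ (fkap * c * expR c * (expR c' * u x))).
    by apply: ler_wpM2l => //; rewrite !mulr_ge0 ?expR_ge0 // ltW.
  have -> : fkap * c * expR c * (expR c' * u x) = fkap * (c * expR (c + c')) * u x by rewrite expRD; ring.
  by rewrite /fkap /c' mulVf ?mul1r // gt_eqF // mulr_gt0 // expR_gt0.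
have ce : 1 <= c * expR c.
  rewrite -[leLHS]mulr1; apply: ler_pM => //; rewrite -expR0 ler_expR //.
have kE1 : fkap * E u <= fkap * c * expR c * E u.
  apply: ler_wpM2r => //; rewrite -mulrA ler_peMr // ltW //.
split; [by apply: bmB => //; exact: bm_cst|by move=> x; rewrite subr_ge0; apply: le_trans kE1 (kE x)|].
move=> n x y h; set a := fkap * E u; set t := th ^+ n.
have t0' : 0 <= t by exact: exprn_ge0.
have t1' : t <= 1 by exact: th_pow_le1.
have h1 := hreg n x y h; rewrite -/t in h1.
have a0 : 0 <= a by rewrite mulr_ge0 // ltW.
have e1 : a * (expR (c * t) - 1) <= t * u y.
  apply: (@le_trans _ _ (a * (c * t * expR c))).
    apply: ler_wpM2l => //; apply: le_trans (expR_sub_le _) _; apply: ler_wpM2l.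
      by rewrite mulr_ge0.
    by rewrite ler_expR ler_piMr.
  have -> : a * (c * t * expR c) = t * (fkap * c * expR c * E u) by rewrite /a; ring.
  exact: ler_wpM2l.
have e2 : t * u y <= (expR (c * t) - expR (c' * t)) * u y.
  apply: ler_wpM2r => //.
  have -> : c * t = c' * t + (c - c') * t by ring.
  rewrite expRD.
  have -> : expR (c' * t) * expR ((c - c') * t) - expR (c' * t) =
    expR (c' * t) * (expR ((c - c') * t) - 1) by ring.
  apply: (@le_trans _ _ (1 * ((c - c') * t))); first by rewrite mul1r ler_peMl.
  apply: ler_pM => //.
  - by rewrite mulr_ge0 // (le_trans _ c'c).
  - by rewrite -expR0 ler_expR mulr_ge0.
  - by have := expR_ge1Dx ((c - c') * t); lra.
move: e1 e2 h1; rewrite mulrBl mulrBr mulrBr mulr1 (mulrC (expR (c * t)) a); lra.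
Qed.

Lemma Tr_E1 P u : cone c 0 u -> E (Tr P u) = E (fun x => (P (lt x))%:R * u x).
Proof.
move=> hu; have [B uB] := cone_ub hu; have [bu u0 _] := hu.
have := Tr_dual P bu u0 uB (bm_cst _ 1).
rewrite (_ : E (fun x => Tr P u x * 1) = E (Tr P u)); last by apply: eq_Ex => x _; rewrite mulr1.
by move=> ->; apply: eq_Ex => x _; rewrite mulr1.
Qed.

Lemma c'_le : c' <= c. Proof. by move: c'c; lra. Qed.

(** Closed by [Defined], since later proofs reduce its projections to the concrete measure, letters
    and block lengths. *)
Definition full_branch_gm : gibbs_markov R T.
Proof.
refine (@GibbsMarkov R d T mu G lt ph (cone c 0) Tr fkap (expR c) mG _ mlt ph0 fkap_gt0 _ _ _ _ _ _ _ _ _).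
- by move=> g hg; apply: Ex_invariant.
- by rewrite -expR0 ler_expR; exact: cge0.
- by move=> u [].
- by move=> u x [].
- split; [exact: bm_cst|by []|move=> n x y _; rewrite mulr1 -expR0 ler_expR; apply: mulr_ge0; [exact: cge0|apply: exprn_ge0; exact: t0]].
- move=> a u a0 [h1 h2 h3]; split; [exact: bmZ|by move=> x; apply: mulr_ge0; [|exact: h2]|].
  by move=> n x y hxy; have := ler_wpM2l a0 (h3 n x y hxy); rewrite mulrCA.
- by move=> P u hu; apply: cone_le c'_le _; exact: cone0_Tr.
- by move=> P u g hu hg; have [B uB] := cone_ub hu; have [bu u0 _] := hu; exact: Tr_dual.
- by move=> P u hu; rewrite -(Tr_E1 P hu); apply: cone_sub; exact: cone0_Tr.
- by move=> u g hu hg g0; exact: cone_mix.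
Defined.

End Build.
End FullBranch.

Lemma tailb_le (R : realType) (c A : R) r x y : 0 <= c -> tailb A r x -> (forall n, 0 <= y n <= c * x n) -> tailb (c * A) r y.
Proof.
move=> c0 [x0 hx] hy; split=> [n|n m]; first by case/andP: (hy n).
apply: (@le_trans _ _ (c * \sum_(n <= j < m) x j)).
  by rewrite mulr_sumr; apply: ler_sum => j _; case/andP: (hy j).
by rewrite -mulrA; apply: ler_wpM2l.
Qed.

(** * Words of letters, completed blocks and damped visits *)

Section Itinerary.
Context (R : realType) d (T : measurableType d) (X : gibbs_markov R T).
Local Notation E := (Ex (gmu X) setT).
Local Notation D := (gD X).
Local Notation bmT := (@bm R d T setT).
Local Notation G := (gG X).
Local Notation lt := (glt X).
Local Notation ph k := (gph X k).
Let mT := @measurableT d T.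

Fixpoint cyl n x : seq nat := if n is n'.+1 then lt x :: cyl n' (G x) else [::].

Lemma size_cyl n x : size (cyl n x) = n.
Proof. by elim: n x => //= n IH x; rewrite IH. Qed.

Lemma cylP n x y : cyl n x = cyl n y <-> agree G lt n x y.
Proof.
elim: n x y => [|n IH] x y /=; first by split.
split=> [[h0 h1] [|j] jn|h]; first by [].
  by rewrite !iterSr; move/IH: h1; apply.
rewrite (h 0%N isT); congr (_ :: _); apply/IH => j jn.
by rewrite -!iterSr; apply: h.
Qed.

Lemma take_cyl m n x : (m <= n)%N -> take m (cyl n x) = cyl m x.
Proof. by elim: n m x => [|n IH] [|m] x //= mn; rewrite IH. Qed.

Lemma measurable_cyl n k : measurable (setT `&` [set x | cyl n x = k]).
Proof.
elim: n k => [|n IH] k /=.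
  case: k => [|a k]; first by rewrite (_ : [set x | _] = setT) ?setTI //; apply/seteqP.
  by rewrite (_ : [set x | _] = set0) ?setI0 //; apply/seteqP; split.
case: k => [|a k]; first by rewrite (_ : [set x | _] = set0) ?setI0 //; apply/seteqP; split.
rewrite (_ : _ `&` _ = (setT `&` [set x | lt x = a]) `&` (setT `&` G @^-1` (setT `&` [set x | cyl n x = k]))).
  by apply: measurableI; [exact: gm_mlt|apply: (gm_mG X); [|exact: IH]].
by apply/seteqP; split => [x [_ /= [-> ->]]|x [[_ /= ->] [_ [_ /= ->]]]].
Qed.

Lemma bm_cyl n (F : seq nat -> R) B : (forall k, `|F k| <= B) -> bmT (fun x => F (cyl n x)).
Proof.
move=> hB; split; last by exists B => x _; exact: hB.
exact: (measurable_key F (measurable_cyl n)).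
Qed.

(* [split_blocks N k] is the pair (number of blocks with letters from [k] completed at time [N], time elapsed since). *)
Fixpoint split_blocks N (k : seq nat) : nat * nat :=
  if k is a :: k' then
    if (ph a <= N)%N then ((split_blocks (N - ph a)%N k').1.+1, (split_blocks (N - ph a)%N k').2) else (0%N, N)
  else (0%N, N).

(** Every block takes at least one unit of time, so [N] letters suffice up to time [N]. *)
Lemma split_blocks_cyl N n x : (N <= n)%N -> split_blocks N (cyl n x) = split_blocks N (cyl N x).
Proof.
elim/ltn_ind: N n x => N IH n x; have p0 := gm_ph X (lt x).
case: N IH => [|N] IH; case: n => [|n] //= Nn.
  by case: ifP p0 => //; rewrite leqn0 => /eqP ->.
have h m : (m <= N)%N -> (m <= n)%N by move/leq_trans; apply.
case: ifP => // hN; have h1 : (N.+1 - ph (lt x) <= N)%N by clear -p0 hN; lia.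
by rewrite !(IH (N.+1 - ph (lt x))%N) ?h.
Qed.

Definition nblocks N x := (split_blocks N (cyl N x)).1.
Definition residual N x := (split_blocks N (cyl N x)).2.

Lemma split_blocksE N x : (nblocks N x, residual N x) = if (ph (lt x) <= N)%N then
  ((nblocks (N - ph (lt x))%N (G x)).+1, residual (N - ph (lt x))%N (G x)) else (0%N, N).
Proof.
rewrite /nblocks /residual; have p0 := gm_ph X (lt x); case: N => [|N] /=.
  by case: ifP p0 => //; rewrite leqn0 => /eqP ->.
case: ifP => // hN /=.
have h1 : (N.+1 - ph (lt x) <= N)%N by clear -p0 hN; lia.
by rewrite (split_blocks_cyl _ h1).
Qed.

Lemma nblocks_le N x : (nblocks N x <= N)%N.
Proof.
elim/ltn_ind: N x => N IH x; have := split_blocksE N x; have p0 := gm_ph X (lt x).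
case: ifP => [h [-> _]|_ [-> _]] //.
have h1 : (N - ph (lt x) < N)%N by clear -p0 h; lia.
exact: leq_ltn_trans (IH _ h1 _) h1.
Qed.

Lemma residual_lt N x : (residual N x < ph (lt (iter (nblocks N x) G x)))%N.
Proof.
elim/ltn_ind: N x => N IH x; have := split_blocksE N x; have p0 := gm_ph X (lt x).
case: ifP => [h [-> ->]|/negbT h [-> ->]]; last by rewrite ltnNge.
have h1 : (N - ph (lt x) < N)%N by clear -p0 h; lia.
by rewrite iterSr; exact: IH.
Qed.

Lemma split_blocks_agree N x y : agree G lt (nblocks N x).+1 x y -> (nblocks N y, residual N y) = (nblocks N x, residual N x).
Proof.
elim/ltn_ind: N x y => N IH x y h; have p0 := gm_ph X (lt x).
have h0 : lt y = lt x by rewrite (h 0%N).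
rewrite (split_blocksE N y) h0; move: h (split_blocksE N x).
case: ifP => // hN h [e1 e2].
have h1 : (N - ph (lt x) < N)%N by clear -p0 hN; lia.
rewrite e1 in h; have := IH _ h1 _ _ (agreeS h).
by move=> [-> ->]; rewrite e1 e2.
Qed.

Section Damped.
Variables (vis : nat -> nat -> bool) (th : R).
Hypothesis th01 : 0 < th < 1.
Hypothesis vis_ph : forall k l, vis k l -> (l < ph k)%N.

(** The majorant of increments: a factor [th] for every completed block, and 0 unless [vis] allows a
    visit at time [N]. *)
Definition damped_visit N x : R := th ^+ nblocks N x * (vis (lt (iter (nblocks N x) G x)) (residual N x))%:R.

Lemma damped_visit_ge0 N x : 0 <= damped_visit N x.
Proof. by apply: mulr_ge0 => //; apply: exprn_ge0; case/andP: th01 => /ltW. Qed.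

Lemma damped_visitE N x : damped_visit N x = (vis (lt x) N)%:R + (ph (lt x) <= N)%N%:R * (th * damped_visit (N - ph (lt x))%N (G x)).
Proof.
rewrite /damped_visit; have := split_blocksE N x; case: ifP => h [-> ->].
  rewrite iterSr exprS mul1r mulrA (_ : vis (lt x) N = false) ?add0r //.
  by apply/negP => /vis_ph; rewrite ltnNge h.
by rewrite mul0r addr0 expr0 mul1r.
Qed.

Lemma bm_rec (c g : nat -> T -> R) q : (forall N, bmT (c N)) ->
  (forall N x, g N x = c N x + (ph (lt x) <= N)%N%:R * (q * g (N - ph (lt x))%N (G x))) ->
  forall N, bmT (g N).
Proof.
move=> hc hg; elim/ltn_ind => N IH.
have h : bmT (fun x => c N x + \sum_(j < N) (pj X j.+1 (lt x))%:R * (q * g (N - j.+1)%N (G x))).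
  apply: bmD => //; apply: bm_sum => j _; apply: bmM; first exact: bm_pj.
  by apply: bmZ; apply: bm_comp_G; apply: IH; have := ltn_ord j; clear; lia.
apply: eq_bm h => x _; rewrite hg; congr (_ + _).
have p0 := gm_ph X (lt x); case: leqP => hN.
  have hj : ((ph (lt x)).-1 < N)%N by rewrite prednK.
  rewrite (bigD1 (Ordinal hj)) //= prednK // /pj eqxx mul1r big1 ?addr0 // => j hj'.
  rewrite (_ : (ph (lt x) == j.+1) = false) ?mul0r //.
  by apply: contraNF hj' => /eqP e; apply/eqP/val_inj; rewrite /= e.
rewrite mul0r big1 // => j _; rewrite /pj (gtn_eqF _) ?mul0r //.
by apply: leq_ltn_trans hN; rewrite ltn_ord.
Qed.

Lemma bm_vis N : bmT (fun x => (vis (lt x) N)%:R).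
Proof. exact: (bm_letter X (fun k => vis k N)). Qed.

Lemma bm_damped_visit N : bmT (damped_visit N).
Proof. by apply: (bm_rec (c := fun N x => (vis (lt x) N)%:R)) => [m|]; [exact: bm_vis|exact: damped_visitE]. Qed.

(** Damping turns the transfer operator into one that loses a fixed fraction of mass, so the
    estimates for chains of blocks apply with [rho = th]. *)
Definition thTr P u x : R := th * gTr X P u x.

Let th01' : 0 <= th < 1. Proof. by case/andP: th01 => /ltW -> ->. Qed.

Lemma thTr_Cn P u : gCn X u -> gCn X (thTr P u).
Proof. by move=> hu; apply: gm_Z; [case/andP: th01'|exact: gm_Tr]. Qed.

Lemma thTr_mass P u : gCn X u -> E (thTr P u) = th * E (fun x => (P (lt x))%:R * u x).
Proof.
by move=> hu; rewrite /thTr ExZ //; [rewrite Tr_mass|apply: gm_bm; exact: gm_Tr].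
Qed.

Lemma damped_visit_conv u N : gCn X u -> E (fun x => u x * damped_visit N x) =
  op_conv X thTr u (fun m x => (vis (lt x) m)%:R) N.
Proof.
elim/ltn_ind: N u => N IH u hu.
rewrite (op_convE th01' thTr_Cn thTr_mass).
have bu := gm_bm hu.
have bj j : bmT (fun x => (pj X j (lt x))%:R * u x * (th * damped_visit (N - j)%N (G x))).
  apply: bmM; first by apply: bmM => //; exact: bm_pj.
  by apply: bmZ; apply: bm_comp_G; exact: bm_damped_visit.
have -> : E (fun x => u x * damped_visit N x) = E (fun x => u x * (vis (lt x) N)%:R +
    \sum_(j < N) (pj X j.+1 (lt x))%:R * u x * (th * damped_visit (N - j.+1)%N (G x))).
  apply: eq_Ex => x _; rewrite damped_visitE mulrDr; congr (_ + _).
  have p0 := gm_ph X (lt x); case: leqP => hN.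
    have hj : ((ph (lt x)).-1 < N)%N by rewrite prednK.
    rewrite (bigD1 (Ordinal hj)) //= prednK // /pj eqxx !mul1r big1 ?addr0 // => j hj'.
    rewrite (_ : (ph (lt x) == j.+1) = false) ?mul0r //.
    by apply: contraNF hj' => /eqP e; apply/eqP/val_inj; rewrite /= e.
  rewrite mul0r mulr0 big1 // => j _; rewrite /pj (gtn_eqF _) ?mul0r //.
  by apply: leq_ltn_trans hN; rewrite ltn_ord.
rewrite ExD //; [|by apply: bmM => //; exact: bm_vis|by apply: bm_sum => j _; exact: bj].
congr (_ + _); rewrite Ex_sum //; apply: eq_bigr => j _.
rewrite -IH; [|have := ltn_ord j; clear; lia|exact: thTr_Cn].
have -> : E (fun x => thTr (pj X j.+1) u x * damped_visit (N - j.+1) x) =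
  E (fun x => gTr X (pj X j.+1) u x * (th * damped_visit (N - j.+1) x)).
  by apply: eq_Ex => x _; rewrite /thTr; ring.
by rewrite gm_TrE //; apply: bmZ; exact: bm_damped_visit.
Qed.

(** By [damped_visit_conv] the mean is at most a convolution of block starts, with tails [psi b],
    and of visits within a block, with tails [s]. *)
Lemma damped_visit_tail b A s : 1 < b -> 0 <= A -> (forall n, return_tail X n <= A * psi b n) ->
  (forall n, 0 <= s n) -> tailb 1 s (fun m => E (fun x => (vis (lt x) m)%:R)) ->
  exists2 L, 0 <= L & tailb L (eta b s) (fun N => E (damped_visit N)).
Proof.
move=> b1 A0 phA s0 hm.
have [C C0 hC] := op_at_tail th01' thTr_Cn thTr_mass b1 A0 phA.
have o := gm_1 X.
exists (D * (2 * (C * E (fun=> 1)) * 1)).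
  by apply: mulr_ge0; [exact: D_ge0|rewrite E1 !mulr1 mulr_ge0].
apply: (tailb_le (x := conv (fun i => op_at X thTr (fun=> 1) i (fun=> 1)) (fun m => E (fun x => (vis (lt x) m)%:R)))).
- exact: D_ge0.
- have c0 : 0 <= C * E (fun=> 1) by rewrite E1 mulr1.
  have h := tailb_conv (@psi_ge0 R b) s0 c0 ler01 (hC _ o) hm.
  split; first by case: h.
  move=> n m; have [_ /(_ n m)] := h.
  by rewrite /eta (convC s).
move=> N; apply/andP; split; first by apply: Ex_ge0 => x _; exact: damped_visit_ge0.
have -> : E (damped_visit N) = E (fun x => 1 * damped_visit N x) by apply: eq_Ex => x _; rewrite mul1r.
rewrite damped_visit_conv //; apply: le_trans (ler_norm _) _.
apply: (op_conv_norm th01' thTr_Cn thTr_mass) => // m; first exact: bm_vis.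
by apply: le_Ex => //; [apply: bm_norm; exact: bm_vis|exact: bm_vis|move=> x _; rewrite ger0_norm].
Qed.

End Damped.

Lemma letter_mix (P : pred nat) g : bmT g -> (forall x, 0 <= g x) ->
  E (fun x => (P (lt x))%:R * g (G x)) <= D * E (fun x => (P (lt x))%:R) * E g.
Proof.
move=> hg g0; have o := gm_1 X.
have -> : E (fun x => (P (lt x))%:R * g (G x)) = E (fun x => (P (lt x))%:R * 1 * g (G x)).
  by apply: eq_Ex => x _; rewrite mulr1.
rewrite -gm_TrE //; apply: le_trans (gm_mix (gm_Tr P o) hg g0) _.
rewrite Tr_mass // (_ : E (fun x => _ * 1) = E (fun x => (P (lt x))%:R)) //.
by apply: eq_Ex => x _; rewrite mulr1.
Qed.

End Itinerary.

(** * Two-sided observables replaced by functions of finitely many letters *)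

Section TwoSided.
Context (R : realType) dB (Yb : measurableType dB) (X : gibbs_markov R Yb) dM (M : measurableType dM).
Variables (nu : probability M R) (Y : set M) (f F : M -> M) (pib : M -> Yb).
Variables (vis : nat -> nat -> bool) (th Ch : R) (y0 : M).
Local Notation E := (Ex (gmu X) setT).
Local Notation EY := (Ex nu Y).
Local Notation D := (gD X).
Local Notation bmT := (@bm R dB Yb setT).
Local Notation G := (gG X).
Local Notation lt := (glt X).
Local Notation ph k := (gph X k).
Local Notation lp y := (glt X (pib y)).
Local Notation agr := (agree G lt).
Let mT := @measurableT dB Yb.
Hypothesis th01 : 0 < th < 1.
Hypothesis Ch0 : 0 <= Ch.
Hypothesis vis_ph : forall k l, vis k l -> (l < ph k)%N.
Hypothesis mY : measurable Y.
Hypothesis mf : measurable_fun setT f.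
Hypothesis mF : measurable_fun Y F.
Hypothesis FY : forall y, Y y -> Y (F y).
Hypothesis Finv : forall u, bm Y u -> EY (fun y => u (F y)) = EY u.
Hypothesis mpi : measurable_fun Y pib.
Hypothesis piF : forall y, Y y -> pib (F y) = G (pib y).
Hypothesis pinv : forall g, bmT g -> EY (fun y => g (pib y)) = E g.
Hypothesis Ff : forall y, Y y -> F y = iter (ph (lp y)) f y.
Hypothesis cyl_ex : forall n x, exists2 y, Y y & agr n (pib y) x.

Implicit Types u v w : M -> R.

(** After [N >= n] returns the two points share at least [n] letters of the past, the current letter
    and [n] letters of the future; the current letter makes the two blocks equally long, so that
    position [l] lies in both. *)
Definition dyn_holder B v := [/\ measurable_fun setT v, forall x, `|v x| <= B,
  forall y l, Y y -> (l < ph (lp y))%N -> ~~ vis (lp y) l -> v (iter l f y) = 0 &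
  forall N n y y' l, Y y -> Y y' -> (n <= N)%N -> agr (N + 1 + n)%N (pib y) (pib y') ->
    (l < ph (lp (iter N F y)))%N ->
    `|v (iter l f (iter N F y)) - v (iter l f (iter N F y'))| <= B * Ch * th ^+ n].

Let t0 : 0 < th. Proof. by case/andP: th01. Qed.

Lemma YN N y : Y y -> Y (iter N F y).
Proof. by move=> Yy; elim: N => //= N; exact: FY. Qed.

Lemma piN N y : Y y -> pib (iter N F y) = iter N G (pib y).
Proof. by move=> Yy; elim: N => //= N IH; rewrite piF ?IH //; exact: YN. Qed.

Lemma measurable_FN N : measurable_fun Y (iter N F).
Proof.
elim: N => [|N IH]; first exact: measurable_id.
by apply: (measurable_comp mY _ mF IH) => _ [y Yy <-]; exact: YN.
Qed.

Lemma measurable_fl l : measurable_fun setT (iter l f).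
Proof.
elim: l => [|l IH]; first exact: measurable_id.
exact: (measurableT_comp mf IH).
Qed.

Lemma bm_FN N u : bm Y u -> bm Y (fun y => u (iter N F y)).
Proof. by apply: bm_comp => //; [exact: measurable_FN|exact: YN]. Qed.

Lemma EY_N N u : bm Y u -> EY (fun y => u (iter N F y)) = EY u.
Proof.
move=> hu; elim: N => [//|N IH]; rewrite -IH -[RHS]Finv; last exact: bm_FN.
by apply: eq_Ex => y _; rewrite iterSr.
Qed.

Lemma bm_pi g : bmT g -> bm Y (fun y => g (pib y)).
Proof. by apply: bm_comp. Qed.

Lemma bm_lp (P : pred nat) : bm Y (fun y => (P (lp y))%:R : R).
Proof. exact: (bm_pi (bm_letter X P)). Qed.

Lemma bm_fl v B l : measurable_fun setT v -> (forall x, `|v x| <= B) -> bm Y (fun y => v (iter l f y)).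
Proof.
move=> mv vB; split; last by exists B.
apply: (@measurable_comp _ _ _ _ _ _ setT) mv _ => //.
by apply: measurable_funS (measurable_fl l).
Qed.

Lemma orbit_blocks N y : Y y ->
  iter N f y = iter (residual X N (pib y)) f (iter (nblocks X N (pib y)) F y).
Proof.
elim/ltn_ind: N y => N IH y Yy; have := split_blocksE X N (pib y); have p0 := gm_ph X (lp y).
case: ifP => [h [-> ->]|_ [-> ->]] //.
have h1 : (N - ph (lp y) < N)%N by clear -p0 h; lia.
by rewrite iterSr -(piF Yy) -IH // ?Ff // -?iterD ?subnK //; rewrite -Ff //; exact: FY.
Qed.

(* The value [y0] is never reached: by [cyl_ex] every cylinder meets [pib @` Y]. *)
Definition ystar (k : seq nat) : M :=
  if pselect (exists y, Y y /\ cyl X (size k) (pib y) = k) is left h then projT1 (cid h) else y0.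

Lemma ystarP n x : Y (ystar (cyl X n x)) /\ agr n (pib (ystar (cyl X n x))) x.
Proof.
rewrite /ystar; case: pselect => [h|[]].
  by case: (cid h) => y /= [Yy]; rewrite size_cyl => /cylP.
by have [y Yy h] := cyl_ex n x; exists y; split => //; rewrite size_cyl; apply/cylP.
Qed.

Lemma damped_visit_agree N x y : agr (nblocks X N x).+1 x y -> damped_visit X vis th N y = damped_visit X vis th N x.
Proof. by move=> h; rewrite /damped_visit; have [-> ->] := split_blocks_agree h; rewrite (h (nblocks X N x)). Qed.

Lemma agree_sym n x y : agr n x y -> agr n y x.
Proof. by move=> h j jn; rewrite h. Qed.

Lemma agree_trans n x y z : agr n x y -> agr n y z -> agr n x z.
Proof. by move=> h h' j jn; rewrite h // h'. Qed.

Section Cocycle.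
Variables (B : R) (w : M -> R).
Hypothesis hw : dyn_holder B w.

Lemma dyn_holder_ge0 : 0 <= B.
Proof. by have [_ h _ _] := hw; apply: le_trans (h y0). Qed.

(** With [r] completed blocks, [2 * r + 1] letters are [r] of the past, the current one and [r] of
    the future: the case [n = N = r] of [dyn_holder]. *)
Lemma osc_iter N y y' : Y y -> Y y' -> agr (nblocks X N (pib y)).*2.+1 (pib y) (pib y') ->
  `|w (iter N f y) - w (iter N f y')| <= B * Ch * damped_visit X vis th N (pib y).
Proof.
move=> Yy Yy' h; rewrite (orbit_blocks N Yy) (orbit_blocks N Yy').
have hr : agr (nblocks X N (pib y)).+1 (pib y) (pib y').
  by apply: agree_le h; rewrite ltnS -addnn leq_addr.
have [-> ->] := split_blocks_agree hr; rewrite /damped_visit.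
set r := nblocks X N (pib y); set m := residual X N (pib y).
have [_ _ h0 hosc] := hw.
have hm : (m < ph (lp (iter r F y)))%N by rewrite piN //; exact: residual_lt.
have el : lp (iter r F y') = lp (iter r F y) by rewrite !piN // (hr r).
case: (boolP (vis (lt (iter r G (pib y))) m)) => hv.
  by rewrite mulr1; apply: hosc => //; rewrite addn1 addSn addnn.
rewrite !mulr0 h0 //; [|exact: YN|by rewrite piN].
rewrite h0 ?subrr ?normr0 //; [exact: YN|by rewrite el|by rewrite el piN].
Qed.

(** The number of letters used depends on the point, so that the error is of order [th ^ r] wherever
    [r] blocks are completed, and a single letter is used before the first return. *)
Definition cyl_obs N x := w (iter N f (ystar (cyl X (nblocks X N x).*2.+1 x))).

Lemma cyl_obs_near N z : Y z -> `|w (iter N f z) - cyl_obs N (pib z)| <= B * Ch * damped_visit X vis th N (pib z).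
Proof.
move=> Yz; have [Yy hy] := ystarP (nblocks X N (pib z)).*2.+1 (pib z).
by apply: osc_iter => //; exact: agree_sym.
Qed.

Lemma bm_cyl_obs N : bmT (cyl_obs N).
Proof.
have [_ wB _ _] := hw.
apply: (eq_bm (u := fun x => (fun k => w (iter N f (ystar (take ((split_blocks X N k).1.*2.+1) k)))) (cyl X N.*2.+1 x))).
  move=> x _; rewrite /cyl_obs split_blocks_cyl; last by rewrite -addnn -addnS leq_addr.
  by rewrite take_cyl // ltnS leq_double; exact: nblocks_le.
exact: (@bm_cyl R _ Yb X _ (fun k => w (iter N f (ystar (take (split_blocks X N k).1.*2.+1 k)))) B).
Qed.

(** The part of [cyl_obs] that does not factor through the first block; it plays the role of [bb] in
    the renewal decomposition. *)
Definition fresh_obs N x := cyl_obs N x - (ph (lt x) <= N)%N%:R * cyl_obs (N - ph (lt x))%N (G x).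

Lemma bm_fresh_obs N : bmT (fresh_obs N).
Proof.
apply: bmB; first exact: bm_cyl_obs.
apply: (eq_bm (u := fun x => \sum_(j < N) (pj X j.+1 (lt x))%:R * cyl_obs (N - j.+1)%N (G x))).
  move=> x _; have p0 := gm_ph X (lt x); case: leqP => hN.
    have hj : ((ph (lt x)).-1 < N)%N by rewrite prednK.
    rewrite (bigD1 (Ordinal hj)) //= prednK // /pj eqxx mul1r big1 ?addr0 ?mul1r // => j hj'.
    rewrite (_ : (ph (lt x) == j.+1) = false) ?mul0r //.
    by apply: contraNF hj' => /eqP e; apply/eqP/val_inj; rewrite /= e.
  rewrite mul0r big1 // => j _; rewrite /pj (gtn_eqF _) ?mul0r //.
  by apply: leq_ltn_trans hN; rewrite ltn_ord.
by apply: bm_sum => j _; apply: bmM; [exact: bm_pj|apply: bm_comp_G; exact: bm_cyl_obs].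
Qed.

(** Two representatives are compared, for the words of [x] and of [G x]. After the first block they
    share [2 * r + 1] letters, with [r] the number of blocks completed from [G x]; this gives
    [th ^ r], one power less than [damped_visit] at [x], whence the factor [1 / th]. *)
Lemma fresh_obs_le N x : `|fresh_obs N x| <= B * (1 + Ch / th) * damped_visit X vis th N x.
Proof.
have B0 := dyn_holder_ge0; have [_ wB h0 _] := hw.
have t0' := t0; have c0 : 0 <= Ch / th by rewrite divr_ge0 // ltW.
rewrite /fresh_obs (damped_visitE th vis_ph); have := split_blocksE X N x; case: ifP => hN [er es].
  have -> : vis (lt x) N = false by apply/negP => /vis_ph; rewrite ltnNge hN.
  rewrite add0r !mul1r /cyl_obs er; set r := nblocks X (N - ph (lt x))%N (G x).
  set y := ystar _; set z := ystar _.
  have [Yy hy] := ystarP (r.+1).*2.+1 x; have [Yz hz] := ystarP r.*2.+1 (G x).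
  rewrite -/y in Yy hy; rewrite -/z in Yz hz.
  have ly : lp y = lt x by rewrite (hy 0%N).
  have -> : iter N f y = iter (N - ph (lt x)) f (F y) by rewrite Ff // ly -iterD subnK.
  have hFy : agr r.*2.+1 (pib (F y)) (G x).
    by rewrite piF //; apply: agreeS; apply: agree_le hy; rewrite doubleS.
  have hr1 : agr r.+1 (G x) (pib (F y)).
    by apply/agree_sym/(agree_le _ hFy); rewrite ltnS -addnn leq_addr.
  have [rE _] := split_blocks_agree hr1.
  have h := osc_iter (N := (N - ph (lt x))%N) (FY Yy) Yz.
  rewrite rE (damped_visit_agree hr1) in h.
  apply: le_trans (h _) _.
    by apply: agree_trans hFy _; exact: agree_sym.
  have -> : B * (1 + Ch / th) * (th * damped_visit X vis th (N - ph (lt x))%N (G x)) =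
    (B * Ch + B * th) * damped_visit X vis th (N - ph (lt x))%N (G x) by field; rewrite gt_eqF.
  by apply: ler_wpM2r; [exact: damped_visit_ge0|rewrite lerDl mulr_ge0 // ltW].
rewrite !mul0r subr0 addr0 /cyl_obs er.
have [Yy hy] := ystarP 1 x; set y := ystar _ in Yy hy *.
have ly : lp y = lt x by rewrite (hy 0%N).
case: (boolP (vis (lt x) N)) => hv.
  rewrite mulr1; apply: le_trans (wB _) _; rewrite -[leLHS]mulr1; apply: ler_wpM2l => //.
  by rewrite lerDl.
by rewrite mulr0 h0 ?normr0 //; rewrite ly // ltnNge hN.
Qed.

Lemma sum_shift_ord (a : nat -> R) p k :
  \sum_(N < k.+1) (p <= N)%N%:R * a (N - p)%N = \sum_(j < k.+1) (p <= k - j)%N%:R * a j.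
Proof.
rewrite -(big_mkord xpredT (fun N => (p <= N)%N%:R * a (N - p)%N)).
transitivity (\sum_(0 <= j < k.+1) (j + p <= k)%N%:R * a j); last first.
  rewrite big_mkord; apply: eq_bigr => i _.
  congr ((nat_of_bool _)%:R * _); have := ltn_ord i; move: (nat_of_ord i) => j hj.
  by clear -hj; apply/idP/idP; lia.
case: (leqP p k) => hp; last first.
  rewrite !big_nat !big1 // => j /andP[_ hj]; rewrite (_ : (_ <= _)%N = false) ?mul0r //.
    by clear -hj hp; lia.
  by clear -hj hp; lia.
rewrite (big_cat_nat (n := p)) //=; last by rewrite leqW.
rewrite big_nat big1 ?add0r; last by move=> j /andP[_ hj]; rewrite leqNgt hj mul0r.
rewrite [RHS](big_cat_nat (n := (k.+1 - p)%N)) //=; last exact: leq_subr.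
rewrite [X in _ = _ + X]big_nat [X in _ = _ + X]big1 ?addr0; last first.
  move=> j /andP[hj _]; rewrite (_ : (_ <= _)%N = false) ?mul0r //.
  by clear -hj hp; lia.
rewrite -{1}[p]add0n big_addn; apply: eq_big_nat => j /andP[_ hj].
rewrite leq_addl addnK (_ : (j + p <= k)%N) //; by clear -hj hp; lia.
Qed.

(** The two sums differ by a coboundary: with [dl N] the error of [cyl_obs] at time [N], each
    difference is [dl (N - ph)] after the return minus [dl N]. Invariance under [F] cancels the sum
    except for returns that come too late for time [k]. *)
Lemma sum_fresh_obs_near k :
  `|\sum_(N < k.+1) E (fresh_obs N) - \sum_(N < k.+1) EY (fun y => (N < ph (lp y))%N%:R * w (iter N f y))|
  <= B * Ch * D * conv (fun N => E (damped_visit X vis th N)) (return_tail X) k.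
Proof.
have B0 := dyn_holder_ge0; have [mw wB _ _] := hw.
pose dl N y := w (iter N f y) - cyl_obs N (pib y).
have bdl N : bm Y (dl N) by apply: bmB; [exact: bm_fl|apply: bm_pi; exact: bm_cyl_obs].
have bdF N : bm Y (fun y => dl N (F y)) by exact: (bm_FN 1 (bdl N)).
have bc N : bm Y (fun y => (N < ph (lp y))%N%:R * w (iter N f y)).
  by apply: bmM; [exact: (bm_lp (fun k => N < ph k)%N)|exact: bm_fl].
have bbp N : bm Y (fun y => fresh_obs N (pib y)) by apply: bm_pi; exact: bm_fresh_obs.
have brest j : bm Y (fun y => (k - j < ph (lp y))%N%:R * dl j (F y)).
  by apply: bmM => //; exact: (bm_lp (fun i => k - j < ph i)%N).
have -> : \sum_(N < k.+1) E (fresh_obs N) = EY (fun y => \sum_(N < k.+1) fresh_obs N (pib y)).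
  by rewrite Ex_sum //; apply: eq_bigr => N _; rewrite pinv //; exact: bm_fresh_obs.
rewrite -Ex_sum // -ExB //; [|by apply: bm_sum|by apply: bm_sum].
have key y : Y y -> \sum_(N < k.+1) fresh_obs N (pib y) - \sum_(N < k.+1) (N < ph (lp y))%N%:R * w (iter N f y) =
    \sum_(j < k.+1) (dl j (F y) - dl j y) - \sum_(j < k.+1) (k - j < ph (lp y))%N%:R * dl j (F y).
  move=> Yy; rewrite -!sumrB.
  have e N : fresh_obs N (pib y) - (N < ph (lp y))%N%:R * w (iter N f y) =
      (ph (lp y) <= N)%N%:R * dl (N - ph (lp y))%N (F y) - dl N y.
    rewrite /fresh_obs /dl piF //; case: leqP => hN; last by rewrite !mul0r mul1r; ring.
    have -> : iter N f y = iter (N - ph (lp y)) f (F y) by rewrite Ff // -iterD subnK.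
    by rewrite !mul1r mul0r; ring.
  transitivity (\sum_(N < k.+1) ((ph (lp y) <= N)%N%:R * dl (N - ph (lp y))%N (F y) - dl N y)).
    by apply: eq_bigr.
  rewrite [LHS]sumrB (sum_shift_ord (fun j => dl j (F y))) -sumrB.
  by apply: eq_bigr => j _; case: ltnP => _; rewrite ?mul1r ?mul0r; ring.
rewrite (eq_Ex _ key) ExB //; [|by apply: bm_sum => j _; apply: bmB|by apply: bm_sum].
rewrite Ex_sum // ; last by move=> j _; apply: bmB.
rewrite big1 ?sub0r; last by move=> j _; rewrite ExB // Finv // subrr.
rewrite normrN Ex_sum // /conv mulr_sumr; apply: le_trans (ler_norm_sum _ _ _) _.
apply: ler_sum => j _; apply: le_trans (ler_norm_Ex _ mY (brest j)) _.
have bdn : bmT (damped_visit X vis th j) by exact: bm_damped_visit.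
have bP : bmT (fun x => (k - j < ph (lt x))%N%:R) by exact: (bm_letter X (fun i => k - j < ph i)%N).
have bg : bmT (fun x => B * Ch * ((k - j < ph (lt x))%N%:R * damped_visit X vis th j (G x))).
  by apply: bmZ; apply: bmM => //; exact: bm_comp_G.
apply: (@le_trans _ _ (EY (fun y => B * Ch * ((k - j < ph (lp y))%N%:R * damped_visit X vis th j (G (pib y)))))).
  apply: le_Ex => //; [exact: bm_norm|exact: (bm_pi bg)|].
  move=> y Yy; rewrite normrM ger0_norm // mulrCA; apply: ler_wpM2l => //.
  by rewrite -piF //; apply: cyl_obs_near; exact: FY.
rewrite (pinv bg) ExZ //; last by apply: bmM => //; exact: bm_comp_G.
rewrite -!mulrA; apply: ler_wpM2l => //; apply: ler_wpM2l => //.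
apply: le_trans (letter_mix X (fun i => k - j < ph i)%N bdn _) _; first by move=> x; exact: damped_visit_ge0.
by rewrite -mulrA; apply: ler_wpM2l; [exact: D_ge0|rewrite mulrC].
Qed.

End Cocycle.

(** Positions are counted backwards from the end of the block: [i + 1] steps remain until the
    return. *)
Definition kick_letter i : pred nat := fun k => (i < ph k)%N && vis k ((ph k).-1 - i).
Definition kick_prob i : R := E (fun x => (kick_letter i (lt x))%:R).

Lemma bm_kick_letter N i : bmT (fun x => (kick_letter i (lt (iter N G x)))%:R : R).
Proof.
have h : bmT (fun x => (kick_letter i (lt x))%:R : R) by exact: bm_letter.
elim: N => [//|N IH]; apply: eq_bm (bm_comp_G X IH) => x _; by rewrite -iterSr.
Qed.

Lemma cone_kick_letter N i a c : 0 <= a -> 0 <= c -> cone G lt th c N.+1 (fun x => a * (kick_letter i (lt (iter N G x)))%:R).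
Proof.
move=> a0 c0; split; [by apply: bmZ; exact: bm_kick_letter|by move=> x; rewrite mulr_ge0|].
move=> n x y h; have t0' := t0; rewrite (h N) ?ltnS ?leq_addr // ler_peMl ?mulr_ge0 //.
by rewrite -expR0 ler_expR mulr_ge0 // exprn_ge0 // ltW.
Qed.

Section Kick.
Variables (B : R) (v : M -> R).
Hypothesis hv : dyn_holder B v.

Definition kick y i : R := (i < ph (lp y))%N%:R * v (iter ((ph (lp y)).-1 - i) f y).

Lemma bm_kick i : bm Y (fun y => kick y i).
Proof.
have [mv vB _ _] := hv; split; last first.
  exists B => y _; rewrite /kick; case: (_ < _)%N; first by rewrite mul1r.
  by rewrite mul0r normr0; exact: dyn_holder_ge0 hv.
have mk k : measurable (Y `&` [set y | lp y = k]).
  have h := gm_mlt X k; rewrite setTI in h.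
  by have := mpi mY h.
apply: (measurable_glue mk) => k.
apply: (@eq_measurable_fun _ _ _ _ _ (fun y => (i < ph k)%N%:R * v (iter ((ph k).-1 - i) f y))).
  by move=> y; rewrite inE => -[_ /= e]; rewrite /kick e.
apply: measurable_funS mY _ _; first by move=> y [].
by have [] := bmZ ((i < ph k)%N%:R) (bm_fl ((ph k).-1 - i) mv vB).
Qed.

Lemma kick_le y i : Y y -> `|kick y i| <= B * (kick_letter i (lp y))%:R.
Proof.
move=> Yy; have [_ vB h0 _] := hv; rewrite /kick /kick_letter; case: ltnP => hi; last by rewrite mul0r normr0 mulr0.
have p0 := gm_ph X (lp y).
rewrite mul1r /=; case: (boolP (vis _ _)) => hvis; first by rewrite mulr1.
by rewrite h0 ?normr0 ?mulr0 //; clear -p0 hi; lia.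
Qed.

Lemma kick_osc N n y y' i : Y y -> Y y' -> (n <= N)%N -> agr (N + 1 + n)%N (pib y) (pib y') ->
  `|kick (iter N F y) i - kick (iter N F y') i| <= B * Ch * th ^+ n * (kick_letter i (lp (iter N F y)))%:R.
Proof.
move=> Yy Yy' nN h.
have el : lp (iter N F y') = lp (iter N F y).
  by rewrite !piN // (h N) // addn1 leq_addr.
case: (boolP (kick_letter i (lp (iter N F y)))) => hL.
  rewrite mulr1 /kick el; case/andP: hL => -> _; rewrite !mul1r.
  have [_ _ _ hosc] := hv; apply: hosc => //.
  by have := gm_ph X (lp (iter N F y)); clear; lia.
have h1 := kick_le i (YN N Yy); have h2 := kick_le i (YN N Yy').
rewrite el (negbTE hL) mulr0 in h2; rewrite (negbTE hL) mulr0 in h1.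
move: h1 h2; rewrite !normr_le0 => /eqP -> /eqP ->.
by rewrite subrr normr0 mulr0.
Qed.

(** The kick depends on the past of the point. After [N] returns it has the same law by invariance,
    and [2 * N + 1] letters determine it up to an error of order [th ^ N]. *)
Definition cyl_kick N i x : R := kick (iter N F (ystar (cyl X N.*2.+1 x))) i.

Lemma bm_cyl_kick N i : bmT (cyl_kick N i).
Proof.
have B0 := dyn_holder_ge0 hv; have [mv vB _ _] := hv.
apply: (@bm_cyl _ _ _ X _ (fun k => kick (iter N F (ystar k)) i) B) => k; rewrite /kick.
by case: (_ < _)%N; rewrite ?mul1r // mul0r normr0.
Qed.

Lemma cyl_kick_le N i x : `|cyl_kick N i x| <= B * (kick_letter i (lt (iter N G x)))%:R.
Proof.
have [Yy hy] := ystarP N.*2.+1 x.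
apply: le_trans (kick_le i (YN N Yy)) _.
by rewrite piN // (hy N) // ltnS -addnn leq_addr.
Qed.

Lemma cyl_kick_near N i y : Y y ->
  `|kick (iter N F y) i - cyl_kick N i (pib y)| <= B * Ch * th ^+ N * (kick_letter i (lp (iter N F y)))%:R.
Proof.
move=> Yy; have [Yz hz] := ystarP N.*2.+1 (pib y).
by apply: kick_osc => //; rewrite addn1 addSn addnn; exact: agree_sym.
Qed.

(** Adding [2 * B] on the support leaves a value of at least [B] there, so that an oscillation of
    [B * Ch * th ^ n] becomes a relative one of [Ch * th ^ n], whatever [B] and [N]. For [n > N] the
    words read by [cyl_kick] coincide. *)
Lemma cone_cyl_kick N i : cone G lt th Ch N.+1 (fun x => cyl_kick N i x + 2 * B * (kick_letter i (lt (iter N G x)))%:R).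
Proof.
have B0 := dyn_holder_ge0 hv.
have lb x : B * (kick_letter i (lt (iter N G x)))%:R <= cyl_kick N i x + 2 * B * (kick_letter i (lt (iter N G x)))%:R.
  by have := cyl_kick_le N i x; rewrite ler_norml => /andP[h _]; lra.
have lb0 x : 0 <= B * (kick_letter i (lt (iter N G x)))%:R :> R by rewrite mulr_ge0.
split; [by apply: bmD; [exact: bm_cyl_kick|apply: bmZ; exact: bm_kick_letter]|by move=> x; apply: le_trans (lb x)|].
move=> n x y h.
have [Yx hx] := ystarP N.*2.+1 x; have [Yz hz] := ystarP N.*2.+1 y.
have el : lt (iter N G x) = lt (iter N G y) by rewrite (h N) // ltnS leq_addr.
have t0' := t0; have e1 : 1 <= expR (Ch * th ^+ n) by rewrite -expR0 ler_expR mulr_ge0 // exprn_ge0 // ltW.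
case: (leqP n N) => hn; last first.
  have -> : cyl_kick N i x = cyl_kick N i y.
    rewrite /cyl_kick; congr (kick (iter N F (ystar _)) i); apply/cylP; apply: agree_le h.
    by clear -hn; lia.
  by rewrite el ler_peMl // (le_trans _ (lb y)).
have := kick_osc i Yx Yz hn; rewrite -!/(cyl_kick N i _) => /(_ _) H.
have {H} : `|cyl_kick N i x - cyl_kick N i y| <= Ch * th ^+ n * (B * (kick_letter i (lt (iter N G y)))%:R).
  have -> : Ch * th ^+ n * (B * (kick_letter i (lt (iter N G y)))%:R) = B * Ch * th ^+ n * (kick_letter i (lt (iter N G y)))%:R by ring.
  have elz : lp (iter N F (ystar (cyl X N.*2.+1 x))) = lt (iter N G y).
    by rewrite piN // (hx N) ?el // ltnS -addnn leq_addr.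
  rewrite -elz; apply: H.
  have nN : (N + 1 + n <= N.*2.+1)%N by clear -hn; lia.
  apply: agree_trans (agree_le nN hx) _.
  apply: agree_trans (agree_sym (agree_le nN hz)).
  by apply: agree_le h; clear; lia.
rewrite ler_norml => /andP[_ h1].
apply: (@le_trans _ _ ((1 + Ch * th ^+ n) * (cyl_kick N i y + 2 * B * (kick_letter i (lt (iter N G y)))%:R))).
  have c0 : 0 <= Ch * th ^+ n by rewrite mulr_ge0 // exprn_ge0 // ltW.
  have := ler_wpM2l c0 (lb y); rewrite el; lra.
by apply: ler_wpM2r; [exact: le_trans (lb y)|exact: expR_ge1Dx].
Qed.

End Kick.

(** Replacing [w] by [cyl_obs] has a cost that [letter_mix] factors into a convolution; replacing
    [kick] by [cyl_kick] costs [th ^ N] per term, which a large [N] makes negligible. *)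
Lemma kick_cocycle Bv Bw v w N n : dyn_holder Bv v -> dyn_holder Bw w ->
  `|\sum_(i < n.+1) EY (fun y => kick v y i * w (iter (n - i) f (F y))) -
    \sum_(i < n.+1) E (fun x => cyl_kick v N i x * cyl_obs w (n - i)%N (iter N.+1 G x))|
  <= Bv * Bw * (Ch * D * conv kick_prob (fun m => E (damped_visit X vis th m)) n + Ch * th ^+ N * n.+1%:R).
Proof.
move=> hv hw; have Bv0 := dyn_holder_ge0 hv; have Bw0 := dyn_holder_ge0 hw.
have [mw wB _ _] := hw; have t0' := t0.
rewrite -sumrB; apply: le_trans (ler_norm_sum _ _ _) _.
have -> : Bv * Bw * (Ch * D * conv kick_prob (fun m => E (damped_visit X vis th m)) n + Ch * th ^+ N * n.+1%:R) =
  \sum_(i < n.+1) (Bv * Bw * Ch * (D * kick_prob i * E (damped_visit X vis th (n - i)%N)) + Bv * Bw * Ch * th ^+ N).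
  rewrite big_split /= sumr_const card_ord -mulr_sumr -[in RHS]mulr_natr.
  rewrite (eq_bigr (fun i : 'I_n.+1 => D * (kick_prob i * E (damped_visit X vis th (n - i)%N)))); last first.
    by move=> i _; rewrite mulrA.
  rewrite -mulr_sumr /conv; ring.
apply: ler_sum => i _; set m := (n - i)%N.
have bLF : bm Y (fun y => kick v (iter N F y) i) by apply: (bm_FN N (bm_kick hv i)).
have bwF : bm Y (fun y => w (iter m f (iter N.+1 F y))) by apply: (bm_FN N.+1 (bm_fl m mw wB)).
have bg := bm_cyl_obs hw m; have bV := bm_cyl_kick hv N i.
have bgG : bmT (fun x => cyl_obs w m (iter N.+1 G x)).
  elim: (N.+1) => [//|k IH]; apply: eq_bm (bm_comp_G X IH) => x _; by rewrite -iterSr.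
have bgY := bm_pi bgG; have bVY := bm_pi bV.
have -> : EY (fun y => kick v y i * w (iter m f (F y))) =
    EY (fun y => kick v (iter N F y) i * w (iter m f (iter N.+1 F y))).
  rewrite -(EY_N N (u := fun y => kick v y i * w (iter m f (F y)))) //.
  by apply: bmM; [exact: (bm_kick hv i)|apply: (bm_FN 1 (bm_fl m mw wB))].
rewrite -pinv; last exact: bmM.
have b1 : bm Y (fun y => kick v (iter N F y) i * (w (iter m f (iter N.+1 F y)) - cyl_obs w m (iter N.+1 G (pib y)))).
  by apply: bmM => //; exact: bmB.
have b2 : bm Y (fun y => (kick v (iter N F y) i - cyl_kick v N i (pib y)) * cyl_obs w m (iter N.+1 G (pib y))).
  by apply: bmM => //; exact: bmB.
rewrite -ExB //; [|exact: bmM|exact: bmM].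
have -> : EY (fun y => kick v (iter N F y) i * w (iter m f (iter N.+1 F y)) -
     cyl_kick v N i (pib y) * cyl_obs w m (iter N.+1 G (pib y))) =
   EY (fun y => kick v (iter N F y) i * (w (iter m f (iter N.+1 F y)) - cyl_obs w m (iter N.+1 G (pib y)))) +
   EY (fun y => (kick v (iter N F y) i - cyl_kick v N i (pib y)) * cyl_obs w m (iter N.+1 G (pib y))).
  by rewrite -ExD //; apply: eq_Ex => y _; ring.
apply: le_trans (ler_normD _ _) _; apply: lerD.
  have bdn : bmT (damped_visit X vis th m) by exact: bm_damped_visit.
  have bP : bmT (fun x => (kick_letter i (lt x))%:R : R) by exact: bm_letter.
  have bk : bmT (fun x => Bv * Bw * Ch * ((kick_letter i (lt x))%:R * damped_visit X vis th m (G x))).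
    by apply: bmZ; apply: bmM => //; exact: bm_comp_G.
  apply: le_trans (ler_norm_Ex _ mY b1) _.
  apply: (@le_trans _ _ (EY (fun y => Bv * Bw * Ch * ((kick_letter i (lp (iter N F y)))%:R * damped_visit X vis th m (G (pib (iter N F y))))))).
    apply: le_Ex => //; [exact: bm_norm|exact: (bm_FN N (bm_pi bk))|].
    move=> y Yy; rewrite normrM.
    have -> : Bv * Bw * Ch * ((kick_letter i (lp (iter N F y)))%:R * damped_visit X vis th m (G (pib (iter N F y)))) =
      (Bv * (kick_letter i (lp (iter N F y)))%:R) * (Bw * Ch * damped_visit X vis th m (G (pib (iter N F y)))) by ring.
    apply: ler_pM => //; first by apply: kick_le => //; exact: YN.
    rewrite -piF; last exact: YN.
    by rewrite -iterS -(piN N.+1 Yy); apply: (cyl_obs_near hw); exact: (YN N.+1).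
  rewrite (EY_N N (bm_pi bk)) (pinv bk) ExZ //; last by apply: bmM => //; exact: bm_comp_G.
  apply: ler_wpM2l; first by rewrite !mulr_ge0.
  by apply: (letter_mix X (kick_letter i) bdn) => x; exact: damped_visit_ge0.
apply: Ex_bound => //; first by rewrite !mulr_ge0 // exprn_ge0 // ltW.
move=> y Yy; rewrite normrM.
have -> : Bv * Bw * Ch * th ^+ N = (Bv * Ch * th ^+ N) * Bw by ring.
apply: ler_pM => //; last exact: wB.
apply: le_trans (cyl_kick_near hv N i Yy) _; rewrite ler_piMr //; last by case: (kick_letter _ _).
by rewrite !mulr_ge0 // exprn_ge0 // ltW.
Qed.

(** * The tower over [Y], its residue classes and the decay estimate *)

Section Tower.
Variables (mu : probability M R) (PB : R).
Hypothesis muf : forall A, measurable A -> mu (setT `&` f @^-1` A) = mu (setT `&` A).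
Local Notation Em := (Ex mu setT).
Local Notation bmM' := (@bm R dM M setT).
Let mM := @measurableT dM M.

Definition visit v l : R := EY (fun y => (l < ph (lp y))%N%:R * v (iter l f y)).

Hypothesis tower : forall A, measurable A -> series (visit \1_A) @ \oo --> PB * fine (mu A).

Lemma bm_visit v l : bmM' v -> bm Y (fun y => (l < ph (lp y))%N%:R * v (iter l f y)).
Proof.
move=> [mv [B vB]]; apply: bmM; first exact: (bm_lp (fun k => l < ph k)%N).
by apply: bm_fl mv _ => x; exact: vB.
Qed.

Lemma EY_ptail l : EY (fun y => (l < ph (lp y))%N%:R) = return_tail X l.
Proof. exact: (pinv (bm_letter X (fun k => l < ph k)%N)). Qed.

Lemma visit_le v B l : bmM' v -> (forall x, `|v x| <= B) -> `|visit v l| <= B * return_tail X l.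
Proof.
move=> hv vB; apply: le_trans (ler_norm_Ex _ mY (bm_visit l hv)) _.
rewrite -EY_ptail -ExZ //; last exact: (bm_lp (fun k => l < ph k)%N).
apply: le_Ex => //; [apply: bm_norm; exact: bm_visit|apply: bmZ; exact: (bm_lp (fun k => l < ph k)%N)|].
move=> y _; rewrite normrM ger0_norm // mulrC; exact: ler_wpM2r.
Qed.

Lemma visit_D u v l : bmM' u -> bmM' v -> visit (fun x => u x + v x) l = visit u l + visit v l.
Proof.
move=> hu hv; rewrite -[RHS]ExD //; [|exact: bm_visit|exact: bm_visit].
by apply: eq_Ex => y _; rewrite mulrDr.
Qed.

Lemma visit_Z (a : R) u l : bmM' u -> visit (fun x => a * u x) l = a * visit u l.
Proof.
move=> hu; rewrite -[RHS]ExZ //; last exact: bm_visit.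
by apply: eq_Ex => y _; rewrite mulrCA.
Qed.

Lemma return_tail_cvg : series (return_tail X) @ \oo --> PB.
Proof.
have := tower mM; rewrite (_ : fine (mu setT) = 1); last by rewrite probability_setT.
rewrite mulr1 (_ : visit \1_setT = return_tail X) //; apply/funext => l.
by rewrite -EY_ptail; apply: eq_Ex => y _; rewrite indicE in_setT mulr1.
Qed.

Lemma return_tail_sum K : \sum_(l < K) return_tail X l <= PB.
Proof.
have h : {homo series (return_tail X) : n m / (n <= m)%N >-> n <= m}.
  move=> n m nm; rewrite /series /= !big_mkord (@sum_ord_split _ (return_tail X) n m) // lerDl.
  by apply: sumr_ge0 => i _; exact: return_tail_ge0.
have := nondecreasing_cvgn_le h (cvgP _ return_tail_cvg) K.
by rewrite (cvg_lim _ return_tail_cvg) // /series /= big_mkord.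
Qed.

Lemma lim_dist (u : nat -> R) L S e : u @ \oo --> L ->
  (forall eps, 0 < eps -> \forall K \near \oo, `|u K - S| <= e + eps) -> `|L - S| <= e.
Proof.
move=> /cvgrPdist_le hu h; apply/ler_addgt0Pr => eps e0.
have e2 : 0 < eps / 2 by rewrite divr_gt0.
have [K [h1 h2]] : exists K, `|L - u K| <= eps / 2 /\ `|u K - S| <= e + eps / 2.
  have := filterI (hu _ e2) (h _ e2); move=> [K0 _ hK]; exists K0.
  by have [] := hK K0 (leqnn _).
have -> : L - S = (L - u K) + (u K - S) by ring.
by apply: le_trans (ler_normD _ _) _; lra.
Qed.

Lemma return_tail_rest eps : 0 < eps -> \forall K \near \oo, PB - \sum_(l < K) return_tail X l <= eps.
Proof.
move=> e0; have /cvgrPdist_le /(_ _ e0) := return_tail_cvg.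
apply: filterS => K; rewrite /series /= big_mkord; apply: le_trans; exact: ler_norm.
Qed.

Implicit Types c : pred nat.

(** The unnormalised integral of [v] over the levels selected by [c]; over all levels it is [PB]
    times the integral on [M]. *)
Definition tower_sum c v : R := limn (series (fun l => (c l)%:R * visit v l)).

Lemma tower_sum_cvg c v : bmM' v -> series (fun l => (c l)%:R * visit v l) @ \oo --> tower_sum c v.
Proof.
move=> hv; have [_ [B vB]] := hv; have vB' x : `|v x| <= B by exact: vB.
apply: normed_cvg; apply: (@series_le_cvg _ _ (fun l => B * return_tail X l)) => [l|l|l|].
- by rewrite /= normr_ge0.
- apply: mulr_ge0; [by apply: le_trans (vB' y0)|exact: return_tail_ge0].
- rewrite /= normrM; apply: le_trans (visit_le l hv vB'); rewrite ler_piMl //.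
  by case: (c l); rewrite ?normr1 ?normr0.
- by apply: is_cvg_seriesZ; apply/cvg_ex; exists PB; exact: return_tail_cvg.
Qed.

Lemma tower_sum_eq c v (S : R) : series (fun l => (c l)%:R * visit v l) @ \oo --> S -> tower_sum c v = S.
Proof. by move=> h; apply: cvg_lim h. Qed.

Lemma eq_cvgn (u v : nat -> R) (L : R) : (forall K, u K = v K) -> u @ \oo --> L -> v @ \oo --> L.
Proof. by move=> /funext ->. Qed.

Lemma cvgn_sum (I : Type) (r : seq I) (g : I -> nat -> R) (L : I -> R) :
  (forall i, g i @ \oo --> L i) -> (fun K => \sum_(i <- r) g i K) @ \oo --> \sum_(i <- r) L i.
Proof.
move=> h; elim: r => [|i r IH].
  by rewrite big_nil; apply: eq_cvgn (cvg_cst 0) => K; rewrite big_nil.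
rewrite big_cons; apply: eq_cvgn (cvgD (h i) IH) => K; by rewrite big_cons.
Qed.

Lemma towD c u v : bmM' u -> bmM' v -> tower_sum c (fun x => u x + v x) = tower_sum c u + tower_sum c v.
Proof.
move=> hu hv; apply: tower_sum_eq; apply: eq_cvgn (cvgD (@tower_sum_cvg c _ hu) (@tower_sum_cvg c _ hv)) => K.
transitivity (series (fun l => (c l)%:R * visit u l) K + series (fun l => (c l)%:R * visit v l) K); first by [].
by rewrite /series /= -big_split /=; apply: eq_bigr => l _; rewrite visit_D // mulrDr.
Qed.

Lemma towZ c a u : bmM' u -> tower_sum c (fun x => a * u x) = a * tower_sum c u.
Proof.
move=> hu; apply: tower_sum_eq; apply: eq_cvgn (cvgM (cvg_cst a) (@tower_sum_cvg c _ hu)) => K.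
by rewrite /series /= mulr_sumr; apply: eq_bigr => l _; rewrite visit_Z // mulrCA.
Qed.

Lemma tower_sum_le c v B : bmM' v -> (forall x, `|v x| <= B) -> `|tower_sum c v| <= B * PB.
Proof.
move=> hv vB; have B0 : 0 <= B by apply: le_trans (vB y0).
rewrite -[tower_sum c v]subr0; apply: (lim_dist (@tower_sum_cvg c _ hv)) => eps e0; near=> K.
rewrite subr0 /series /= big_mkord; apply: le_trans (ler_norm_sum _ _ _) _.
apply: (@le_trans _ _ (B * PB)); last by rewrite lerDl ltW.
apply: (@le_trans _ _ (B * \sum_(l < K) return_tail X l)); last by apply: ler_wpM2l => //; exact: return_tail_sum.
rewrite mulr_sumr; apply: ler_sum => l _; rewrite normrM; apply: le_trans (visit_le l hv vB).
by rewrite ler_piMl //; case: (c l); rewrite ?normr1 ?normr0.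
Unshelve. all: by end_near. Qed.

Lemma tower_sum_full v : bmM' v -> tower_sum xpredT v = PB * Em v.
Proof.
move=> hv; apply/eqP; rewrite -subr_eq0; apply/eqP.
apply: (@linear_ext0 R dM M setT mM (fun v => tower_sum xpredT v - PB * Em v) (PB + PB)) => //.
- by move=> u w hu hw; rewrite towD // ExD //; ring.
- by move=> c u hu; rewrite towZ // ExZ //; ring.
- move=> u B B0 hu uB; have uB' x : `|u x| <= B by exact: uB.
  have PB0 : 0 <= PB by have := return_tail_sum 0; rewrite big_ord0.
  apply: le_trans (ler_normB _ _) _; rewrite mulrDl; apply: lerD.
    by rewrite [leRHS]mulrC; exact: tower_sum_le.
  by rewrite normrM ger0_norm //; apply: ler_wpM2l => //; apply: Ex_bound.
- move=> A mA; rewrite (tower_sum_eq (S := PB * fine (mu A))); last first.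
    have := tower mA; apply: cvg_trans; apply: near_eq_cvg; near=> K.
    by apply: eq_bigr => l _; rewrite mul1r.
  by rewrite Ex_indic // setTI subrr.
Unshelve. all: by end_near. Qed.

Lemma tower_sum_mono c u w : bmM' u -> bmM' w -> (forall x, u x <= w x) -> tower_sum c u <= tower_sum c w.
Proof.
move=> hu hw h; apply: (ler_cvg_to (@tower_sum_cvg c _ hu) (@tower_sum_cvg c _ hw)); near=> K.
rewrite /series /=; apply: ler_sum => l _; apply: ler_wpM2l => //.
apply: le_Ex => //; [exact: bm_visit|exact: bm_visit|].
by move=> y _; apply: ler_wpM2l.
Unshelve. all: by end_near. Qed.

Lemma tower_sum_abs c u : bmM' u -> `|tower_sum c u| <= PB * Em (fun x => `|u x|).
Proof.
move=> hu; have hn := bm_norm hu; rewrite -tower_sum_full //.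
have h1 : tower_sum c (fun x => `|u x|) <= tower_sum xpredT (fun x => `|u x|).
  apply: (ler_cvg_to (@tower_sum_cvg c _ hn) (@tower_sum_cvg xpredT _ hn)); near=> K.
  rewrite /series /=; apply: ler_sum => l _; apply: ler_wpM2r; last by case: (c l).
  by apply: Ex_ge0 => y _; rewrite mulr_ge0.
apply: le_trans h1; rewrite ler_norml; apply/andP; split.
  rewrite lerNl -mulN1r -towZ //; apply: tower_sum_mono => //; first exact: bmZ.
  by move=> x; rewrite mulN1r -normrN ler_norm.
by apply: tower_sum_mono => // x; exact: ler_norm.
Unshelve. all: by end_near. Qed.

Lemma sum_trunc (a : nat -> R) p K :
  \sum_(l < K) (l < p)%N%:R * a l = \sum_(l < p) (l < K)%N%:R * a l.
Proof.
have h (m q : nat) : \sum_(l < m) (l < q)%N%:R * a l = \sum_(l < minn m q) a l.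
  rewrite -(big_mkord xpredT (fun l => (l < q)%N%:R * a l)) -(big_mkord xpredT a).
  rewrite (big_cat_nat (n := minn m q)) //= ?geq_minl //.
  rewrite [X in _ + X]big_nat [X in _ + X]big1 ?addr0; last first.
    move=> l /andP[h1 h2]; rewrite (_ : (l < q)%N = false) ?mul0r //.
    by clear -h1 h2; lia.
  by apply: eq_big_nat => l /andP[_]; rewrite leq_min => /andP[_ ->]; rewrite mul1r.
by rewrite !h minnC.
Qed.

(** The levels from which [n] steps leave a block of length [p], renumbered backwards from its
    top. *)
Lemma sum_window (a : nat -> R) p n K :
  \sum_(l < K) ((l < p) && (p <= l + n))%N%:R * a l =
  \sum_(i < n) ((i < p) && (p.-1 - i < K))%N%:R * a (p.-1 - i)%N.
Proof.
transitivity (\sum_(l < K) (l < p)%N%:R * ((p <= l + n)%N%:R * a l)).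
  by apply: eq_bigr => l _; rewrite mulrA -natrM mulnb.
transitivity (\sum_(i < n) (i < p)%N%:R * ((p.-1 - i < K)%N%:R * a (p.-1 - i)%N)); last first.
  by apply: eq_bigr => l _; rewrite mulrA -natrM mulnb.
rewrite (sum_trunc (fun l => (p <= l + n)%N%:R * a l)).
rewrite (sum_trunc (fun i => (p.-1 - i < K)%N%:R * a (p.-1 - i)%N)).
rewrite (reindex_inj rev_ord_inj) /=; apply: eq_bigr => i _; have := ltn_ord i.
move: (nat_of_ord i) => j jp.
have -> : (p - j.+1)%N = (p.-1 - j)%N by clear; lia.
rewrite !mulrA -!natrM !mulnb; congr ((nat_of_bool _)%:R * _).
rewrite andbC; congr (_ && _).
by clear -jp; apply/idP/idP; lia.
Qed.

Lemma EY_kick_le B v i : dyn_holder B v -> `|EY (fun y => kick v y i)| <= B * kick_prob i.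
Proof.
move=> hv; have bL : bm Y (fun y => (kick_letter i (lp y))%:R : R) by exact: (bm_lp (kick_letter i)).
apply: le_trans (ler_norm_Ex _ mY (bm_kick hv i)) _.
rewrite /kick_prob -(pinv (bm_letter X (kick_letter i))) -ExZ //.
apply: le_Ex => //; [by apply: bm_norm; exact: (bm_kick hv i)|exact: bmZ|].
by move=> y Yy; exact: kick_le.
Qed.


Section Assembly.
Variable s : nat -> R.
Hypothesis s0 : forall n, 0 <= s n.
Hypothesis sdecr : forall n m, (n <= m)%N -> s m <= s n.
Hypothesis hL : tailb 1 s kick_prob.
Hypothesis hM : tailb 1 s (fun m => E (fun x => (vis (lt x) m)%:R)).
Hypothesis hV : forall n K,
  E (fun x => \sum_(l < K) ((l + n < ph (lt x))%N && vis (lt x) l)%:R) <= s n.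

(** Follow the [n] steps that start at level [l] of the tower. If they leave the block, its last
    stretch is a kick and the rest starts from [F y]; otherwise [l] is a visit in a block longer
    than [l + n], and such visits are counted by [s n]. *)
Lemma kick_split Bv Bw v w n : dyn_holder Bv v -> dyn_holder Bw w ->
  `|PB * Em (fun x => v x * w (iter n f x)) -
    \sum_(i < n) EY (fun y => kick v y i * w (iter (n.-1 - i) f (F y)))| <= Bv * Bw * s n.
Proof.
move=> hv hw; have Bv0 := dyn_holder_ge0 hv; have Bw0 := dyn_holder_ge0 hw.
have [mv vB v0 _] := hv; have [mw wB _ _] := hw.
have BB : 0 <= Bv * Bw by exact: mulr_ge0.
pose g x := v x * w (iter n f x).
have hg : bmM' g.
  apply: bmM; first by split; [|exists Bv].
  apply: (@bm_comp _ _ _ _ _ setT setT _ w) => //; first exact: measurable_fl.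
  by split; [|exists Bw].
rewrite -/g -tower_sum_full //; apply: (lim_dist (@tower_sum_cvg xpredT _ hg)) => eps e0.
(* Cutting the tower at [K] levels affects only blocks longer than [K], in at most [n] positions
   each. *)
have e1 : 0 < eps / (n%:R * (Bv * Bw) + 1) by rewrite divr_gt0 // ltr_wpDl // mulr_ge0.
have [K0 _ hK0] := return_tail_rest e1; exists K0 => // K /= hK.
have bP l : bm Y (fun y => ((l + n < ph (lp y))%N && vis (lp y) l)%:R : R).
  exact: (bm_lp (fun k => (l + n < ph k)%N && vis k l)).
have bT : bm Y (fun y => (K < ph (lp y))%N%:R : R) by exact: (bm_lp (fun k => K < ph k)%N).
have bLw i : bm Y (fun y => kick v y i * w (iter (n.-1 - i) f (F y))).
  by apply: bmM; [exact: (bm_kick hv i)|exact: (bm_FN 1 (bm_fl _ mw wB))].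
have bser : bm Y (fun y => \sum_(l < K) (l < ph (lp y))%N%:R * g (iter l f y)).
  by apply: bm_sum => l _; exact: bm_visit.
have bsum : bm Y (fun y => \sum_(i < n) kick v y i * w (iter (n.-1 - i) f (F y))).
  by apply: bm_sum.
have -> : series (fun l => 1 * visit g l) K = EY (fun y => \sum_(l < K) (l < ph (lp y))%N%:R * g (iter l f y)).
  rewrite Ex_sum //; last by move=> l _; exact: bm_visit.
  by rewrite /series /= big_mkord; apply: eq_bigr => l _; rewrite mul1r.
rewrite -Ex_sum // -ExB //.
have bmaj : bm Y (fun y => Bv * Bw * \sum_(l < K) ((l + n < ph (lp y))%N && vis (lp y) l)%:R +
    (n%:R * (Bv * Bw)) * (K < ph (lp y))%N%:R).
  by apply: bmD => //; apply: bmZ => //; apply: bm_sum.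
apply: le_trans (ler_norm_Ex _ mY (bmB bser bsum)) _.
apply: (@le_trans _ _ (EY (fun y => Bv * Bw * \sum_(l < K) ((l + n < ph (lp y))%N && vis (lp y) l)%:R +
    (n%:R * (Bv * Bw)) * (K < ph (lp y))%N%:R))); last first.
  rewrite ExD //; [|by apply: bmZ => //; apply: bm_sum|exact: bmZ].
  rewrite !ExZ //; last by apply: bm_sum.
  apply: lerD.
    apply: ler_wpM2l => //.
    have := pinv (g := fun x => \sum_(l < K) ((l + n < ph (lt x))%N && vis (lt x) l)%:R).
    move=> -> //; apply: bm_sum => l _; exact: (bm_letter X (fun k => (l + n < ph k)%N && vis k l)).
  rewrite EY_ptail; apply: (@le_trans _ _ ((n%:R * (Bv * Bw) + 1) * (eps / (n%:R * (Bv * Bw) + 1)))).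
    apply: ler_pM; [by rewrite mulr_ge0|exact: return_tail_ge0|by rewrite lerDl|].
    apply: le_trans (hK0 K hK).
    by have := return_tail_sum K.+1; rewrite big_ord_recr /=; lra.
  by rewrite mulrC divfK // gt_eqF // ltr_wpDl // mulr_ge0.
apply: le_Ex => //; first by apply: bm_norm; exact: bmB.
move=> y Yy; have p0 := gm_ph X (lp y).
have e1' l : (l < ph (lp y))%N%:R * g (iter l f y) = (l + n < ph (lp y))%N%:R * g (iter l f y) +
    ((l < ph (lp y)) && (ph (lp y) <= l + n))%N%:R * g (iter l f y).
  case: (ltnP (l + n) (ph (lp y))) => h1.
    by rewrite andbF mul0r addr0 (leq_ltn_trans (leq_addr n l) h1).
  by rewrite andbT mul0r add0r.
rewrite (eq_bigr (fun l : 'I_K => (l + n < ph (lp y))%N%:R * g (iter l f y) +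
    ((l < ph (lp y)) && (ph (lp y) <= l + n))%N%:R * g (iter l f y))) // big_split /=.
rewrite (sum_window (fun l => g (iter l f y))) -addrA; apply: le_trans (ler_normD _ _) _.
apply: lerD.
  rewrite mulr_sumr; apply: le_trans (ler_norm_sum _ _ _) _; apply: ler_sum => l _.
  case: (ltnP (l + n) (ph (lp y))) => h1; last by rewrite mul0r normr0 mulr0.
  rewrite mul1r normrM /=; case: (boolP (vis (lp y) l)) => hvis.
    by rewrite mulr1; apply: ler_pM.
  by rewrite v0 ?normr0 ?mul0r ?mulr0 //; exact: leq_ltn_trans (leq_addr n l) h1.
rewrite -sumrB; apply: le_trans (ler_norm_sum _ _ _) _.
rewrite -mulrA mulr_natl -[n in leRHS]card_ord -sumr_const; apply: ler_sum => i _.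
have iN := ltn_ord i; rewrite /kick; case: (ltnP i (ph (lp y))) => hi; last first.
  by rewrite !mul0r subrr normr0 mulr_ge0.
have -> : g (iter ((ph (lp y)).-1 - i) f y) =
    v (iter ((ph (lp y)).-1 - i) f y) * w (iter (n.-1 - i) f (F y)).
  rewrite /g Ff // -!iterD; congr (_ * w (iter _ f y)).
  by clear -hi iN; lia.
case: (ltnP ((ph (lp y)).-1 - i) K) => hK'; first by rewrite !mul1r subrr normr0 mulr_ge0.
have -> : (K < ph (lp y))%N by clear -hK' hi p0; lia.
by rewrite mul0r sub0r normrN !mul1r mulr1 normrM; apply: ler_pM.
Qed.

Lemma visit_sum Bw w k : dyn_holder Bw w ->
  `|\sum_(N < k.+1) visit w N - PB * Em w| <= Bw * s k.
Proof.
move=> hw; have Bw0 := dyn_holder_ge0 hw; have [mw wB w0 _] := hw.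
have bw' : bmM' w by split; [|exists Bw].
rewrite distrC -tower_sum_full //; apply: (lim_dist (@tower_sum_cvg xpredT _ bw')) => eps e0.
exists k.+1 => // K /= hK.
rewrite /series /= big_mkord (eq_bigr (fun l : 'I_K => visit w l)) => [|l _]; last by rewrite mul1r.
rewrite (@sum_ord_split _ (visit w) k.+1 K) // addrAC subrr add0r.
apply: (@le_trans _ _ (Bw * \sum_(k.+1 <= N < K) E (fun x => (vis (lt x) N)%:R))).
  rewrite mulr_sumr; apply: le_trans (ler_norm_sum _ _ _) _; apply: ler_sum => N _.
  have bV : bm Y (fun y => (vis (lp y) N)%:R : R) by exact: (bm_lp (fun k => vis k N)).
  rewrite -(pinv (bm_letter X (fun k => vis k N))) -ExZ //.
  apply: le_trans (ler_norm_Ex _ mY (bm_visit N bw')) _.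
  apply: le_Ex => //; [by apply: bm_norm; exact: bm_visit|exact: bmZ|].
  move=> y Yy; case: ltnP => h; last by rewrite mul0r normr0 mulr_ge0.
  rewrite mul1r; case: (boolP (vis (lp y) N)) => hvis; first by rewrite mulr1.
  by rewrite w0 ?normr0 ?mulr0.
apply: (@le_trans _ _ (Bw * s k)); last by rewrite lerDl ltW.
apply: ler_wpM2l => //; apply: le_trans (sdecr (leqnSn k)).
by have [_ /(_ k.+1 K)] := hM; rewrite mul1r.
Qed.

Section Classes.
Variable dd : nat.
Hypothesis dd0 : (0 < dd)%N.
Hypothesis dd_ph : forall y, Y y -> (dd %| ph (lp y))%N.

Definition residue_class r : pred nat := fun l => (dd %| l + r)%N.

Lemma bm_f v n : bmM' v -> bmM' (fun x => v (iter n f x)).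
Proof. by apply: bm_comp => //; exact: measurable_fl. Qed.

(** One step of [f] raises the level by 1. From the top it leads to level 0, in the matching class
    because [dd] divides the length of every block, and invariance under [F] balances the two
    ends. *)
Lemma tower_sum_shift r v : bmM' v -> tower_sum (residue_class r.+1) (fun x => v (f x)) = tower_sum (residue_class r) v.
Proof.
move=> hv; have [mv [B vB]] := hv; have hvf := bm_f 1 hv.
have vB' x : `|v x| <= B by exact: vB.
have vY : bm Y v by exact: (bm_fl 0 mv vB').
have vFY : bm Y (fun y => v (F y)) by exact: (bm_FN 1 vY).
apply: tower_sum_eq; apply/cvgrPdist_le => eps e0.
have B0 : 0 <= B by apply: le_trans (vB' y0).
have e2 : 0 < eps / 2 by rewrite divr_gt0.
have e3 : 0 < eps / 2 / (B + 1) by rewrite divr_gt0 // ltr_wpDl.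
have /cvgrPdist_le /(_ _ e2) [K1 _ hK1] := @tower_sum_cvg (residue_class r) _ hv.
have [K2 _ hK2] := return_tail_rest e3.
exists (K1 + K2)%N => // K /= hK.
have bP : bm Y (fun y => (ph (lp y) <= K)%N%:R * v (F y)).
  by apply: bmM => //; exact: (bm_lp (fun k => ph k <= K)%N).
pose I : R := (dd %| r)%N%:R.
have key y : Y y -> \sum_(l < K) (residue_class r.+1 l)%:R * ((l < ph (lp y))%N%:R * v (f (iter l f y))) =
   \sum_(l < K.+1) (residue_class r l)%:R * ((l < ph (lp y))%N%:R * v (iter l f y)) +
   I * ((ph (lp y) <= K)%N%:R * v (F y) - v y).
  move=> Yy; have p0 := gm_ph X (lp y).
  rewrite big_ord_recl /= p0 /residue_class add0n -/I mul1r.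
  have step : \sum_(l < K) (residue_class r.+1 l)%:R * ((l < ph (lp y))%N%:R * v (f (iter l f y))) =
     \sum_(l < K) (residue_class r l.+1)%:R * ((l.+1 < ph (lp y))%N%:R * v (f (iter l f y))) +
     I * ((ph (lp y) <= K)%N%:R * v (F y)).
    apply/eqP; rewrite addrC -subr_eq -sumrB; apply/eqP.
    have e l : (residue_class r.+1 l)%:R * ((l < ph (lp y))%N%:R * v (f (iter l f y))) -
      (residue_class r l.+1)%:R * ((l.+1 < ph (lp y))%N%:R * v (f (iter l f y))) =
      (ph (lp y) == l.+1)%:R * (I * v (F y)).
      rewrite /residue_class addSnnS; case: (ltngtP (ph (lp y)) l.+1) => h.
      - by rewrite !mul0r !mulr0 subrr.
      - by rewrite subrr mul0r.
      - rewrite mul0r mulr0 subr0 !mul1r -iterS -h -Ff //; congr (_ * _).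
        by rewrite /I -addSnnS -h dvdn_addr // dd_ph.
    rewrite (eq_bigr (fun l : 'I_K => (ph (lp y) == l.+1)%:R * (I * v (F y)))) //.
    have := sum_eqS R K p0; rewrite -mulr_suml => h.
    have -> : \sum_(i < K) (ph (lp y) == i.+1)%:R = (ph (lp y) <= K)%N%:R :> R.
      by move: h; case: leqP => _ /= h; lra.
    ring.
  rewrite step /residue_class; rewrite -/I; ring.
have eqK : series (fun l => (residue_class r.+1 l)%:R * visit (fun x => v (f x)) l) K =
  series (fun l => (residue_class r l)%:R * visit v l) K.+1 - I * EY (fun y => (K < ph (lp y))%N%:R * v (F y)).
  have bs1 l : bm Y (fun y => (residue_class r.+1 l)%:R * ((l < ph (lp y))%N%:R * v (f (iter l f y)))).
    by apply: bmZ; exact: (bm_visit l hvf).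
  have bs2 l : bm Y (fun y => (residue_class r l)%:R * ((l < ph (lp y))%N%:R * v (iter l f y))).
    by apply: bmZ; exact: (bm_visit l hv).
  rewrite /series /= !big_mkord.
  transitivity (EY (fun y => \sum_(l < K) (residue_class r.+1 l)%:R * ((l < ph (lp y))%N%:R * v (f (iter l f y))))).
    by rewrite Ex_sum //; apply: eq_bigr => l _; rewrite ExZ //; exact: (bm_visit l hvf).
  rewrite (eq_Ex _ key) ExD //; [|by apply: bm_sum|by apply: bmZ; exact: bmB].
  congr (_ + _); first by rewrite Ex_sum //; apply: eq_bigr => l _; rewrite ExZ //; exact: bm_visit.
  rewrite ExZ //; last exact: bmB.
  rewrite -mulrN; congr (_ * _); rewrite ExB // -(Finv vY) -ExB // -mulN1r -ExZ //; last first.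
    by apply: bmM => //; exact: (bm_lp (fun k => K < ph k)%N).
  by apply: eq_Ex => y _; case: leqP => _; rewrite ?mul1r ?mul0r; ring.
rewrite eqK opprB addrCA addrC; apply: le_trans (ler_normD _ _) _.
have h1 := hK1 K.+1; rewrite /= in h1.
have h2 := hK2 K; rewrite /= in h2.
have Kp : `|I * EY (fun y => (K < ph (lp y))%N%:R * v (F y))| <= eps / 2.
  rewrite normrM; apply: (@le_trans _ _ (B * return_tail X K)).
    apply: (@le_trans _ _ (`|EY (fun y => (K < ph (lp y))%N%:R * v (F y))|)).
      by rewrite ler_piMl // /I; case: (dd %| r)%N; rewrite ?normr1 ?normr0.
    have bq : bm Y (fun y => (K < ph (lp y))%N%:R * v (F y)).
      by apply: bmM => //; exact: (bm_lp (fun k => K < ph k)%N).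
    apply: le_trans (ler_norm_Ex _ mY bq) _.
    rewrite -EY_ptail -ExZ //; last exact: (bm_lp (fun k => K < ph k)%N).
    apply: le_Ex => //; [exact: bm_norm|apply: bmZ; exact: (bm_lp (fun k => K < ph k)%N)|].
    by move=> y _; rewrite normrM ger0_norm // mulrC; apply: ler_wpM2r.
  apply: (@le_trans _ _ ((B + 1) * (eps / 2 / (B + 1)))); last by rewrite mulrC divfK // gt_eqF // ltr_wpDl.
  apply: ler_pM => //; [exact: return_tail_ge0|by rewrite lerDl|].
  apply: le_trans (h2 _); last by apply: leq_trans hK; rewrite leq_addl.
  by have := return_tail_sum K.+1; rewrite big_ord_recr /=; lra.
rewrite -[leRHS](divfK (x := 2)) // mulrDr mulr1; apply: lerD => //.
by apply: h1; apply: leqW; apply: leq_trans hK; rewrite leq_addr.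
Qed.

Lemma tower_sum_shift_iter r n v : bmM' v -> tower_sum (residue_class (r + n)) (fun x => v (iter n f x)) = tower_sum (residue_class r) v.
Proof.
move=> hv; elim: n r => [|n IH] r; first by rewrite addn0.
rewrite addnS -(IH r) -(tower_sum_shift (r + n) (bm_f n hv)); congr tower_sum.
by apply/funext => x; rewrite iterSr.
Qed.

Hypothesis mixf : forall A B, measurable A -> measurable B ->
  (fun n => fine (mu (A `&` (iter n f) @^-1` B))) @ \oo --> fine (mu A) * fine (mu B).

Lemma Em_f n v : bmM' v -> Em (fun x => v (iter n f x)) = Em v.
Proof.
move=> hv; elim: n => [//|n IH]; rewrite -IH.
rewrite -[RHS](@Ex_invariant _ _ _ mu setT f mM mf _ muf _ (bm_f n hv)) //.
by apply: eq_Ex => x _; rewrite iterSr.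
Qed.

(* Averages of [u o f^m] along a sparse arithmetic progression of times [m] are small in [L^2] by
   mixing, while [tower_sum (residue_class r)] takes the same value on all of them. *)
Lemma tower_sum_class_mean r A : measurable A ->
  tower_sum (residue_class r) (fun x => \1_A x - fine (mu A)) = 0.
Proof.
move=> mA; set a := fine (mu A); pose u x : R := \1_A x - a.
have PB0 : 0 <= PB by have := return_tail_sum 0; rewrite big_ord0.
have bA : bmM' (\1_A : M -> R) by exact: bm_indic.
have hu : bmM' u by apply: bmB => //; exact: bm_cst.
have a01 : 0 <= a <= 1.
  rewrite fine_ge0 //= -lee_fin fineK ?fin_num_measure //; exact: probability_le1.
have u1 x : `|u x| <= 1.
  rewrite /u indicE; move: a01 => /andP[? ?]; rewrite ler_norml.
  by case: (_ \in _) => /=; apply/andP; split; lra.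
have EA : Em (\1_A) = a by rewrite Ex_indic // setTI.
have Ec (z : R) : Em (fun=> z) = z by rewrite Ex_cst // probability_setT mulr1.
have corr n : Em (fun x => u x * u (iter n f x)) = fine (mu (A `&` (iter n f) @^-1` A)) - a * a.
  have bAn : bmM' (fun x => \1_A (iter n f x) : R) by exact: bm_f.
  have mAn : measurable (A `&` (iter n f) @^-1` A).
    by apply: measurableI => //; rewrite -[X in measurable X]setTI; exact: measurable_fl.
  have -> : Em (fun x => u x * u (iter n f x)) =
    Em (fun x => \1_A x * \1_A (iter n f x) - a * \1_A x - a * \1_A (iter n f x) + a * a).
    by apply: eq_Ex => x _; rewrite /u; ring.
  have b1 : bmM' (fun x => \1_A x * \1_A (iter n f x) : R) by exact: bmM.
  have b2 : bmM' (fun x => a * \1_A x) by exact: bmZ.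
  have b3 : bmM' (fun x => a * \1_A (iter n f x)) by exact: bmZ.
  have b4 : bmM' (fun=> a * a) by exact: bm_cst.
  rewrite (ExD _ mM (bmB (bmB b1 b2) b3) b4) (ExB _ mM (bmB b1 b2) b3) (ExB _ mM b1 b2) (ExZ mu mM a bA) (ExZ mu mM a bAn) Ec.
  rewrite (Em_f n bA) EA (_ : Em (fun x => _ * _) = fine (mu (A `&` (iter n f) @^-1` A))); first by ring.
  have -> : Em (fun x => \1_A x * \1_A (iter n f x)) = Em (\1_(A `&` (iter n f) @^-1` A)).
    by apply: eq_Ex => x _; rewrite indicI /= !indicE.
  by rewrite Ex_indic // setTI.
apply/eqP; rewrite -normr_le0; apply/ler_addgt0Pr => eps e0; rewrite add0r.
pose q := eps / (3 * (PB + 1)).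
have q0 : 0 < q by rewrite divr_gt0 // mulr_gt0 // ltr_wpDl.
have q2 : 0 < q ^+ 2 by rewrite exprn_gt0.
have /cvgrPdist_le /(_ _ q2) [m0 _ hm0] := mixf mA mA.
(* A multiple of [dd], so that shifts by [m * j] preserve the class, and beyond [m0], so that all
   correlations along the progression are at most [q ^ 2]. *)
pose m := (dd * m0.+1)%N.
have mm j : (0 < j)%N -> `|Em (fun x => u x * u (iter (m * j) f x))| <= q ^+ 2.
  move=> j0; rewrite corr distrC; apply: hm0 => /=; rewrite /m.
  by have := dd0; clear -j0; nia.
pose S J x := \sum_(j < J) u (iter (m * j) f x).
have bu j : bmM' (fun x => u (iter (m * j) f x)) by exact: bm_f.
have bS J : bmM' (S J) by apply: bm_sum => j _.
have QS J : Em (fun x => S J x ^+ 2) <= J%:R ^+ 2 * q ^+ 2 + J%:R.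
  elim: J => [|J IH].
    have -> : Em (fun x => S 0%N x ^+ 2) = Em (fun=> 0) by apply: eq_Ex => x _; rewrite /S big_ord0 expr2 mul0r.
    by rewrite Ec expr2 !mul0r addr0.
  have -> : Em (fun x => S J.+1 x ^+ 2) = Em (fun x => S J x ^+ 2 +
     (\sum_(j < J) 2 * (u (iter (m * j) f x) * u (iter (m * J) f x)) + u (iter (m * J) f x) ^+ 2)).
    apply: eq_Ex => x _; rewrite -mulr_sumr -mulr_suml /S big_ord_recr /=; ring.
  have bc j : bmM' (fun x => u (iter (m * j) f x) * u (iter (m * J) f x)) by exact: bmM.
  have b1 : bmM' (fun x => S J x ^+ 2) by exact: bmX.
  have b2 : bmM' (fun x => u (iter (m * J) f x) ^+ 2) by exact: bmX.
  have b3 : bmM' (fun x => \sum_(j < J) 2 * (u (iter (m * j) f x) * u (iter (m * J) f x))).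
    by apply: bm_sum => j _; exact: bmZ.
  rewrite (ExD _ mM b1 (bmD b3 b2)) (ExD _ mM b3 b2) Ex_sum //; last by move=> j _; exact: bmZ.
  have -> : J.+1%:R ^+ 2 * q ^+ 2 + J.+1%:R = (J%:R ^+ 2 * q ^+ 2 + J%:R) + ((J%:R * (2 * q ^+ 2)) + (q ^+ 2 + 1)).
    by rewrite -natr1; ring.
  apply: lerD => //; apply: lerD.
    rewrite -[J in J%:R * _]card_ord mulr_natl -sumr_const; apply: ler_sum => j _.
    rewrite ExZ //; apply: ler_wpM2l => //.
    have jJ := ltn_ord j.
    have -> : Em (fun x => u (iter (m * j) f x) * u (iter (m * J) f x)) =
        Em (fun x => u x * u (iter (m * (J - j)) f x)).
      rewrite -[RHS](Em_f (m * j)); last by apply: bmM => //; exact: bm_f.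
      apply: eq_Ex => x _; rewrite -iterD -mulnDr subnK //; exact: ltnW.
    by apply: le_trans (ler_norm _) _; apply: mm; rewrite subn_gt0.
  apply: (@le_trans _ _ 1); last by rewrite lerDr ltW.
  rewrite -(Ec 1); apply: le_Ex => //; first exact: bm_cst.
  move=> x _; rewrite -real_normK ?num_real //; apply: exprn_ile1 => //.
have towS J : tower_sum (residue_class r) (S J) = J%:R * tower_sum (residue_class r) u.
  elim: J => [|J IH].
    rewrite mul0r (_ : S 0%N = (fun x => 0 * u x)) ?towZ ?mul0r //.
    by apply/funext => x; rewrite /S big_ord0 mul0r.
  have -> : S J.+1 = (fun x => S J x + u (iter (m * J) f x)).
    by apply/funext => x; rewrite /S big_ord_recr.
  rewrite towD // IH -natr1 mulrDl mul1r; congr (_ + _).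
  rewrite -[RHS](tower_sum_shift_iter r (m * J) hu); congr tower_sum.
  apply/funext => l; rewrite /residue_class addnA; apply/esym/dvdn_addl.
  by rewrite /m -mulnA dvdn_mulr.
pose J := (Num.bound (q ^+ 2)^-1).+1.
have J0 : 0 < J%:R :> R by rewrite ltr0n.
have hJ : J%:R^-1 <= q ^+ 2.
  rewrite -[leRHS]invrK lef_pV2 ?posrE ?invr_gt0 //.
  apply: le_trans (ltW (archi_boundP _)) _; first by rewrite invr_ge0 ltW.
  by rewrite ler_nat.
pose U x := J%:R^-1 * S J x.
have bU : bmM' U by exact: bmZ.
have -> : tower_sum (residue_class r) u = tower_sum (residue_class r) U by rewrite towZ // towS mulrA mulVf ?mul1r // gt_eqF.
apply: le_trans (tower_sum_abs _ bU) _.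
have hU : Em (fun x => U x ^+ 2) <= 2 * q ^+ 2.
  have -> : Em (fun x => U x ^+ 2) = Em (fun x => (J%:R^-1) ^+ 2 * S J x ^+ 2).
    by apply: eq_Ex => x _; rewrite /U exprMn.
  rewrite ExZ //; last exact: bmX.
  apply: (@le_trans _ _ ((J%:R^-1) ^+ 2 * (J%:R ^+ 2 * q ^+ 2 + J%:R))).
    by apply: ler_wpM2l => //; exact: exprn_ge0 (ltW _).
  have -> : (J%:R^-1) ^+ 2 * (J%:R ^+ 2 * q ^+ 2 + J%:R) = q ^+ 2 + J%:R^-1.
    by field; rewrite gt_eqF.
  by lra.
have hUa : Em (fun x => `|U x|) <= 3 * q.
  (* The pointwise bound of [|U|] by [q + U ^ 2 / q] stands in for the Cauchy-Schwarz inequality. *)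
  apply: (@le_trans _ _ (Em (fun x => q + q^-1 * U x ^+ 2))).
    apply: le_Ex => //; [exact: bm_norm|by apply: bmD; [exact: bm_cst|apply: bmZ; exact: bmX]|].
    move=> x _; rewrite -(ler_pM2l q0).
    have -> : q * (q + q^-1 * U x ^+ 2) = q ^+ 2 + `|U x| ^+ 2.
      by rewrite [in RHS]real_normK ?num_real //; field; rewrite gt_eqF.
    have h1 := sqr_ge0 (q - `|U x|); have h2 := sqr_ge0 q; have h3 := sqr_ge0 `|U x|.
    by move: h1 h2 h3; rewrite !expr2 !mulrBl !mulrBr; lra.
  rewrite ExD //; [|exact: bm_cst|by apply: bmZ; exact: bmX].
  have bU2 : bmM' (fun x => U x ^+ 2) by exact: bmX.
  rewrite (ExZ mu mM q^-1 bU2) Ec (_ : 3 * q = q + q^-1 * (2 * q ^+ 2)); last by field; rewrite gt_eqF.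
  by rewrite lerD2l; apply: ler_wpM2l => //; rewrite invr_ge0 ltW.
apply: (@le_trans _ _ ((PB + 1) * (3 * q))).
  by apply: ler_pM => //; [apply: Ex_ge0|rewrite lerDl].
rewrite (_ : (PB + 1) * (3 * q) = eps) // /q; field; by rewrite gt_eqF // ltr_wpDl.
Qed.

(** For constants the classes have equal weight by [tower_sum_shift_iter] and add up to [PB].
    Centred indicators give 0 by [tower_sum_class_mean], and [linear_ext0] extends the identity to
    all bounded [v]. *)
Lemma tower_sum_class r v : bmM' v -> tower_sum (residue_class r) v = PB / dd%:R * Em v.
Proof.
have b1 : bmM' (fun=> 1) by exact: bm_cst.
have t1 k : tower_sum (residue_class k) (fun=> 1) = tower_sum (residue_class 0) (fun=> 1).
  by rewrite -(tower_sum_shift_iter 0 k b1) add0n.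
have E1' : Em (fun=> 1) = 1 by rewrite Ex_cst // probability_setT mulr1.
have c1 : tower_sum (residue_class 0) (fun=> 1) = PB / dd%:R.
  have dd1 : dd%:R != 0 :> R by rewrite pnatr_eq0 -lt0n.
  apply: (mulIf dd1); rewrite divfK // mulr_natr -[dd in _ *+ dd]card_ord -sumr_const.
  rewrite (eq_bigr (fun k : 'I_dd => tower_sum (residue_class k) (fun=> 1))) => [|k _]; last by rewrite t1.
  have -> : PB = tower_sum xpredT (fun=> 1) by rewrite tower_sum_full // E1' mulr1.
  apply/esym/tower_sum_eq; rewrite (_ : series _ = (fun K => \sum_(k < dd)
      series (fun l => (residue_class k l)%:R * visit (fun=> 1) l) K)).
    by apply: cvgn_sum => k; exact: (@tower_sum_cvg (residue_class k) _ b1).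
  apply/funext => K; rewrite /series /= exchange_big /=; apply: eq_bigr => l _.
  rewrite mul1r -mulr_suml (_ : \sum_(i < dd) _ = 1) ?mul1r //.
  have hl : ((dd - l %% dd) %% dd < dd)%N by rewrite ltn_mod.
  rewrite (bigD1 (Ordinal hl)) //= big1 ?addr0.
    rewrite /residue_class (_ : (dd %| _)%N = true) //; apply/eqP.
    rewrite -modnDmr modn_mod modnDmr -modnDml subnKC ?modnn //; exact/ltnW/ltn_pmod.
  move=> k hk; rewrite (_ : residue_class k l = false) //; apply: contraNF hk => /eqP h.
  apply/eqP/val_inj => /=; have lk := ltn_ord k.
  have hl2 : (l %% dd < dd)%N by rewrite ltn_mod.
  move: h; rewrite -modnDml; have [e|ne] := eqVneq (l %% dd)%N 0%N.
    by rewrite e subn0 modnn add0n modn_small.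
  rewrite (modn_small (m := (dd - l %% dd)%N)); last by clear -ne hl2; lia.
  move/eqP => /dvdnP[t ht]; have : t = 1%N by clear -ne ht hl2 lk; nia.
  by move=> e; move: ht; rewrite e mul1n; clear; lia.
move=> hv; apply/eqP; rewrite -subr_eq0; apply/eqP.
have PB0 : 0 <= PB by have := return_tail_sum 0; rewrite big_ord0.
have Pd0 : 0 <= PB / dd%:R by rewrite divr_ge0.
apply: (@linear_ext0 R dM M setT mM (fun v => tower_sum (residue_class r) v - PB / dd%:R * Em v) (PB + PB / dd%:R)) => //.
- by move=> u w hu hw; rewrite towD // ExD //; ring.
- by move=> c u hu; rewrite towZ // ExZ //; ring.
- move=> u B B0 hu uB; have uB' x : `|u x| <= B by exact: uB.
  apply: le_trans (ler_normB _ _) _; rewrite mulrDl; apply: lerD.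
    by rewrite [leRHS]mulrC; exact: tower_sum_le.
  by rewrite normrM ger0_norm //; apply: ler_wpM2l => //; apply: Ex_bound.
- move=> A mA; have bA : bmM' (\1_A : M -> R) by exact: bm_indic.
  have := tower_sum_class_mean r mA.
  have -> : (fun x => \1_A x - fine (mu A)) = (fun x => \1_A x + - fine (mu A) * 1 : R).
    by apply/funext => x; rewrite mulr1.
  rewrite towD //; last exact: bmZ.
  by rewrite towZ // t1 c1 Ex_indic // setTI => <-; ring.
Qed.

Hypothesis Kptail : forall eps : R, 0 < eps -> \forall K \near \oo, K%:R * return_tail X K <= eps.

(** A kick at backward position [i] sits at level [ph - 1 - i]. Since [dd] divides [ph], asking that
    [i] and [k] agree modulo [dd] selects the levels [l] with [dd] dividing [l + k + 1]. Blocks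
    longer than [K] are lost in the truncation, at a cost of order [K * return_tail X K], which
    tends to 0. *)
Lemma kick_class_sum B v k : dyn_holder B v ->
  `|\sum_(i < k.+1 | (i %% dd == k %% dd)%N) EY (fun y => kick v y i) - PB / dd%:R * Em v| <= B * s k.
Proof.
move=> hv; have B0 := dyn_holder_ge0 hv; have [mv vB v0 _] := hv.
have bv : bmM' v by split; [|exists B].
rewrite distrC -(tower_sum_class k.+1 bv); apply: (lim_dist (@tower_sum_cvg (residue_class k.+1) _ bv)) => eps e0.
have e1 : 0 < eps / (2 * B + 1) by rewrite divr_gt0 // ltr_wpDl // mulr_ge0.
have [K0 _ hK0] := Kptail e1.
exists (K0 + k.+1)%N => // K /= hK.
have kK : (k.+1 <= K)%N by apply: leq_trans hK; rewrite leq_addl.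
have {}hK0 : K%:R * return_tail X K <= eps / (2 * B + 1).
  by apply: hK0; apply: leq_trans hK; rewrite leq_addr.
pose a i : R := (i %% dd == k %% dd)%N%:R * EY (fun y => kick v y i).
have -> : \sum_(i < k.+1 | (i %% dd == k %% dd)%N) EY (fun y => kick v y i) = \sum_(i < k.+1) a i.
  rewrite big_mkcond; apply: eq_bigr => i _; rewrite /a.
  by case: ifP; rewrite ?mul1r ?mul0r.
have tailL : `|\sum_(i < K) a i - \sum_(i < k.+1) a i| <= B * s k.
  rewrite (@sum_ord_split _ a k.+1 K) // addrAC subrr add0r.
  apply: (@le_trans _ _ (B * \sum_(k.+1 <= i < K) kick_prob i)).
    rewrite mulr_sumr; apply: le_trans (ler_norm_sum _ _ _) _; apply: ler_sum => i _.
    rewrite normrM; apply: le_trans (EY_kick_le i hv); rewrite ler_piMl //.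
    by case: (_ == _); rewrite ?normr1 ?normr0.
  apply: ler_wpM2l => //; apply: le_trans (sdecr (leqnSn k)).
  by have [_ /(_ k.+1 K)] := hL; rewrite mul1r.
set Sr := series _ K.
have -> : Sr - \sum_(i < k.+1) a i = (Sr - \sum_(i < K) a i) + (\sum_(i < K) a i - \sum_(i < k.+1) a i).
  by ring.
apply: le_trans (ler_normD _ _) _; rewrite [leRHS]addrC; apply: lerD => //.
have b1 l : bm Y (fun y => (residue_class k.+1 l)%:R * ((l < ph (lp y))%N%:R * v (iter l f y))).
  by apply: bmZ; exact: bm_visit.
have b2 i : bm Y (fun y => (i %% dd == k %% dd)%N%:R * kick v y i) by apply: bmZ; exact: (bm_kick hv i).
have -> : Sr = EY (fun y => \sum_(l < K) (residue_class k.+1 l)%:R * ((l < ph (lp y))%N%:R * v (iter l f y))).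
  rewrite /Sr /series /= big_mkord Ex_sum //; apply: eq_bigr => l _.
  by rewrite ExZ //; exact: bm_visit.
have -> : \sum_(i < K) a i = EY (fun y => \sum_(i < K) (i %% dd == k %% dd)%N%:R * kick v y i).
  rewrite Ex_sum //; apply: eq_bigr => i _; rewrite ExZ //; exact: (bm_kick hv i).
have bs1 : bm Y (fun y => \sum_(l < K) (residue_class k.+1 l)%:R * ((l < ph (lp y))%N%:R * v (iter l f y))) by apply: bm_sum.
have bs2 : bm Y (fun y => \sum_(i < K) (i %% dd == k %% dd)%N%:R * kick v y i) by apply: bm_sum.
rewrite -ExB //.
have bT : bm Y (fun y => (K < ph (lp y))%N%:R : R) by exact: (bm_lp (fun k => K < ph k)%N).
apply: (@le_trans _ _ (EY (fun y => (2 * B * K%:R) * (K < ph (lp y))%N%:R))); last first.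
  rewrite ExZ // EY_ptail (_ : 2 * B * K%:R * return_tail X K = 2 * B * (K%:R * return_tail X K)); last by ring.
  apply: (@le_trans _ _ ((2 * B + 1) * (eps / (2 * B + 1)))).
    apply: ler_pM => //; [by rewrite mulr_ge0|by rewrite mulr_ge0 // return_tail_ge0|by rewrite lerDl].
  by rewrite mulrC divfK // gt_eqF // ltr_wpDl // mulr_ge0.
apply: le_trans (ler_norm_Ex _ mY (bmB bs1 bs2)) _.
apply: le_Ex => //; [by apply: bm_norm; exact: bmB|exact: bmZ|].
move=> y Yy; have p0 := gm_ph X (lp y); have ddp := dd_ph Yy.
case: (ltnP K (ph (lp y))) => hKp.
  have h1 : `|\sum_(l < K) (residue_class k.+1 l)%:R * ((l < ph (lp y))%N%:R * v (iter l f y))| <= K%:R * B.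
    apply: le_trans (ler_norm_sum _ _ _) _.
    rewrite mulr_natl -[K in leRHS]card_ord -sumr_const; apply: ler_sum => l _.
    rewrite mulrA -natrM mulnb normrM ger0_norm // -[leRHS]mul1r; apply: ler_pM => //.
    by case: (_ && _).
  have h2 : `|\sum_(i < K) (i %% dd == k %% dd)%N%:R * kick v y i| <= K%:R * B.
    apply: le_trans (ler_norm_sum _ _ _) _.
    rewrite mulr_natl -[K in leRHS]card_ord -sumr_const; apply: ler_sum => l _.
    rewrite /kick mulrA -natrM mulnb normrM ger0_norm // -[leRHS]mul1r; apply: ler_pM => //.
    by case: (_ && _).
  by apply: le_trans (ler_normB _ _) _; rewrite mulr1; lra.
rewrite mulr0 normr_le0 subr_eq0; apply/eqP.
transitivity (\sum_(l < K) ((l < ph (lp y)) && (ph (lp y) <= l + K))%N%:R * ((residue_class k.+1 l)%:R * v (iter l f y))).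
  by apply: eq_bigr => l _; rewrite (leq_trans hKp (leq_addl _ _)) andbT mulrCA.
rewrite (sum_window (fun l => (residue_class k.+1 l)%:R * v (iter l f y))); apply: eq_bigr => i _.
rewrite /kick; case: (ltnP i (ph (lp y))) => hi; last by rewrite /= !mul0r mulr0.
have -> : ((ph (lp y)).-1 - i < K)%N by clear -hKp p0; lia.
rewrite !mul1r; congr ((nat_of_bool _)%:R * _).
rewrite /residue_class (_ : ((ph (lp y)).-1 - i + k.+1 = ph (lp y) + k - i)%N); last by clear -hi p0; lia.
have hik : (i <= ph (lp y) + k)%N by clear -hi; lia.
rewrite -eqn_mod_dvd // eq_sym -modnDml; case/dvdnP: ddp => t ->.
by rewrite modnMl add0n.
Qed.

End Classes.

Variables (b A : R).
Hypothesis b1 : 1 < b.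
Hypothesis A0 : 0 <= A.
Hypothesis phA : forall n, return_tail X n <= A * psi b n.
Hypothesis s00 : 0 < s 0%N.
Hypothesis cone_lift : forall N (u : Yb -> R), cone G lt th Ch N.+1 u -> exists u' : Yb -> R, gCn X u' /\
  forall g, bmT g -> E (fun x => u' x * g x) = E (fun x => u x * g (iter N.+1 G x)).
Hypothesis letter_pos : forall y, Y y -> 0 < E (fun x => (pj X (ph (lp y)) (lt x))%:R).
Hypothesis mix : forall A B, measurable A -> measurable B ->
  (fun n => fine (mu (A `&` (iter n f) @^-1` B))) @ \oo --> fine (mu A) * fine (mu B).

Lemma Kptail_small eps : 0 < eps -> \forall K \near \oo, K%:R * return_tail X K <= eps.
Proof.
move=> e0; have e1 : 0 < eps / (A + 1) by rewrite divr_gt0 // ltr_wpDl.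
have c0 : 0 < b - 1 by rewrite subr_gt0.
have [N hN] := powR_to0 c0 e1; exists N => // K /= hK.
apply: (@le_trans _ _ ((A + 1) * (eps / (A + 1)))); last by rewrite mulrC divfK // gt_eqF // ltr_wpDl.
apply: (@le_trans _ _ (A * psi (b - 1) K)); last first.
  by apply: ler_pM => //; [exact: psi_ge0|rewrite lerDl|exact: hN].
rewrite -psi_succ mulrCA; apply: ler_pM => //; [exact: return_tail_ge0|by rewrite ler_nat].
Qed.

Lemma small_power n : exists N, th ^+ N * n%:R <= psi b n.
Proof.
have p0 := psi_gt0 b n; have q0 : 0 < psi b n / (n%:R + 1) by rewrite divr_gt0 // ltr_wpDl.
have h : `|th| < 1 by rewrite ger0_norm; case/andP: th01 => // /ltW.
have /cvgrPdist_le /(_ _ q0) [N _ hN] := cvg_expr h; exists N.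
have {hN} := hN N (leqnn N); rewrite /= sub0r normrN => hN.
apply: (@le_trans _ _ (psi b n / (n%:R + 1) * (n%:R + 1))); last by rewrite divfK // gt_eqF // ltr_wpDl.
apply: ler_pM => //; [by apply: exprn_ge0; case/andP: th01 => /ltW|exact: le_trans (ler_norm _) hN|].
by rewrite lerDl.
Qed.

(** The kicks have mass [V = PB / dd * Em v] in every residue class, and the fresh parts of [w] sum
    to [W = PB * Em w]. The period cancels, as [psum e n / (dd * gkap X)] tends to [1 / PB]. *)
Theorem tower_decay : exists dd e, [/\ (0 < dd)%N,
  exists2 Ce, 0 <= Ce & forall n, `|e n| <= Ce * psi b n,
  exists2 K, 0 <= K & forall n,
     `|psum e n / (dd%:R * gkap X) - (1 + (PB - \sum_(j < n.+1) return_tail X j) / PB) / PB| <= K * Zt b n &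
  exists2 C, 0 <= C & forall Bv Bw v w n, dyn_holder Bv v -> dyn_holder Bw w ->
    `|PB * Em (fun x => v x * w (iter n.+1 f x)) -
      PB ^+ 2 * Em v * Em w * (psum e n / (dd%:R * gkap X))| <= C * Bv * Bw * eta b s (n.+1 %/ 3)%N].
Proof.
have [dd [e [dd0 hdd [Ce Ce0 hCe] hexp hmain]]] := regen_expansion b1 A0 phA.
exists dd, e; split => //; first by exists Ce.
  apply: hexp; first exact: return_tail_sum.
  by move=> eps e0; have [N _ hN] := return_tail_rest e0; exists N; apply: hN => /=.
have [L1 L10 hL1] := damped_visit_tail th01 vis_ph b1 A0 phA s0 hM.
set lam := (fun N => _) in hL1.
have dd_ph y : Y y -> (dd %| ph (lp y))%N by move=> Yy; apply: hdd; exact: letter_pos.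
have D0 := D_ge0 X; have pp0 := ppC_ge0 b1; have pc0 := psiC_ge0 b1.
have t0' := t0; have k0 := gm_kap X.
have et0 := eta_ge0 b s0; have se := s_le_eta b s0; have pe := psi_le_eta b s0.
pose L := L1 + Ch * D * L1 * A * ppC b + 1.
have L0 : 0 <= L by rewrite /L !addr_ge0 // !mulr_ge0.
have hL' : tailb L (eta b s) lam.
  apply: tailb_weaken hL1 => n; apply: ler_wpM2r => //.
  by rewrite /L -addrA lerDl addr_ge0 // !mulr_ge0.
have c0 : 0 <= Ch / th by rewrite divr_ge0 // ltW.
have [K K0 hK] := hmain s L s0 sdecr L0.
pose J := 2 * 1 * L1 * (1 + psiC b) * eta b s 0%N.
have J0 : 0 <= J by rewrite !mulr_ge0 // addr_ge0.
pose C := 1 + (Ch * D * J + Ch * (s 0%N)^-1) + K * (3 + Ch) * (1 + Ch / th).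
have s0i : 0 <= (s 0%N)^-1 by rewrite invr_ge0.
exists C; first by rewrite /C !addr_ge0 // !mulr_ge0 // addr_ge0.
move=> Bv Bw v w n hv hw.
have Bv0 := dyn_holder_ge0 hv; have Bw0 := dyn_holder_ge0 hw.
(* [N] depends on [n]: an error of order [th ^ N] in each of the [n + 1] terms must stay below
   [psi b]. The constant [C] chosen above does not involve [N]. *)
have [N hN] := small_power n.+1.
have /choice [u1 hu1] : forall i, exists u' : Yb -> R, gCn X u' /\
    forall g, bmT g -> E (fun x => u' x * g x) =
      E (fun x => (cyl_kick v N i x + 2 * Bv * (kick_letter i (lt (iter N G x)))%:R) * g (iter N.+1 G x)).
  by move=> i; apply: cone_lift; exact: cone_cyl_kick hv N i.
have /choice [u2 hu2] : forall i, exists u' : Yb -> R, gCn X u' /\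
    forall g, bmT g -> E (fun x => u' x * g x) =
      E (fun x => (2 * Bv * (kick_letter i (lt (iter N G x)))%:R) * g (iter N.+1 G x)).
  by move=> i; apply: cone_lift; apply: cone_kick_letter => //; exact: mulr_ge0.
have one : bmT (fun=> 1) by exact: bm_cst.
have bV i := bm_cyl_kick hv N i; have bL i := bm_kick_letter N i.
have b2L i : bmT (fun x => 2 * Bv * (kick_letter i (lt (iter N G x)))%:R) by exact: bmZ.
have E1' (u : Yb -> R) : E (fun x => u x * 1) = E u by apply: eq_Ex => x _; rewrite mulr1.
have EG (g : Yb -> R) k : bmT g -> E (fun x => g (iter k G x)) = E g.
  move=> hg; elim: k => [//|k IH]; rewrite -IH -[RHS](gm_inv X); last first.
    elim: k {IH} => [//|k IH]; apply: eq_bm (bm_comp_G X IH) => x _; by rewrite -iterSr.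
  by apply: eq_Ex => x _; rewrite iterSr.
have EL i : E (fun x => (kick_letter i (lt (iter N G x)))%:R) = kick_prob i by exact: (EG (fun x => (kick_letter i (lt x))%:R) N (bm_letter X (kick_letter i))).
have Eu2 i : E (u2 i) = 2 * Bv * kick_prob i.
  by have [_ h] := hu2 i; have := h _ one; rewrite !E1' => ->; rewrite ExZ // EL.
have Eu1 i : E (u1 i) = E (cyl_kick v N i) + 2 * Bv * kick_prob i.
  have [_ h] := hu1 i; have := h _ one; rewrite !E1' => ->.
  by rewrite (ExD _ mT (bV i) (b2L i)) ExZ // EL.
have EV i : `|E (cyl_kick v N i)| <= Bv * kick_prob i.
  apply: le_trans (ler_norm_Ex _ mT (bV i)) _; rewrite -EL -ExZ //.
  by apply: le_Ex => //; [exact: bm_norm|exact: bmZ|move=> x _; exact: cyl_kick_le].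
have l01 i : 0 <= kick_prob i <= s i.
  by apply/andP; split; [case: hL|have := tailb_ub i hL; rewrite mul1r].
have l0 i : 0 <= kick_prob i by case/andP: (l01 i).
(* In [B1] the 3 is 1 for [cyl_kick] and 2 for the part added to make it positive; [Ch] accounts for
   the approximation error in the class sums. *)
pose B1 := (3 + Ch) * Bv; pose B2 := (1 + Ch / th) * Bw.
have B10 : 0 <= B1 by rewrite mulr_ge0 // addr_ge0.
have B20 : 0 <= B2 by rewrite mulr_ge0 // addr_ge0.
have tN : th ^+ N * n.+1%:R <= psi b n.+1 := hN.
have thN0 : 0 <= th ^+ N by rewrite exprn_ge0 // ltW.
have tN1 : th ^+ N <= psi b n.+1.
  by apply: le_trans tN; rewrite ler_peMr // ler1n.
have hB1 i : E (u1 i) <= B1 * kick_prob i.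
  rewrite Eu1; have := EV i; rewrite ler_norml => /andP[_ h].
  have : 0 <= Ch * Bv * kick_prob i by rewrite !mulr_ge0.
  by rewrite /B1; lra.
have hB1' i : E (u2 i) <= B1 * kick_prob i.
  rewrite Eu2; have : 0 <= Ch * Bv * kick_prob i by rewrite !mulr_ge0.
  have : 0 <= Bv * kick_prob i by rewrite mulr_ge0.
  by rewrite /B1; lra.
have cyl_kickE i : `|EY (fun y => kick v y i) - E (cyl_kick v N i)| <= Bv * Ch * th ^+ N * kick_prob i.
  have bLv := bm_kick hv i; have bLF := bm_FN N bLv; have bVY := bm_pi (bV i).
  rewrite -(EY_N N bLv) -(pinv (bV i)) -ExB //.
  apply: le_trans (ler_norm_Ex _ mY (bmB bLF bVY)) _.
  have bk := bm_FN N (bm_lp (kick_letter i)).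
  apply: (@le_trans _ _ (EY (fun y => Bv * Ch * th ^+ N * (kick_letter i (lp (iter N F y)))%:R))).
    by apply: le_Ex => //; [apply: bm_norm; exact: bmB|exact: bmZ|move=> y Yy; exact: cyl_kick_near].
  rewrite ExZ // (EY_N N (bm_lp (kick_letter i))) (_ : EY _ = kick_prob i) //.
  exact: (pinv (bm_letter X (kick_letter i))).
have hcls k : (k <= n)%N ->
    `|\sum_(i < k.+1 | (i %% dd == k %% dd)%N) (E (u1 i) - E (u2 i)) - PB / dd%:R * Em v| <= B1 * eta b s k.
  move=> kn; have h1 := @kick_class_sum dd dd0 dd_ph mix Kptail_small Bv v k hv.
  have h2 : `|\sum_(i < k.+1 | (i %% dd == k %% dd)%N) (E (u1 i) - E (u2 i)) -
      \sum_(i < k.+1 | (i %% dd == k %% dd)%N) EY (fun y => kick v y i)| <= Bv * Ch * eta b s k.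
    rewrite -sumrB; apply: le_trans (ler_norm_sum _ _ _) _.
    apply: (@le_trans _ _ (\sum_(i < k.+1) Bv * Ch * th ^+ N * kick_prob i)).
      rewrite [leRHS](bigID (fun i : 'I_k.+1 => (i %% dd == k %% dd)%N)) /= -[leLHS]addr0.
      apply: lerD; last by apply: sumr_ge0 => i _; rewrite !mulr_ge0.
      apply: ler_sum => i _; rewrite Eu1 Eu2 addrK distrC; exact: cyl_kickE.
    rewrite -mulr_sumr -!mulrA; apply: ler_wpM2l => //; apply: ler_wpM2l => //.
    apply: le_trans (pe k); rewrite mulrC; apply: ler_pM => //; first by apply: sumr_ge0.
      by have := tailb_sum k.+1 hL; rewrite mul1r.
    apply: le_trans tN1 _; apply: psi_decr; first exact: b_ge0.
    by apply: leqW.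
  have -> : \sum_(i < k.+1 | (i %% dd == k %% dd)%N) (E (u1 i) - E (u2 i)) - PB / dd%:R * Em v =
    (\sum_(i < k.+1 | (i %% dd == k %% dd)%N) (E (u1 i) - E (u2 i)) -
      \sum_(i < k.+1 | (i %% dd == k %% dd)%N) EY (fun y => kick v y i)) +
    (\sum_(i < k.+1 | (i %% dd == k %% dd)%N) EY (fun y => kick v y i) - PB / dd%:R * Em v) by ring.
  apply: le_trans (ler_normD _ _) _.
  have h3 : Bv * s k <= Bv * eta b s k by apply: ler_wpM2l.
  have h4 : 0 <= Bv * eta b s k by exact: mulr_ge0.
  by rewrite /B1; lra.
have hpsum k : `|psum (fun j => E (fresh_obs w j)) k - PB * Em w| <= B2 * L * eta b s k.
  have h1 := visit_sum k hw; have h2 := sum_fresh_obs_near hw k; rewrite -/lam in h2.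
  have h3 : conv lam (return_tail X) k <= L1 * (A * (ppC b * eta b s k)).
    apply: (@le_trans _ _ (conv (fun i => L1 * eta b s i) (fun i => A * psi b i) k)).
      apply: ler_conv => i; first by apply/andP; split; [case: hL1|exact: tailb_ub hL1].
      by rewrite return_tail_ge0 phA.
    by rewrite convZl convZr convC; apply: ler_wpM2l => //; apply: ler_wpM2l => //; exact: conv_psi_eta.
  have -> : psum (fun j => E (fresh_obs w j)) k - PB * Em w =
    (\sum_(N < k.+1) E (fresh_obs w N) - \sum_(N < k.+1) visit w N) + (\sum_(N < k.+1) visit w N - PB * Em w).
    by rewrite /psum; ring.
  apply: le_trans (ler_normD _ _) _.
  apply: (@le_trans _ _ (Bw * L * eta b s k)); last first.
    by rewrite /B2; apply: ler_wpM2r => //; apply: ler_wpM2r => //; rewrite mulrDl mul1r lerDl mulr_ge0.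
  have h4 : Bw * s k <= Bw * eta b s k by apply: ler_wpM2l.
  have h5 : Bw * Ch * D * conv lam (return_tail X) k <= Bw * Ch * D * (L1 * (A * (ppC b * eta b s k))).
    by apply: ler_wpM2l => //; rewrite !mulr_ge0.
  have h6 : 0 <= Bw * L1 * eta b s k by rewrite !mulr_ge0.
  have -> : Bw * L * eta b s k = Bw * L1 * eta b s k + Bw * Ch * D * (L1 * (A * (ppC b * eta b s k))) + Bw * eta b s k.
    by rewrite /L; ring.
  by move: (le_trans h2 h5) (le_trans h1 h4); rewrite /visit; lra.
have hbb k : E (fun x => `|fresh_obs w k x|) <= B2 * lam k.
  have bd : bmT (damped_visit X vis th k) by exact: bm_damped_visit.
  rewrite /lam -ExZ //; apply: le_Ex => //; [by apply: bm_norm; exact: (bm_fresh_obs hw k)|exact: bmZ|].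
  by move=> x _; rewrite /B2 [X in X * damped_visit _ _ _ _ _]mulrC; exact: fresh_obs_le.
have Cn1 i : gCn X (u1 i) by have [] := hu1 i.
have Cn2 i : gCn X (u2 i) by have [] := hu2 i.
have cyl_obsE k x : cyl_obs w k x = fresh_obs w k x + (ph (lt x) <= k)%N%:R * cyl_obs w (k - ph (lt x))%N (G x).
  by rewrite /fresh_obs subrK.
have main := hK u1 u2 kick_prob lam (cyl_obs w) (fresh_obs w) (PB / dd%:R * Em v) (PB * Em w) B1 B2 n.+1
  B10 B20 Cn1 Cn2 hB1 hB1' l01 (bm_cyl_obs hw) (bm_fresh_obs hw) cyl_obsE hbb hL' hcls hpsum.
rewrite /= in main.
have kc := kick_cocycle N n hv hw; rewrite -/lam in kc.
have ks := kick_split n.+1 hv hw; rewrite /= in ks.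
have eqS : \sum_(i < n.+1) (E (fun x => u1 i x * cyl_obs w (n - i)%N x) - E (fun x => u2 i x * cyl_obs w (n - i)%N x)) =
    \sum_(i < n.+1) E (fun x => cyl_kick v N i x * cyl_obs w (n - i)%N (iter N.+1 G x)).
  apply: eq_bigr => i _; have bg := bm_cyl_obs hw (n - i)%N.
  have bgG : bmT (fun x => cyl_obs w (n - i)%N (iter N.+1 G x)).
    elim: (N.+1) => [//|k IH]; apply: eq_bm (bm_comp_G X IH) => x _; by rewrite -iterSr.
  have [_ h1] := hu1 i; have [_ h2] := hu2 i.
  rewrite (h1 _ bg) (h2 _ bg) -ExB //; [|by apply: bmM => //; exact: bmD|exact: bmM].
  by apply: eq_Ex => x _; ring.
rewrite eqS in main.
set S1 := \sum_(i < n.+1) EY _ in kc ks; set S2 := \sum_(i < n.+1) E _ in kc main.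
set et := eta b s (n.+1 %/ 3)%N.
have dn3 : (n.+1 %/ 3 <= n.+1)%N by exact: leq_div.
have e1 : s n.+1 <= et by apply: le_trans (sdecr dn3) (se _).
have e2 : conv kick_prob lam n <= J * et.
  have := @conv_big_jump R b b1 s s0 sdecr 1 L1 kick_prob lam n.+1 ler01 L10; apply => // j.
  by case/andP: (l01 j) => -> h; rewrite mul1r; exact: le_trans h (se j).
have e3 : th ^+ N * n.+1%:R <= (s 0%N)^-1 * et.
  apply: le_trans tN _; rewrite ler_pdivlMl //; apply: le_trans (pe _).
  by apply: ler_wpM2l; [exact: ltW|apply: psi_decr => //; exact: b_ge0].
have VW : PB / dd%:R * Em v * (PB * Em w) / gkap X * psum e n =
    PB ^+ 2 * Em v * Em w * (psum e n / (dd%:R * gkap X)).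
  have dd1 : dd%:R != 0 :> R by rewrite pnatr_eq0 -lt0n.
  by field; rewrite dd1 gt_eqF.
rewrite VW in main.
set Q := PB ^+ 2 * _ * _ * _ in main *.
have -> : PB * Em (fun x => v x * w (iter n.+1 f x)) - Q =
  (PB * Em (fun x => v x * w (iter n.+1 f x)) - S1) + (S1 - S2) + (S2 - Q) by ring.
apply: le_trans (ler_normD _ _) _; apply: le_trans (lerD (ler_normD _ _) (lexx _)) _.
have BB : 0 <= Bv * Bw by exact: mulr_ge0.
have f1 : Bv * Bw * s n.+1 <= Bv * Bw * et by apply: ler_wpM2l.
have f2 : Bv * Bw * (Ch * D * conv kick_prob lam n + Ch * th ^+ N * n.+1%:R) <=
    Bv * Bw * (Ch * D * (J * et) + Ch * ((s 0%N)^-1 * et)).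
  apply: ler_wpM2l => //; apply: lerD; first by apply: ler_wpM2l => //; exact: mulr_ge0.
  by rewrite -mulrA; apply: ler_wpM2l.
have -> : C * Bv * Bw * et = Bv * Bw * et + Bv * Bw * (Ch * D * (J * et) + Ch * ((s 0%N)^-1 * et)) + K * B1 * B2 * et.
  by rewrite /C /B1 /B2; ring.
by apply: lerD => //; apply: lerD; [exact: le_trans ks f1|exact: le_trans kc f2].
Qed.

End Assembly.
End Tower.

End TwoSided.

(** * Coding the partition by integers *)

Section Branches.
Context (R : realType) d (T : measurableType d) (mu : probability T R) (G : T -> T)
  (I : countType) (a : I -> set T) (hinv : I -> T -> T) (xi : T -> R) (C0 th : R).
Hypothesis th01 : 0 < th < 1.
Hypothesis mG : measurable_fun setT G.
Hypothesis Ginv : forall A, measurable A -> mu (setT `&` G @^-1` A) = mu (setT `&` A).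
Hypothesis ma : forall i, measurable (a i).
Hypothesis disj : forall i j, i != j -> a i `&` a j = set0.
Hypothesis cover : forall x, exists i, a i x.
Hypothesis mhinv : forall i, measurable_fun setT (hinv i).
Hypothesis hinvP : forall i z, a i (hinv i z) /\ G (hinv i z) = z.
Hypothesis hinvK : forall i x, a i x -> hinv i (G x) = x.
Hypothesis mxi : measurable_fun setT xi.
Hypothesis xi0 : forall x, 0 < xi x.
Hypothesis mubr : forall i B, measurable B ->
  mu (a i `&` G @^-1` B) = (\int[mu]_(z in B) (xi (hinv i z))%:E)%E.
Hypothesis xi_dist : forall i x y, a i x -> a i y ->
  `|ln (xi x) - ln (xi y)| <= C0 * thpow th (sep_time G a x y).

Definition elem x : I := projT1 (cid (cover x)).
Definition lett x : nat := pickle (elem x).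
(** Not every integer codes an element of the partition; the other letters get weight 0 and a dummy
    branch. *)
Definition okl : pred nat := fun k => isSome (@pickle_inv I k).
Definition hvl k z := if @pickle_inv I k is Some i then hinv i z else z.
Definition wtl k z : R := if @pickle_inv I k is Some i then xi (hinv i z) else 0.

Lemma elemP x : a (elem x) x. Proof. by rewrite /elem; case: cid. Qed.

Lemma elem_eq i x : a i x -> elem x = i.
Proof.
move=> h; apply/eqP; apply: contraT => /disj e.
have : (a (elem x) `&` a i) x by split => //; exact: elemP.
by rewrite e.
Qed.

Lemma lett_same x y i : a i x -> (lett y = lett x <-> a i y).
Proof.
move=> h; split=> [e|h']; last by rewrite /lett (elem_eq h) (elem_eq h').
have : elem y = elem x by apply: (pcan_inj (@pickleK_inv I)).
by rewrite (elem_eq h) => <-; exact: elemP.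
Qed.

Lemma lett_some k i x : @pickle_inv I k = Some i -> (lett x = k <-> a i x).
Proof.
move=> e; have ek : pickle i = k by have := @pickle_invK I k; rewrite e.
split=> [|h]; last by rewrite /lett (elem_eq h).
by rewrite -ek => /(pcan_inj (@pickleK_inv I)) <-; exact: elemP.
Qed.

Lemma lett_none k x : @pickle_inv I k = None -> lett x <> k.
Proof. by move=> e h; move: e; rewrite -h pickleK_inv. Qed.

Lemma measurable_lett k : measurable (setT `&` [set x | lett x = k]).
Proof.
rewrite setTI; case e : (@pickle_inv I k) => [i|].
  by rewrite (_ : [set x | _] = a i) //; apply/seteqP; split=> x /=; rewrite (lett_some _ e).
by rewrite (_ : [set x | _] = set0) //; apply/seteqP; split=> x //= /(lett_none e).
Qed.

Lemma measurable_hvl k : measurable_fun setT (hvl k).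
Proof. by rewrite /hvl; case: (@pickle_inv I k) => [i|]; [exact: mhinv|exact: measurable_id]. Qed.

Lemma measurable_wtl k : measurable_fun setT (wtl k).
Proof.
rewrite /wtl; case: (@pickle_inv I k) => [i|]; last exact: measurable_cst.
exact: measurableT_comp mxi (mhinv i).
Qed.

Lemma wtl_ge0 k x : 0 <= wtl k x.
Proof. by rewrite /wtl; case: (@pickle_inv I k) => [i|] //; exact: ltW. Qed.

Lemma wtl_gt0 k x : okl k -> 0 < wtl k x.
Proof. by rewrite /okl /wtl; case: (@pickle_inv I k). Qed.

Lemma okl_lett x : okl (lett x). Proof. by rewrite /okl /lett pickleK_inv. Qed.

Lemma lett_hvl k z : okl k -> lett (hvl k z) = k.
Proof.
rewrite /okl /hvl; case e : (@pickle_inv I k) => [i|] // _.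
by apply/(lett_some _ e); have [] := hinvP i z.
Qed.

Lemma G_hvl k z : okl k -> G (hvl k z) = z.
Proof. by rewrite /okl /hvl; case: (@pickle_inv I k) => [i|] // _; have [] := hinvP i z. Qed.

Lemma hvl_G x : hvl (lett x) (G x) = x.
Proof. by rewrite /hvl /lett pickleK_inv hinvK //; exact: elemP. Qed.

Lemma wtl_nok k z : ~~ okl k -> wtl k z = 0.
Proof. by rewrite /okl /wtl; case: (@pickle_inv I k). Qed.

Lemma wtl_branch k B : okl k -> measurable B ->
  mu ([set x | lett x = k] `&` G @^-1` B) = (\int[mu]_(z in B) (wtl k z)%:E)%E.
Proof.
rewrite /okl /wtl; case e : (@pickle_inv I k) => [i|] // _ mB; rewrite -mubr //; congr (mu (_ `&` _)).
by apply/seteqP; split=> x /=; rewrite (lett_some _ e).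
Qed.

Lemma agree_sep n x y m : agree G lett n x y -> sep_time G a x y = Some m -> (n <= m)%N.
Proof.
move=> h; rewrite /sep_time; case: pselect => // H [] <-; case: ex_minnP => k /asboolP hk _.
rewrite leqNgt; apply/negP => kn; apply: hk; exists (elem (iter k G x)); split; first exact: elemP.
by apply/(lett_same _ (elemP _)); rewrite h.
Qed.

Lemma agree_thpow n x y : agree G lett n x y -> thpow th (sep_time G a x y) <= th ^+ n.
Proof.
have /andP[t0 t1] := th01; move=> h; case e : (sep_time G a x y) => [m|] /=.
  by apply: ler_wiXn2l; [exact: ltW|exact: ltW|exact: agree_sep e].
by apply: exprn_ge0; exact: ltW.
Qed.

Lemma agree_thpow_shift n N x y : (N <= n)%N -> agree G lett n x y ->
  thpow_shift th (sep_time G a x y) N <= th ^+ (n - N).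
Proof.
have /andP[t0 t1] := th01; move=> Nn h; case e : (sep_time G a x y) => [m|] /=; last first.
  by apply: exprn_ge0; exact: ltW.
have nm := agree_sep h e; rewrite subzn; last exact: leq_trans nm.
apply: ler_wiXn2l; [exact: ltW|exact: ltW|exact: leq_sub2r].
Qed.

(** Pulling back along a branch adds one common letter, hence the exponent [n + 1]. *)
Lemma wtl_dist k n x y : okl k -> agree G lett n x y ->
  wtl k x <= expR (`|C0| * th ^+ n.+1) * wtl k y.
Proof.
move=> ok h; have h1 := agree_hv lett_hvl G_hvl ok h; have := ok; move: h1.
rewrite /okl /wtl /hvl; case: (@pickle_inv I k) => [i|] // h1 _.
have t0 : 0 <= thpow th (sep_time G a (hinv i x) (hinv i y)).
  by case: sep_time => //= m; apply: exprn_ge0; case/andP: th01 => /ltW.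
have := xi_dist (hinvP i x).1 (hinvP i y).1; rewrite ler_norml => /andP[_ h2].
rewrite -{1}(lnK (xi0 (hinv i x))) -{1}(lnK (xi0 (hinv i y))) -expRD ler_expR -lerBlDr.
apply: le_trans h2 _; apply: (@le_trans _ _ (`|C0| * thpow th (sep_time G a (hinv i x) (hinv i y)))).
  by apply: ler_wpM2r => //; exact: ler_norm.
by apply: ler_wpM2l => //; exact: agree_thpow.
Qed.

Section Model.
Variables (c : R) (ph : nat -> nat).
Hypothesis hc : (1 + th * `|C0|) / (1 - th) <= c.
Hypothesis ph0 : forall k, (0 < ph k)%N.

Definition base_gm : gibbs_markov R T :=
  full_branch_gm th01 (normr_ge0 C0) mG Ginv measurable_lett measurable_hvl measurable_wtl wtl_ge0
    okl_lett lett_hvl G_hvl hvl_G wtl_nok wtl_branch wtl_dist hc ph0.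

Lemma base_cone_lift a0 N u : 0 <= a0 -> a0 + `|C0| / (1 - th) <= c -> cone G lett th a0 N u ->
  exists u', gCn base_gm u' /\ forall g, bm setT g ->
    Ex mu setT (fun x => u' x * g x) = Ex mu setT (fun x => u x * g (iter N G x)).
Proof.
move=> a00 ac hu; exists (iter N (Tr hvl wtl predT) u); split.
  apply: (cone_le th01 ac).
  exact: (cone_iter th01 (normr_ge0 C0) mG measurable_lett measurable_hvl measurable_wtl wtl_ge0
    okl_lett lett_hvl G_hvl wtl_nok wtl_branch wtl_dist a00 hu).
move=> g hg; exact: (iter_Tr_dual th01 (normr_ge0 C0) mG measurable_lett measurable_hvl measurable_wtl
  wtl_ge0 okl_lett lett_hvl G_hvl hvl_G wtl_nok wtl_branch wtl_dist a00 hu hg).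
Qed.

(** Branches are full and weights positive with bounded distortion, so each further letter costs at
    most a positive factor of mass. The lemma provides points of [Y] over every word, although [pib]
    need not be onto. *)
Lemma cyl_mass n x : 0 < Ex mu setT (fun z => (cyl base_gm n z == cyl base_gm n x)%:R).
Proof.
have bc m k : @bm R d T setT (fun z => (cyl base_gm m z == k)%:R).
  apply: (@bm_cyl R d T base_gm m (fun q => (q == k)%:R) 1) => q.
  by case: (_ == _); rewrite ?normr1 ?normr0.
elim: n x => [|n IH] x.
  rewrite (_ : Ex _ _ _ = Ex mu setT (fun=> 1)); last by apply: eq_Ex => z _.
  by rewrite (E1 base_gm).
have -> : Ex mu setT (fun z => (cyl base_gm n.+1 z == cyl base_gm n.+1 x)%:R) =
  Ex mu setT (fun z => (lett z == lett x)%:R * (cyl base_gm n (G z) == cyl base_gm n (G x))%:R).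
  by apply: eq_Ex => z _; rewrite -natrM mulnb.
have bch := branch_change th01 (normr_ge0 C0) mG measurable_lett measurable_wtl wtl_ge0 okl_lett
  wtl_nok wtl_branch wtl_dist (lett x) (bc n (cyl base_gm n (G x))).
rewrite bch; have wx := wtl_gt0 x (okl_lett x).
have bw := bm_wt mu th01 (normr_ge0 C0) measurable_wtl wtl_ge0 wtl_nok wtl_dist (lett x).
pose q := wtl (lett x) x / expR `|C0|.
apply: (@lt_le_trans _ _ (q * Ex mu setT (fun z => (cyl base_gm n z == cyl base_gm n (G x))%:R))).
  by apply: mulr_gt0 (IH _); rewrite divr_gt0 // expR_gt0.
rewrite -ExZ //; apply: le_Ex => //; [exact: bmZ|by apply: bmM|].
move=> z _; apply: ler_wpM2r => //; rewrite /q ler_pdivrMr ?expR_gt0 // mulrC.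
exact: (wt_eC th01 (normr_ge0 C0) wtl_ge0 wtl_nok wtl_dist).
Qed.

End Model.
End Branches.

(** * Returns to [X] within one excursion from [Y] *)

Section Returns.
Context (M : Type) (f : M -> M) (X : set M) (h sigma : M -> nat).
Hypothesis hret : first_return f X h.

Lemma fX_in j x : X x -> X (iter j (fX f h) x).
Proof. by move=> Xx; elim: j => //= j; case/hret. Qed.

Definition ret_time j x := (\sum_(i < j) h (iter i (fX f h) x))%N.

Lemma iter_fX j x : iter j (fX f h) x = iter (ret_time j x) f x.
Proof.
elim: j => [|j IH]; first by rewrite /ret_time big_ord0.
by rewrite iterS IH /fX /ret_time big_ord_recr /= addnC iterD -/(ret_time j x) -IH.
Qed.

Lemma return_times J x l : X x -> (l < ret_time J x)%N -> X (iter l f x) ->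
  exists2 j, (j < J)%N & l = ret_time j x.
Proof.
move=> Xx; elim: J => [|J IH]; first by rewrite /ret_time big_ord0.
have e : ret_time J.+1 x = (ret_time J x + h (iter J (fX f h) x))%N by rewrite /ret_time big_ord_recr.
rewrite e => hl Xl; case: (ltnP l (ret_time J x)) => hlJ.
  by have [j jJ ->] := IH hlJ Xl; exists j => //; exact: ltnW.
exists J => //; apply/eqP; rewrite eqn_leq hlJ andbT leqNgt; apply/negP => hl2.
have [_ _ /(_ (l - ret_time J x)%N)] := hret (fX_in J Xx); rewrite iter_fX -iterD subnK //.
by move=> hh; apply: hh => //; rewrite subn_gt0 hl2 -iter_fX ltn_subLR.
Qed.

Section LetterData.
Variables (Y : set M) (lk : M -> nat).
Hypothesis YX : Y `<=` X.
Hypothesis sig0 : forall y, Y y -> (0 < sigma y)%N.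
Hypothesis sig_const : forall y y', Y y -> Y y' -> lk y = lk y' -> sigma y = sigma y'.
Hypothesis h_const : forall l y y', Y y -> Y y' -> lk y = lk y' -> (l < sigma y)%N ->
  h (iter l (fX f h) y) = h (iter l (fX f h) y').

Local Notation phi := (phi f h sigma).

Lemma ret_time_const j y y' : Y y -> Y y' -> lk y = lk y' -> (j <= sigma y)%N ->
  ret_time j y = ret_time j y'.
Proof.
move=> Yy Yy' e js; apply: eq_bigr => i _; apply: h_const => //.
exact: leq_trans (ltn_ord i) js.
Qed.

Lemma phi_ret y : phi y = ret_time (sigma y) y. Proof. by []. Qed.

Lemma phi_const y y' : Y y -> Y y' -> lk y = lk y' -> phi y = phi y'.
Proof.
by move=> Yy Yy' e; rewrite !phi_ret -(sig_const Yy Yy' e); exact: ret_time_const.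
Qed.

Lemma phi_gt0 y : Y y -> (0 < phi y)%N.
Proof.
move=> Yy; rewrite phi_ret; have := sig0 Yy; case: (sigma y) => // j _.
by rewrite /ret_time big_ord_recl /= addn_gt0; have [-> _ _] := hret (YX Yy).
Qed.

(* The default [1] is for letters carried by no point of [Y]. *)
Definition letter_val (u : M -> nat) k : nat :=
  if pselect (exists y, Y y /\ lk y = k) is left H then u (projT1 (cid H)) else 1%N.

Lemma letter_valE u y : (forall y y', Y y -> Y y' -> lk y = lk y' -> u y = u y') -> Y y ->
  letter_val u (lk y) = u y.
Proof.
move=> hu Yy; rewrite /letter_val; case: pselect => [H|[]]; last by exists y.
by case: (cid H) => z /= [Yz e]; exact: hu.
Qed.

Lemma letter_val_gt0 u k : (forall y, Y y -> (0 < u y)%N) -> (0 < letter_val u k)%N.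
Proof.
by move=> hu; rewrite /letter_val; case: pselect => // H; case: (cid H) => z /= [Yz _]; exact: hu.
Qed.

(** Under the constancy of [sigma] and [h], all points of [Y] with the same letter visit [X] at the
    same times, so the choice of the witness is immaterial. *)
Definition visits k l : bool :=
  (l < letter_val phi k)%N && `[< exists y, [/\ Y y, lk y = k & X (iter l f y)] >].

Lemma visits_lt k l : visits k l -> (l < letter_val phi k)%N.
Proof. by case/andP. Qed.

Lemma not_visits y l : Y y -> (l < phi y)%N -> ~~ visits (lk y) l -> ~ X (iter l f y).
Proof.
move=> Yy hl; rewrite /visits letter_valE ?hl //; last exact: phi_const.
by move=> /asboolPn hn Xl; apply: hn; exists y.
Qed.

(** Before the return to [Y], visits to [X] happen exactly at the partial return times [ret_time j]
    with [j < sigma y]. *)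
Lemma sum_visits y K : Y y -> (\sum_(l < K) visits (lk y) l <= sigma y)%N.
Proof.
move=> Yy; apply: (@leq_trans (\sum_(l < K) \sum_(j < sigma y) (nat_of_ord l == ret_time j y))).
  apply: leq_sum => l _; case: (boolP (visits _ _)) => // /andP[hl /asboolP[z [Yz ez Xz]]].
  rewrite letter_valE // in hl; last exact: phi_const.
  rewrite -(phi_const Yz Yy ez) phi_ret in hl.
  have [j js ej] := return_times (YX Yz) hl Xz; rewrite (sig_const Yz Yy ez) in js.
  rewrite (bigD1 (Ordinal js)) //= ej (@ret_time_const j z y) ?eqxx //.
  by rewrite (sig_const Yz Yy ez) ltnW.
rewrite exchange_big /= -[leqRHS]card_ord -sum1_card; apply: leq_sum => j _.
elim: K => [|K IH]; first by rewrite big_ord0.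
rewrite big_ord_recr /=; case: eqP => [e|_]; last by rewrite addn0.
rewrite big1 // => i _; rewrite -e (ltn_eqF (ltn_ord i)) //.
Qed.

End LetterData.
End Returns.

(** * Integrals over long excursions *)

Section TailIntegral.
Context (R : realType) d (M : measurableType d) (nu : probability M R) (Y : set M) (p g : M -> nat).
Hypothesis mY : measurable Y.
Hypothesis mp : forall n, measurable (Y `&` [set y | (n < p y)%N]).
Hypothesis mg : forall n, measurable (Y `&` [set y | g y = n]).
Hypothesis ig : (\int[nu]_(y in Y) (g y)%:R%:E < +oo)%E.

Definition tail_int n : R := \int[nu]_(y in Y `&` [set y | (n < p y)%N]) (g y)%:R.

Let trunc n y : R := (n < p y)%N%:R * (g y)%:R.

Let mgR : measurable_fun Y (fun y => (g y)%:R : R).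
Proof. exact: (measurable_key (fun k => k%:R : R) mg). Qed.

Let ig' : nu.-integrable Y (EFin \o (fun y => (g y)%:R : R)).
Proof.
apply/integrableP; split; first exact/measurable_EFinP.
by rewrite (eq_integral (fun y => (g y)%:R%:E)) // => y _; rewrite /= ger0_norm.
Qed.

Let itr n : nu.-integrable Y (EFin \o trunc n).
Proof.
apply: (le_integrable mY _ _ ig').
  apply/measurable_EFinP/measurable_funM; last exact: mgR.
  by have [] := @bm_bool R _ _ Y mY (fun y => (n < p y)%N) (mp n).
move=> y Yy; rewrite /= lee_fin /trunc !ger0_norm ?mulr_ge0 // ler_piMl //.
by case: (_ < _)%N.
Qed.

Lemma tail_intE n : tail_int n = \int[nu]_(y in Y) trunc n y.
Proof.
rewrite /tail_int /Rintegral integral_mkcondr; congr fine; apply: eq_integral => y _.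
rewrite patchE /trunc; case: ifPn => h.
  have -> : (n < p y)%N by move: h; rewrite inE.
  by rewrite mul1r.
rewrite (_ : (n < p y)%N = false) ?mul0r //; apply: contraNF h => h; by rewrite inE.
Qed.

Lemma tail_int_ge0 n : 0 <= tail_int n.
Proof. by rewrite tail_intE; apply: Rintegral_ge0 => y _; rewrite mulr_ge0. Qed.

Lemma tail_int_decr n m : (n <= m)%N -> tail_int m <= tail_int n.
Proof.
move=> nm; rewrite !tail_intE; apply: le_Rintegral; [exact: mY|exact: (itr m)|exact: (itr n)|move=> y _; apply: ler_wpM2r => //].
by rewrite ler_nat; case: (ltnP m) => // h; rewrite (leq_ltn_trans nm h).
Qed.

Lemma Ex_le_tail_int n u : bm Y u -> (forall y, Y y -> u y <= (n < p y)%N%:R * (g y)%:R) ->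
  Ex nu Y u <= tail_int n.
Proof.
by move=> hu h; rewrite tail_intE; apply: le_Rintegral; [exact: mY|exact: bm_integrable|exact: (itr n)|exact: h].
Qed.

End TailIntegral.

Lemma combine_bounds (R : realType) (a1 a2 a3 x y : R) : 0 <= x -> 0 <= y ->
  0 <= a1 * y -> 0 <= a2 * x -> 0 <= a3 * y ->
  a1 * x + a2 * y + a3 * x <= (a1 + a2 + a3 + 1) * (x + y).
Proof. by move=> *; rewrite !mulrDl !mulrDr !mul1r; lra. Qed.

(** * The two-sided structure as an instance, and the final bounds *)

Section CMZ.
Context (R : realType) (dM : measure_display) (M : measurableType dM)
  (dist : M -> M -> R) (mu : probability M R) (f : M -> M) (X Y : set M)
  (h sigma : M -> nat) (muY : probability M R)
  (dB : measure_display) (Yb : measurableType dB) (mub : probability Yb R)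
  (Fb : Yb -> Yb) (I : countType) (a : I -> set Yb) (pib : M -> Yb)
  (C0 th : R) (hinv : I -> Yb -> Yb) (xi : Yb -> R).
Local Notation F := (Fmap f h sigma).
Local Notation phi := (phi f h sigma).
Local Notation EY := (Ex muY Y).
Local Notation Eb := (Ex mub setT).
Local Notation bmT := (@bm R dB Yb setT).

Hypothesis th01 : 0 < th < 1.
Hypothesis mG : measurable_fun setT Fb.
Hypothesis Ginv : forall A, measurable A -> mub (setT `&` Fb @^-1` A) = mub (setT `&` A).
Hypothesis ma : forall i, measurable (a i).
Hypothesis disj : forall i j, i != j -> a i `&` a j = set0.
Hypothesis cover : forall x, exists i, a i x.
Hypothesis mhinv : forall i, measurable_fun setT (hinv i).
Hypothesis hinvP : forall i z, a i (hinv i z) /\ Fb (hinv i z) = z.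
Hypothesis hinvK : forall i x, a i x -> hinv i (Fb x) = x.
Hypothesis mxi : measurable_fun setT xi.
Hypothesis xi0 : forall x, 0 < xi x.
Hypothesis mubr : forall i B, measurable B ->
  mub (a i `&` Fb @^-1` B) = (\int[mub]_(z in B) (xi (hinv i z))%:E)%E.
Hypothesis xi_dist : forall i x y, a i x -> a i y ->
  `|ln (xi x) - ln (xi y)| <= C0 * thpow th (sep_time Fb a x y).

Hypothesis dist_ge0 : forall x y, 0 <= dist x y.
Hypothesis dist_eq0 : forall x y, dist x y = 0 <-> x = y.
Hypothesis mf : measurable_fun setT f.
Hypothesis muf : forall A, measurable A -> mu (setT `&` f @^-1` A) = mu (setT `&` A).
Hypothesis mix : mixing mu f.
Hypothesis mY : measurable Y.
Hypothesis YX : Y `<=` X.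
Hypothesis hret : first_return f X h.
Hypothesis sig0 : forall y, Y y -> (0 < sigma y)%N.
Hypothesis msig : forall n, measurable (Y `&` [set y | sigma y = n]).
Hypothesis isig : (\int[muY]_(y in Y) (sigma y)%:R%:E < +oo)%E.
Hypothesis sigc : forall i y y', Y y -> Y y' -> a i (pib y) -> a i (pib y') -> sigma y = sigma y'.
Hypothesis mF : measurable_fun Y F.
Hypothesis FY : forall y, Y y -> Y (F y).
Hypothesis Finv : forall A, measurable A -> muY (Y `&` F @^-1` A) = muY (Y `&` A).
Hypothesis mpi : measurable_fun Y pib.
Hypothesis piF : forall y, Y y -> pib (F y) = Fb (pib y).
Hypothesis pinv : forall B, measurable B -> muY (Y `&` pib @^-1` B) = mub B.
Hypothesis contr : forall y y' n, Y y -> Y y' -> (1 <= n)%N ->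
  dist (iter n F y) (iter n F y') <=
    C0 * (th ^+ n + thpow_shift th (sep_time Fb a (pib y) (pib y')) n).
Hypothesis hconst : forall i l y y', Y y -> Y y' -> a i (pib y) -> a i (pib y') ->
  (l < sigma y)%N -> h (iter l (fX f h) y) = h (iter l (fX f h) y').
Hypothesis towerE : forall A, measurable A ->
  (mu A = (\sum_(0 <= l <oo) muY (Y `&` [set y | (l < phi y)%N] `&` (iter l f) @^-1` A))
    * (\int[muY]_(y in Y) (phi y)%:R%:E)^-1)%E.

Definition lk y : nat := lett cover (pib y).
Definition lph : nat -> nat := letter_val Y lk phi.
Definition lvis : nat -> nat -> bool := visits f X h sigma Y lk.
(** The contraction accounts for [2 * |C0|] and the separation time for 1; before the first return
    only twice the norm is available, whence the 2. *)
Definition Ch : R := 2 * `|C0| + 2.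
(** The sum of two lower bounds: one makes the cone stable under removal of a constant, the other
    leaves room for the kicks smoothed by [cone_iter]. *)
Definition cone_c : R := (1 + th * `|C0|) / (1 - th) + (Ch + `|C0| / (1 - th)).

Lemma lk_elem y y' : lk y = lk y' -> exists2 i, a i (pib y) & a i (pib y').
Proof.
move=> e; exists (elem cover (pib y)); first exact: elemP.
by apply/(lett_same disj cover _ (elemP cover (pib y))).
Qed.

Lemma sigma_lk y y' : Y y -> Y y' -> lk y = lk y' -> sigma y = sigma y'.
Proof. by move=> Yy Yy' /lk_elem[i i1 i2]; exact: sigc i1 i2. Qed.

Lemma h_lk l y y' : Y y -> Y y' -> lk y = lk y' -> (l < sigma y)%N ->
  h (iter l (fX f h) y) = h (iter l (fX f h) y').
Proof. by move=> Yy Yy' /lk_elem[i i1 i2]; exact: hconst i1 i2. Qed.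

Lemma lphE y : Y y -> lph (lk y) = phi y.
Proof.
move=> Yy; apply: letter_valE => // y1 y2 Y1 Y2 e.
exact: (phi_const (lk := lk) sigma_lk h_lk).
Qed.

Lemma lph_gt0 k : (0 < lph k)%N.
Proof. by apply: letter_val_gt0 => y Yy; exact: (phi_gt0 hret YX sig0 Yy). Qed.

Let t0 : 0 < th. Proof. by case/andP: th01. Qed.
Let t1 : 0 < 1 - th. Proof. by rewrite subr_gt0; case/andP: th01. Qed.

Lemma Ch_ge0 : 0 <= Ch. Proof. by rewrite /Ch addr_ge0 // mulr_ge0. Qed.

Lemma cone_c_ge : (1 + th * `|C0|) / (1 - th) <= cone_c.
Proof.
have h1 : 0 <= (1 - th)^-1 by rewrite invr_ge0; exact: ltW t1.
by rewrite /cone_c lerDl addr_ge0 ?Ch_ge0 // mulr_ge0.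
Qed.

Lemma cone_c_ge' : Ch + `|C0| / (1 - th) <= cone_c.
Proof.
have h1 : 0 <= (1 - th)^-1 by rewrite invr_ge0; exact: ltW t1.
have h2 : 0 <= th := ltW t0.
by rewrite /cone_c lerDr mulr_ge0 // addr_ge0 // mulr_ge0.
Qed.

Definition bgm : gibbs_markov R Yb :=
  base_gm th01 mG Ginv ma disj cover mhinv hinvP hinvK mxi xi0 mubr xi_dist cone_c_ge lph_gt0.

Lemma bgm_lift N (u : Yb -> R) : cone Fb (lett cover) th Ch N.+1 u -> exists u' : Yb -> R, gCn bgm u' /\
  forall g, bmT g -> Eb (fun x => u' x * g x) = Eb (fun x => u x * g (iter N.+1 Fb x)).
Proof.
exact: (base_cone_lift th01 mG Ginv ma disj mhinv hinvP hinvK mxi xi0 mubr xi_dist cone_c_ge lph_gt0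
  Ch_ge0 cone_c_ge').
Qed.

Lemma bgm_mass n x : 0 < Eb (fun z => (cyl bgm n z == cyl bgm n x)%:R).
Proof. exact: cyl_mass. Qed.

Lemma EY_pi g : bmT g -> EY (fun y => g (pib y)) = Eb g.
Proof.
move=> hg; have mT := @measurableT _ Yb.
have h1 (v : Yb -> R) : Eb v = Eb (fun x => 1 * v x) by apply: eq_Ex => x _; rewrite mul1r.
have h2 (v : M -> R) : EY v = EY (fun x => 1 * v x) by apply: eq_Ex => x _; rewrite mul1r.
rewrite h2 h1; apply: (@Ex_transfer _ _ _ mub setT _ _ muY Y pib (fun=> 1) (fun=> 1)) => //;
  try exact: bm_cst.
move=> A mA; rewrite -h1 -h2 Ex_indic // setTI -pinv //.
have mP : measurable (Y `&` pib @^-1` A) by exact: mpi.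
rewrite -[in RHS](setIidr (@subIsetl _ Y (pib @^-1` A))) -Ex_indic //.
apply: eq_Ex => x Yx; rewrite !indicE; congr (nat_of_bool _)%:R.
apply/idP/idP; first by rewrite !inE => hx; split.
by rewrite !inE => -[].
Qed.

Lemma EY_F u : bm Y u -> EY (fun y => u (F y)) = EY u.
Proof. by move=> hu; apply: Ex_invariant. Qed.

(** A word missed by the image of [Y] would have mass 0. *)
Lemma bgm_ex n x : exists2 y, Y y & agree Fb (lett cover) n (pib y) x.
Proof.
have hm := bgm_mass n x; apply: contrapT => hn; move: hm.
have bc : bmT (fun z => (cyl bgm n z == cyl bgm n x)%:R).
  apply: (@bm_cyl R _ Yb bgm n (fun q => (q == cyl bgm n x)%:R) 1) => q.
  by case: (_ == _); rewrite ?normr1 ?normr0.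
rewrite -(EY_pi bc) (_ : EY _ = 0) ?ltxx //.
transitivity (EY (fun=> 0)); last by rewrite Ex0.
apply: eq_Ex => y Yy.
case: eqP => // e; exfalso; apply: hn; exists y => //.
exact/(cylP bgm).
Qed.

Lemma bgm_letter_pos y : Y y -> 0 < Eb (fun x => (pj bgm (lph (lk y)) (lett cover x))%:R).
Proof.
move=> Yy; apply: lt_le_trans (bgm_mass 1 (pib y)) _.
have mT := @measurableT _ Yb.
apply: le_Ex => //.
- apply: (@bm_cyl R _ Yb bgm 1 (fun q => (q == cyl bgm 1 (pib y))%:R) 1) => q.
  by case: (_ == _); rewrite ?normr1 ?normr0.
- exact: (bm_letter bgm (pj bgm (lph (lk y)))).
move=> x _; case: eqP => // -[e]; rewrite /pj.
by rewrite (_ : gph bgm (lett cover x) = lph (lk y)) ?eqxx //; rewrite /lk -e.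
Qed.


Local Notation normH := (normH dist f h sigma Y Fb a pib th).
Local Notation inHX := (inHX dist f X h sigma Y Fb a pib th).
Local Notation hset v := (holder_set dist f h sigma Y Fb a pib th v).

Lemma thpow_ge0 s : 0 <= thpow th s.
Proof. by case: s => //= k; apply: exprn_ge0; exact: ltW t0. Qed.

Lemma supnorm_ge v x : inHX v -> `|v x| <= supnorm v.
Proof. by move=> [_ _ hB _]; apply: ub_le_sup => //; exists x. Qed.

Lemma sup_holder_ge0 v : inHX v -> 0 <= sup (hset v).
Proof.
move=> [_ _ _ hB]; have [[r hr]|hn] := pselect (hset v !=set0); last first.
  by have /set0P/negP/negPn/eqP -> := hn; rewrite sup0.
apply: le_trans (ub_le_sup hB hr); case: hr => y [y' [l [_ _ _ _ ->]]].
by rewrite divr_ge0 // addr_ge0 // thpow_ge0.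
Qed.

Lemma supnorm_le_normH v : inHX v -> supnorm v <= normH v.
Proof. by move=> hv; rewrite /Defs.normH lerDl; exact: sup_holder_ge0. Qed.

Lemma le_normH v x : inHX v -> `|v x| <= normH v.
Proof. by move=> hv; apply: le_trans (supnorm_ge x hv) (supnorm_le_normH hv). Qed.

Lemma normH_ge0 v (x : M) : inHX v -> 0 <= normH v.
Proof. by move=> hv; apply: le_trans (le_normH x hv). Qed.

Lemma holder_le v y y' l : inHX v -> Y y -> Y y' -> (l < phi y)%N ->
  `|v (iter l f y) - v (iter l f y')| <=
    normH v * (dist y y' + thpow th (sep_time Fb a (pib y) (pib y'))).
Proof.
move=> hv Yy Yy' hl; have [_ _ _ hB] := hv.
have d0 : 0 <= dist y y' + thpow th (sep_time Fb a (pib y) (pib y')) by rewrite addr_ge0 // thpow_ge0.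
have n0 := normH_ge0 y hv.
have [->|ne] := pselect (y = y'); first by rewrite subrr normr0 mulr_ge0 // addr_ge0 // thpow_ge0.
have dp : 0 < dist y y' + thpow th (sep_time Fb a (pib y) (pib y')).
  rewrite ltr_wpDr ?thpow_ge0 // lt_neqAle dist_ge0 andbT eq_sym.
  by apply/eqP => /dist_eq0.
rewrite -ler_pdivrMr //; apply: (@le_trans _ _ (sup (hset v))).
  by apply: ub_le_sup => //; exists y, y', l.
rewrite /Defs.normH lerDr; exact: le_trans (supnorm_ge y hv).
Qed.

Lemma agree_iter N m x x' : agree Fb (lett cover) (N + m) x x' ->
  agree Fb (lett cover) m (iter N Fb x) (iter N Fb x').
Proof. by move=> hx j jm; rewrite -!iterD hx // addnC ltn_add2l. Qed.

(** The contraction is available from the first return on; at [N = 0] the condition [n <= N] leaves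
    only [n = 0], where the sup norm suffices. Otherwise the past contributes a power of [th] at
    least [N], hence at least [n], and the future one of at least [n] through the separation
    time. *)
Lemma inHX_dyn v : inHX v -> dyn_holder bgm Y f F pib lvis th Ch (normH v) v.
Proof.
move=> hv; have [mv vX _ _] := hv; split => //; first by move=> x; exact: le_normH.
  move=> y l Yy hl hvis; apply: vX; apply: (not_visits sigma_lk h_lk Yy _ hvis).
  by rewrite -lphE.
move=> N n y y' l Yy Yy' nN hag hl.
have Y1 := YN FY N Yy; have Y2 := YN FY N Yy'.
have e1 := piN (X := bgm) FY piF N Yy; have e2 := piN (X := bgm) FY piF N Yy'.
have n0 := normH_ge0 y hv.
case: N nN hag hl Y1 Y2 e1 e2 => [|N] nN hag hl Y1 Y2 e1 e2.
  move: nN; rewrite leqn0 => /eqP ->; rewrite expr0 mulr1.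
  apply: le_trans (ler_normB _ _) _; apply: le_trans (lerD (le_normH _ hv) (le_normH _ hv)) _.
  have : 0 <= normH v * (2 * `|C0|) by rewrite !mulr_ge0.
  by rewrite /Ch; lra.
have hl' : (l < phi (iter N.+1 F y))%N by rewrite -lphE.
apply: le_trans (holder_le hv Y1 Y2 hl') _; rewrite -mulrA; apply: ler_wpM2l => //.
have hag' : agree Fb (lett cover) (N.+1 + n.+1) (pib y) (pib y') by move: hag; rewrite -addnA add1n.
have t0' := t0; have t1' : th <= 1 by case/andP: th01 => _ /ltW.
have tn : th ^+ n.+1 <= th ^+ n by rewrite exprS ler_piMl // exprn_ge0 // ltW.
have s1 : thpow th (sep_time Fb a (pib (iter N.+1 F y)) (pib (iter N.+1 F y'))) <= th ^+ n.
  by apply: le_trans tn; apply: (agree_thpow th01 disj (cover := cover)); rewrite e1 e2; exact: agree_iter.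
have s2 : thpow_shift th (sep_time Fb a (pib y) (pib y')) N.+1 <= th ^+ n.
  apply: le_trans tn.
  by have := agree_thpow_shift th01 disj (cover := cover) (leq_addr n.+1 N.+1) hag'; rewrite addKn.
have s3 : th ^+ N.+1 <= th ^+ n by apply: ler_wiXn2l => //; exact: ltW.
have s4 : 0 <= thpow_shift th (sep_time Fb a (pib y) (pib y')) N.+1.
  by case: sep_time => //= k; apply: exprz_ge0; exact: ltW.
have := contr Yy Yy' (isT : (1 <= N.+1)%N) => hd.
have hd2 : C0 * (th ^+ N.+1 + thpow_shift th (sep_time Fb a (pib y) (pib y')) N.+1) <= `|C0| * (2 * th ^+ n).
  have q0 : 0 <= th ^+ N.+1 by rewrite exprn_ge0 // ltW.
  apply: (@le_trans _ _ (`|C0| * (th ^+ N.+1 + thpow_shift th (sep_time Fb a (pib y) (pib y')) N.+1))).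
    by apply: ler_wpM2r; [exact: addr_ge0|exact: ler_norm].
  by apply: ler_wpM2l => //; lra.
have q1 : 0 <= th ^+ n by rewrite exprn_ge0 // ltW.
by rewrite /Ch; move: (le_trans hd hd2) s1; lra.
Qed.

Local Notation sn := (sigman muY Y f h sigma).

Lemma measurable_lk k : measurable (Y `&` [set y | lk y = k]).
Proof.
have hk := gm_mlt bgm k; rewrite setTI in hk.
exact: (mpi mY hk).
Qed.

Lemma measurable_phi_gt n : measurable (Y `&` [set y | (n < phi y)%N]).
Proof.
rewrite (_ : _ `&` _ = Y `&` [set y | (n < lph (lk y))%N]).
  exact: (measurable_key_set (fun k => n < lph k)%N measurable_lk).
by apply/seteqP; split => y [Yy] /=; rewrite lphE.
Qed.

Lemma sn_ge0 n : 0 <= sn n.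
Proof. exact: (tail_int_ge0 muY Y phi sigma n). Qed.

Lemma sn_decr n m : (n <= m)%N -> sn m <= sn n.
Proof. exact: (tail_int_decr mY measurable_phi_gt msig isig). Qed.

(** The source of [sigman] in all tail bounds: a count of visits that vanishes on blocks of length
    at most [n] and never exceeds [sigma]. *)
Lemma letters_le_sn (q : nat -> R) n : bmT (fun x => q (lett cover x)) ->
  (forall y, Y y -> q (lk y) <= (n < phi y)%N%:R * (sigma y)%:R) ->
  Eb (fun x => q (lett cover x)) <= sn n.
Proof.
move=> hq hle; rewrite -(EY_pi hq).
apply: (Ex_le_tail_int mY measurable_phi_gt msig isig) => //.
exact: (@bm_comp R _ Yb _ M setT Y pib _ measurableT mpi (fun _ _ => Logic.I) hq).
Qed.

Lemma lvis_sum y K : Y y -> \sum_(l < K) (lvis (lk y) l)%:R <= (sigma y)%:R :> R.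
Proof.
move=> Yy; have := sum_visits hret YX sigma_lk h_lk K Yy; rewrite -(ler_nat R) natr_sum; apply.
Qed.

Lemma sn0_gt0 : 0 < sn 0.
Proof.
apply: (@lt_le_trans _ _ 1) => //.
have -> : 1 = Eb (fun x => (fun=> 1 : R) (lett cover x)) by rewrite (E1 bgm).
apply: (@letters_le_sn (fun=> 1) 0); first exact: bm_cst.
move=> y Yy; rewrite (phi_gt0 hret YX sig0 Yy) mul1r.
by rewrite ler1n; exact: sig0.
Qed.

Let bml (q : nat -> bool) : bmT (fun x => (q (lett cover x))%:R).
Proof. exact: (bm_letter bgm q). Qed.

Lemma vis_tail : tailb 1 sn (fun m => Eb (fun x => (lvis (lett cover x) m)%:R)).
Proof.
split=> [n|n m]; first by apply: Ex_ge0.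
rewrite mul1r -Ex_sum //; last by move=> i _; exact: (bml (fun k => lvis k i)).
apply: (@letters_le_sn (fun k => \sum_(n <= i < m) (lvis k i)%:R)).
  by apply: bm_sum => i _; exact: (bml (fun k => lvis k i)).
move=> y Yy; case: ltnP => hn.
  rewrite mul1r; apply: le_trans (lvis_sum m Yy).
  have [nm|mn] := leqP n m; last by rewrite big_geq ?sumr_ge0 // ltnW.
  by rewrite (@sum_ord_split _ (fun i => (lvis (lk y) i)%:R) n m) // lerDr sumr_ge0.
rewrite mul0r big_nat big1 // => i /andP[ni _].
rewrite (_ : lvis (lk y) i = false) //; apply/negP => /visits_lt.
by rewrite -/(lph (lk y)) lphE // ltnNge (leq_trans hn ni).
Qed.

Lemma vis_late n K :
  Eb (fun x => \sum_(l < K) ((l + n < lph (lett cover x))%N && lvis (lett cover x) l)%:R) <= sn n.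
Proof.
apply: (@letters_le_sn (fun k => \sum_(l < K) ((l + n < lph k)%N && lvis k l)%:R)).
  by apply: bm_sum => i _; exact: (bml (fun k => (i + n < lph k)%N && lvis k i)).
move=> y Yy; rewrite -lphE //; case: (ltnP n (lph (lk y))) => hn.
  rewrite mul1r; apply: le_trans (lvis_sum K Yy); apply: ler_sum => l _.
  by rewrite ler_nat; case: (lvis _ _); rewrite ?andbT ?andbF // leq_b1.
rewrite mul0r big1 // => l _; rewrite (_ : (_ < _)%N = false) //.
by apply/negbTE; rewrite -leqNgt; apply: leq_trans hn (leq_addl _ _).
Qed.

Lemma kick_tail : tailb 1 sn (kick_prob bgm lvis).
Proof.
split=> [n|n m]; first by apply: Ex_ge0.
rewrite mul1r -Ex_sum; [|exact: measurableT|by move=> i _; exact: (bml (kick_letter bgm lvis i))].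
apply: (@letters_le_sn (fun k => \sum_(n <= i < m) (kick_letter bgm lvis i k)%:R)).
  by apply: bm_sum => i _; exact: (bml (kick_letter bgm lvis i)).
move=> y Yy; rewrite -lphE // /kick_letter -/(lph _); case: (ltnP n (lph (lk y))) => hn; last first.
  rewrite mul0r big_nat big1 // => i /andP[ni _].
  by rewrite (_ : (i < gph bgm (lk y))%N = false) //; apply/negbTE; rewrite -leqNgt (leq_trans hn ni).
rewrite mul1r; apply: le_trans (lvis_sum (lph (lk y)) Yy).
apply: (@le_trans _ _ (\sum_(i < m) (i < lph (lk y))%N%:R * (lvis (lk y) ((lph (lk y)).-1 - i)%N)%:R)).
  have [nm|mn] := leqP n m; last by rewrite big_geq ?sumr_ge0 // 1?ltnW // => i _; rewrite mulr_ge0.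
  rewrite (@sum_ord_split _ (fun i => (i < lph (lk y))%N%:R * (lvis (lk y) ((lph (lk y)).-1 - i)%N)%:R) n m) //.
  apply: (@le_trans _ _ (\sum_(n <= i < m) (i < lph (lk y))%N%:R * (lvis (lk y) ((lph (lk y)).-1 - i)%N)%:R)).
    by apply: ler_sum => i _; rewrite -natrM mulnb.
  by rewrite lerDr sumr_ge0 // => i _; rewrite mulr_ge0.
rewrite (sum_trunc (fun i => (lvis (lk y) ((lph (lk y)).-1 - i)%N)%:R)).
rewrite [leRHS](reindex_inj rev_ord_inj) /=; apply: ler_sum => i _.
have -> : (lph (lk y) - i.+1)%N = ((lph (lk y)).-1 - i)%N by clear; lia.
by rewrite ler_piMl //; case: (_ < _)%N.
Qed.

Local Notation PB := (phibar muY Y f h sigma).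
Local Notation slab l A := (Y `&` [set y | (l < phi y)%N] `&` (iter l f) @^-1` A).

Lemma measurable_slab l A : measurable A -> measurable (slab l A).
Proof.
move=> mA; apply: measurableI; first exact: measurable_phi_gt.
by rewrite -[X in measurable X]setTI; exact: (measurable_fl mf).
Qed.

(** For the whole space the tower formula reads [1 = S / phibar]; with the conventions for the
    inverses of 0 and of infinity neither extreme value is compatible with it. This yields the
    integrability of [phi]. *)
Lemma phibar_fin : (\int[muY]_(y in Y) (phi y)%:R%:E)%E = PB%:E /\ 0 < PB.
Proof.
have := towerE (@measurableT _ M); set S := (\sum_(0 <= l <oo) _)%E.
rewrite probability_setT.
have S0 : (0 <= S)%E by apply: nneseries_ge0.
have P0 : (0 <= \int[muY]_(y in Y) (phi y)%:R%:E)%E.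
  by apply: integral_ge0 => y _; rewrite lee_fin.
rewrite /phibar /Rintegral; move: P0; case: (\int[muY]_(y in Y) (phi y)%:R%:E)%E => [r||] //=.
  rewrite lee_fin le_eqVlt => /orP[/eqP <-|r0] //.
  rewrite inve0; move: S0; rewrite le_eqVlt => /orP[/eqP <-|S0].
    by rewrite mul0e => /eqP; rewrite onee_eq0.
  by rewrite gt0_muley.
by move=> _; rewrite invey mule0 => /eqP; rewrite onee_eq0.
Qed.

Lemma slab_series A : measurable A ->
  (\sum_(0 <= l <oo) muY (slab l A) = (PB * fine (mu A))%:E)%E.
Proof.
move=> mA; have := towerE mA; have [e P0] := phibar_fin; rewrite e.
set S := (\sum_(0 <= l <oo) _)%E; rewrite inver gt_eqF //.
have S0 : (0 <= S)%E by apply: nneseries_ge0.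
move: S0; case: S => [r||] // _.
  by rewrite -EFinM => ->; rewrite /= mulrC divfK // gt_eqF.
rewrite gt0_mulye ?lte_fin ?invr_gt0 // => e2.
have hA : mu A \is a fin_num by exact: fin_num_measure.
by rewrite e2 in hA.
Qed.

Lemma visit_slab l A : measurable A -> visit bgm muY Y f pib \1_A l = fine (muY (slab l A)).
Proof.
move=> mA; have mS := measurable_slab l mA; rewrite -(setIidr (_ : slab l A `<=` Y)); last by move=> y [[]].
rewrite -(Ex_indic muY mY mS); apply: eq_Ex => y Yy.
rewrite -/(lk y) -[gph bgm _]/(lph (lk y)) lphE // !indicE -natrM mulnb; congr (nat_of_bool _)%:R.
apply/andP/idP => [[h1 h2]|]; first by rewrite inE in h2; rewrite inE; split.
by rewrite inE => -[[_ h1] h2]; split => //; rewrite inE.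
Qed.

Lemma visit_series A : measurable A ->
  series (visit bgm muY Y f pib \1_A) @ \oo --> PB * fine (mu A).
Proof.
move=> mA; have hc : (fun n => (\sum_(0 <= l < n) muY (slab l A))%E) @ \oo --> (PB * fine (mu A))%:E.
  by rewrite -(slab_series mA); apply: is_cvg_nneseries.
have {}hc := fine_cvg hc.
rewrite (_ : series (visit bgm muY Y f pib \1_A) =
  fine \o (fun n => (\sum_(0 <= l < n) muY (slab l A))%E)); first exact: hc.
apply/funext => n; rewrite /= /series /=.
rewrite [in RHS](eq_bigr (fun l => (visit bgm muY Y f pib \1_A l)%:E)) ?sumEFin // => l _.
by rewrite visit_slab // fineK //; apply: fin_num_measure; exact: measurable_slab.
Qed.

Lemma return_tail_phi l : return_tail bgm l = fine (muY (Y `&` [set y | (l < phi y)%N])).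
Proof.
have bl : bmT (fun x => (l < lph (lett cover x))%N%:R) by exact: (bm_letter bgm (fun k => l < lph k)%N).
rewrite /return_tail -[gph bgm]/lph -(EY_pi bl) -Ex_bool //; last exact: measurable_phi_gt.
by apply: eq_Ex => y Yy; rewrite -/(lk y) lphE.
Qed.

Lemma tail_ptail n : tail muY Y f h sigma n = PB - \sum_(j < n.+1) return_tail bgm j.
Proof.
have hS := slab_series (@measurableT _ M); rewrite probability_setT mulr1 in hS.
have eS l : slab l setT = Y `&` [set y | (l < phi y)%N] by rewrite preimage_setT setIT.
have {}hS : (\sum_(0 <= l <oo) muY (Y `&` [set y | (l < phi y)%N]) = PB%:E)%E.
  by rewrite -hS; apply: eq_eseriesr => l _; rewrite eS.
have := @nneseries_split R (fun l => muY (Y `&` [set y | (l < phi y)%N])) 0 n.+1 (fun k _ => measure_ge0 _ _).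
rewrite hS add0n /tail; set T := (\sum_(n.+1 <= k <oo) _)%E.
rewrite (_ : (\sum_(0 <= k < n.+1) _)%E = (\sum_(j < n.+1) return_tail bgm j)%:E); last first.
  rewrite big_mkord -sumEFin; apply: eq_bigr => l _; rewrite return_tail_phi fineK //.
  by apply: fin_num_measure; exact: measurable_phi_gt.
by case: T => [r||] //= [->]; rewrite addrAC subrr add0r.
Qed.

(** The values before [N] are absorbed by [(N + 1) ^ b], and [2 ^ b] pays for the shift by one in
    [psi]. *)
Lemma return_tail_psi b : 1 < b ->
  (exists (K : R) (N : nat), forall n : nat, (N <= n)%N ->
     (muY (Y `&` [set y | (n < phi y)%N]) <= (K * n%:R `^ (- b))%:E)%E) ->
  exists2 A, 0 <= A & forall n, return_tail bgm n <= A * psi b n.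
Proof.
move=> b1 [K [N hK]]; have b0 := b_ge0 b1.
exists (N.+1%:R `^ b + `|K| * 2 `^ b); first by rewrite addr_ge0 ?powR_ge0 // mulr_ge0 // powR_ge0.
move=> n; rewrite mulrDl; case: (ltnP n N) => hn.
  apply: (@le_trans _ _ (N.+1%:R `^ b * psi b n)); last by rewrite lerDl !mulr_ge0 ?powR_ge0 ?psi_ge0.
  apply: (@le_trans _ _ (psi b 0)); last by apply: psi_scale => //; rewrite mulnS muln0 addn0 ltnW // ltnS ltnW.
  rewrite psi0 return_tail_phi -lee_fin fineK; first exact: probability_le1 (measurable_phi_gt n).
  by apply: fin_num_measure; exact: measurable_phi_gt.
case: n hn => [|n] hn.
  apply: (@le_trans _ _ 1).
    rewrite return_tail_phi -lee_fin fineK; first exact: probability_le1 (measurable_phi_gt 0).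
    by apply: fin_num_measure; exact: measurable_phi_gt.
  rewrite psi0 !mulr1; move: hn; rewrite leqn0 => /eqP ->.
  by rewrite powR1 lerDl mulr_ge0 // powR_ge0.
apply: (@le_trans _ _ (`|K| * 2 `^ b * psi b n.+1)); last by rewrite lerDr mulr_ge0 ?powR_ge0 ?psi_ge0.
apply: (@le_trans _ _ (`|K| * psi b n)).
  have := hK n.+1 hn; rewrite -(fineK (fin_num_measure muY _ (measurable_phi_gt n.+1))) lee_fin -return_tail_phi.
  by move/le_trans; apply; apply: ler_wpM2r; [exact: powR_ge0|exact: ler_norm].
rewrite -mulrA; apply: ler_wpM2l => //; apply: psi_scale => //.
by clear; lia.
Qed.

Lemma eta_le_gamma b m : 1 < b -> eta b sn m <= gamma muY Y f h sigma b m.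
Proof.
move=> b1; rewrite /eta convC /conv big_ord_recl subn0 psi0 mul1r /gamma lerD2l big_add1 /= big_mkord.
apply: ler_sum => j _; apply: ler_wpM2r; first exact: sn_ge0.
by apply: psi_decr => //; exact: b_ge0.
Qed.

Lemma Em_le (v : M -> R) B : measurable_fun setT v -> 0 <= B -> (forall x, `|v x| <= B) -> `|Ex mu setT v| <= B.
Proof. by move=> mv B0 vB; apply: Ex_bound => //; split => //; exists B. Qed.

Lemma F_iter y : Y y -> F y = iter (lph (lk y)) f y.
Proof. by move=> Yy; rewrite lphE // /Fmap iter_fX. Qed.

(** At time [n + 1] the correlation involves [psum e n], whereas the expansion with [tail] at
    [n + 1] is that of [psum e (n + 1)]. The difference [e (n + 1)] is of order [psi b], hence of
    order [gamma]. For centred [v] the product of the means annihilates the whole main term, and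
    with it the error [zeta]. *)
Theorem cmz_decay b : 1 < b ->
  (exists (K : R) (N : nat), forall n : nat, (N <= n)%N ->
     (muY (Y `&` [set y | (n < phi y)%N]) <= (K * n%:R `^ (- b))%:E)%E) ->
  exists C : R, 0 < C /\ forall n : nat, (1 <= n)%N ->
    (forall v w : M -> R, inHX v -> inHX w ->
       `| rho mu f v w n - PB^-1 * tail muY Y f h sigma n * (\int[mu]_x v x) * (\int[mu]_x w x) |
       <= C * normH v * normH w * (gamma muY Y f h sigma b (n %/ 3) + zeta b n)) /\
    (forall v w : M -> R, inHX v -> inHX w -> \int[mu]_x v x = 0 ->
       `| rho mu f v w n | <= C * normH v * normH w * gamma muY Y f h sigma b (n %/ 3)).
Proof.
move=> b1 hO; have [A A0 phA] := return_tail_psi b1 hO; have [_ P0] := phibar_fin.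
have [y0 _] : exists y0 : M, True.
  apply: contrapT => hn; have e : [set: M] = set0 by rewrite -subset0 => x _; apply: hn; exists x.
  by have := probability_setT mu; rewrite e measure0 => /eqP; rewrite eq_sym onee_eq0.
have [dd [e [dd0 [Ce Ce0 hCe] [K K0 hK] [C C0' hC]]]] :=
  tower_decay (X := bgm) y0 th01 Ch_ge0 (@visits_lt M f X h sigma Y lk) mY mf mF FY EY_F mpi piF EY_pi
    F_iter bgm_ex muf visit_series
    sn_ge0 sn_decr kick_tail vis_tail vis_late b1 A0 phA sn0_gt0 bgm_lift bgm_letter_pos mix.
have [Cz Cz0 hCz] := Zt_zeta b1.
have k0 := gm_kap bgm; set q := dd%:R * gkap bgm in hK hC.
have q0 : 0 < q by rewrite mulr_gt0 // ltr0n.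
have s0 := sn0_gt0; have Pi : 0 <= PB^-1 by rewrite invr_ge0 ltW.
have qi : 0 <= q^-1 by rewrite invr_ge0 ltW.
have si : 0 <= (sn 0)^-1 by rewrite invr_ge0 ltW.
set P := PB in P0 hK hC Pi *.
(* [A1] carries the error of [tower_decay], [A2] the part of the expansion error proportional to
   [zeta], and [A3] the part of order [psi b], turned into [gamma] by the division by [sn 0]. *)
pose A1 := P^-1 * C; pose A2 := P * (K * Cz); pose A3 := P * (K * Cz + Ce / q) / sn 0.
have A10 : 0 <= A1 by exact: mulr_ge0.
have A20 : 0 <= A2 by rewrite !mulr_ge0 // ltW.
have A30 : 0 <= A3.
  apply: mulr_ge0 => //; apply: mulr_ge0; first exact: ltW.
  by rewrite addr_ge0 // mulr_ge0.
exists (A1 + A2 + A3 + 1); split; first by rewrite ltr_wpDl // !addr_ge0.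
case=> // n _; set g := gamma _ _ _ _ _ _ _; set z := zeta _ _.
have eg : eta b sn (n.+1 %/ 3) <= g by exact: eta_le_gamma.
have e0 : 0 <= eta b sn (n.+1 %/ 3) by apply: eta_ge0; exact: sn_ge0.
have g0 : 0 <= g by exact: le_trans eg.
have z0 : 0 <= z.
  rewrite /z /zeta; case: ifP => _; first exact: powR_ge0.
  case: ifP => _; last exact: powR_ge0.
  by rewrite mulr_ge0 ?powR_ge0 // ln_ge0 // ler1n.
have pg : psi b n.+1 <= g / sn 0.
  rewrite ler_pdivlMr // mulrC; apply: le_trans eg; apply: le_trans (psi_le_eta b sn_ge0 _).
  by apply: ler_wpM2l; [exact: ltW|apply: psi_decr; [exact: b_ge0|exact: leq_div]].
have main v w : inHX v -> inHX w ->
    `|P * Ex mu setT (fun x => v x * w (iter n.+1 f x)) -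
      P ^+ 2 * Ex mu setT v * Ex mu setT w * (psum e n / q)| <= C * normH v * normH w * g.
  move=> hv hw; apply: le_trans (hC _ _ _ _ n (inHX_dyn hv) (inHX_dyn hw)) _.
  by apply: ler_wpM2l => //; rewrite !mulr_ge0 // (normH_ge0 y0).
have hU : `|psum e n / q - (1 + tail muY Y f h sigma n.+1 / P) / P| <= K * Cz * z + (K * Cz + Ce / q) * (g / sn 0).
  have e1 := hK n.+1; rewrite -tail_ptail in e1.
  have e2 : psum e n.+1 = psum e n + e n.+1 by rewrite /psum big_ord_recr.
  have -> : psum e n / q - (1 + tail muY Y f h sigma n.+1 / P) / P =
    (psum e n.+1 / q - (1 + tail muY Y f h sigma n.+1 / P) / P) - e n.+1 / q.
    by rewrite e2 mulrDl; ring.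
  apply: le_trans (ler_normB _ _) _.
  have e3 : K * Zt b n.+1 <= K * (Cz * (z + psi b n.+1)) by apply: ler_wpM2l => //; exact: hCz.
  have e4 : `|e n.+1 / q| <= Ce * psi b n.+1 / q.
    by rewrite normrM (ger0_norm qi); apply: ler_wpM2r => //; exact: hCe.
  have e5 : (K * Cz + Ce / q) * psi b n.+1 <= (K * Cz + Ce / q) * (g / sn 0).
    by apply: ler_wpM2l => //; rewrite addr_ge0 // mulr_ge0.
  apply: le_trans (lerD (le_trans e1 e3) e4) _; rewrite mulrDl in e5 *; move: e5; rewrite !mulrDl !mulrDr.
  by rewrite (mulrAC Ce) !mulrA; lra.
split=> v w hv hw.
  have v0 := normH_ge0 y0 hv; have w0 := normH_ge0 y0 hw.
  have [mv _ _ _] := hv; have [mw _ _ _] := hw.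
  have Iv := Em_le mv v0 (fun x => le_normH x hv); have Iw := Em_le mw w0 (fun x => le_normH x hw).
  have := main v w hv hw; rewrite /rho -![Rintegral mu setT _]/(Ex mu setT _).
  set Q := Ex mu setT (fun x => v x * _); set i := Ex mu setT v in Iv *; set j := Ex mu setT w in Iw *.
  set U := psum e n / q in hU *; set t := tail _ _ _ _ _ _ in hU * => hm.
  have -> : Q - i * j - P^-1 * t * i * j = P^-1 * (P * Q - P ^+ 2 * i * j * U) +
      P * (i * j) * (U - (1 + t / P) / P) by field; rewrite gt_eqF.
  apply: le_trans (ler_normD _ _) _.
  have b1' : `|P^-1 * (P * Q - P ^+ 2 * i * j * U)| <= A1 * (normH v * normH w) * g.
    rewrite normrM (ger0_norm Pi) /A1 -!mulrA; apply: ler_wpM2l => //.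
    by move: hm; rewrite -!mulrA.
  have b2' : `|P * (i * j) * (U - (1 + t / P) / P)| <= (normH v * normH w) * (A2 * z + A3 * g).
    rewrite !normrM (ger0_norm (ltW P0)).
    have -> : (normH v * normH w) * (A2 * z + A3 * g) =
      P * (normH v * normH w) * (K * Cz * z + (K * Cz + Ce / q) * (g / sn 0)) by rewrite /A2 /A3; ring.
    apply: ler_pM => //; first by rewrite mulr_ge0 ?mulr_ge0 // ltW.
    by apply: ler_wpM2l; [exact: ltW|apply: ler_pM].
  apply: le_trans (lerD b1' b2') _.
  have vw0 : 0 <= normH v * normH w by exact: mulr_ge0.
  rewrite -mulrA -[_ * normH v * normH w]mulrA.
  have -> : A1 * (normH v * normH w * g) + normH v * normH w * (A2 * z + A3 * g) =
    (normH v * normH w) * (A1 * g + A2 * z + A3 * g) by ring.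
  rewrite -[leRHS]mulrA mulrCA; apply: ler_wpM2l => //.
  have c1 := mulr_ge0 A10 z0; have c2 := mulr_ge0 A20 g0; have c3 := mulr_ge0 A30 z0.
  exact: combine_bounds.
move=> i0; have v0 := normH_ge0 y0 hv; have w0 := normH_ge0 y0 hw.
have := main v w hv hw; rewrite /rho i0 -[Ex mu setT v]/(\int[mu]_x v x) i0 mulr0 !mul0r !subr0.
rewrite -[Rintegral mu setT _]/(Ex mu setT _); set Q := Ex _ _ _ => hm.
have -> : Q = P^-1 * (P * Q) by rewrite mulrA mulVf ?mul1r // gt_eqF.
rewrite normrM (ger0_norm Pi); apply: (le_trans (ler_wpM2l Pi hm)).
rewrite !mulrA; apply: ler_wpM2r => //; apply: ler_wpM2r => //; apply: ler_wpM2r => //.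
by rewrite -/A1; lra.
Qed.

End CMZ.

Theorem theorem7p1 (R : realType) (dM : measure_display) (M : measurableType dM)
  (dist : M -> M -> R) (mu : probability M R) (f : M -> M) (X Y : set M)
  (h sigma : M -> nat) (muY : probability M R)
  (dB : measure_display) (Yb : measurableType dB) (mub : probability Yb R)
  (Fb : Yb -> Yb) (I : countType) (a : I -> set Yb) (pib : M -> Yb)
  (C0 θ β' : R) :
  0 < θ < 1 ->
  CMZ2 dist mu f X Y h sigma muY mub Fb a pib C0 θ ->
  1 < β' ->
  (* muY(varphi > n) = O(n^-β') *)
  (exists (K : R) (N : nat), forall n : nat, (N <= n)%N ->
     (muY (Y `&` [set y | (n < phi f h sigma y)%N]) <= (K * n%:R `^ (- β'))%:E)%E) ->
  exists C : R, 0 < C /\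
    forall n : nat, (1 <= n)%N ->
      (forall v w : M -> R,
         inHX dist f X h sigma Y Fb a pib θ v ->
         inHX dist f X h sigma Y Fb a pib θ w ->
         `| rho mu f v w n
            - (phibar muY Y f h sigma)^-1 * tail muY Y f h sigma n
              * (\int[mu]_x v x) * (\int[mu]_x w x) |
         <= C * normH dist f h sigma Y Fb a pib θ v * normH dist f h sigma Y Fb a pib θ w
              * (gamma muY Y f h sigma β' (n %/ 3) + zeta β' n)) /\
      (forall v w : M -> R,
         inHX dist f X h sigma Y Fb a pib θ v ->
         inHX dist f X h sigma Y Fb a pib θ w ->
         \int[mu]_x v x = 0 ->
         `| rho mu f v w n |
         <= C * normH dist f h sigma Y Fb a pib θ v * normH dist f h sigma Y Fb a pib θ w
              * gamma muY Y f h sigma β' (n %/ 3)).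
Proof.
move=> th01 [[[[d0 d1] _ _ _ _] [[_ mf _ muf] _ mix]] [_ mY YX _] [[hret _ _] [sig0 msig isig sigc]]].
move=> [[_ [[_ mF FY Finv] _]] [[[_ mG _ Ginv] _] ma disj cover gm] [mpi piF] [pinv contr]].
move=> [_ hconst towerE] b1 hO; have [hinv [xi [[mh hP] hK [mxi xi0] mubr xid]]] := gm.
exact: (cmz_decay th01 mG Ginv ma disj cover mh hP hK mxi xi0 mubr xid d0 d1 mf muf mix mY YX hret
  sig0 msig isig sigc mF FY Finv mpi piF pinv contr hconst towerE b1 hO).
Qed.
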